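(* Let $T>0$, $d\ge1$, $q\in[1,\infty]$, $\alpha\in(0,1)$ with $2/q<\alpha$, and let $b\in L^q(0,T;\mathcal{C}^\alpha_b(\mathbb{R}^d;\mathbb{R}^d))$. Then for every $s\in[0,T]$ and $x\in\mathbb{R}^d$, the stochastic differential equation $$dX(s,t)=b(t,X(s,t))\,dt+dB(t),\quad t\in(s,T],\qquad X(s,t)|_{t=s}=x,$$ has a unique continuous adapted solution $\{X(s,t,x),\ t\in[s,T],\ \omega\in\Omega\}$, and this solution forms a stochastic flow $X(s,t)$ of diffeomorphisms of class $\mathcal{C}^{1,\alpha'}$ for every $0<\alpha'<\alpha-2/q$.
   Context: $B$ is a $d$-dimensional standard Brownian motion on a stochastic basis $(\Omega,\mathcal{F},\mathbb{P},(\mathcal{F}_t)_{t\ge0})$, and $\mathcal{F}_{s,t}$ is the (completed) $\sigma$-algebra generated by $B(r)-B(s)$, $s\le r\le t$. $\mathcal{C}^\alpha_b(\mathbb{R}^d;\mathbb{R}^d)$ is the space of bounded $\alpha$-Hölder continuous vector fields with its usual norm. A stochastic homeomorphism flow associated to the equation is a map $(s,t,x,\omega)\mapsto X(s,t,x)(\omega)\in\mathbb{R}^d$, defined for $0\le s\le t\le T$, $x\in\mathbb{R}^d$, $\omega\in\Omega$, such that: (i) for every $s\in[0,T]$, $x\in\mathbb{R}^d$, the process $\{X(s,t,x),\ t\in[s,T]\}$ is a continuous $\{\mathcal{F}_{s,t}\}_{s\le t\le T}$-adapted solution of the equation; (ii) $\mathbb{P}$-a.s., for all $0\le s\le t\le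 T$ the map $X(s,t,\cdot)$ is invertible and $X(s,t,x)$, $X^{-1}(s,t,x)$ are continuous in $(s,t,x)$; (iii) $\mathbb{P}$-a.s., $X(s,t,x)=X(r,t,X(s,r,x))$ for all $0\le s\le r\le t\le T$, $x\in\mathbb{R}^d$, and $X(s,s,x)=x$. It is a stochastic flow of diffeomorphisms of class $\mathcal{C}^{1,\beta}$, $\beta\in(0,1)$, if moreover, $\mathbb{P}$-a.s., for all $0\le s\le t\le T$ the maps $X(s,t,\cdot)$ and $X^{-1}(s,t,\cdot)$ are continuously differentiable with locally $\beta$-Hölder continuous derivatives in $x$. *)

(* Defs.v *)
From HB Require Import structures.
From mathcomp Require Import all_boot all_order all_algebra.
From mathcomp Require Import all_classical all_reals all_analysis.

Set Implicit Arguments.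
Unset Strict Implicit.
Unset Printing Implicit Defensive.

Import Order.TTheory GRing.Theory Num.Theory.
Import numFieldNormedType.Exports.

Local Open Scope classical_set_scope.
Local Open Scope ring_scope.

(** R^d is ['rV[R]_d].  Its library norm is the sup norm; every notion below
    that uses a norm on R^d is unchanged under passing to the Euclidean one. *)

(** ** Bochner spaces and Hölder vector fields *)

Section bochner.
Context {R : realType}.

(** A normed space is presented as the subgroup [N w < +oo] of an additive
    group [W] on which the extended norm [N] is defined. *)
Definition simple_into (W : zmodType) (N : W -> \bar R) (g : R -> W) : Prop :=
  [/\ finite_set (range g),
      forall w, measurable (g @^-1` [set w]) &
      forall t, (N (g t) < +oo)%E].

Definition strongly_measurable (W : zmodType) (N : W -> \bar R) (T : R)
    (f : R -> W) : Prop :=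
  exists g : nat -> R -> W,
    (forall n, simple_into N (g n)) /\
    {ae @lebesgue_measure R, forall t, 0 < t < T ->
      N (g n t - f t) @[n --> \oo] --> 0%E}.

(** [f] is a representative of an element of L^q(0,T; {N < +oo}); its values
    outside the interval, or on a null set, do not matter. *)
Definition bochner_Lq (W : zmodType) (N : W -> \bar R) (q : \bar R) (T : R)
    (f : R -> W) : Prop :=
  [/\ {ae @lebesgue_measure R, forall t, 0 < t < T -> (N (f t) < +oo)%E},
      strongly_measurable N T f &
      (Lnorm lebesgue_measure q ((fun t => N (f t)) \_ `]0%R, T[%classic) < +oo)%E].

Definition holder_norm (d : nat) (a : R) (f : 'rV[R]_d -> 'rV[R]_d) : \bar R :=
  (ereal_sup [set `|f x|%:E | x in [set: 'rV[R]_d]] +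
   ereal_sup [set (`|f z.1 - f z.2| / `|z.1 - z.2| `^ a)%:E
             | z in [set z : 'rV[R]_d * 'rV[R]_d | z.1 != z.2]])%E.

(** L^q(0,T; C^a_b(R^d; R^d)) *)
Definition Lq_holder (d : nat) (q : \bar R) (T a : R)
    (b : R -> 'rV[R]_d -> 'rV[R]_d) : Prop :=
  bochner_Lq (@holder_norm d a) q T b.

End bochner.

(** ** Regularity of two-parameter families of maps *)

Section deterministic_flow.
Context {R : realType} (d : nat).
Local Notation V := 'rV[R]_d.

Definition ordered_times (T s t : R) : Prop := [/\ 0 <= s, s <= t & t <= T].

Definition continuous_stx (T : R) (Phi : R -> R -> V -> V) : Prop :=
  {within [set z : R * R * V | ordered_times T z.1.1 z.1.2],
    continuous (fun z => Phi z.1.1 z.1.2 z.2)}.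

Definition inverse_family (T : R) (Phi Psi : R -> R -> V -> V) : Prop :=
  forall s t, ordered_times T s t ->
    cancel (Phi s t) (Psi s t) /\ cancel (Psi s t) (Phi s t).

Definition locally_holder (m n : nat) (beta : R) (D : V -> 'M[R]_(m, n))
    : Prop :=
  forall x0 : V, exists C : R, \forall x & y \near x0,
    `|D x - D y| <= C * `|x - y| `^ beta.

Definition C1_holder (beta : R) (f : V -> V) : Prop :=
  [/\ forall x, differentiable f x, continuous (jacobian f) &
      locally_holder beta (jacobian f)].

End deterministic_flow.

(** ** Stochastic bases and Brownian motion *)

Section stochastic_basis.
Context {R : realType} {disp : measure_display} {Omega : measurableType disp}.
Context (P : probability Omega R) (d : nat).
Local Notation V := 'rV[R]_d.

Definition filtration (F : R -> set (set Omega)) : Prop :=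
  [/\ forall t, 0 <= t -> sigma_algebra setT (F t),
      forall t, 0 <= t -> F t `<=` measurable &
      forall s t, 0 <= s -> s <= t -> F s `<=` F t].

Definition completed (G : set (set Omega)) : set (set Omega) :=
  <<s G `|` P.-negligible >>.

Definition borel : set (set V) := <<s [set U : set V | open U] >>.

(** [Y] is measurable from (Omega, G) to R^d with its Borel sets. *)
Definition rv_measurable (G : set (set Omega)) (Y : Omega -> V) : Prop :=
  forall C, borel C -> G (Y @^-1` C).

Definition increment (B : R -> Omega -> V) (s t : R) (w : Omega) : V :=
  B t w - B s w.

Definition brownian_motion (F : R -> set (set Omega)) (B : R -> Omega -> V)
    : Prop :=
  [/\ forall t, 0 <= t -> rv_measurable (F t) (B t),
      {ae P, forall w, B 0 w = 0},
      {ae P, forall w, {within `[0, +oo[, continuous (B ^~ w)}},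
      (forall s t A C, 0 <= s -> s < t -> F s A -> borel C ->
        P (A `&` increment B s t @^-1` C) =
        (P A * P (increment B s t @^-1` C))%E) &
      (* the increment has law N(0, (t - s) I_d) *)
      (forall s t (C : 'I_d -> set R), 0 <= s -> s < t ->
        (forall i, measurable (C i)) ->
        P [set w | forall i, C i (increment B s t w ord0 i)] =
        (\prod_(i < d) normal_prob 0 (Num.sqrt (t - s)) (C i))%E)].

(** The sigma-algebra F_{s,t}. *)
Definition increments_algebra (B : R -> Omega -> V) (s t : R)
    : set (set Omega) :=
  completed [set A | exists r C,
    [/\ s <= r <= t, borel C & A = increment B s r @^-1` C]].

(** ** The equation dX = b(t, X) dt + dB *)

(** The drift integral is taken coordinatewise.  [G] is the filtration to which
    solutions are adapted; only [G t] with [s <= t <= T] matters.  For a drift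
    that is only a representative of a class in L^q, [r |-> b r (X r w)] is
    Lebesgue but maybe not Borel measurable, so integrability is expressed by
    finiteness of the integral of the norm rather than by [integrable]. *)
Definition sde_solution (b : R -> V -> V) (B : R -> Omega -> V)
    (G : R -> set (set Omega)) (T s : R) (x : V) (X : R -> Omega -> V) : Prop :=
  [/\ forall t, s <= t <= T -> rv_measurable (G t) (X t),
      {ae P, forall w, {within `[s, T], continuous (X ^~ w)}},
      {ae P, forall w,
        (\int[lebesgue_measure]_(r in `[s, T]) `|b r (X r w)|%:E < +oo)%E} &
      {ae P, forall w, forall t, s <= t <= T ->
        X t w = x +
          \row_i (\int[lebesgue_measure]_(r in `[s, t]) b r (X r w) ord0 i) +
          increment B s t w}].

Definition indistinguishable (s T : R) (X Y : R -> Omega -> V) : Prop :=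
  {ae P, forall w, forall t, s <= t <= T -> X t w = Y t w}.

(** ** Flows *)

Definition homeo_flow (b : R -> V -> V) (B : R -> Omega -> V) (T : R)
    (X : R -> R -> V -> Omega -> V) : Prop :=
  [/\ forall s x, 0 <= s <= T ->
        sde_solution b B (increments_algebra B s) T s x (fun t => X s t x),
      {ae P, forall w, exists Psi : R -> R -> V -> V,
        let Phi := fun s t x => X s t x w in
        [/\ inverse_family T Phi Psi, continuous_stx T Phi &
            continuous_stx T Psi]} &
      {ae P, forall w,
        (forall s r t x, 0 <= s -> s <= r -> r <= t -> t <= T ->
          X s t x w = X r t (X s r x w) w) /\
        (forall s x, 0 <= s <= T -> X s s x w = x)}].

Definition diffeo_flow (b : R -> V -> V) (B : R -> Omega -> V) (T beta : R)
    (X : R -> R -> V -> Omega -> V) : Prop :=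
  homeo_flow b B T X /\
  {ae P, forall w, exists Psi : R -> R -> V -> V,
    let Phi := fun s t x => X s t x w in
    inverse_family T Phi Psi /\
    forall s t, ordered_times T s t ->
      C1_holder beta (Phi s t) /\ C1_holder beta (Psi s t)}.

End stochastic_basis.

(* Main.v *)
(** The drift psi_{s,t}(z) = int_s^t b(r,z) dr satisfies |psi_{s,t}| <= w(t) - w(s) <= C (t-s)^rho with rho = 1 - 1/q, and
    the same weight controls its alpha-Hoelder constant; the hypothesis reads 2 (rho - 1) + alpha > 0.  Everything is
    obtained from one explicit scheme on the dyadic grids T 2^-n, without stochastic integrals.  In each step the Brownian
    increment W is added first and then the drift psi of that step, mollified by the heat operator at the scale of the mesh:
    y = X + W, X' = y + f(y).

    Averaging over the noise turns the f's into increments of the heat semigroup, and a backward recursion (a discrete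
    form of the Zvonkin transform) produces functions u, of small C^{2,beta} norm on short windows uniformly in n, such that
    X + u(X) is a martingale whose increments depend on X only through u.  A discrete Gronwall inequality then bounds the high moments
    of the first and second differences of the scheme in the initial point by |h|^p and (|h| |k|^beta)^p, uniformly in n.
    By Borel-Cantelli over dyadic lattices, almost surely the scheme is gamma-Hoelder in x for a gamma close to 1 and has the
    expected second differences at all lattice scales comparable to 2^-n.

    The rest is pathwise.  A path with the expansion Y_t - Y_s = W_t - W_s + psi_{s,t}(Y_s) + O(|t-s|^theta), theta > 1, is
    compared with the scheme by telescoping its one-step errors along the almost Lipschitz discrete flow.  This gives the
    convergence of the scheme, the flow property of the limit and uniqueness.  The inverse is the flow of the time-reversed
    data, and the second-difference bounds pass to the limit, where they yield C^{1,alpha'}. *)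

(* Three exponents shape the proof. A third difference of a mollification at time [t] costs
   [t^-(1 - (a - b)/2)], which can be summed against a weight of order [rho = 1 - 1/q] when
   [b < a - 2/q]; hence the range of [alpha']. The expansion has order [theta = rho + alpha h] with
   [h < 1/2] a Hoelder exponent of the noise, and [2/q < alpha] leaves room for [theta > 1]. A
   [gamma]-Hoelder flow turns an error [2^-(n theta)] into [2^-(n theta gamma)]; [2^n] such errors
   vanish in the limit if [theta gamma > 1], so almost Lipschitz is enough. The obstacle is that
   Borel-Cantelli controls only finitely many events per lattice level [m], so the grid level must
   satisfy [n <= Lam m]; the convergence rate decides how large the fixed [Lam] has to be. Finite
   differences stand for derivatives until the last step. The drift enters through its time
   integral: a representative measurable along paths is chosen off a null set, and the integrals of
   [b] do not see the change. *)
Require Import Defs.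
From HB Require Import structures.
From mathcomp Require Import all_boot all_order all_algebra.
From mathcomp Require Import all_classical all_reals all_analysis.
From mathcomp Require Import measurable_realfun ess_sup_inf.
From mathcomp Require Import ring lra.
From mathcomp Require Import zify.
Set Implicit Arguments.
Unset Strict Implicit.
Unset Printing Implicit Defensive.
Import Order.TTheory GRing.Theory Num.Theory.
Import numFieldNormedType.Exports.
Local Open Scope classical_set_scope.
Local Open Scope ring_scope.

(** * Borel structure of row vectors *)

Section vector_norm.
Context {R : realType} {d : nat}.
Local Notation V := 'rV[R]_d.
Implicit Types (x y z : V).

Lemma coord_le_norm x i : `|x ord0 i| <= `|x|.
Proof.
by rewrite [leRHS]/Num.Def.normr /= mx_normrE; apply: le_trans (le_bigmax _ _ (ord0, i)).
Qed.

Lemma norm_le_coord x c : 0 <= c -> (forall i, `|x ord0 i| <= c) -> `|x| <= c.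
Proof.
move=> c0 h; rewrite [leLHS]/Num.Def.normr /= mx_normrE; apply: bigmax_le => // -[i j] _ /=.
by rewrite (ord1 i).
Qed.

Lemma norm_lt_coord x c : 0 < c -> (forall i, `|x ord0 i| < c) -> `|x| < c.
Proof.
move=> c0 h; rewrite [ltLHS]/Num.Def.normr /= mx_normrE; apply/bigmax_ltP; split => // -[i j] _ /=.
by rewrite (ord1 i).
Qed.

Lemma continuous_coord (i : 'I_d) : continuous (fun x : V => x ord0 i).
Proof. exact: coord_continuous. Qed.

Lemma ball_coordP x y e : 0 < e ->
  ball x e y <-> forall i, ball (x ord0 i) e (y ord0 i).
Proof.
move=> e0; split => [xy i|h].
  move: xy; rewrite -!ball_normE /ball_ /=; apply: le_lt_trans.
  by apply: le_trans (coord_le_norm _ i); rewrite !mxE.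
rewrite -ball_normE /ball_ /=; apply: norm_lt_coord => // i.
by have := h i; rewrite -ball_normE /ball_ /= !mxE.
Qed.

End vector_norm.

(** An alias of the vector space that carries the sigma-algebra generated by the open sets, which is
    [borel]. Statements use [V] for the topology and [Vm] for measurability. *)
Definition borelV {R : realType} (d : nat) : Type :=
  g_sigma_algebraType [set U : set 'rV[R]_d | open U].
HB.instance Definition _ R d := Measurable.on (@borelV R d).

Section borelV.
Context {R : realType} {d : nat}.
Local Notation V := 'rV[R]_d.
Local Notation Vm := (@borelV R d).

(** Second countability in explicit form: centres are rational and radii are [1/(n+1)], so the index
    type is countable. In the sup norm such a ball is also a finite intersection of coordinate
    conditions, which ties open sets to coordinates. *)
Lemma open_rat_balls (U : set V) : open U ->
  U = \bigcup_(p in [set p : 'rV[rat]_d * nat |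
       ball (map_mx ratr p.1 : V) p.2.+1%:R^-1 `<=` U])
     ball (map_mx ratr p.1 : V) p.2.+1%:R^-1.
Proof.
move=> oU; apply/seteqP; split => [x Ux|x [p /= hp]]; last exact: hp.
have /nbhs_ballP[e /= e0 he] : nbhs x U by rewrite nbhsE /=; exists U.
have [n hn] : exists n : nat, n.+1%:R^-1 < e / 2.
  have [n _ hn] := near_infty_natSinv_lt (PosNum (divr_gt0 e0 (ltr0n R 2))).
  by exists n; exact: (hn n (leqnn n)).
have hq (i : 'I_d) : exists q : rat, ball (ratr q : R) n.+1%:R^-1 (x ord0 i).
  have [q hq] : exists q : rat, x ord0 i < ratr q < x ord0 i + n.+1%:R^-1.
    have /rat_in_itvoo[q] : x ord0 i < x ord0 i + n.+1%:R^-1.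
      by rewrite ltrDl invr_gt0 ltr0n.
    by rewrite in_itv /=; exists q.
  exists q; rewrite -ball_normE /ball_ /=; move/andP: hq => [h1 h2].
  by rewrite ger0_norm ?subr_ge0 ?ltW// ltrBlDr addrC.
have [q {}hq] := choice hq.
exists (\row_i q i, n) => /=.
  move=> y /= Hy; apply: he.
  rewrite -ball_normE /ball_ /=.
  have H1 : `|(map_mx ratr (\row_i q i) : V) - y| < n.+1%:R^-1 by rewrite -ball_normE in Hy.
  have H2 : `|(map_mx ratr (\row_i q i) : V) - x| < n.+1%:R^-1.
    suff : ball (map_mx ratr (\row_i q i) : V) n.+1%:R^-1 x by rewrite -ball_normE.
    by apply/ball_coordP => // i; rewrite !mxE.
  rewrite -(subrKA (map_mx ratr (\row_i q i))) (splitr e) addrC.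
  apply: le_lt_trans (ler_normD _ _) _; rewrite addrC; apply: ltrD.
    by rewrite distrC; apply: lt_trans H2 _.
  by apply: lt_trans H1 _.
by apply/ball_coordP => // i; rewrite !mxE.
Qed.

Lemma measurable_coord (i : 'I_d) :
  measurable_fun [set: Vm] (fun x : Vm => (x : V) ord0 i).
Proof.
apply: (measurability _ (RGenOpens.measurableE R)) => /=.
move=> _ [_ [a [b ->] <-]]; rewrite setTI; apply: sub_sigma_algebra => /=.
by apply: open_comp => [x _|]; [exact: continuous_coord|exact: interval_open].
Qed.

Lemma measurable_to_V dT (S : measurableType dT) (f : S -> Vm) :
  (forall i, measurable_fun [set: S] (fun s => (f s : V) ord0 i)) ->
  measurable_fun [set: S] f.
Proof.
move=> mf;
have E : @measurable _ Vm = <<s [set U : set V | open U] >> by [].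
apply: (measurability _ E).
move=> _ [U oU <-]; rewrite setTI (open_rat_balls oU) preimage_bigcup.
rewrite bigcup_mkcond; apply: (countable_bigcupT_measurable (countableP _)) => -[p n] /=; case: ifP => // _.
suff -> : f @^-1` ball (map_mx ratr p : V) n.+1%:R^-1 =
   \bigcap_(i in [set: 'I_d]) ((fun s => (f s : V) ord0 i) @^-1` ball ((map_mx ratr p : V) ord0 i) n.+1%:R^-1).
  apply: fin_bigcap_measurable => // i _.
  rewrite -[X in measurable X]setTI; apply: mf => //.
  exact: measurable_ball.
apply/seteqP; split => s /=; first by move=> /ball_coordP h i _; exact: h.
by move=> h; apply/ball_coordP => // i; exact: h.
Qed.

Lemma continuous_measurable_V (f : V -> R) : continuous f -> measurable_fun [set: Vm] (f : Vm -> R).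
Proof.
move=> cf; apply: (measurability _ (RGenOpens.measurableE R)) => /=.
move=> _ [_ [a [b ->] <-]]; rewrite setTI; apply: sub_sigma_algebra => /=.
by apply: open_comp => [x _|]; [exact: cf|exact: interval_open].
Qed.

Lemma measurable_VD : measurable_fun [set: Vm * Vm] (fun p : Vm * Vm => ((p.1 : V) + (p.2 : V)) : Vm).
Proof.
apply: measurable_to_V => i.
rewrite (_ : (fun _ => _) = (fun p : Vm * Vm => (p.1 : V) ord0 i) \+ (fun p => (p.2 : V) ord0 i)); last first.
  by apply/funext => p; rewrite /= mxE.
apply: measurable_funD.
  by apply: (measurableT_comp (measurable_coord i)).
by apply: (measurableT_comp (measurable_coord i)).
Qed.

End borelV.

(** * Integration against a density *)

Section density.
Local Open Scope ereal_scope.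
Context d (T : measurableType d) (R : realType).
Variables (mu nu : {measure set T -> \bar R}) (p : T -> R).
Hypothesis p0 : forall x, (0 <= p x)%R.
Hypothesis mp : measurable_fun setT p.
Hypothesis nuE : forall A, measurable A -> nu A = \int[mu]_(x in A) (p x)%:E.

Import HBNNSimple.
(** Both sides are monotone limits along simple approximations of [f], and for an indicator the
    identity is [nuE]. *)
Lemma ge0_integral_density (f : T -> \bar R) :
  (forall x, 0 <= f x) -> measurable_fun setT f ->
  \int[nu]_x f x = \int[mu]_x (f x * (p x)%:E).
Proof.
move=> f0 mf; pose h := nnsfun_approx measurableT mf.
have mp' : measurable_fun setT (EFin \o p) by exact/measurable_EFinP.
have -> : \int[nu]_x f x = lim (\int[nu]_x (EFin \o h n) x @[n --> \oo]).
  have fE x : f x = lim ((EFin \o h n) x @[n --> \oo]).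
    by apply/esym/cvg_lim => //; exact: cvg_nnsfun_approx.
  under eq_integral do rewrite fE.
  apply: monotone_convergence => //.
  - by move=> n; apply/measurable_EFinP/measurable_funP.
  - by move=> n x _ /=; rewrite lee_fin.
  - by move=> x _ a b ab; rewrite lee_fin; exact/lefP/nd_nnsfun_approx.
have -> : \int[mu]_x (f x * (p x)%:E) =
    lim (\int[mu]_x ((EFin \o h n) x * (p x)%:E) @[n --> \oo]).
  have fE x : f x * (p x)%:E = lim ((EFin \o h n) x * (p x)%:E @[n --> \oo]).
    by apply/esym/cvg_lim => //; apply: cvgeZr => //; exact: cvg_nnsfun_approx.
  under eq_integral do rewrite fE.
  apply: monotone_convergence => //.
  - move=> n; apply: emeasurable_funM => //; exact/measurable_EFinP/measurable_funP.
  - by move=> n x _ /=; rewrite mule_ge0// lee_fin.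
  - move=> x _ a b ab; rewrite lee_wpmul2r ?lee_fin//; exact/lefP/nd_nnsfun_approx.
suff suf n : \int[nu]_x (EFin \o h n) x = \int[mu]_x ((EFin \o h n) x * (p x)%:E).
  by under eq_fun do rewrite suf.
have eh x : (EFin \o h n) x =
   \sum_(y \in range (h n)) (y * \1_(h n @^-1` [set y]) x)%:E.
  by rewrite /= fimfunE -fsumEFin.
have ge y x : 0 <= (y * \1_(h n @^-1` [set y]) x)%:E by exact: nnfun_muleindic_ge0.
have mh y : measurable_fun setT (fun x => (y * \1_(h n @^-1` [set y]) x)%:E).
  by apply/measurable_EFinP; exact: measurable_funM.
under eq_integral do rewrite eh.
rewrite ge0_integral_fsum//.
under [RHS]eq_integral => x _ do rewrite eh ge0_mule_fsuml//.
rewrite ge0_integral_fsum//; last 2 first.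
  - by move=> y; apply: emeasurable_funM.
  - by move=> y x _; rewrite mule_ge0// lee_fin.
apply: eq_fsbigr => y; rewrite inE => -[t _ yE].
have y0 : (0 <= y)%R by rewrite -yE.
rewrite integralZl_indic_nnsfun// integral_indic// setIT nuE//.
under [RHS]eq_integral do rewrite EFinM -muleA.
rewrite ge0_integralZl//; last 2 first.
  - by apply: emeasurable_funM => //; exact/measurable_EFinP.
  - by move=> x _; rewrite mule_ge0 ?lee_fin.
congr (_ * _); rewrite integral_mkcond; apply: eq_integral => x _.
rewrite patchE indicE.
by case: ifPn => xh; rewrite ?mul1e ?mul0e.
Qed.
End density.

Section box_uniqueness.
Context {R : realType} {d : nat}.
Local Notation V := 'rV[R]_d.
Local Notation Vm := (@borelV R d).

Definition box (C : 'I_d -> set R) : set V := [set w | forall i, C i (w ord0 i)].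

Lemma boxE C : box C = \bigcap_(i in [set: 'I_d]) ((fun w : V => w ord0 i) @^-1` C i).
Proof. by apply/seteqP; split => w /= h i; [move=> _|]; exact: h. Qed.

Lemma measurable_box C : (forall i, measurable (C i)) -> @measurable _ Vm (box C).
Proof.
move=> mC; rewrite boxE; apply: fin_bigcap_measurable => // i _.
by rewrite -[X in measurable X]setTI; apply: measurable_coord.
Qed.

Definition boxes : set (set V) := [set A | exists2 C, (forall i, measurable (C i)) & A = box C].

(** Rational balls of the sup norm are themselves boxes, so every open set is a countable union of
    boxes. *)
Lemma borel_boxes : @measurable _ Vm = <<s boxes >>.
Proof.
apply/seteqP; split; last first.
  apply: smallest_sub; first exact: (@sigma_algebra_measurable _ Vm).
  by move=> _ [C mC ->]; exact: measurable_box.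
apply: smallest_sub; first exact: smallest_sigma_algebra.
move=> U /= oU; rewrite (open_rat_balls oU) bigcup_mkcond.
have hs := @smallest_sigma_algebra _ setT boxes.
have -> : forall F : 'rV[rat]_d * nat -> set V,
   \bigcup_p F p = \bigcup_n (if unpickle n is Some p then F p else set0).
  move=> F; apply/seteqP; split => x [p _ h].
    by exists (pickle p) => //; rewrite pickleK.
  by move: h; case: (unpickle p) => // q h; exists q.
case: hs => hs0 _ hsU; apply: hsU => n.
case: (unpickle n) => [p|]; last exact: hs0.
case: ifP => // _.
apply: sub_sigma_algebra.
exists (fun i => ball ((map_mx ratr p.1 : V) ord0 i) p.2.+1%:R^-1).
  by move=> i; exact: measurable_ball.
have e0 : 0 < p.2.+1%:R^-1 :> R by [].
by apply/seteqP; split => w /= /(ball_coordP _ _ e0).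
Qed.

Lemma boxes_setI : setI_closed boxes.
Proof.
move=> _ _ [C mC ->] [D mD ->]; exists (fun i => C i `&` D i).
  by move=> i; exact: measurableI.
apply/seteqP; split => w /=; first by move=> [hC hD] i; split; [exact: hC|exact: hD].
by move=> h; split => i; case: (h i).
Qed.

Lemma boxes_setT : boxes setT.
Proof. by exists (fun=> setT) => //; apply/seteqP; split => w. Qed.

(** Boxes form a pi-system that generates the Borel sets; a product formula on boxes, as in
    [brownian_motion], therefore determines a law. *)
Lemma measure_box_unique (mu nu : {measure set Vm -> \bar R}) :
  (mu setT < +oo)%E ->
  (forall C, (forall i, measurable (C i)) -> mu (box C) = nu (box C)) ->
  forall A, measurable A -> mu A = nu A.
Proof.
move=> mufin h.
apply: (@measure_unique _ _ Vm boxes (fun=> setT)) => //.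
- exact: borel_boxes.
- exact: boxes_setI.
- by move=> _; exact: boxes_setT.
- by rewrite bigcup_const//; exists 0%N.
- by move=> _ [C mC ->]; exact: h.
Qed.

End box_uniqueness.

(** * Gaussian vectors and the heat operator *)

Section gauss1.
Context {R : realType}.
Local Notation mu := (@lebesgue_measure R).

Lemma ge0_integral_shift (f : R -> \bar R) (h : R) :
  measurable_fun setT f -> (forall x, 0 <= f x)%E ->
  (\int[mu]_x f (x + h)%R = \int[mu]_x f x)%E.
Proof.
move=> mf f0.
pose sh := (fun x : R => x + h) : measurableTypeR R -> measurableTypeR R.
have msh : measurable_fun setT sh by exact: measurable_funD.
transitivity (\int[pushforward mu sh]_x f x)%E.
  by rewrite ge0_integral_pushforward//.
apply: eq_measure_integral => A mA _; apply/esym.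
apply: (@lebesgue_measure_unique R (pushforward mu sh)) => // _ [[a b]] _ <-.
change (mu `]a, b]%classic = mu (sh @^-1` `]a, b]%classic)).
have -> : sh @^-1` `]a, b]%classic = `](a - h), (b - h)]%classic.
  by apply/seteqP; split => x; rewrite /sh /= !in_itv /= ltrBlDr lerBrDr.
by rewrite !lebesgue_measure_itv /= !lte_fin ltrD2r; case: ifP => // _; rewrite -!EFinB; congr EFin; ring.
Qed.

Lemma normal_pdf0E (s x : R) : 0 < s ->
  normal_pdf 0 s x = normal_peak s * expR (- (x / s) ^+ 2 / 2).
Proof.
move=> s0; rewrite normal_pdfE ?gt_eqF// /normal_fun subr0; congr (_ * expR _).
by field; rewrite gt_eqF.
Qed.

Lemma normal_peak2 (s : R) : 0 < s -> normal_peak (2 * s) = normal_peak s / 2.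
Proof.
move=> s0; rewrite /normal_peak.
have -> : (2 * s) ^+ 2 * pi *+ 2 = 2 ^+ 2 * (s ^+ 2 * pi *+ 2) by rewrite !mulr2n; ring.
by rewrite sqrtrM ?sqr_ge0// sqrtr_sqr ger0_norm// invfM mulrC.
Qed.

Lemma ge0_integral_normal (s : R) (f : R -> \bar R) :
  measurable_fun setT f -> (forall x, 0 <= f x)%E ->
  (\int[normal_prob 0 s]_x f x = \int[mu]_x (f x * (normal_pdf 0 s x)%:E))%E.
Proof.
move=> mf f0; apply: ge0_integral_density => //; first exact: normal_pdf_ge0.
exact: measurable_normal_pdf.
Qed.

(** The right-hand exponential is the density of deviation [2 * s] without its peak. That density
    has mass one and its peak is half as high, hence the factor 2. *)
Lemma normal_dom_integral (s K : R) (g : R -> R) : 0 < s ->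
  measurable_fun setT g -> (forall x, 0 <= g x) -> 0 <= K ->
  (forall x, g x * expR (- (x / s) ^+ 2 / 2) <= K * expR (- (x / s) ^+ 2 / 8)) ->
  (\int[normal_prob 0 s]_x (g x)%:E <= (2 * K)%:E)%E.
Proof.
move=> s0 mg g0 K0 h.
rewrite ge0_integral_normal//; last exact/measurable_EFinP.
have -> : (2 * K)%:E = (\int[mu]_x ((2 * K)%:E * (normal_pdf 0 (2 * s) x)%:E))%E.
  rewrite ge0_integralZl ?lee_fin ?mulr_ge0//; last 2 first.
  - by apply/measurable_EFinP; exact: measurable_normal_pdf.
  - by move=> x _; rewrite lee_fin normal_pdf_ge0.
  by rewrite integral_normal_pdf mule1.
apply: ge0_le_integral => //.
- by move=> x _; rewrite -EFinM lee_fin mulr_ge0// normal_pdf_ge0.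
- by apply/measurable_EFinP/measurable_funM => //; exact: measurable_normal_pdf.
- by apply/measurable_EFinP/measurable_funM => //; exact: measurable_normal_pdf.
move=> x _; rewrite -!EFinM lee_fin !normal_pdf0E ?mulr_gt0// normal_peak2//.
rewrite mulrCA [leRHS](_ : _ = normal_peak s * (K * expR (- (x / s) ^+ 2 / 8))); last first.
  rewrite (_ : - (x / (2 * s)) ^+ 2 / 2 = - (x / s) ^+ 2 / 8); first by field.
  by field; rewrite gt_eqF.
by apply: ler_wpM2l => //; rewrite normal_peak_ge0.
Qed.

Lemma normal_moment (p : nat) : exists2 C : R, 0 <= C &
  forall s : R, 0 < s -> (\int[normal_prob 0 s]_x (`|x| ^+ p)%:E <= (C * s ^+ p)%:E)%E.
Proof.
pose q : R := p.+1%:R.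
have q0 : 0 < q by rewrite ltr0n.
(* With [y = x / s], the power is absorbed by the gap 3/8 between the exponents 1/2 and 1/8. For
   [u = 3 y^2 / (8 q)] one has [1 + y^2 <= (1 + 8 q / 3) exp u], and the power [q = p + 1] turns
   [exp u] into the available exponential. *)
exists (2 * (1 + 8 * q / 3) ^+ p.+1).
  by rewrite mulr_ge0// exprn_ge0// addr_ge0// divr_ge0// mulr_ge0// ltW.
move=> s s0; rewrite -mulrA.
have b1 : 0 <= 8 * q / 3 by rewrite divr_ge0// mulr_ge0// ltW.
apply: normal_dom_integral => //.
- by apply: measurable_funX; exact: normr_measurable.
- by rewrite mulr_ge0 ?exprn_ge0// ?addr_ge0// ltW.
move=> x; set y := x / s.
have -> : `|x| ^+ p = s ^+ p * `|y| ^+ p.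
  by rewrite /y normrM normfV (gtr0_norm s0) -exprMn mulrCA divff ?mulr1// gt_eqF.
have -> : expR (- y ^+ 2 / 2) = expR (- y ^+ 2 / 8) * expR (- (3 * y ^+ 2 / 8)).
  by rewrite -expRD; congr expR; field.
clearbody y.
rewrite [leLHS](_ : _ = s ^+ p * expR (- y ^+ 2 / 8) * (`|y| ^+ p * expR (- (3 * y ^+ 2 / 8)))); last by ring.
rewrite [leRHS](_ : _ = s ^+ p * expR (- y ^+ 2 / 8) * (1 + 8 * q / 3) ^+ p.+1); last by ring.
apply: ler_wpM2l; first by rewrite mulr_ge0 ?expR_ge0// exprn_ge0// ltW.
rewrite expRN ler_pdivrMr ?expR_gt0//.
have y20 := sqr_ge0 y.
apply: (@le_trans _ _ ((1 + y ^+ 2) ^+ p.+1)).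
  apply: (@le_trans _ _ ((1 + y ^+ 2) ^+ p)).
    apply: lerXn2r; rewrite ?nnegrE ?addr_ge0//.
    have := sqr_ge0 (`|y| - 1); rewrite -(real_normK (num_real y)); nra.
  by apply: ler_weXn2l => //; rewrite lerDl.
have -> : expR (3 * y ^+ 2 / 8) = expR (3 * y ^+ 2 / 8 / q) ^+ p.+1.
  by rewrite -expRM_natl; congr expR; rewrite /q; field; rewrite gt_eqF.
rewrite -exprMn; apply: lerXn2r; rewrite ?nnegrE ?addr_ge0//.
  by rewrite mulr_ge0 ?expR_ge0// addr_ge0.
set e := expR _.
have e1 : 1 + 3 * y ^+ 2 / 8 / q <= e by exact: expR_ge1Dx.
have u0 : 0 <= 3 * y ^+ 2 / 8 / q.
  by apply: divr_ge0; [apply: divr_ge0 => //; rewrite mulr_ge0|rewrite ltW].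
have e1' : 1 <= e by apply: le_trans e1; rewrite lerDl.
rewrite mulrDl mul1r; apply: lerD => //.
apply: (@le_trans _ _ (8 * q / 3 * (3 * y ^+ 2 / 8 / q))).
  by rewrite le_eqVlt; apply/orP; left; apply/eqP; field; rewrite gt_eqF.
apply: ler_wpM2l => //; apply: le_trans e1; by rewrite lerDr.
Qed.

Lemma expR_lipschitz (a b : R) : `|expR (- a) - expR (- b)| <= `|a - b| * (expR (- a) + expR (- b)).
Proof.
wlog ab : a b / a <= b.
  move=> h; case: (leP a b) => [/h//|/ltW/h]; by rewrite distrC (distrC b) addrC (addrC (expR (- b))).
have e : expR (- b) <= expR (- a) by rewrite ler_expR lerN2.
rewrite ger0_norm ?subr_ge0// distrC ger0_norm ?subr_ge0//.
have := expR_ge1Dx (- (b - a)); rewrite opprB => h.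
have -> : expR (- b) = expR (- a) * expR (a - b) by rewrite -expRD; congr expR; ring.
have A0 := expR_gt0 (- a); have t0 := expR_gt0 (a - b).
have h1 : 1 - expR (a - b) <= b - a by lra.
have := ler_wpM2l (ltW A0) h1.
have : 0 <= (b - a) * (expR (- a) * expR (a - b)).
  by rewrite mulr_ge0 ?subr_ge0// mulr_ge0 ?ltW.
lra.
Qed.

(** A pointwise form of the total variation estimate. The error is a wider Gaussian, so it stays
    integrable; [|h| <= s] is what bounds both exponentials by [exp (- y^2 / 4)] up to a
    constant. *)
Lemma normal_pdf_shift : exists2 K : R, 0 <= K & forall s h x : R, 0 < s -> `|h| <= s ->
  normal_pdf 0 s (x - h) <= normal_pdf 0 s x + K * (`|h| / s) * normal_pdf 0 (2 * s) x.
Proof.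
pose E : R := expR (2^-1).
have E1 : 1 <= E by rewrite -expR0 ler_expR.
exists (16 * E); first by rewrite mulr_ge0// ltW// expR_gt0.
move=> s h x s0 hs; rewrite !normal_pdf0E ?mulr_gt0// normal_peak2//.
set y := x / s; set e := h / s.
have -> : (x - h) / s = y - e by rewrite mulrBl.
have -> : x / (2 * s) = y / 2 by rewrite /y; field; rewrite gt_eqF.
have -> : `|h| / s = `|e| by rewrite normrM normfV (gtr0_norm s0).
have e1 : `|e| <= 1 by rewrite normrM normfV (gtr0_norm s0) ler_pdivrMr// mul1r.
have P0 : 0 <= normal_peak s by exact: normal_peak_ge0.
rewrite [leRHS](_ : _ = normal_peak s * (expR (- y ^+ 2 / 2) + 8 * E * `|e| * expR (- (y / 2) ^+ 2 / 2))); last by field.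
apply: ler_wpM2l => //.
rewrite -lerBlDl; clearbody y e.
apply: le_trans (ler_norm _) _.
rewrite !mulNr; apply: le_trans (expR_lipschitz _ _) _.
have -> : - ((y / 2) ^+ 2 / 2) = - (y ^+ 2 / 8) by field.
have H1 : expR (- (y ^+ 2 / 2)) <= E * expR (- (y ^+ 2 / 4)).
  rewrite /E -expRD ler_expR; have := sqr_ge0 y; lra.
have H2 : expR (- ((y - e) ^+ 2 / 2)) <= E * expR (- (y ^+ 2 / 4)).
  rewrite /E -expRD ler_expR; have := sqr_ge0 (y - 2 * e).
  have : e ^+ 2 <= 1 by rewrite -(real_normK (num_real e)) expr_le1.
  by rewrite !expr2; nra.
have H3 : `|(y - e) ^+ 2 / 2 - y ^+ 2 / 2| <= `|e| * (2 * `|y| + 1) / 2.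
  have -> : (y - e) ^+ 2 / 2 - y ^+ 2 / 2 = e * (e - 2 * y) / 2 by field.
  rewrite !normrM (ger0_norm (_ : 0 <= 2^-1 :> R)) ?invr_ge0//.
  apply: ler_wpM2r; first by rewrite invr_ge0.
  apply: ler_wpM2l => //; apply: le_trans (ler_normB _ _) _.
  by rewrite (normrM 2 y) (ger0_norm (ler0n R 2)) addrC lerD2l.
have H4 : 2 * `|y| + 1 <= 8 * expR (y ^+ 2 / 8).
  have := expR_ge1Dx (y ^+ 2 / 8); have := sqr_ge0 (`|y| - 1).
  rewrite -(real_normK (num_real y)); nra.
have H5 : expR (- (y ^+ 2 / 8)) = expR (y ^+ 2 / 8) * expR (- (y ^+ 2 / 4)).
  by rewrite -expRD; congr expR; field.
set A := expR (- (y ^+ 2 / 4)) in H1 H2 H5 *.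
have A0 : 0 < A by exact: expR_gt0.
apply: (@le_trans _ _ (`|e| * (2 * `|y| + 1) / 2 * (2 * (E * A)))).
  by apply: ler_pM; rewrite ?addr_ge0 ?expR_ge0//; lra.
rewrite H5.
have EA0 : 0 <= E * A * `|e| by rewrite mulr_ge0// mulr_ge0 ?ltW// expR_gt0.
have := ler_wpM2l EA0 H4; nra.
Qed.

(** The shift is moved from [G] to the density. For [|h| > s] the bound [M] alone is enough, which
    accounts for the extra 1 in the constant. *)
Lemma normal_integral_shift : exists2 K : R, 0 <= K &
  forall (s h M : R) (G : R -> R), 0 < s -> measurable_fun setT G ->
    (forall x, 0 <= G x <= M) ->
  (\int[normal_prob 0 s]_x (G (x + h))%:E <= \int[normal_prob 0 s]_x (G x)%:E + (K * (`|h| / s) * M)%:E)%E.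
Proof.
have [K K0 hK] := normal_pdf_shift.
exists (K + 1); first by rewrite addr_ge0.
move=> s h M G s0 mG hG.
have G0 x : 0 <= G x by have /andP[] := hG x.
have GM x : G x <= M by have /andP[] := hG x.
have M0 : 0 <= M by apply: le_trans (GM 0).
have mGh : measurable_fun setT (fun x : R => G (x + h)).
  by apply: (measurableT_comp mG); exact: measurable_funD.
have mN t : measurable_fun setT (normal_pdf 0 t : R -> R) by exact: measurable_normal_pdf.
case: (leP `|h| s) => [hs|hs]; last first.
  apply: (@le_trans _ _ M%:E).
    apply: (@le_trans _ _ (\int[normal_prob 0 s]_x M%:E))%E.
      by apply: ge0_le_integral => //; [move=> x _; rewrite lee_fin|exact/measurable_EFinP|move=> x _; rewrite lee_fin].
    by rewrite integral_cst// [X in (_ * X)%E](_ : _ = 1%E) ?mule1//; exact: integral_normal_pdf.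
  rewrite -[leLHS]add0e; apply: leeD.
    by apply: integral_ge0 => x _; rewrite lee_fin.
  rewrite lee_fin -{1}(mul1r M); apply: ler_wpM2r => //.
  rewrite -{1}(mul1r 1); apply: ler_pM => //; first by rewrite lerDr.
  by rewrite ler_pdivlMr// mul1r ltW.
rewrite [X in (X <= _)%E]ge0_integral_normal//; last 2 first.
- exact/measurable_EFinP.
- by move=> x; rewrite lee_fin.
pose F x := ((G x)%:E * (normal_pdf 0 s (x - h))%:E)%E.
have mF : measurable_fun setT F.
  apply/measurable_EFinP/measurable_funM => //.
  by apply: (measurableT_comp (mN s)); exact: measurable_funB.
have -> : (\int[mu]_x ((G (x + h))%:E * (normal_pdf 0 s x)%:E) = \int[mu]_x F x)%E.
  rewrite -(ge0_integral_shift h mF); last by move=> x; rewrite /F -EFinM lee_fin mulr_ge0// normal_pdf_ge0.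
  by apply: eq_integral => x _; rewrite /F addrK.
have -> : (\int[normal_prob 0 s]_x (G x)%:E = \int[mu]_x ((G x)%:E * (normal_pdf 0 s x)%:E))%E.
  by apply: ge0_integral_normal => [|x]; [exact/measurable_EFinP|rewrite lee_fin].
apply: (@le_trans _ _ (\int[mu]_x ((G x)%:E * (normal_pdf 0 s x)%:E + (K * (`|h| / s) * M)%:E * (normal_pdf 0 (2 * s) x)%:E))%E).
  apply: ge0_le_integral => //.
  - by move=> x _; rewrite /F -EFinM lee_fin mulr_ge0// normal_pdf_ge0.
  - by apply: emeasurable_funD; apply/measurable_EFinP; apply: measurable_funM => //; exact: mN.
  move=> x _; rewrite /F -!EFinM -EFinD lee_fin.
  have := hK s h x s0 hs; have := normal_pdf_ge0 0 (2 * s) x.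
  have hh : 0 <= K * (`|h| / s) by rewrite mulr_ge0// divr_ge0// ltW.
  have := G0 x; have := GM x; set a := normal_pdf _ _ _; set c := normal_pdf _ _ _; set e := normal_pdf _ _ _.
  move=> g1 g2 c0 le1; apply: le_trans (ler_wpM2l g2 le1) _; rewrite mulrDr lerD2l.
  by rewrite mulrCA -[leRHS]mulrA; apply: ler_wpM2l => //; exact: ler_wpM2r.
rewrite ge0_integralD//.
- apply: leeD => //; rewrite ge0_integralZl//.
  + rewrite integral_normal_pdf mule1 lee_fin; apply: ler_wpM2r => //; apply: ler_wpM2r; first by rewrite divr_ge0// ltW.
    by rewrite lerDl.
  + by apply/measurable_EFinP; exact: mN.
  + by move=> x _; rewrite lee_fin normal_pdf_ge0.
  + by rewrite lee_fin !mulr_ge0// invr_ge0 ltW.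
- by move=> x _; rewrite -EFinM lee_fin mulr_ge0// normal_pdf_ge0.
- by apply/measurable_EFinP; apply: measurable_funM => //; exact: mN.
- by move=> x _; rewrite -EFinM lee_fin !mulr_ge0 ?normal_pdf_ge0// invr_ge0 ltW.
- by apply/measurable_EFinP; apply: measurable_funM => //; exact: mN.
Qed.

End gauss1.

(** * Expectations of bounded measurable functions *)

Section bounded_expectation.
Context dd (T : measurableType dd) (R : realType) (P : probability T R).
Implicit Types f g : T -> R.

Definition bounded_mfun f := measurable_fun setT f /\ exists M, forall x, `|f x| <= M.

Lemma bounded_mfun_integrable f : bounded_mfun f -> P.-integrable setT (EFin \o f).
Proof.
move=> [mf [M hM]]; apply: (@le_integrable _ _ _ _ _ _ _ (EFin \o cst M)) => //.
- exact/measurable_EFinP.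
- move=> x _; rewrite /= lee_fin; apply: le_trans (hM x) _; exact: ler_norm.
- exact: finite_measure_integrable_cst.
Qed.

Lemma bounded_mfunD f g : bounded_mfun f -> bounded_mfun g -> bounded_mfun (fun x => f x + g x).
Proof.
move=> [mf [M hM]] [mg [N hN]]; split; first exact: measurable_funD.
by exists (M + N) => x; apply: le_trans (ler_normD _ _) _; apply: lerD.
Qed.

Lemma bounded_mfunZ (c : R) f : bounded_mfun f -> bounded_mfun (fun x => c * f x).
Proof.
move=> [mf [M hM]]; split; first exact: measurable_funM.
by exists (`|c| * M) => x; rewrite normrM; apply: ler_wpM2l.
Qed.

Lemma bounded_mfunB f g : bounded_mfun f -> bounded_mfun g -> bounded_mfun (fun x => f x - g x).
Proof.
move=> bf /(bounded_mfunZ (-1)) /(bounded_mfunD bf).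
by under [X in bounded_mfun X -> _]eq_fun do rewrite mulN1r.
Qed.

Lemma bounded_mfun_cst (c : R) : bounded_mfun (fun=> c).
Proof. by split; [exact: measurable_cst|exists `|c|]. Qed.

Lemma expectD f g : bounded_mfun f -> bounded_mfun g ->
  \int[P]_x (f x + g x) = \int[P]_x f x + \int[P]_x g x.
Proof. by move=> bf bg; rewrite RintegralD//; exact: bounded_mfun_integrable. Qed.

Lemma expectB f g : bounded_mfun f -> bounded_mfun g ->
  \int[P]_x (f x - g x) = \int[P]_x f x - \int[P]_x g x.
Proof. by move=> bf bg; rewrite RintegralB//; exact: bounded_mfun_integrable. Qed.

Lemma expectZ c f : bounded_mfun f -> \int[P]_x (c * f x) = c * \int[P]_x f x.
Proof. by move=> bf; rewrite RintegralZl//; exact: bounded_mfun_integrable. Qed.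

Lemma integral_prob_cst (c : \bar R) : (\int[P]_x c = c)%E.
Proof. by rewrite integral_cst//= probability_setT mule1. Qed.

Lemma expect_cst (c : R) : \int[P]_x c = c.
Proof. by rewrite Rintegral_cst//= probability_setT mulr1. Qed.

Lemma expect_norm_le f (g : T -> R) : bounded_mfun f ->
  P.-integrable setT (EFin \o g) -> (forall x, `|f x| <= g x) ->
  `|\int[P]_x f x| <= \int[P]_x g x.
Proof.
move=> bf ig fg; have if1 := bounded_mfun_integrable bf.
apply: le_trans (le_normr_Rintegral measurableT if1) _.
have ia := integrable_abse if1.
by apply: le_Rintegral => // x _; exact: fg.
Qed.

Lemma expect_bound f M : bounded_mfun f -> (forall x, `|f x| <= M) -> `|\int[P]_x f x| <= M.
Proof.
move=> bf fM; rewrite -(expect_cst M); apply: expect_norm_le => //.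
exact/bounded_mfun_integrable/bounded_mfun_cst.
Qed.

Lemma expect_fin f : bounded_mfun f -> (\int[P]_x (f x)%:E = (\int[P]_x f x)%:E)%E.
Proof.
move=> bf; rewrite /Rintegral fineK//.
exact: integrable_fin_num (bounded_mfun_integrable bf).
Qed.

End bounded_expectation.

Section gaussian_family.
Context {R : realType} {d : nat}.
Local Notation V := 'rV[R]_d.
Local Notation Vm := (@borelV R d).

Definition gaussian_law (g : probability Vm R) (t : R) := forall C : 'I_d -> set R,
  (forall i, measurable (C i)) -> (g (box C) = \prod_(i < d) normal_prob 0 (Num.sqrt t) (C i))%E.

Definition upd (w : V) (i : 'I_d) (x : R) : V := \row_j (if j == i then x else w ord0 j).

Lemma measurable_upd i : measurable_fun [set: Vm * R] (fun p : Vm * R => upd p.1 i p.2 : Vm).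
Proof.
apply: measurable_to_V => j; rewrite /upd.
case: (eqVneq j i) => [->|ji].
  rewrite (_ : (fun _ => _) = snd); first exact: measurable_snd.
  by apply/funext => p; rewrite mxE eqxx.
rewrite (_ : (fun _ => _) = (fun p : Vm * R => (p.1 : V) ord0 j)).
  by apply: (measurableT_comp (measurable_coord j)).
by apply/funext => p; rewrite mxE (negbTE ji).
Qed.

Section one_time.
Variables (g : probability Vm R) (t : R).
Hypothesis t0 : 0 < t.
Hypothesis hg : gaussian_law g t.
Let s := Num.sqrt t.
Let s0 : 0 < s. Proof. by rewrite sqrtr_gt0. Qed.

(** Redrawing one coordinate independently does not change the law, since the two laws agree on
    boxes. Through it every statement about [g] is reduced to one variable at a time. *)
Lemma gaussian_resample (i : 'I_d) (f : Vm -> \bar R) :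
  measurable_fun setT f -> (forall w, 0 <= f w)%E ->
  (\int[g]_w f w = \int[g]_w \int[normal_prob 0 s]_x f (upd w i x))%E.
Proof.
move=> mf f0.
pose u := (fun p : Vm * R => upd p.1 i p.2 : Vm).
have mu : measurable_fun setT u by exact: measurable_upd.
pose N : probability _ R := normal_prob 0 s.
transitivity (\int[pushforward (g \x N) u]_w f w)%E; last first.
  rewrite ge0_integral_pushforward// fubini_tonelli1//.
  - exact: measurableT_comp.
  - by move=> p; exact: f0.
apply: eq_measure_integral => A mA _.
apply: (@measure_box_unique _ _ g (pushforward (g \x N)%E u)) => //.
  by rewrite (le_lt_trans (probability_le1 _ _)) ?ltry.
move=> C mC; apply: (etrans (hg mC)).
change ((\prod_(i0 < d) normal_prob 0 (Num.sqrt t) (C i0))%E = (g \x N)%E (u @^-1` box C)).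
have -> : u @^-1` box C = box (fun j => if j == i then setT else C j) `*` C i.
  apply/seteqP; split => -[w x] /=.
    move=> h; split; last by have := h i; rewrite mxE eqxx.
    by move=> j; have := h j; rewrite mxE; case: eqP.
  move=> [h1 h2] j; rewrite mxE; have := h1 j; case: eqP => [->//|_].
  by [].
have hgi : forall j, measurable (if j == i then setT else C j) by move=> j; case: ifP.
rewrite product_measure1E; [|exact: measurable_box|exact: mC].
rewrite [X in (_ = X * _)%E](hg hgi).
rewrite (bigD1 i)//= [in RHS](bigD1 i)//= eqxx.
have -> : (normal_prob 0 (Num.sqrt t) setT = 1 :> \bar R)%E by exact: integral_normal_pdf.
rewrite mul1e muleC; congr (_ * _)%E.
by apply: eq_bigr => j /negbTE ->.
Qed.

Lemma gaussian_coord_integral (i : 'I_d) (f : R -> \bar R) :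
  measurable_fun setT f -> (forall w, 0 <= f w)%E ->
  (\int[g]_w f ((w : V) ord0 i) = \int[normal_prob 0 s]_x f x)%E.
Proof.
move=> mf f0; rewrite (gaussian_resample i)//; last first.
  by apply: (measurableT_comp mf); exact: measurable_coord.
under eq_integral => w _.
  under eq_integral => x _ do rewrite /upd mxE eqxx.
  over.
by rewrite integral_prob_cst.
Qed.

Variable K : R.
Hypotheses (K0 : 0 <= K) (hK : forall (s h M : R) (G : R -> R), 0 < s -> measurable_fun setT G ->
    (forall x, 0 <= G x <= M) ->
  (\int[normal_prob 0 s]_x (G (x + h))%:E <= \int[normal_prob 0 s]_x (G x)%:E + (K * (`|h| / s) * M)%:E)%E).

Lemma gaussian_shift1 : forall (i : 'I_d) (h M : R) (G : V -> R),
  measurable_fun [set: Vm] (G : Vm -> R) -> (forall w, 0 <= G w <= M) ->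
  (\int[g]_w (G (w + h *: delta_mx ord0 i))%:E <= \int[g]_w (G w)%:E + (K * (`|h| / s) * M)%:E)%E.
Proof.
move=> i h M G mG hG.
have M0 : 0 <= M by have /andP[a b] := hG 0; exact: le_trans b.
have mS : measurable_fun [set: Vm] (fun w : Vm => (w + h *: delta_mx ord0 i : V) : Vm).
  apply: measurable_to_V => j; rewrite (_ : (fun _ => _) = (fun w : Vm => (w : V) ord0 j + (h *: delta_mx ord0 i : V) ord0 j)).
    by apply: measurable_funD => //; exact: measurable_coord.
  by apply/funext => w; rewrite mxE.
have updD w x : upd w i x + h *: delta_mx ord0 i = upd w i (x + h).
  apply/rowP => j; rewrite !mxE eqxx /=; case: eqP => _; first by rewrite mulr1.
  by rewrite mulr0 addr0.
have mGu w : measurable_fun setT (fun x : R => G (upd w i x)).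
  by have := measurableT_comp (measurableT_comp mG (measurable_upd i)) (@measurable_pair1 _ _ Vm R w).
have mGS : measurable_fun [set: Vm] (EFin \o (fun w : Vm => G (w + h *: delta_mx ord0 i))).
  by apply/measurable_EFinP; exact: (measurableT_comp mG mS).
have mGE : measurable_fun [set: Vm] (EFin \o (G : Vm -> R)) by exact/measurable_EFinP.
rewrite (gaussian_resample i mGS); last by move=> w /=; rewrite lee_fin; case/andP: (hG (w + h *: delta_mx ord0 i)).
rewrite (gaussian_resample i mGE); last by move=> w /=; rewrite lee_fin; case/andP: (hG w).
have -> : (K * (`|h| / s) * M)%:E = (\int[g]_w (K * (`|h| / s) * M)%:E)%E.
  by rewrite integral_prob_cst.
have c0 : 0 <= K * (`|h| / s) * M by rewrite !mulr_ge0// invr_ge0 ltW.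
have mI (f : Vm -> \bar R) : measurable_fun setT f -> (forall w, 0 <= f w)%E ->
    measurable_fun setT (fun w : Vm => \int[normal_prob 0 s]_x f (upd w i x))%E.
  move=> mf f0; pose N : probability _ R := normal_prob 0 s.
  apply: (@measurable_fun_fubini_tonelli_F _ _ Vm _ _ N (f \o (fun p : Vm * R => upd p.1 i p.2 : Vm))) => //.
    by apply: (measurableT_comp mf); exact: measurable_upd.
  by move=> x; exact: f0.
have I0 (f : Vm -> \bar R) : (forall w, 0 <= f w)%E -> forall w, (0 <= \int[normal_prob 0 s]_x f (upd w i x))%E.
  by move=> f0 w; apply: integral_ge0 => x _; exact: f0.
have G0 w : (0 <= (EFin \o G) w)%E by rewrite /= lee_fin; case/andP: (hG w).
rewrite -ge0_integralD//; [|by move=> w _; exact: I0|exact: mI].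
apply: ge0_le_integral => //.
- by move=> w _; apply: I0 => {}w /=; rewrite lee_fin; case/andP: (hG (w + h *: delta_mx ord0 i)).
- by apply: mI => // w /=; rewrite lee_fin; case/andP: (hG (w + h *: delta_mx ord0 i)).
- by apply: emeasurable_funD => //; exact: mI.
move=> w _ /=; under eq_integral do rewrite updD.
exact: (hK h s0 (mGu w) (fun x => hG _)).
Qed.

(** The vector shift is carried out coordinate by coordinate, each at the price of the
    one-dimensional estimate; hence the factor [d]. *)
Lemma gaussian_shift_aux : forall (h : V) (M : R) (G : V -> R),
  measurable_fun [set: Vm] (G : Vm -> R) -> (forall w, 0 <= G w <= M) ->
  (\int[g]_w (G (w + h))%:E <= \int[g]_w (G w)%:E + (d%:R * K * (`|h| / s) * M)%:E)%E.
Proof.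
move=> h M G mG hG.
have M0 : 0 <= M by have /andP[a b] := hG 0; exact: le_trans b.
have main (r : seq 'I_d) : (\int[g]_w (G (w + \sum_(i <- r) h ord0 i *: delta_mx ord0 i))%:E
     <= \int[g]_w (G w)%:E + ((size r)%:R * K * (`|h| / s) * M)%:E)%E.
  elim: r => [|i r IH].
    by under eq_integral do rewrite big_nil addr0; rewrite /= !mul0r adde0.
  pose v : V := \sum_(j <- r) h ord0 j *: delta_mx ord0 j.
  pose G' := fun w : V => G (w + v).
  have mS : measurable_fun [set: Vm] (fun w : Vm => (w + v : V) : Vm).
    apply: measurable_to_V => j; rewrite (_ : (fun _ => _) = (fun w : Vm => (w : V) ord0 j + v ord0 j)).
      by apply: measurable_funD => //; exact: measurable_coord.
    by apply/funext => w; rewrite mxE.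
  have mG' : measurable_fun [set: Vm] (G' : Vm -> R) by exact: (measurableT_comp mG mS).
  under eq_integral do rewrite big_cons addrA.
  apply: (le_trans (gaussian_shift1 i (h ord0 i) mG' (fun w => hG _))).
  apply: (@le_trans _ _ (\int[g]_w (G w)%:E + ((size r)%:R * K * (`|h| / s) * M)%:E + (K * (`|h| / s) * M)%:E)%E).
    apply: leeD; first exact: IH.
    rewrite lee_fin; apply: ler_wpM2r => //; apply: ler_wpM2l => //; apply: ler_wpM2r.
      by rewrite invr_ge0 ltW.
    exact: coord_le_norm.
  rewrite -addeA; apply: leeD => //; rewrite -EFinD lee_fin /= -natr1.
  by rewrite le_eqVlt; apply/orP; left; apply/eqP; ring.
by have := main (enum 'I_d); rewrite big_enum /= -row_sum_delta size_enum_ord.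
Qed.

End one_time.

Lemma norm_pow_le_sum (p : nat) (w : V) : (0 < p)%N -> `|w| ^+ p <= \sum_(i < d) `|w ord0 i| ^+ p.
Proof.
move=> p0; have [w0|w0] := eqVneq `|w| 0.
  by rewrite w0 expr0n gtn_eqF//; apply: sumr_ge0 => i _; rewrite exprn_ge0.
have [i hi] : exists i, `|w| <= `|w ord0 i|.
  apply: contrapT => /forallNP h.
  have : `|w| < `|w|; last by rewrite ltxx.
  apply: norm_lt_coord; first by rewrite lt_def w0 normr_ge0.
  by move=> i; rewrite ltNge; apply/negP/h.
rewrite (bigD1 i)//=; apply: (@le_trans _ _ (`|w ord0 i| ^+ p)).
  by apply: lerXn2r; rewrite ?nnegrE.
by rewrite lerDl; apply: sumr_ge0 => j _; rewrite exprn_ge0.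
Qed.

Lemma measurable_normV : measurable_fun [set: Vm] (fun w : Vm => `|w : V|).
Proof. by apply: (@continuous_measurable_V R d (fun w => `|w|)) => x; exact: norm_continuous. Qed.

Lemma gaussian_moment (p : nat) : (0 < p)%N -> exists2 C : R, 0 <= C &
  forall (g : probability Vm R) t, 0 < t -> gaussian_law g t ->
  (\int[g]_w (`|w : V| ^+ p)%:E <= (C * Num.sqrt t ^+ p)%:E)%E.
Proof.
move=> p0; have [C C0 hC] := @normal_moment R p.
exists (d%:R * C); first by rewrite mulr_ge0.
move=> g t t0 hg.
have mp i : measurable_fun [set: Vm] (fun w : Vm => `|(w : V) ord0 i| ^+ p).
  by apply: measurable_funX; apply: (measurableT_comp (@normr_measurable R setT)); exact: measurable_coord.
apply: (@le_trans _ _ (\int[g]_w \sum_(i < d) (`|(w : V) ord0 i| ^+ p)%:E)%E).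
  apply: ge0_le_integral => //.
  - by apply/measurable_EFinP/measurable_funX; exact: measurable_normV.
  - by apply: emeasurable_sum => i; apply/measurable_EFinP; exact: mp.
  - by move=> w _; rewrite sumEFin lee_fin; exact: norm_pow_le_sum.
rewrite ge0_integral_sum//; last first.
  by move=> i; apply/measurable_EFinP; exact: mp.
apply: (@le_trans _ _ (\sum_(i < d) (C * Num.sqrt t ^+ p)%:E)%E).
  apply: lee_sum => i _.
  rewrite (@gaussian_coord_integral g t hg i (fun x => (`|x| ^+ p)%:E)); last 2 first.
  - by apply/measurable_EFinP/measurable_funX; exact: normr_measurable.
  - by move=> x; rewrite lee_fin exprn_ge0.
  by apply: hC; rewrite sqrtr_gt0.
by rewrite sumEFin lee_fin sumr_const card_ord -mulrA mulr_natl.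
Qed.

Lemma gaussian_shift : exists2 K : R, 0 <= K & forall (g : probability Vm R) t, 0 < t -> gaussian_law g t ->
  forall (h : V) (M : R) (G : V -> R),
  measurable_fun [set: Vm] (G : Vm -> R) -> (forall w, 0 <= G w <= M) ->
  (\int[g]_w (G (w + h))%:E <= \int[g]_w (G w)%:E + (K * (`|h| / Num.sqrt t) * M)%:E)%E.
Proof.
have [K K0 hK] := @normal_integral_shift R.
exists (d%:R * K); first by rewrite mulr_ge0.
by move=> g t t0 hg h M G mG hG; exact: gaussian_shift_aux.
Qed.

End gaussian_family.

(** * The heat operator on bounded continuous functions *)

Section heat.
Context {R : realType} {d : nat}.
Local Notation V := 'rV[R]_d.
Local Notation Vm := (@borelV R d).

Definition cb (f : V -> R) := continuous f /\ exists M, forall x, `|f x| <= M.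

Lemma cb_mfun f : cb f -> bounded_mfun (f : Vm -> R).
Proof. by move=> [cf bf]; split => //; exact: continuous_measurable_V. Qed.

Lemma cb_comp f (g : V -> V) : cb f -> continuous g -> cb (fun z => f (g z)).
Proof.
move=> [cf [M hM]] cg; split; last by exists M.
by move=> x; apply: continuous_comp; [exact: cg|exact: cf].
Qed.

Lemma continuous_addr (h : V) : continuous (fun z : V => z + h).
Proof. by move=> x; apply: (@continuousD _ V V id (cst h) x) => [?|]; [|exact: cst_continuous]. Qed.

Lemma cb_shift f h : cb f -> cb (fun z => f (z + h)).
Proof. by move=> cf; exact/(cb_comp cf)/continuous_addr. Qed.

Lemma cb_shiftl f h : cb f -> cb (fun z => f (h + z)).
Proof. by move=> /(cb_shift h); under eq_fun do rewrite addrC. Qed.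

Lemma cbD f g : cb f -> cb g -> cb (fun z => f z + g z).
Proof.
move=> [cf [M hM]] [cg [N hN]]; split; first by move=> x; exact: (@continuousD _ R^o V f g x (cf x) (cg x)).
by exists (M + N) => x; apply: le_trans (ler_normD _ _) _; apply: lerD.
Qed.

Lemma cbB f g : cb f -> cb g -> cb (fun z => f z - g z).
Proof.
move=> [cf [M hM]] [cg [N hN]]; split; first by move=> x; exact: (@continuousB _ R^o V f g x (cf x) (cg x)).
by exists (M + N) => x; apply: le_trans (ler_normB _ _) _; apply: lerD.
Qed.

Lemma cb_cst (c : R) : cb (fun=> c).
Proof. by split; [move=> x; exact: cst_continuous|exists `|c|]. Qed.

Lemma lip_continuous (f : V -> R) (L : R) :
  (forall z h, `|f (z + h) - f z| <= L * `|h|) -> continuous f.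
Proof.
move=> hf x; apply/(@cvgrPdist_lt R R^o V (nbhs x) _ f (f x)) => e e0.
have L0 : 0 < `|L| + 1 by rewrite ltr_wpDl.
near=> y; rewrite distrC.
have -> : y = x + (y - x) by rewrite addrC subrK.
apply: le_lt_trans (hf _ _) _.
apply: (@le_lt_trans _ _ ((`|L| + 1) * `|y - x|)).
  by apply: ler_wpM2r => //; apply: le_trans (ler_norm _) _; rewrite lerDl.
rewrite mulrC -ltr_pdivlMr// distrC.
near: y; apply: (@cvgr_dist_lt _ V) => //; by rewrite divr_gt0.
Unshelve. all: by end_near. Qed.

(** Only two facts about the family are used: its Gaussian marginals and the convolution identity.
    Later [gam t] is the law of a Brownian increment, for which the identity follows from
    independence, so no densities have to be convolved. *)
Variable gam : R -> probability Vm R.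
Hypothesis hgam : forall t : R, 0 < t -> gaussian_law (gam t) t.
Hypothesis conv : forall (s t : R) (f : Vm -> \bar R), 0 < s -> 0 < t ->
  measurable_fun setT f -> (forall w, 0 <= f w)%E ->
  (\int[gam (s + t)]_w f w = \int[gam s]_w \int[gam t]_w' f ((w : V) + (w' : V))%R)%E.

Definition heat t (f : V -> R) (z : V) : R := \int[gam t]_w f (z + (w : V)).

Lemma heat_mfun f z : cb f -> bounded_mfun (fun w : Vm => f (z + (w : V))).
Proof. by move=> cf; apply: cb_mfun; exact: cb_shiftl. Qed.

Lemma heatD t f g z : cb f -> cb g ->
  heat t (fun x => f x + g x) z = heat t f z + heat t g z.
Proof. by move=> cf cg; rewrite /heat expectD//; exact: heat_mfun. Qed.

Lemma heatB t f g z : cb f -> cb g ->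
  heat t (fun x => f x - g x) z = heat t f z - heat t g z.
Proof. by move=> cf cg; rewrite /heat expectB//; exact: heat_mfun. Qed.

Lemma heat_cst t c z : heat t (fun=> c) z = c.
Proof. exact: expect_cst. Qed.

Lemma heat_bound t f M z : cb f -> (forall x, `|f x| <= M) -> `|heat t f z| <= M.
Proof. by move=> cf fM; apply: expect_bound => // *; exact: heat_mfun. Qed.

Lemma heat_translate t f h z : heat t (fun x => f (x + h)) z = heat t f (z + h).
Proof. by rewrite /heat; apply: eq_Rintegral => w _; rewrite addrAC. Qed.

(** The gradient bound in difference form. Adding [A] makes [f] nonnegative and bounded by [2 * A],
    so the one-sided estimate for shifted Gaussians applies; the reverse inequality comes from the
    shift by [- h]. *)
Lemma heat_smooth1 : exists2 K : R, 0 <= K & forall t, 0 < t -> forall f A z h, cb f ->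
  (forall x, `|f x| <= A) -> `|heat t f (z + h) - heat t f z| <= K * (`|h| / Num.sqrt t) * A.
Proof.
have [K K0 hK] := @gaussian_shift R d.
exists (2 * K); first by rewrite mulr_ge0.
move=> t t0 f A z h cf fA.
have one v k : heat t f (v + k) - heat t f v <= 2 * K * (`|k| / Num.sqrt t) * A.
  pose G := fun w : V => f (v + w) + A.
  have cG : cb G by apply: cbD; [exact: cb_shiftl|exact: cb_cst].
  have G0 w : 0 <= G w <= 2 * A.
    have := fA (v + w); rewrite ler_norml /G => /andP[? ?]; lra.
  have := hK (gam t) t t0 (hgam t0) k (2 * A) G (cb_mfun cG).1 G0.
  have -> : (\int[gam t]_w (G (w + k))%:E = (heat t f (v + k) + A)%:E)%E.
    rewrite (expect_fin (gam t) (cb_mfun (cb_shift k cG))); congr EFin.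
    rewrite -[X in _ = _ + X](heat_cst t A (v + k)) -heatD//; last exact: cb_cst.
    by apply: eq_Rintegral => w _; rewrite /G -!addrA (addrC k).
  have -> : (\int[gam t]_w (G w)%:E = (heat t f v + A)%:E)%E.
    rewrite (expect_fin (gam t) (cb_mfun cG)); congr EFin.
    by rewrite -[X in _ = _ + X](heat_cst t A v) -heatD//; exact: cb_cst.
  rewrite -EFinD lee_fin; lra.
have t1 : `|h| / Num.sqrt t = `|- h| / Num.sqrt t by rewrite normrN.
rewrite ler_norml (one z h) andbT lerNl opprB.
by have := one (z + h) (- h); rewrite addrK normrN.
Qed.

Lemma heat_cb t f : 0 < t -> cb f -> cb (heat t f).
Proof.
move=> t0 cf; have [M hM] := cf.2; split; last by exists M => x; exact: heat_bound.
have [K K0 hK] := heat_smooth1.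
apply: (@lip_continuous _ (K * (1 / Num.sqrt t) * M)) => z h.
by apply: le_trans (hK t t0 f M z h cf hM) _; rewrite le_eqVlt; apply/orP; left; apply/eqP; ring.
Qed.

Lemma heat_semigroup s t f z : 0 < s -> 0 < t -> cb f ->
  heat s (heat t f) z = heat (s + t) f z.
Proof.
move=> s0 t0 cf; have [M hM] := cf.2.
pose g := fun w : V => f (z + w) + M.
have cg : cb g by apply: cbD; [exact: cb_shiftl|exact: cb_cst].
have g0 w : 0 <= g w by have := hM (z + w); rewrite ler_norml /g => /andP[? ?]; lra.
apply: (@addIr _ M).
have -> : heat (s + t) f z + M = \int[gam (s + t)]_w g w.
  by rewrite -[X in _ + X](heat_cst (s + t) M z) -heatD//; exact: cb_cst.
have -> : heat s (heat t f) z + M = \int[gam s]_w (heat t f (z + w) + M).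
  rewrite -[X in _ + X](heat_cst s M z) -heatD//; last exact: cb_cst.
  exact: heat_cb.
apply: EFin_inj; rewrite -(expect_fin _ (cb_mfun cg)).
rewrite -(expect_fin (gam s) (f := fun w : Vm => heat t f (z + (w : V)) + M)); last first.
  apply: cb_mfun; apply: cbD; last exact: cb_cst.
  by apply: cb_shiftl; exact: heat_cb.
have mg : measurable_fun [set: Vm] (fun w : Vm => (g w)%:E).
  by apply/measurable_EFinP; exact: (cb_mfun cg).1.
rewrite (conv s0 t0 mg); last by move=> w; rewrite lee_fin.
apply: eq_integral => w _.
rewrite (expect_fin (gam t) (f := fun w' : Vm => g ((w : V) + (w' : V)))); last first.
  by apply: cb_mfun; exact: cb_shiftl.
congr EFin; rewrite -[X in _ + X](heat_cst t M (z + w)) -heatD//; last exact: cb_cst.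
by apply: eq_Rintegral => w' _; rewrite /g addrA.
Qed.

(* x^a <= 1 + x^2 turns the fractional moment into the second moment *)
Lemma powR_le_1Dsqr (u a : R) : 0 <= u -> 0 < a -> a <= 1 -> u `^ a <= 1 + u ^+ 2.
Proof.
move=> u0 a0 a1; case: (leP u 1) => [u1|u1].
  apply: (@le_trans _ _ 1); last by rewrite lerDl sqr_ge0.
  have <- : 1 `^ a = 1 :> R by rewrite powR1.
  by apply: ge0_ler_powR; rewrite ?nnegrE// ltW.
apply: (@le_trans _ _ (u `^ 1)); first by apply: ler_powR => //; exact: ltW.
rewrite powRr1//; have := sqr_ge0 (u - 1); nra.
Qed.

Lemma heat_holder : exists2 K : R, 0 <= K & forall t, 0 < t -> forall f A a z, cb f ->
  0 < a -> a <= 1 -> 0 <= A -> (forall x y, `|f x - f y| <= A * `|x - y| `^ a) ->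
  `|heat t f z - f z| <= K * A * Num.sqrt t `^ a.
Proof.
have [C C0 hC] := @gaussian_moment R d 2 isT.
exists (1 + C); first by rewrite addr_ge0.
move=> t t0 f A a z cf a0 a1 A0 fH.
have s0 : 0 < Num.sqrt t by rewrite sqrtr_gt0.
set s := Num.sqrt t in s0 *.
rewrite -[X in _ - X](heat_cst t (f z) z) -heatB//; last exact: cb_cst.
pose G := fun w : V => A * s `^ a * (1 + (`|w| / s) ^+ 2).
have Ga (w : V) : `|f (z + w) - f z| <= G w.
  apply: le_trans (fH _ _) _; rewrite [z + w]addrC addrK /G -mulrA; apply: ler_wpM2l => //.
  have -> : `|w| = s * (`|w| / s) by field; rewrite gt_eqF.
  have ws0 : 0 <= `|w| / s by rewrite divr_ge0// ltW.
  rewrite (powRM _ (ltW s0) ws0).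
  apply: ler_wpM2l; first exact: powR_ge0.
  rewrite [s * _ / s](_ : _ = `|w| / s); last by field; rewrite gt_eqF.
  exact: powR_le_1Dsqr.
have mn2 : measurable_fun [set: Vm] (fun w : Vm => `|w : V| ^+ 2).
  by apply: measurable_funX; exact: measurable_normV.
have mG : measurable_fun [set: Vm] (G : Vm -> R).
  apply: measurable_funM => //; apply: measurable_funD => //; apply: measurable_funX.
  by apply: measurable_funM => //; exact: measurable_normV.
have As0 : 0 <= A * s `^ a by rewrite mulr_ge0// powR_ge0.
have iG : (\int[gam t]_w (G w)%:E <= ((1 + C) * A * s `^ a)%:E)%E.
  have -> : (\int[gam t]_w (G w)%:E = \int[gam t]_w ((A * s `^ a)%:E + (A * s `^ a / s ^+ 2)%:E * (`|w : V| ^+ 2)%:E))%E.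
    apply: eq_integral => w _; rewrite /G -EFinM -EFinD; congr EFin.
    by rewrite exprMn mulrDr mulr1 exprVn; congr (_ + _); ring.
  have I2 (w : Vm) : (0 <= (A * s `^ a / s ^+ 2)%:E * (`|w : V| ^+ 2)%:E)%E.
    by rewrite -EFinM lee_fin mulr_ge0 ?exprn_ge0// divr_ge0// exprn_ge0// ltW.
  have I3 : measurable_fun setT (fun w : Vm => ((A * s `^ a / s ^+ 2)%:E * (`|w : V| ^+ 2)%:E)%E).
    by apply/measurable_EFinP; apply: measurable_funM.
  have I4 : measurable_fun setT (fun w : Vm => (`|w : V| ^+ 2)%:E) by exact/measurable_EFinP.
  have I5 : (0 <= (A * s `^ a / s ^+ 2)%:E)%E by rewrite lee_fin divr_ge0// exprn_ge0// ltW.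
  rewrite ge0_integralD// integral_prob_cst ge0_integralZl//.
  have -> : ((1 + C) * A * s `^ a)%:E = ((A * s `^ a)%:E + (A * s `^ a / s ^+ 2)%:E * (C * s ^+ 2)%:E)%E.
    by rewrite -EFinM -EFinD; congr EFin; field; rewrite gt_eqF.
  apply: leeD => //; apply: lee_wpmul2l; first by rewrite lee_fin divr_ge0// exprn_ge0// ltW.
  exact: (hC (gam t) t t0 (hgam t0)).
have G0 w : 0 <= G w by rewrite mulr_ge0// addr_ge0// sqr_ge0.
have iG' : (gam t).-integrable setT (EFin \o (G : Vm -> R)).
  apply/integrableP; split; first exact/measurable_EFinP.
  apply: le_lt_trans (ltry ((1 + C) * A * s `^ a)).
  by under eq_integral => w _ do rewrite /= ger0_norm//.
apply: (@le_trans _ _ (\int[gam t]_w G w)).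
  apply: expect_norm_le => //.
  by apply: cb_mfun; apply: cbB; [exact: cb_shiftl|exact: cb_cst].
rewrite -lee_fin; apply: le_trans iG.
by rewrite /Rintegral fineK//; exact: integrable_fin_num.
Qed.

End heat.

(** * Parabolic smoothing for finite differences *)

Section powR_gt0.
Context {R : realType}.
Lemma gt0_powRB (x r s : R) : 0 < x -> x `^ (r - s) = x `^ r / x `^ s.
Proof. by move=> x0; rewrite powRB// (gt_eqF x0) implybT. Qed.
Lemma gt0_powRD (x r s : R) : 0 < x -> x `^ (r + s) = x `^ r * x `^ s.
Proof. by move=> x0; rewrite powRD// (gt_eqF x0) implybT. Qed.
Lemma gt0_powRB1 (x r : R) : 0 < x -> x `^ (r - 1) = x `^ r / x.
Proof. by move=> x0; rewrite gt0_powRB// powRr1 ?ltW. Qed.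
Lemma ge0_ler_powR_base (x y r : R) : 0 <= r -> 0 <= x -> x <= y -> x `^ r <= y `^ r.
Proof.
by move=> r0 x0 xy; apply: ge0_ler_powR => //; rewrite nnegrE// (le_trans x0).
Qed.
End powR_gt0.

Section difference.
Context {R : realType} {d : nat} {W : zmodType}.
Local Notation V := 'rV[R]_d.
Definition dif (h : V) (f : V -> W) : V -> W := fun z => f (z + h) - f z.
End difference.

Section smoothing.
Context {R : realType} {d : nat}.
Local Notation V := 'rV[R]_d.
Local Notation Vm := (@borelV R d).

Variable gam : R -> probability Vm R.
Hypothesis hgam : forall t : R, 0 < t -> gaussian_law (gam t) t.
Hypothesis conv : forall (s t : R) (f : Vm -> \bar R), 0 < s -> 0 < t ->
  measurable_fun setT f -> (forall w, 0 <= f w)%E ->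
  (\int[gam (s + t)]_w f w = \int[gam s]_w \int[gam t]_w' f ((w : V) + (w' : V))%R)%E.
Local Notation heat := (heat gam).

Lemma cb_dif h (f : V -> R) : cb f -> cb (dif h f).
Proof. by move=> cf; apply: cbB => //; exact: cb_shift. Qed.

Lemma heat_dif t h f z : cb f -> heat t (dif h f) z = dif h (heat t f) z.
Proof. by move=> cf; rewrite /dif heatB ?heat_translate//; exact: cb_shift. Qed.

Lemma heat_difE t h f : cb f -> heat t (dif h f) = dif h (heat t f).
Proof. by move=> cf; apply/funext => z; exact: heat_dif. Qed.

Definition holder_bounded (A a : R) (f : V -> R) :=
  [/\ cb f, forall x, `|f x| <= A & forall x y, `|f x - f y| <= A * `|x - y| `^ a].

Variables (T a : R).
Hypotheses (T0 : 0 < T) (a0 : 0 < a) (a1 : a < 1).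

(** Doubling of time: [P_t f = P_t (f - P_t f) + P_2t f]. The first term gains from
    [|f - P_t f| <= C t^(a/2)], the second is known from the later time, and the gains sum because
    [q = sqrt 2 ^ (a - 1) < 1]. The constant satisfies [c + K q <= K], so the induction keeps it. *)
Lemma heat_smooth_holder : exists2 K : R, 0 <= K & forall t, 0 < t -> t <= T ->
  forall f A l z, holder_bounded A a f ->
  `|dif l (heat t f) z| <= K * A * `|l| * Num.sqrt t `^ (a - 1).
Proof.
have [K1 K10 hK1] := heat_smooth1 hgam.
have [K2 K20 hK2] := heat_holder hgam.
pose q : R := Num.sqrt 2 `^ (a - 1).
have q1 : q < 1.
  have s2 : 1 < Num.sqrt (2 : R) by rewrite -[ltLHS]sqrtr1 ltr_sqrt// ltr1n.
  rewrite /q -(opprB 1) powRN invf_lt1 ?powR_gt0 ?(lt_trans _ s2)//.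
  have {1}<- : 1 `^ (1 - a) = 1 :> R by rewrite powR1.
  by apply: gt0_ltr_powR; rewrite ?subr_gt0 ?nnegrE ?sqrtr_ge0.
pose c := K1 * K2.
pose K := K1 * Num.sqrt T `^ (- a) + c / (1 - q).
have q0 : 0 < 1 - q by rewrite subr_gt0.
have c0 : 0 <= c by rewrite mulr_ge0.
have K0 : 0 <= K by rewrite addr_ge0// ?mulr_ge0 ?powR_ge0// invr_ge0 ltW.
have cE : c = K1 * K2 by [].
clearbody c.
exists K; first exact: K0.
(* [N] bounds the number of doublings that lead from [t] to a time at least [T], where the bound for
   bounded functions suffices. *)
suff main N : forall t, 0 < t -> T / 2 ^+ N <= t ->
  forall f A l z, holder_bounded A a f ->
  `|dif l (heat t f) z| <= K * A * `|l| * Num.sqrt t `^ (a - 1).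
  move=> t t0 tT f A l z hf.
  have [N hN] : exists N, T / 2 ^+ N <= t.
    have [N hN] : exists N : nat, T / t <= N%:R.
      have h0 : 0 <= T / t by rewrite divr_ge0// ltW.
      by exists (Num.Def.archi_bound (T / t)); apply/ltW/archi_boundP.
    exists N; rewrite ler_pdivrMr ?exprn_gt0// mulrC -ler_pdivrMr//.
    apply: le_trans hN _; rewrite -natrX ler_nat; exact/ltnW/ltn_expl.
  exact: (main N).
elim: N => [|N IH] t t0 hT f A l z [cf fA fH].
  have A0 : 0 <= A by apply: le_trans (fA 0).
  apply: le_trans (hK1 t t0 f A z l cf fA) _.
  rewrite expr0 divr1 in hT.
  set s := Num.sqrt t; have s0 : 0 < s by rewrite sqrtr_gt0.
  have -> : s `^ (a - 1) = s `^ a / s by exact: gt0_powRB1.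
  apply: (@le_trans _ _ (K1 * Num.sqrt T `^ (- a) * A * `|l| * (s `^ a / s))); last first.
    rewrite [leLHS](_ : _ = K1 * Num.sqrt T `^ (- a) * (A * `|l| * (s `^ a / s))); last by ring.
    rewrite [leRHS](_ : _ = K * (A * `|l| * (s `^ a / s))); last by ring.
    apply: ler_wpM2r.
      by rewrite !mulr_ge0 ?powR_ge0// invr_ge0 ltW.
    by rewrite /K lerDl divr_ge0// ltW.
  have h1 : 1 <= Num.sqrt T `^ (- a) * s `^ a.
    rewrite powRN mulrC ler_pdivlMr ?powR_gt0 ?sqrtr_gt0// mul1r.
    by apply: ge0_ler_powR_base; [exact: ltW|exact: sqrtr_ge0|exact: ler_wsqrtr].
  rewrite [leRHS](_ : _ = (K1 * (`|l| / s) * A) * (Num.sqrt T `^ (- a) * s `^ a)); last by ring.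
  by rewrite ler_peMr// !mulr_ge0// invr_ge0 ltW.
have A0 : 0 <= A by apply: le_trans (fA 0).
have t2 : 0 < t + t by rewrite addr_gt0.
have hT2 : T / 2 ^+ N <= t + t.
  by have := hT; rewrite exprSr invfM mulrA => h; lra.
have := IH (t + t) t2 hT2 f A l z (And3 cf fA fH).
set s := Num.sqrt t; have s0 : 0 < s by rewrite sqrtr_gt0.
have -> : Num.sqrt (t + t) `^ (a - 1) = q * s `^ (a - 1).
  rewrite /q -powRM ?sqrtr_ge0// -sqrtrM//; congr (Num.sqrt _ `^ _).
  by rewrite mulrDl mul1r.
move=> h2.
have cht := heat_cb hgam t0 cf.
have cg : cb (fun x => f x - heat t f x) by exact: cbB.
have h1 : `|dif l (heat t (fun x => f x - heat t f x)) z| <= c * A * `|l| * s `^ (a - 1).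
  have gA x : `|f x - heat t f x| <= K2 * A * s `^ a.
    by rewrite distrC; exact: hK2 (ltW a1) A0 fH.
  apply: le_trans (hK1 t t0 _ _ z l cg gA) _.
  by rewrite gt0_powRB1// -/s le_eqVlt cE; apply/orP; left; apply/eqP; ring.
have -> : dif l (heat t f) z = dif l (heat t (fun x => f x - heat t f x)) z + dif l (heat (t + t) f) z.
  by rewrite /dif !heatB// !(heat_semigroup hgam conv)//; ring.
apply: le_trans (ler_normD _ _) _.
apply: le_trans (lerD h1 h2) _.
rewrite (_ : _ + _ = (c + K * q) * (A * `|l| * s `^ (a - 1))); last by ring.
rewrite -!mulrA; apply: ler_wpM2r; first by rewrite !mulr_ge0// powR_ge0.
rewrite -lerBrDr -{1}(mulr1 K) -mulrBr /K mulrDl divfK ?gt_eqF//.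
by rewrite lerDr !mulr_ge0 ?powR_ge0// ltW.
Qed.

Variable b : R.
Hypotheses (b0 : 0 < b) (ba : b < a).
(* [sg] is minus twice the exponent sigma = 1 - (a - b)/2 of integrability in time *)
Let sg := a - b - 2.

(** A second difference uses half of the time for each direction. For the third, if [|l| <= sqrt t]
    the Hoelder bound on [dif l f] precedes two smoothings; otherwise two second differences
    suffice, since [sqrt t ^ b <= |l| ^ b]. All three bounds are given with the worst power [sg], at
    the price of a factor depending on [T]. *)
Lemma heat_smooth : exists2 K : R, 0 <= K & forall t, 0 < t -> t <= T ->
  forall f A, holder_bounded A a f -> forall h k l z,
  [/\ `|dif h (heat t f) z| <= K * A * `|h| * Num.sqrt t `^ sg,
      `|dif h (dif k (heat t f)) z| <= K * A * `|h| * `|k| * Num.sqrt t `^ sg &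
      `|dif h (dif k (dif l (heat t f))) z| <= K * A * `|h| * `|k| * `|l| `^ b * Num.sqrt t `^ sg].
Proof.
have [K1 K10 hK1] := heat_smooth1 hgam.
have [K2 K20 hK2] := heat_smooth_holder.
have [q [q0 qE]] : exists q : R, 0 < q /\ q = Num.sqrt 2^-1.
  by exists (Num.sqrt 2^-1); rewrite sqrtr_gt0 invr_gt0.
pose C2 := K1 / q * K2 * q `^ (a - 1).
have C20 : 0 <= C2 by rewrite !mulr_ge0 ?powR_ge0// invr_ge0 ltW.
have C2E : C2 = K1 / q * K2 * q `^ (a - 1) by [].
clearbody C2.
pose C3 := K1 / q * (K1 / q) + 2 * C2.
have K1q : 0 <= K1 / q by rewrite divr_ge0// ltW.
have C30 : 0 <= C3 by apply: addr_ge0; apply: mulr_ge0.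
have C3a : K1 / q * (K1 / q) <= C3 by rewrite /C3 lerDl mulr_ge0.
have C3b : 2 * C2 <= C3 by rewrite /C3 lerDr mulr_ge0.
clearbody C3.
have [S [S0 SE]] : exists S : R, 0 < S /\ S = Num.sqrt T.
  by exists (Num.sqrt T); rewrite sqrtr_gt0.
pose K := K2 * S `^ (1 + b) + C2 * S `^ b + C3.
have p1 : 0 <= K2 * S `^ (1 + b) by rewrite mulr_ge0 ?powR_ge0.
have p2 : 0 <= C2 * S `^ b by rewrite mulr_ge0 ?powR_ge0.
have K0 : 0 <= K by apply: addr_ge0 => //; apply: addr_ge0.
have K2K : K2 * S `^ (1 + b) <= K by rewrite /K -addrA lerDl addr_ge0.
have C2K : C2 * S `^ b <= K by rewrite /K addrAC lerDr addr_ge0.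
have C3K : C3 <= K by rewrite /K lerDr addr_ge0.
clearbody K.
exists K; first exact: K0.
move=> t t0 tT f A hf h k l z.
have [cf fA fH] := hf.
have A0 : 0 <= A by apply: le_trans (fA 0).
have s0 : 0 < Num.sqrt t by rewrite sqrtr_gt0.
have sS : Num.sqrt t <= S by rewrite SE ler_wsqrtr.
have t2 : 0 < t / 2 by rewrite divr_gt0.
have t2T : t / 2 <= T by apply: le_trans tT; rewrite ler_pdivrMr// ler_peMr ?ler1n// ltW.
have sq : Num.sqrt (t / 2) = q * Num.sqrt t by rewrite qE mulrC sqrtrM// ltW.
have [s sE] : exists s : R, s = Num.sqrt t by exists (Num.sqrt t).
rewrite -sE in s0 sS sq *.
have pw (c e : R) : 0 <= e -> c = sg + e -> s `^ c <= S `^ e * s `^ sg.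
  move=> e0 ->; rewrite gt0_powRD// mulrC; apply: ler_wpM2r; first exact: powR_ge0.
  by apply: ge0_ler_powR_base => //; exact: ltW.
have sq0 : 0 < q * s by rewrite mulr_gt0.
have half g : cb g -> heat t g = heat (t / 2) (heat (t / 2) g).
  by move=> cg; apply/funext => x; rewrite (heat_semigroup hgam conv)// -splitr.
have B2 g B h' k' x : holder_bounded B a g ->
    `|dif h' (dif k' (heat t g)) x| <= C2 * B * `|h'| * `|k'| * s `^ (a - 2).
  move=> hg; have [cg gB gH] := hg; have B0 : 0 <= B by apply: le_trans (gB 0).
  have cht := heat_cb hgam t2 cg.
  rewrite half// -heat_difE//.
  have bd y : `|dif k' (heat (t / 2) g) y| <= K2 * B * `|k'| * (q * s) `^ (a - 1).
    by rewrite -sq; exact: hK2.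
  apply: le_trans (hK1 _ t2 _ _ x h' (cb_dif _ cht) bd) _.
  rewrite sq (powRM _ (ltW q0) (ltW s0)) le_eqVlt C2E; apply/orP; left; apply/eqP.
  have -> : s `^ (a - 2) = s `^ (a - 1) / s.
    by rewrite (_ : a - 2 = a - 1 - 1) ?gt0_powRB1//; ring.
  by field; rewrite !gt_eqF.
split.
- apply: le_trans (hK2 t t0 tT f A h z hf) _; rewrite -sE.
  have h1 : s `^ (a - 1) <= S `^ (1 + b) * s `^ sg.
    by apply: pw; [rewrite addr_ge0// ltW|rewrite /sg; ring].
  apply: (@le_trans _ _ (K2 * A * `|h| * (S `^ (1 + b) * s `^ sg))).
    by apply: ler_wpM2l => //; rewrite !mulr_ge0.
  rewrite (_ : _ * _ = K2 * S `^ (1 + b) * (A * `|h| * s `^ sg)); last by ring.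
  by rewrite -!(mulrA K); apply: ler_wpM2r => //; rewrite !mulr_ge0 ?powR_ge0.
- apply: le_trans (B2 f A h k z hf) _.
  have h1 : s `^ (a - 2) <= S `^ b * s `^ sg by apply: pw; [exact: ltW|rewrite /sg; ring].
  apply: (@le_trans _ _ (C2 * A * `|h| * `|k| * (S `^ b * s `^ sg))).
    by apply: ler_wpM2l => //; rewrite !mulr_ge0.
  rewrite (_ : _ * _ = C2 * S `^ b * (A * `|h| * `|k| * s `^ sg)); last by ring.
  by rewrite -!(mulrA K); apply: ler_wpM2r => //; rewrite !mulr_ge0 ?powR_ge0.
have ssg : s `^ sg = s `^ (a - b) / s ^+ 2.
  by rewrite /sg (gt0_powRB (a - b) 2 s0) (powR_mulrn 2 (ltW s0)).
apply: (@le_trans _ _ (C3 * (A * `|h| * `|k| * `|l| `^ b * s `^ sg))); last first.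
  by rewrite -!(mulrA K); apply: ler_wpM2r => //; rewrite !mulr_ge0 ?powR_ge0.
have AHK0 : 0 <= A * `|h| * `|k| by rewrite !mulr_ge0.
case: (leP `|l| s) => ls.
  have cd := cb_dif l cf.
  have gb x : `|dif l f x| <= A * `|l| `^ a by apply: le_trans (fH _ _) _; rewrite addrC addKr.
  rewrite -(heat_difE t l cf) half//.
  have cht := heat_cb hgam t2 cd.
  have cdk := cb_dif k cht.
  rewrite -(heat_difE (t / 2) k cht).
  have bd y : `|dif k (heat (t / 2) (dif l f)) y| <= K1 * (`|k| / (q * s)) * (A * `|l| `^ a).
    by rewrite -sq; exact: hK1.
  apply: le_trans (hK1 _ t2 _ _ z h cdk bd) _; rewrite sq.
  have la : `|l| `^ a <= `|l| `^ b * s `^ (a - b).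
    have [->|l0] := eqVneq `|l| 0; first by rewrite powR0 ?gt_eqF// mulr_ge0 ?powR_ge0.
    have -> : `|l| `^ a = `|l| `^ b * `|l| `^ (a - b).
      by rewrite -gt0_powRD ?lt_def ?l0 ?normr_ge0//; congr (_ `^ _); ring.
    apply: ler_wpM2l; first exact: powR_ge0.
    by apply: ge0_ler_powR; rewrite ?nnegrE ?subr_ge0// ltW.
  rewrite [leLHS](_ : _ = K1 / q * (K1 / q) * (A * `|h| * `|k|) / s ^+ 2 * `|l| `^ a); last first.
    by field; rewrite !gt_eqF.
  apply: (@le_trans _ _ (K1 / q * (K1 / q) * (A * `|h| * `|k|) / s ^+ 2 * (`|l| `^ b * s `^ (a - b)))).
    by apply: ler_wpM2l => //; rewrite !mulr_ge0 ?invr_ge0 ?exprn_ge0// ltW.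
  rewrite ssg [leLHS](_ : _ = K1 / q * (K1 / q) * (A * `|h| * `|k| * `|l| `^ b * (s `^ (a - b) / s ^+ 2))); last by ring.
  apply: ler_wpM2r; first by rewrite !mulr_ge0 ?powR_ge0// invr_ge0 exprn_ge0// ltW.
  exact: C3a.
have -> : dif h (dif k (dif l (heat t f))) z =
  dif h (dif k (heat t f)) (z + l) - dif h (dif k (heat t f)) z.
  by move: (heat t f) => g; rewrite /dif (addrAC z l h) (addrAC z l k) (addrAC (z + h) l k); ring.
apply: le_trans (ler_normB _ _) _.
apply: le_trans (lerD (B2 f A h k _ hf) (B2 f A h k _ hf)) _.
have la : s `^ (a - 2) <= `|l| `^ b * s `^ sg.
  rewrite ssg (_ : s `^ (a - 2) = s `^ b * (s `^ (a - b) / s ^+ 2)); last first.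
    by rewrite mulrA -gt0_powRD// (addrC b) subrK (gt0_powRB a 2 s0) (powR_mulrn 2 (ltW s0)).
  apply: ler_wpM2r; first by rewrite mulr_ge0 ?powR_ge0// invr_ge0 exprn_ge0// ltW.
  by apply: ge0_ler_powR_base => //; exact: ltW.
rewrite [leLHS](_ : _ = 2 * C2 * (A * `|h| * `|k|) * s `^ (a - 2)); last by ring.
apply: (@le_trans _ _ (2 * C2 * (A * `|h| * `|k|) * (`|l| `^ b * s `^ sg))).
  by apply: ler_wpM2l => //; rewrite !mulr_ge0.
rewrite [leLHS](_ : _ = 2 * C2 * (A * `|h| * `|k| * `|l| `^ b * s `^ sg)); last by ring.
apply: ler_wpM2r; first by rewrite !mulr_ge0 ?powR_ge0.
exact: C3b.
Qed.

End smoothing.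

(** * Bounded continuous and Hoelder vector fields *)

Section vector_functions.
Context {R : realType} {d : nat}.
Local Notation V := 'rV[R]_d.
Implicit Types F G : V -> V.

Definition vcb F := continuous F /\ exists M, forall x, `|F x| <= M.

Lemma continuous_row F : (forall i, continuous (fun x => F x ord0 i)) -> continuous F.
Proof.
move=> cF x; apply/(@cvgrPdist_lt R V V (nbhs x) _ F (F x)) => e e0.
have H (i : 'I_d) : \forall y \near x, `|F x ord0 i - F y ord0 i| < e.
  exact: ((@cvgrPdist_lt R R^o V (nbhs x) _ _ (F x ord0 i)).1 (cF i x)).
have H2 : \forall y \near x, forall i, `|F x ord0 i - F y ord0 i| < e.
  exact: (@filter_forall _ _ _ _ (nbhs_filter (x : V)) H).
near=> y; apply: norm_lt_coord => // i; rewrite !mxE; move: i; near: y; exact: H2.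
Unshelve. all: by end_near. Qed.

Lemma vcb_coord F i : vcb F -> cb (fun x => F x ord0 i).
Proof.
move=> [cF [M hM]]; split; last by exists M => x; exact: le_trans (coord_le_norm _ i) (hM x).
move=> x; apply: (@continuous_comp _ _ _ F (fun y : V => y ord0 i)); first exact: cF.
exact: continuous_coord.
Qed.

Lemma cb_vcb F : (forall i, cb (fun x => F x ord0 i)) -> vcb F.
Proof.
move=> cF; split; first by apply: continuous_row => i; exact: (cF i).1.
have /choice[M hM] : forall i, exists M, forall x, `|F x ord0 i| <= M by move=> i; exact: (cF i).2.
have M0 i : 0 <= M i by apply: le_trans (hM i 0).
exists (\sum_i M i) => x; apply: norm_le_coord; first exact: sumr_ge0.
by move=> i; apply: le_trans (hM i x) _; rewrite (bigD1 i)//= lerDl sumr_ge0.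
Qed.

Lemma vcbD F G : vcb F -> vcb G -> vcb (fun x => F x + G x).
Proof.
move=> cF cG; apply: cb_vcb => i.
rewrite (_ : (fun _ => _) = (fun x => F x ord0 i + G x ord0 i)); last by apply/funext => x; rewrite mxE.
by apply: cbD; exact: vcb_coord.
Qed.

Lemma vcbB F G : vcb F -> vcb G -> vcb (fun x => F x - G x).
Proof.
move=> cF cG; apply: cb_vcb => i.
rewrite (_ : (fun _ => _) = (fun x => F x ord0 i - G x ord0 i)); last by apply/funext => x; rewrite !mxE.
by apply: cbB; exact: vcb_coord.
Qed.

Lemma vcb0 : vcb (fun=> 0).
Proof. by apply: cb_vcb => i; rewrite (_ : (fun _ => _) = (fun=> 0)); [exact: cb_cst|apply/funext => x; rewrite mxE]. Qed.

Lemma continuous_idD F : continuous F -> continuous (fun x : V => x + F x).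
Proof. by move=> cF x; apply: (@continuousD _ V V id F x) => //; exact: cF. Qed.

Lemma vcb_comp F (g : V -> V) : vcb F -> continuous g -> vcb (fun x => F (g x)).
Proof.
move=> cF cg; apply: cb_vcb => i.
exact: (cb_comp (vcb_coord i cF) cg).
Qed.

Definition vholder_bounded (A a : R) F :=
  [/\ vcb F, forall x, `|F x| <= A & forall x y, `|F x - F y| <= A * `|x - y| `^ a].

Lemma vholder_coord A a F i : vholder_bounded A a F -> holder_bounded A a (fun x => F x ord0 i).
Proof.
move=> [cF FA FH]; split; first exact: vcb_coord.
- by move=> x; exact: le_trans (coord_le_norm _ i) (FA x).
- move=> x y; apply: le_trans (FH x y); rewrite (_ : _ - _ = (F x - F y) ord0 i) ?coord_le_norm//.
  by rewrite !mxE.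
Qed.

End vector_functions.

Section vheat.
Context {R : realType} {d : nat}.
Local Notation V := 'rV[R]_d.
Local Notation Vm := (@borelV R d).
Implicit Types F G : V -> V.

Variable gam : R -> probability Vm R.
Hypothesis hgam : forall t : R, 0 < t -> gaussian_law (gam t) t.
Hypothesis conv : forall (s t : R) (f : Vm -> \bar R), 0 < s -> 0 < t ->
  measurable_fun setT f -> (forall w, 0 <= f w)%E ->
  (\int[gam (s + t)]_w f w = \int[gam s]_w \int[gam t]_w' f ((w : V) + (w' : V))%R)%E.

Definition vheat t F : V -> V := fun z => \row_i heat gam t (fun x => F x ord0 i) z.

Lemma vheatD t F G z : vcb F -> vcb G -> vheat t (fun x => F x + G x) z = vheat t F z + vheat t G z.
Proof.
move=> cF cG; apply/rowP => i; rewrite !mxE -heatD; [|exact: vcb_coord|exact: vcb_coord].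
by congr (heat _ _ _ _); apply/funext => x; rewrite mxE.
Qed.

Lemma vheat_vcb t F : 0 < t -> vcb F -> vcb (vheat t F).
Proof.
move=> t0 cF; apply: cb_vcb => i.
rewrite (_ : (fun _ => _) = heat gam t (fun x => F x ord0 i)); last by apply/funext => x; rewrite mxE.
by apply: heat_cb => //; exact: vcb_coord.
Qed.

Lemma vheat_semigroup s t F : 0 < s -> 0 < t -> vcb F -> vheat s (vheat t F) = vheat (s + t) F.
Proof.
move=> s0 t0 cF; apply/funext => z; apply/rowP => i; rewrite !mxE.
rewrite -(heat_semigroup hgam conv z s0 t0 (vcb_coord i cF)).
by congr (heat _ _ _ _); apply/funext => x; rewrite mxE.
Qed.

Lemma vheat_bound t F A z : vcb F -> (forall x, `|F x| <= A) -> `|vheat t F z| <= A.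
Proof.
move=> cF FA; have A0 : 0 <= A by apply: le_trans (FA 0).
apply: norm_le_coord => // i; rewrite mxE; apply: heat_bound; first exact: vcb_coord.
by move=> x; exact: le_trans (coord_le_norm _ i) (FA x).
Qed.

Lemma vheat_dif t F h z : vcb F -> dif h (vheat t F) z = vheat t (dif h F) z.
Proof.
move=> cF; apply/rowP => i; rewrite !mxE -[RHS]/(heat _ _ _ _).
rewrite -[LHS]/(dif h (heat gam t (fun x => F x ord0 i)) z) -heat_dif; last exact: vcb_coord.
by congr (heat _ _ _ _); apply/funext => x; rewrite /dif !mxE.
Qed.

Lemma vcb_dif h F : vcb F -> vcb (dif h F).
Proof. by move=> cF; apply: vcbB => //; apply: (vcb_comp cF); exact: continuous_addr. Qed.

Lemma vheat_vholder t F A a : 0 < t -> vholder_bounded A a F -> vholder_bounded A a (vheat t F).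
Proof.
move=> t0 [cF FA FH]; split; first exact: vheat_vcb.
- by move=> x; exact: vheat_bound.
- move=> x y; have -> : vheat t F x - vheat t F y = dif (x - y) (vheat t F) y by rewrite /dif subrKC.
  rewrite vheat_dif//; apply: vheat_bound; first exact: vcb_dif.
  by move=> z; apply: le_trans (FH _ _) _; rewrite addrC addKr.
Qed.

Variables (T a : R).
Hypotheses (T0 : 0 < T) (a0 : 0 < a) (a1 : a < 1).

Lemma vheat_close : exists2 K : R, 0 <= K & forall t, 0 < t -> forall F A z, vholder_bounded A a F ->
  `|vheat t F z - F z| <= K * A * Num.sqrt t `^ a.
Proof.
have [K K0 hK] := heat_holder hgam; exists K => // t t0 F A z hF.
have [cF FA FH] := hF; have A0 : 0 <= A by apply: le_trans (FA 0).
apply: norm_le_coord; first by rewrite !mulr_ge0// powR_ge0.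
move=> i; rewrite !mxE; have [cf fA fH] := vholder_coord i hF.
by apply: hK => //; exact: ltW.
Qed.

Variable b : R.
Hypotheses (b0 : 0 < b) (ba : b < a).
Let sg := a - b - 2.

Lemma vheat_smooth : exists2 K : R, 0 <= K & forall t, 0 < t -> t <= T ->
  forall F A, vholder_bounded A a F -> forall h k l z,
  [/\ `|dif h (vheat t F) z| <= K * A * `|h| * Num.sqrt t `^ sg,
      `|dif h (dif k (vheat t F)) z| <= K * A * `|h| * `|k| * Num.sqrt t `^ sg &
      `|dif h (dif k (dif l (vheat t F))) z| <= K * A * `|h| * `|k| * `|l| `^ b * Num.sqrt t `^ sg].
Proof.
have [K K0 hK] := heat_smooth hgam conv T0 a0 a1 b0 ba.
exists K => // t t0 tT F A hF h k l z.
have [cF FA FH] := hF; have A0 : 0 <= A by apply: le_trans (FA 0).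
have C i : [/\ dif h (vheat t F) z ord0 i = dif h (heat gam t (fun x => F x ord0 i)) z,
   dif h (dif k (vheat t F)) z ord0 i = dif h (dif k (heat gam t (fun x => F x ord0 i))) z &
   dif h (dif k (dif l (vheat t F))) z ord0 i = dif h (dif k (dif l (heat gam t (fun x => F x ord0 i)))) z].
  by split; rewrite /dif !mxE.
have K' i := hK t t0 tT _ A (vholder_coord i hF) h k l z.
have s0 : 0 <= Num.sqrt t `^ sg by exact: powR_ge0.
split; apply: norm_le_coord => [|i]; rewrite ?mulr_ge0 ?powR_ge0//; have [e1 e2 e3] := C i; have [h1 h2 h3] := K' i.
- by rewrite e1.
- by rewrite e2.
- by rewrite e3.
Qed.

End vheat.

Section weighted_sum.
Context {R : realType}.
Variables (rho sg : R).
Hypotheses (sg0 : 0 < sg) (sgrho : sg < rho).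

(* halving the range: the second half has time weight comparable to its length *)
Lemma weighted_sum (C : R) : 0 <= C -> exists2 K : R, 0 <= K &
  forall (dl : R) (om : nat -> R), 0 < dl -> (forall i, 0 <= om i) ->
  (forall m, \sum_(0 <= i < m) om i <= C * (m%:R * dl) `^ rho) ->
  forall m, \sum_(0 <= i < m) om i * (i.+1%:R * dl) `^ (- sg) <= K * (m%:R * dl) `^ (rho - sg).
Proof.
move=> C0.
pose q : R := 2^-1 `^ (rho - sg).
have q1 : q < 1.
  have {1}<- : 1 `^ (rho - sg) = 1 :> R by rewrite powR1.
  by apply: gt0_ltr_powR; rewrite ?subr_gt0 ?nnegrE ?invr_ge0// invf_lt1 ?ltr1n.
have q0 : 0 < 1 - q by rewrite subr_gt0.
pose K := 2 `^ sg * C / (1 - q).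
have K0 : 0 <= K by rewrite divr_ge0 ?mulr_ge0 ?powR_ge0// ltW.
exists K => // dl om dl0 om0 hom; elim/ltn_ind => m IH.
case: m IH => [|m] IH; first by rewrite big_nil mulr_ge0// powR_ge0.
set M := m.+1; pose h := M./2.
have hM : (h < M)%N by rewrite /h /M; lia.
rewrite (big_cat_nat (n := h))//=; last exact: ltnW.
have M0 : 0 < M%:R * dl by rewrite mulr_gt0// ltr0n.
set X := M%:R * dl in M0 *.
have B1 : \sum_(0 <= i < h) om i * (i.+1%:R * dl) `^ (- sg) <= K * q * X `^ (rho - sg).
  apply: le_trans (IH h hM) _; rewrite -mulrA; apply: ler_wpM2l => //.
  have h2 : 0 <= 2^-1 :> R by rewrite invr_ge0.
  rewrite /q -(powRM _ h2 (ltW M0)); apply: ge0_ler_powR_base; first by rewrite subr_ge0 ltW.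
    by rewrite mulr_ge0// ltW.
  rewrite /X mulrA; apply: ler_wpM2r; first exact: ltW.
  by rewrite ler_pdivlMl// -natrM ler_nat /h; clear; lia.
have B2 : \sum_(h <= i < M) om i * (i.+1%:R * dl) `^ (- sg) <= 2 `^ sg * C * X `^ (rho - sg).
  apply: (@le_trans _ _ (\sum_(h <= i < M) om i * (2 `^ sg * X `^ (- sg)))).
    apply: ler_sum_nat => i /andP[hi _]; apply: ler_wpM2l => //.
    have -> : 2 `^ sg * X `^ (- sg) = (X / 2) `^ (- sg).
      have h2 : 0 <= 2^-1 :> R by rewrite invr_ge0.
      have e : 2 `^ sg * 2^-1 `^ sg = 1 :> R by rewrite -(powRM _ _ h2)// divff// powR1.
      rewrite (powRM _ (ltW M0) h2) (powRN 2^-1) mulrC; congr (_ * _).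
      have e0 : 2^-1 `^ sg != 0 :> R by rewrite gt_eqF// powR_gt0// invr_gt0.
      by apply: (mulIf e0); rewrite e mulVf.
    rewrite !powRN lef_pV2 ?posrE ?powR_gt0 ?divr_gt0 ?mulr_gt0//.
    apply: ge0_ler_powR_base; [exact: ltW|by rewrite divr_ge0// ltW|].
    rewrite /X mulrAC; apply: ler_wpM2r; first exact: ltW.
    by rewrite ler_pdivrMr// -natrM ler_nat /M; move: hi; rewrite /h /M; clear; lia.
  rewrite -mulr_suml.
  have S : \sum_(h <= i < M) om i <= C * X `^ rho.
    apply: le_trans (hom M); rewrite [leRHS](big_cat_nat (n := h))//=; last exact: ltnW.
    by rewrite lerDr; apply: sumr_ge0.
  apply: le_trans (ler_wpM2r _ S) _; first by rewrite mulr_ge0// powR_ge0.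
  by rewrite gt0_powRD// le_eqVlt; apply/orP; left; apply/eqP; ring.
apply: le_trans (lerD B1 B2) _.
rewrite -mulrDl; apply: ler_wpM2r; first exact: powR_ge0.
by rewrite -lerBrDl -{1}(mulr1 K) -mulrBr /K divfK// gt_eqF.
Qed.

End weighted_sum.

(** * The backward equation on a time grid *)

Lemma time_exponent_gt0 (R : realType) (a b : R) : a < 1 -> 0 < b -> 0 < 1 - (a - b) / 2.
Proof. by move=> a1 b0; lra. Qed.

Lemma powR_inv_exponent (R : realType) (k c : R) : 0 < k -> 0 <= c -> (c `^ k^-1) `^ k = c.
Proof. by move=> k0 c0; rewrite -powRrM mulVf ?gt_eqF// powRr1. Qed.

Section C2b.
Context {R : realType} {d : nat}.
Local Notation V := 'rV[R]_d.

(* C^{2,b} bounds phrased with finite differences *)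
Definition C2b (b c : R) (F : V -> V) :=
  [/\ vcb F, forall h z, `|dif h F z| <= c * `|h|,
      forall h k z, `|dif h (dif k F) z| <= c * `|h| * `|k| &
      forall h k l z, `|dif h (dif k (dif l F)) z| <= c * `|h| * `|k| * `|l| `^ b].

Lemma dif0 (h : V) : dif h (fun=> 0 : V) = fun=> 0.
Proof. by apply/funext => z; rewrite /dif subrr. Qed.

Lemma C2b0 b c : 0 <= c -> C2b b c (fun=> 0).
Proof.
move=> c0; split; first exact: vcb0.
- by move=> h z; rewrite dif0 normr0 mulr_ge0.
- by move=> h k z; rewrite !dif0 normr0 !mulr_ge0.
- by move=> h k l z; rewrite !dif0 normr0 !mulr_ge0 ?powR_ge0.
Qed.
End C2b.

Section value_function.
Context {R : realType} {d : nat}.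
Local Notation V := 'rV[R]_d.
Local Notation Vm := (@borelV R d).

Variable gam : R -> probability Vm R.
Hypothesis hgam : forall t : R, 0 < t -> gaussian_law (gam t) t.
Hypothesis conv : forall (s t : R) (f : Vm -> \bar R), 0 < s -> 0 < t ->
  measurable_fun setT f -> (forall w, 0 <= f w)%E ->
  (\int[gam (s + t)]_w f w = \int[gam s]_w \int[gam t]_w' f ((w : V) + (w' : V))%R)%E.
Local Notation vheat := (vheat gam).

(* [value f dl l m z] is the expected displacement between steps [l - m] and [l] of the
   scheme [X' = y + f_k y], [y = X + W_k], started at [z]. *)
Fixpoint value (f : nat -> V -> V) (dl : R) (l m : nat) : V -> V :=
  if m is m'.+1 then
    vheat dl (fun z => f (l - m'.+1)%N z + value f dl l m' (z + f (l - m'.+1)%N z))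
  else fun=> 0.

(** The source term of one step: the drift plus the change of [u] across the drift displacement, a
    discrete counterpart of [b + b . grad u]. *)
Definition increment_value (u : V -> V) (f : V -> V) : V -> V :=
  fun z => f z + (u (z + f z) - u z).

Lemma value_vcb f dl l m : 0 < dl -> (forall j, vcb (f j)) -> vcb (value f dl l m).
Proof.
move=> dl0 cf; elim: m => [|m IH] /=; first exact: vcb0.
apply: vheat_vcb => //; apply: vcbD => //; apply: (vcb_comp IH).
by apply: continuous_idD; exact: (cf _).1.
Qed.

Lemma increment_value_vcb u f : vcb u -> vcb f -> vcb (increment_value u f).
Proof.
move=> cu cf; apply: vcbD => //; apply: vcbB => //; apply: (vcb_comp cu).
by apply: continuous_idD; exact: cf.1.
Qed.

(** The recursion reads [P_dl (increment + remaining value)], and the semigroup law collects the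
    operators. Because the noise comes before the drift, the heat time of term [i] is [(i + 1) dl]
    and never zero. *)
Lemma value_duhamel f dl l m z : 0 < dl -> (forall j, vcb (f j)) -> (m <= l)%N ->
  value f dl l m z = \sum_(0 <= i < m)
    vheat (i.+1%:R * dl) (increment_value (value f dl l (m - i.+1)) (f (l - m + i)%N)) z.
Proof.
move=> dl0 cf; elim: m z => [|m IH] z ml; first by rewrite big_nil.
have cv k := value_vcb l k dl0 cf.
rewrite big_nat_recl// addn0 subSS subn0 mul1r.
transitivity (vheat dl (fun x => increment_value (value f dl l m) (f (l - m.+1)%N) x + value f dl l m x) z).
  by congr (vheat _ _ z); apply/funext => x; rewrite /increment_value -addrA subrK.
rewrite vheatD//; last exact: increment_value_vcb.
congr (_ + _).
have -> : value f dl l m = fun x => \sum_(0 <= i < m)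
    vheat (i.+1%:R * dl) (increment_value (value f dl l (m - i.+1)) (f (l - m + i)%N)) x.
  by apply/funext => x; apply: IH; exact: ltnW.
have S : forall (n : nat) (F : nat -> V -> V), (forall i, vcb (F i)) ->
    vheat dl (fun x => \sum_(0 <= i < n) F i x) z = \sum_(0 <= i < n) vheat dl (F i) z.
  move=> n F cF; elim: n => [|n IHn].
    by rewrite big_nil; apply/rowP => i; rewrite !mxE (_ : (fun _ => _) = (fun=> 0)) ?heat_cst//;
       apply/funext => x; rewrite big_nil mxE.
  rewrite big_nat_recr//= -IHn -vheatD//.
    by congr (vheat _ _ z); apply/funext => x; rewrite big_nat_recr.
  elim: n {IHn} => [|n IHn]; first by rewrite (_ : (fun _ => _) = (fun=> 0)); [exact: vcb0|apply/funext => x; rewrite big_nil].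
  rewrite (_ : (fun _ => _) = (fun x => \sum_(0 <= i < n) F i x + F n x)); first exact: vcbD.
  by apply/funext => x; rewrite big_nat_recr.
have iv0 (i : nat) : 0 < i.+1%:R * dl by rewrite mulr_gt0// ltr0n.
rewrite S; last by move=> i; apply: vheat_vcb => //; exact: increment_value_vcb.
apply: eq_big_nat => i /andP[_ im].
rewrite (vheat_semigroup hgam conv)//; last exact: increment_value_vcb.
rewrite -[X in X + _](mul1r dl) -mulrDl addrC natr1.
congr (vheat _ (increment_value _ (f _)) z); lia.
Qed.

Variables (T a b : R).
Hypotheses (T0 : 0 < T) (a0 : 0 < a) (a1 : a < 1) (b0 : 0 < b) (ba : b < a).
Let sg : R := 1 - (a - b) / 2.

(** The increment of [u (z + f z) - u z] splits into a second difference of [u] along [x - y] and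
    [f x], and a first difference along [f x - f y]. The second difference is Lipschitz in [x - y],
    hence Hoelder when [|x - y| <= 1]; for larger distances first differences along [f x] do. The
    constant 1/2 of [u] keeps the total below 3. *)
Lemma increment_value_holder (om : R) u f : 0 <= om ->
  C2b b 2^-1 u -> vholder_bounded om a f -> vholder_bounded (3 * om) a (increment_value u f).
Proof.
move=> om0 [cu u1 u2 u3] [cf fA fH].
have u1' x h : `|u (x + h) - u x| <= 2^-1 * `|h| by exact: u1.
split; first exact: increment_value_vcb.
- move=> x; rewrite /increment_value; apply: le_trans (ler_normD _ _) _.
  have := u1' x (f x); have := fA x; lra.
move=> x y; rewrite /increment_value.
have p0 : 0 <= `|x - y| `^ a by exact: powR_ge0.
have e : f x + (u (x + f x) - u x) - (f y + (u (y + f y) - u y)) =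
  (f x - f y) + (dif (x - y) (dif (f x) u) y) + (u ((y + f y) + (f x - f y)) - u (y + f y)).
  rewrite /dif; have -> : y + f y + (f x - f y) = y + f x by rewrite addrA addrAC addrK.
  have -> : y + (x - y) = x by rewrite subrKC.
  rewrite opprD opprB !addrA; apply/rowP => i; rewrite !mxE; ring.
rewrite e; apply: le_trans (ler_normD _ _) _; apply: le_trans (lerD (ler_normD _ _) (u1' _ _)) _.
have H2 : `|dif (x - y) (dif (f x) u) y| <= om * `|x - y| `^ a.
  case: (leP `|x - y| 1) => xy.
    apply: le_trans (u2 _ _ _) _.
    have xyp : `|x - y| <= `|x - y| `^ a.
      have [->|xy0] := eqVneq `|x - y| 0; first by rewrite powR_ge0.
      rewrite -{1}(powRr1 (normr_ge0 (x - y))); apply: ger_powR; last exact: ltW.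
      by rewrite lt_def xy0 normr_ge0 xy.
    rewrite mulrAC (mulrC om).
    apply: (@le_trans _ _ (`|x - y| * om)); last exact: ler_wpM2r.
    rewrite mulrAC -mulrA mulrCA; apply: ler_wpM2l => //.
    have := fA x; have := normr_ge0 (f x); lra.
  have p1 : 1 <= `|x - y| `^ a.
    have {1}<- : 1 `^ a = 1 :> R by rewrite powR1.
    by apply: ge0_ler_powR_base => //; exact: ltW.
  apply: (@le_trans _ _ om); last by rewrite -{1}(mulr1 om); apply: ler_wpM2l.
  rewrite /dif; apply: le_trans (ler_normB _ _) _.
  have := u1' (y + (x - y)) (f x); have := u1' y (f x); have := fA x; lra.
have := fH x y; have := mulr_ge0 om0 p0; lra.
Qed.

Variables (rho Cw : R).
Hypotheses (Cw0 : 0 <= Cw) (sgrho : sg < rho).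

Lemma sqrt_powR (t : R) : 0 < t -> Num.sqrt t `^ (a - b - 2) = t `^ (- sg).
Proof.
move=> t0; rewrite -powR12_sqrt ?ltW// -powRrM; congr (_ `^ _); rewrite /sg; lra.
Qed.

(** The bound 1/2 reproduces itself: if the shorter values satisfy it, the source terms are
    [3 om]-Hoelder, and smoothing followed by the weighted sum gives a constant times
    [(m dl)^(rho - sg)]. A window length [tau] independent of [dl] makes this at most 1/2. *)
Lemma value_regular : exists2 tau : R, 0 < tau & forall (dl : R) (f : nat -> V -> V) (om : nat -> R),
  0 < dl -> (forall j, 0 <= om j) -> (forall j, vholder_bounded (om j) a (f j)) ->
  (forall k m, \sum_(0 <= i < m) om (k + i)%N <= Cw * (m%:R * dl) `^ rho) ->
  forall l m, (m <= l)%N -> m%:R * dl <= tau -> C2b b 2^-1 (value f dl l m).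
Proof.
have sg0 : 0 < sg by exact: time_exponent_gt0.
have [Ks Ks0 hKs] := vheat_smooth hgam conv T0 a0 a1 b0 ba.
have [Kw Kw0 hKw] := weighted_sum sg0 sgrho Cw0.
pose kap := rho - sg; have kap0 : 0 < kap by rewrite subr_gt0.
(* Chosen so that [3 * Ks * Kw * c <= 1/2]; the summand 1 avoids division by zero. *)
pose c := (6 * Ks * Kw + 1)^-1.
have den0 : 0 < 6 * Ks * Kw + 1 by rewrite ltr_wpDl// !mulr_ge0.
have c0 : 0 < c by rewrite invr_gt0.
exists (Num.min T (c `^ kap^-1)); first by rewrite lt_min T0 powR_gt0.
move=> dl f om dl0 om0 hf hom l; elim/ltn_ind => m IH ml mtau.
have cf j : vcb (f j) by have [] := hf j.
case: m IH ml mtau => [|m] IH ml mtau; first by apply: C2b0; rewrite invr_ge0.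
set M := m.+1 in IH ml mtau *.
have mT : M%:R * dl <= T by apply: le_trans mtau _; rewrite ge_min lexx.
have mk : 3 * Ks * Kw * (M%:R * dl) `^ kap <= 2^-1.
  have h : (M%:R * dl) `^ kap <= c.
    apply: (@le_trans _ _ ((c `^ kap^-1) `^ kap)).
      apply: ge0_ler_powR_base; [exact: ltW|by rewrite mulr_ge0// ltW|].
      by apply: le_trans mtau _; rewrite ge_min lexx orbT.
    by rewrite (powR_inv_exponent kap0 (ltW c0)).
  apply: (@le_trans _ _ (3 * Ks * Kw * c)); first by apply: ler_wpM2l => //; rewrite !mulr_ge0.
  rewrite /c (ler_pdivrMr _ _ den0); lra.
pose G i := increment_value (value f dl l (M - i.+1)) (f (l - M + i)%N).
have hG i : (i < M)%N -> vholder_bounded (3 * om (l - M + i)%N) a (G i).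
  move=> iM; apply: (increment_value_holder (om0 _) _ (hf _)); apply: IH.
  - by rewrite /M subSS ltnS leq_subr.
  - exact: leq_trans (leq_subr _ _) ml.
  apply: le_trans mtau; apply: ler_wpM2r; first exact: ltW.
  by rewrite ler_nat leq_subr.
have t0 i : 0 < i.+1%:R * dl by rewrite mulr_gt0// ltr0n.
have tT i : (i < M)%N -> i.+1%:R * dl <= T.
  move=> iM; apply: le_trans mT; apply: ler_wpM2r; first exact: ltW.
  by rewrite ler_nat.
have sm i (iM : (i < M)%N) := hKs _ (t0 i) (tT i iM) _ _ (hG i iM).
have vE z : value f dl l M z = \sum_(0 <= i < M) vheat (i.+1%:R * dl) (G i) z.
  exact: value_duhamel.
have ws : \sum_(0 <= i < M) om (l - M + i)%N * (i.+1%:R * dl) `^ (- sg) <= Kw * (M%:R * dl) `^ kap.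
  by apply: (hKw dl (fun i => om (l - M + i)%N)) => // k; exact: hom.
have fin (X : R) (Y : nat -> V) : 0 <= X ->
   (forall i, (i < M)%N -> `|Y i| <= Ks * (3 * om (l - M + i)%N) * X * (i.+1%:R * dl) `^ (- sg)) ->
   `|\sum_(0 <= i < M) Y i| <= 2^-1 * X.
  move=> X0 hY; apply: le_trans (ler_norm_sum _ _ _) _.
  apply: (@le_trans _ _ (\sum_(0 <= i < M) 3 * Ks * X * (om (l - M + i)%N * (i.+1%:R * dl) `^ (- sg)))).
    apply: ler_sum_nat => i /andP[_ iM]; apply: le_trans (hY i iM) _.
    by rewrite le_eqVlt; apply/orP; left; apply/eqP; ring.
  rewrite -mulr_sumr; apply: (@le_trans _ _ (3 * Ks * X * (Kw * (M%:R * dl) `^ kap))).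
    by apply: ler_wpM2l => //; rewrite !mulr_ge0.
  rewrite [leLHS](_ : _ = 3 * Ks * Kw * (M%:R * dl) `^ kap * X); last by ring.
  exact: ler_wpM2r.
have d1 h z : dif h (value f dl l M) z = \sum_(0 <= i < M) dif h (vheat (i.+1%:R * dl) (G i)) z.
  by rewrite /dif !vE -sumrB.
have d2 h k z : dif h (dif k (value f dl l M)) z = \sum_(0 <= i < M) dif h (dif k (vheat (i.+1%:R * dl) (G i))) z.
  by rewrite {1}/dif (d1 k (z + h)) (d1 k z) -sumrB.
have d3 h k k' z : dif h (dif k (dif k' (value f dl l M))) z = \sum_(0 <= i < M) dif h (dif k (dif k' (vheat (i.+1%:R * dl) (G i)))) z.
  by rewrite {1}/dif (d2 k k' (z + h)) (d2 k k' z) -sumrB.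
split; first exact: value_vcb.
- move=> h z; rewrite d1; apply: fin => // i iM.
  by rewrite -sqrt_powR//; have [] := sm i iM h h h z.
- move=> h k z; rewrite d2 -mulrA; apply: fin => [|i iM]; first by rewrite mulr_ge0.
  by rewrite -sqrt_powR// mulrA; have [] := sm i iM h k h z.
- move=> h k k' z; rewrite d3 -!mulrA; apply: fin => [|i iM]; first by rewrite !mulr_ge0// powR_ge0.
  rewrite -sqrt_powR//; have [_ _ s3] := sm i iM h k k' z.
  by apply: le_trans s3 _; rewrite le_eqVlt; apply/orP; left; apply/eqP; ring.
Qed.

(** Explains the scale of mollification: the third differences cost [dl^(-sg)], the weight of a
    single step pays [dl^rho], and [sg < rho]. *)
Lemma mollified_regular : exists2 tau : R, 0 < tau & forall (dl : R) (om : R) (psi : V -> V),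
  0 < dl -> dl <= tau -> 0 <= om -> om <= Cw * dl `^ rho -> vholder_bounded om a psi ->
  C2b b 2^-1 (vheat dl psi).
Proof.
have sg0 : 0 < sg by exact: time_exponent_gt0.
have [Ks Ks0 hKs] := vheat_smooth hgam conv T0 a0 a1 b0 ba.
pose kap := rho - sg; have kap0 : 0 < kap by rewrite subr_gt0.
pose c := (2 * Ks * Cw + 1)^-1.
have den0 : 0 < 2 * Ks * Cw + 1 by rewrite ltr_wpDl// !mulr_ge0.
have c0 : 0 < c by rewrite invr_gt0.
exists (Num.min T (c `^ kap^-1)); first by rewrite lt_min T0 powR_gt0.
move=> dl om psi dl0 dltau om0 omC hpsi.
have dT : dl <= T by apply: le_trans dltau _; rewrite ge_min lexx.
have cpsi : vcb psi by have [] := hpsi.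
have mk : Ks * om * dl `^ (- sg) <= 2^-1.
  have h : dl `^ kap <= c.
    apply: (@le_trans _ _ ((c `^ kap^-1) `^ kap)).
      apply: ge0_ler_powR_base; [exact: ltW|exact: ltW|].
      by apply: le_trans dltau _; rewrite ge_min lexx orbT.
    by rewrite (powR_inv_exponent kap0 (ltW c0)).
  apply: (@le_trans _ _ (Ks * Cw * c)); last first.
    rewrite /c (ler_pdivrMr _ _ den0); lra.
  rewrite -!mulrA; apply: ler_wpM2l => //.
  apply: (@le_trans _ _ (Cw * dl `^ rho * dl `^ (- sg))); first by apply: ler_wpM2r => //; exact: powR_ge0.
  by rewrite -mulrA -gt0_powRD//; apply: ler_wpM2l.
have sm := hKs dl dl0 dT psi om hpsi; rewrite -/(sg) in sm.
have fin (X : R) (Y : V) : 0 <= X -> `|Y| <= Ks * om * X * dl `^ (- sg) -> `|Y| <= 2^-1 * X.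
  move=> X0 /le_trans; apply; rewrite mulrAC; exact: ler_wpM2r.
split; first exact: vheat_vcb.
- by move=> h z; apply: fin => //; rewrite -sqrt_powR//; have [] := sm h h h z.
- by move=> h k z; rewrite -mulrA; apply: fin; rewrite ?mulr_ge0// -sqrt_powR// mulrA; have [] := sm h k h z.
- by move=> h k k' z; rewrite -!mulrA; apply: fin; rewrite ?mulr_ge0 ?powR_ge0// -sqrt_powR// !mulrA; have [] := sm h k k' z.
Qed.

End value_function.

(** * Moments of first and second differences of the scheme *)

Section composition.
Context {R : realType} {d : nat}.
Local Notation V := 'rV[R]_d.
Variable b : R.
Hypotheses (b0 : 0 < b) (b1 : b < 1).

Lemma difC (h k : V) (F : V -> V) : dif h (dif k F) = dif k (dif h F).
Proof. by apply/funext => z; rewrite /dif (addrAC z k h) opprB addrACA [in RHS]opprB [in RHS]addrACA (addrC (- _) (- _)). Qed.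

(** The form of the bound that survives composition: the chain rule creates terms of order [|l|]
    next to [|l|^b], and for large [l] neither dominates in the right direction. The order of the
    directions fits its use on rectangles. *)
Definition C2b_weak (c : R) (g : V -> V) :=
  [/\ vcb g, forall h z, `|dif h g z| <= c * `|h|,
      forall h k z, `|dif h (dif k g) z| <= c * `|h| * `|k| &
      forall h k l z, `|dif h (dif l (dif k g)) z| <= c * `|h| * `|k| * (`|l| `^ b + `|l|)].

Lemma powR_scale (c x : R) : 1 <= c -> 0 <= x -> (c * x) `^ b <= c * x `^ b.
Proof.
move=> c1 x0; have c0 : 0 <= c by apply: le_trans c1.
rewrite powRM//; apply: ler_wpM2r; first exact: powR_ge0.
by rewrite -[leRHS](powRr1 c0); apply: ler_powR => //; exact: ltW.
Qed.

(** The chain rule of third order for [id + f], in differences. The images of the corners of a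
    parallelepiped are [p], [p + h'], [p + l'], [p + a] and so on, up to the corrections [e], [ah],
    [al], [ep], which are second and third differences of [f]. *)
Lemma comp_C2b (u f : V -> V) : C2b b 2^-1 u -> C2b b 2^-1 f ->
  C2b_weak 10 (fun z => f z + u (z + f z)).
Proof.
move=> [cu u1 u2 u3] [cf f1 f2 f3].
pose G := fun z => z + f z.
have U1 x h : `|u (x + h) - u x| <= 2^-1 * `|h| by exact: u1.
have G1 h z : `|dif h G z| <= 3 / 2 * `|h|.
  rewrite /dif /G (_ : _ - _ = h + dif h f z); last by rewrite /dif; apply/rowP => i; rewrite !mxE; ring.
  by apply: le_trans (ler_normD _ _) _; have := f1 h z; lra.
have G2E h k z : dif h (dif k G) z = dif h (dif k f) z.
  by rewrite /dif /G; apply/rowP => i; rewrite !mxE; ring.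
have f2l h k z : `|dif h (dif k f) z| <= `|h|.
  by rewrite difC {1}/dif; apply: le_trans (ler_normB _ _) _; have := f1 h (z + k); have := f1 h z; lra.
have U2 x y v : `|u (y + v) - u y - (u (x + v) - u x)| <= 2^-1 * `|y - x| * `|v|.
  by have := u2 (y - x) v x; rewrite /dif subrKC.
have U3 p h v l : `|u (p + h + l + v) - u (p + h + l) - (u (p + h + v) - u (p + h))
     - (u (p + l + v) - u (p + l) - (u (p + v) - u p))| <= 2^-1 * `|h| * `|v| * `|l| `^ b.
  by have := u3 h v l p; rewrite (difC v l) /dif.
split.
- by apply: vcbD => //; apply: (vcb_comp cu); apply: continuous_idD; exact: cf.1.
- move=> h z; rewrite (_ : dif h _ z = dif h f z + (u (G z + dif h G z) - u (G z))); last first.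
    by rewrite /dif /G subrKC; apply/rowP => i; rewrite !mxE; ring.
  apply: le_trans (ler_normD _ _) _.
  have := U1 (G z) (dif h G z); have := G1 h z; have := f1 h z; have := normr_ge0 h; lra.
- move=> h k z.
  set p := G z; pose h' := dif h G z; pose k' := dif k G z; pose e := dif h (dif k f) z.
  have E1 : G (z + h) = p + h' by rewrite /h' /dif subrKC.
  have E2 : G (z + k) = p + k' by rewrite /k' /dif subrKC.
  have E3 : G (z + h + k) = p + h' + k' + e.
    by rewrite /e -G2E /h' /k' /dif /p; apply/rowP => i; rewrite !mxE; ring.
  have -> : dif h (dif k (fun z0 => f z0 + u (z0 + f z0))) z = dif h (dif k f) z +
      ((u (p + h' + k' + e) - u (p + h' + k')) + (u (p + h' + k') - u (p + h') - (u (p + k') - u p))).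
    rewrite -E3 -E2 -[X in _ - u X - _]E1 /p /dif -!/(G _); apply/rowP => i; rewrite !mxE; ring.
  have B1 := U1 (p + h' + k') e.
  have B2 := U2 p (p + h') k'; rewrite (addrC p h') addrK in B2.
  apply: le_trans (ler_normD _ _) _; apply: le_trans (lerD (lexx _) (ler_normD _ _)) _.
  have := f2 h k z; rewrite -/e; have hk : `|h'| * `|k'| <= (3 / 2 * `|h|) * (3 / 2 * `|k|).
    by apply: ler_pM => //; exact: G1.
  have : 0 <= `|h| * `|k| by rewrite mulr_ge0.
  rewrite (addrC h' p) in B2; move: B1 B2 hk; lra.
move=> h k l z.
set p := G z; pose h' := dif h G z; pose l' := dif l G z; pose e := dif h (dif l G) z.
pose a := dif k G z; pose ah := dif h (dif k G) z; pose al := dif l (dif k G) z.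
pose ep := dif h (dif l (dif k G)) z.
pose Q := p + h' + l' + e.
have E1 : G (z + h) = p + h' by rewrite /h' /dif subrKC.
have E2 : G (z + l) = p + l' by rewrite /l' /dif subrKC.
have E3 : G (z + h + l) = Q.
  by rewrite /Q /e /h' /l' /dif /p; apply/rowP => i; rewrite !mxE; ring.
have E4 : G (z + k) = p + a by rewrite /a /dif subrKC.
have E5 : G (z + h + k) = p + h' + a + ah.
  by rewrite /ah /h' /a /dif /p; apply/rowP => i; rewrite !mxE; ring.
have E6 : G (z + l + k) = p + l' + a + al.
  by rewrite /al /l' /a /dif /p; apply/rowP => i; rewrite !mxE; ring.
have E7 : G (z + h + l + k) = Q + a + ah + al + ep.
  by rewrite /Q /e /h' /l' /ep /al /ah /a /dif /p; apply/rowP => i; rewrite !mxE; ring.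
have -> : dif h (dif l (dif k (fun z0 => f z0 + u (z0 + f z0)))) z = dif h (dif l (dif k f)) z +
   ((u (Q + a + ah + al + ep) - u Q) - (u (p + h' + a + ah) - u (p + h'))
    - ((u (p + l' + a + al) - u (p + l')) - (u (p + a) - u p))).
  rewrite -E7 -E3 -E5 -E1 -E6 -E2 -E4 /p /dif -!/(G _); apply/rowP => i; rewrite !mxE; ring.
(* Each of the first four summands removes one correction vector; the last is a third difference of
   [u] on an exact parallelepiped. *)
have -> : (u (Q + a + ah + al + ep) - u Q) - (u (p + h' + a + ah) - u (p + h'))
    - ((u (p + l' + a + al) - u (p + l')) - (u (p + a) - u p)) =
   (u (Q + a + ah + al + ep) - u (Q + a + ah + al)) +
   (u (Q + a + ah + al) - u (Q + a + ah) - (u (p + l' + a + al) - u (p + l' + a))) +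
   (u (Q + a + ah) - u (Q + a) - (u (p + h' + a + ah) - u (p + h' + a))) +
   (u (Q + a) - u Q - (u (p + h' + l' + a) - u (p + h' + l'))) +
   (u (p + h' + l' + a) - u (p + h' + l') - (u (p + h' + a) - u (p + h'))
     - (u (p + l' + a) - u (p + l') - (u (p + a) - u p))).
  by clear; do 15 (move: (u _) => ?); apply/rowP => i; rewrite !mxE; ring.
have nh' : `|h'| <= 3 / 2 * `|h| by exact: G1.
have nl' : `|l'| <= 3 / 2 * `|l| by exact: G1.
have na : `|a| <= 3 / 2 * `|k| by exact: G1.
have nah : `|ah| <= 2^-1 * `|h| * `|k| by rewrite /ah G2E; exact: f2.
have nah1 : `|ah| <= `|h| by rewrite /ah G2E; exact: f2l.
have nal : `|al| <= 2^-1 * `|l| * `|k| by rewrite /al G2E; exact: f2.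
have ne : `|e| <= 2^-1 * `|h| * `|l| by rewrite /e G2E; exact: f2.
have neh : `|e| <= `|h| by rewrite /e G2E; exact: f2l.
have nel : `|e| <= `|l| by rewrite /e G2E difC; exact: f2l.
have nep : `|ep| <= 2^-1 * `|h| * `|k| * `|l| `^ b.
  have -> : ep = dif h (dif k (dif l f)) z.
    by rewrite (difC k l) /ep {1}/dif !G2E.
  exact: f3.
have nf : `|dif h (dif l (dif k f)) z| <= 2^-1 * `|h| * `|k| * `|l| `^ b by rewrite (difC l k); exact: f3.
have B1 := U1 (Q + a + ah + al) ep.
have B2 := U2 (p + l' + a) (Q + a + ah) al.
have B3 := U2 (p + h' + a) (Q + a) ah.
have B4 := U2 (p + h' + l') Q a.
have B5 := U3 p h' a l'.
have D2 : `|Q + a + ah - (p + l' + a)| <= 7 / 2 * `|h|.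
  rewrite (_ : _ - _ = h' + e + ah); last by rewrite /Q; apply/rowP => i; rewrite !mxE; ring.
  apply: le_trans (ler_normD _ _) _; have := ler_normD h' e.
  by move: nh' neh nah1; clear; lra.
have D3 : `|Q + a - (p + h' + a)| <= 5 / 2 * `|l|.
  rewrite (_ : _ - _ = l' + e); last by rewrite /Q; apply/rowP => i; rewrite !mxE; ring.
  apply: le_trans (ler_normD _ _) _.
  by move: nl' nel; clear; lra.
have D4 : `|Q - (p + h' + l')| <= 2^-1 * `|h| * `|l|.
  by rewrite (_ : _ - _ = e)// /Q; apply/rowP => i; rewrite !mxE; ring.
have lb : `|l'| `^ b <= 3 / 2 * `|l| `^ b.
  apply: le_trans (powR_scale (_ : 1 <= 3 / 2) (normr_ge0 l)); last by rewrite ler_pdivlMr// mul1r ler_nat.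
  by apply: ge0_ler_powR_base => //; exact: ltW.
set X := `|h| * `|k| * `|l| `^ b; set Y := `|h| * `|k| * `|l|.
have X0 : 0 <= X by rewrite !mulr_ge0 ?powR_ge0.
have Y0 : 0 <= Y by rewrite !mulr_ge0.
have C2 : 2^-1 * `|Q + a + ah - (p + l' + a)| * `|al| <= 7 / 8 * Y.
  rewrite -mulrA; apply: (@le_trans _ _ (2^-1 * ((7 / 2 * `|h|) * (2^-1 * `|l| * `|k|)))).
    by apply: ler_wpM2l => //; apply: ler_pM.
  by rewrite le_eqVlt; apply/orP; left; apply/eqP; rewrite /Y; field.
have C3 : 2^-1 * `|Q + a - (p + h' + a)| * `|ah| <= 5 / 8 * Y.
  rewrite -mulrA; apply: (@le_trans _ _ (2^-1 * ((5 / 2 * `|l|) * (2^-1 * `|h| * `|k|)))).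
    by apply: ler_wpM2l => //; apply: ler_pM.
  by rewrite le_eqVlt; apply/orP; left; apply/eqP; rewrite /Y; field.
have C4 : 2^-1 * `|Q - (p + h' + l')| * `|a| <= 3 / 8 * Y.
  rewrite -mulrA; apply: (@le_trans _ _ (2^-1 * ((2^-1 * `|h| * `|l|) * (3 / 2 * `|k|)))).
    by apply: ler_wpM2l => //; apply: ler_pM.
  by rewrite le_eqVlt; apply/orP; left; apply/eqP; rewrite /Y; field.
have C5 : 2^-1 * `|h'| * `|a| * `|l'| `^ b <= 27 / 16 * X.
  apply: (@le_trans _ _ (2^-1 * (3 / 2 * `|h|) * (3 / 2 * `|k|) * (3 / 2 * `|l| `^ b))).
    apply: ler_pM => //; rewrite ?mulr_ge0 ?powR_ge0//; apply: ler_pM => //; rewrite ?mulr_ge0//.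
    by apply: ler_wpM2l.
  by rewrite le_eqVlt; apply/orP; left; apply/eqP; rewrite /X; field.
have eX : 2^-1 * `|h| * `|k| * `|l| `^ b = 2^-1 * X by rewrite /X; ring.
rewrite eX in nep nf.
have -> : 10 * `|h| * `|k| * (`|l| `^ b + `|l|) = 10 * X + 10 * Y by rewrite /X /Y; ring.
apply: le_trans (ler_normD _ _) _; apply: le_trans (lerD nf (ler_normD _ _)) _.
apply: le_trans (lerD (lexx _) (lerD (ler_normD _ _) B5)) _.
apply: le_trans (lerD (lexx _) (lerD (lerD (ler_normD _ _) B4) (lexx _))) _.
apply: le_trans (lerD (lexx _) (lerD (lerD (lerD (ler_normD _ _) B3) (lexx _)) (lexx _))) _.
apply: le_trans (lerD (lexx _) (lerD (lerD (lerD (lerD B1 B2) (lexx _)) (lexx _)) (lexx _))) _.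
have half0 : 0 <= 2^-1 :> R by rewrite invr_ge0.
apply: le_trans (lerD (lexx _) (lerD (lerD (lerD (lerD (ler_wpM2l half0 nep) C2) C3) C4) C5)) _.
by move: X0 Y0; clear; move: X Y => X Y; lra.
Qed.

End composition.

(** * Even moments of one noisy step *)

Section even_moment.
Context {R : realType}.

(** The linear term is kept exact since it will have mean zero. Every later term lies below the sum
    of the two extreme ones, and the binomial coefficients add up to at most [2^p]. *)
Lemma binomial_remainder (q : nat) (a m : R) :
  (a + m) ^+ q.*2.+2 <= a ^+ q.*2.+2 + q.*2.+2%:R * (a ^+ q.*2.+1 * m)
    + 2 ^+ q.*2.+2 * (a ^+ q.*2 * m ^+ 2 + m ^+ q.*2.+2).
Proof.
have ev (x : R) (k : nat) : ~~ odd k -> `|x| ^+ k = x ^+ k.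
  by move=> ek; rewrite -normrX ger0_norm// exprn_even_ge0.
have e0 : ~~ odd q.*2 by rewrite odd_double.
rewrite exprDn big_ord_recl big_ord_recl /= subn0 expr0 mulr1 bin0 mulr1n /bump /= add1n subn1 /= expr1 bin1.
have -> : a ^+ q.*2.+2 + q.*2.+2%:R * (a ^+ q.*2.+1 * m) + 2 ^+ q.*2.+2 * (a ^+ q.*2 * m ^+ 2 + m ^+ q.*2.+2)
  = a ^+ q.*2.+2 + (a ^+ q.*2.+1 * m *+ q.*2.+2 + 2 ^+ q.*2.+2 * (a ^+ q.*2 * m ^+ 2 + m ^+ q.*2.+2)).
  by rewrite -[in RHS]mulr_natl addrA.
apply: lerD; first by []; apply: lerD; first by [].
have dom (j : nat) : (j <= q.*2)%N -> a ^+ (q.*2 - j) * m ^+ j.+2 <= a ^+ q.*2 * m ^+ 2 + m ^+ q.*2.+2.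
  move=> jq; apply: le_trans (ler_norm _) _; rewrite normrM !normrX.
  have e1 : a ^+ q.*2 = `|a| ^+ q.*2 by rewrite ev.
  have e2 : m ^+ 2 = `|m| ^+ 2 by rewrite ev.
  have e3 : m ^+ q.*2.+2 = `|m| ^+ q.*2 * `|m| ^+ 2 by rewrite -exprD addn2 ev//= odd_double.
  have e4 : `|m| ^+ j.+2 = `|m| ^+ j * `|m| ^+ 2 by rewrite -exprD addn2.
  rewrite e1 e2 e3 e4 mulrA -mulrDl; apply: ler_wpM2r; first exact: exprn_ge0.
  case: (leP `|a| `|m|) => am.
    apply: (@le_trans _ _ (`|m| ^+ (q.*2 - j) * `|m| ^+ j)).
      by apply: ler_wpM2r; [exact: exprn_ge0|apply: lerXn2r; rewrite ?nnegrE].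
    by rewrite -exprD subnK// lerDr exprn_ge0.
  apply: (@le_trans _ _ (`|a| ^+ (q.*2 - j) * `|a| ^+ j)).
    by apply: ler_wpM2l; [exact: exprn_ge0|apply: lerXn2r; rewrite ?nnegrE// ltW].
  by rewrite -exprD subnK// lerDl exprn_ge0.
set B := a ^+ q.*2 * m ^+ 2 + m ^+ q.*2.+2 in dom *.
have B0 : 0 <= B.
  by apply: addr_ge0; [apply: mulr_ge0|]; apply: exprn_even_ge0; rewrite //= odd_double.
apply: (@le_trans _ _ (\sum_(i < q.*2.+1) 'C(q.*2.+2, i.+2)%:R * B)).
  apply: ler_sum => i _; rewrite -mulr_natl /bump /= !add1n subSS subSS.
  by apply: ler_wpM2l => //; apply: dom; rewrite -ltnS ltn_ord.
rewrite -mulr_suml; apply: ler_wpM2r => //.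
rewrite -natr_sum -natrX ler_nat.
have := Pascal 1 1 q.*2.+2; rewrite addn1 => ->.
rewrite big_ord_recl [X in (_ + X)%N]big_ord_recl /=.
apply: leq_trans _ (leq_addl _ _); apply: leq_trans _ (leq_addl _ _).
by apply: leq_sum => i _; rewrite !exp1n !muln1.
Qed.

End even_moment.

Section even_moment2.
Context {R : realType}.

Lemma expr_addr_le (k : nat) (x y : R) : 0 <= x -> 0 <= y -> (x + y) ^+ k <= 2 ^+ k * (x ^+ k + y ^+ k).
Proof.
move=> x0 y0; case: (leP x y) => xy.
  apply: (@le_trans _ _ ((2 * y) ^+ k)).
    apply: lerXn2r; rewrite ?nnegrE; [exact: addr_ge0|exact: mulr_ge0|].
    by move: xy; clear; lra.
  rewrite exprMn; apply: ler_wpM2l; first exact: exprn_ge0.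
  by rewrite lerDr exprn_ge0.
apply: (@le_trans _ _ ((2 * x) ^+ k)).
  apply: lerXn2r; rewrite ?nnegrE; [exact: addr_ge0|exact: mulr_ge0|].
  by move: xy; clear; lra.
rewrite exprMn; apply: ler_wpM2l; first exact: exprn_ge0.
by rewrite lerDl exprn_ge0.
Qed.

Lemma even_young (q : nat) (a m : R) : a ^+ q.*2 * m ^+ 2 <= a ^+ q.*2.+2 + m ^+ q.*2.+2.
Proof.
have ev (x : R) (k : nat) : ~~ odd k -> x ^+ k = `|x| ^+ k.
  by move=> ek; rewrite -normrX ger0_norm// exprn_even_ge0.
have e0 : ~~ odd q.*2 by rewrite odd_double.
rewrite (ev a q.*2)// (ev m 2%N)// (ev a q.*2.+2)/= ?odd_double// (ev m q.*2.+2)/= ?odd_double//.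
have E (x : R) : x ^+ q.*2.+2 = x ^+ q.*2 * x ^+ 2 by rewrite -exprD addn2.
rewrite !E.
case: (leP `|a| `|m|) => am.
  apply: (@le_trans _ _ (`|m| ^+ q.*2 * `|m| ^+ 2)); last by rewrite lerDr mulr_ge0 ?exprn_ge0.
  by apply: ler_wpM2r; [exact: exprn_ge0|apply: lerXn2r; rewrite ?nnegrE].
apply: (@le_trans _ _ (`|a| ^+ q.*2 * `|a| ^+ 2)); last by rewrite lerDl mulr_ge0 ?exprn_ge0.
by apply: ler_wpM2l; [exact: exprn_ge0|apply: lerXn2r; rewrite ?nnegrE// ltW].
Qed.

End even_moment2.

Section step_moment.
Context {R : realType} {d : nat}.
Local Notation V := 'rV[R]_d.
Local Notation Vm := (@borelV R d).

Lemma bounded_mfunX (k : nat) (n : Vm -> R) : bounded_mfun n -> bounded_mfun (fun w => n w ^+ k).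
Proof.
move=> [mn [M hM]]; split; first exact: measurable_funX.
exists (M ^+ k) => x; rewrite normrX; apply: lerXn2r; rewrite ?nnegrE//.
exact: le_trans (hM x).
Qed.

(** The moment is of order [t^(k/2)]. As [k >= 2] and [t <= 1], it is at most of order [t], which is
    what an iteration over about [1/t] steps can afford. *)
Lemma noise_moment (k : nat) (C1 : R) : (2 <= k)%N -> ~~ odd k -> 0 <= C1 -> exists2 C : R, 0 <= C &
  forall (g : probability Vm R) (t : R), 0 < t -> t <= 1 -> gaussian_law g t ->
  forall (n : V -> R) (M : R), bounded_mfun (n : Vm -> R) -> 0 <= M ->
    (forall w, `|n w| <= M * (`|w| + C1 * Num.sqrt t)) ->
    \int[g]_w (n w ^+ k) <= C * M ^+ k * t.
Proof.
move=> k2 ek C10; have [C C0 hC] := @gaussian_moment R d k (ltnW k2).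
exists (2 ^+ k * (C + C1 ^+ k)); first by rewrite mulr_ge0 ?exprn_ge0// addr_ge0// exprn_ge0.
move=> g t t0 t1 hg n M bn M0 hn.
have bk := bounded_mfunX k bn.
rewrite -lee_fin -expect_fin//.
have st : Num.sqrt t ^+ k <= t.
  rewrite -(subnK k2) exprD (sqr_sqrtr (ltW t0)).
  apply: ler_piMl; first exact: ltW.
  apply: exprn_ile1; first exact: sqrtr_ge0.
  by rewrite -[leRHS]sqrtr1 ler_sqrt.
have mw : measurable_fun [set: Vm] (fun w : Vm => `|w : V| ^+ k) by apply: measurable_funX; exact: measurable_normV.
apply: (@le_trans _ _ (\int[g]_w ((M ^+ k * 2 ^+ k)%:E * ((`|w : V| ^+ k)%:E + ((C1 * Num.sqrt t) ^+ k)%:E)))%E).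
  apply: ge0_le_integral => //.
  - by move=> w _; rewrite lee_fin exprn_even_ge0.
  - by apply/measurable_EFinP; case: bk.
  - apply: measurable_funeM; apply: emeasurable_funD; apply/measurable_EFinP => //.
  - move=> w _; rewrite -EFinD -EFinM lee_fin.
    rewrite -(ger0_norm (exprn_even_ge0 _ ek)) normrX.
    apply: (@le_trans _ _ ((M * (`|w : V| + C1 * Num.sqrt t)) ^+ k)).
      apply: lerXn2r; rewrite ?nnegrE//; apply: mulr_ge0 => //; apply: addr_ge0 => //.
      by apply: mulr_ge0 => //; exact: sqrtr_ge0.
    rewrite exprMn -mulrA; apply: ler_wpM2l; first exact: exprn_ge0.
    by apply: expr_addr_le => //; rewrite mulr_ge0 ?sqrtr_ge0.
have E0 : (0 <= (M ^+ k * 2 ^+ k)%:E :> \bar R)%E by rewrite lee_fin mulr_ge0// exprn_ge0.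
have E1 (w : Vm) : (0 <= (`|w : V| ^+ k)%:E + ((C1 * Num.sqrt t) ^+ k)%:E :> \bar R)%E.
  by rewrite -EFinD lee_fin addr_ge0// exprn_ge0// mulr_ge0// sqrtr_ge0.
have E2 : measurable_fun [set: Vm] (fun w : Vm => (`|w : V| ^+ k)%:E + ((C1 * Num.sqrt t) ^+ k)%:E)%E.
  by apply: emeasurable_funD; apply/measurable_EFinP.
have E3 (w : Vm) : (0 <= (`|w : V| ^+ k)%:E :> \bar R)%E by rewrite lee_fin exprn_ge0.
have E4 : (0 <= ((C1 * Num.sqrt t) ^+ k)%:E :> \bar R)%E by rewrite lee_fin exprn_ge0// mulr_ge0// sqrtr_ge0.
have E5 : measurable_fun [set: Vm] (fun w : Vm => (`|w : V| ^+ k)%:E) by apply/measurable_EFinP.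
rewrite ge0_integralZl//.
rewrite ge0_integralD//.
rewrite integral_prob_cst.
apply: (@le_trans _ _ ((M ^+ k * 2 ^+ k)%:E * ((C * Num.sqrt t ^+ k)%:E + ((C1 * Num.sqrt t) ^+ k)%:E))%E).
  by apply: lee_wpmul2l => //; apply: leeD => //; exact: hC.
rewrite -EFinD -EFinM lee_fin exprMn -mulrDl.
rewrite [leRHS](_ : _ = M ^+ k * 2 ^+ k * ((C + C1 ^+ k) * t)); last by ring.
apply: ler_wpM2l; first by rewrite -lee_fin.
by apply: ler_wpM2l => //; apply: addr_ge0 => //; exact: exprn_ge0.
Qed.

(** Noise of size [sqrt t] would ruin the iteration, but its linear contribution has mean zero, so
    the growth per step is [1 + C t]. *)
Lemma step_moment (q : nat) (C1 : R) : 0 <= C1 -> exists2 C : R, 0 <= C &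
  forall (g : probability Vm R) (t : R), 0 < t -> t <= 1 -> gaussian_law g t ->
  forall (n : V -> R) (A M : R), bounded_mfun (n : Vm -> R) -> 0 <= M ->
    (forall w, `|n w| <= M * (`|w| + C1 * Num.sqrt t)) -> \int[g]_w n w = 0 ->
    \int[g]_w ((A + n w) ^+ q.*2.+2) <= (1 + C * t) * A ^+ q.*2.+2 + C * t * M ^+ q.*2.+2.
Proof.
move=> C10.
have [Ca Ca0 hCa] := @noise_moment 2 C1 isT isT C10.
have [|Cb Cb0 hCb] := @noise_moment q.*2.+2 C1 isT _ C10; first by rewrite /= odd_double.
exists (2 ^+ q.*2.+2 * (Ca + Cb)); first by rewrite mulr_ge0 ?exprn_ge0// addr_ge0.
move=> g t t0 t1 hg n A M bn M0 hn n0.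
have ha := hCa g t t0 t1 hg n M bn M0 hn.
have hb := hCb g t t0 t1 hg n M bn M0 hn.
set p := q.*2.+2 in hb *.
pose c1 := p%:R * A ^+ q.*2.+1.
pose H := fun w : Vm => A ^+ p + c1 * n w + (2 ^+ p * A ^+ q.*2 * n w ^+ 2 + 2 ^+ p * n w ^+ p).
have b1 : bounded_mfun (fun w : Vm => A ^+ p + c1 * n w).
  by apply: bounded_mfunD; [exact: bounded_mfun_cst|exact: bounded_mfunZ].
have b2 : bounded_mfun (fun w : Vm => 2 ^+ p * A ^+ q.*2 * n w ^+ 2).
  by apply: bounded_mfunZ; exact: bounded_mfunX.
have b3 : bounded_mfun (fun w : Vm => 2 ^+ p * n w ^+ p).
  by apply: bounded_mfunZ; exact: bounded_mfunX.
have bH : bounded_mfun H by apply: bounded_mfunD => //; exact: bounded_mfunD.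
have bL : bounded_mfun (fun w : Vm => (A + n w) ^+ p).
  by apply: bounded_mfunX; apply: bounded_mfunD => //; exact: bounded_mfun_cst.
apply: (@le_trans _ _ (\int[g]_w H w)).
  rewrite -lee_fin -!expect_fin//; apply: ge0_le_integral => //.
  - by move=> w _; rewrite lee_fin exprn_even_ge0//= odd_double.
  - by apply/measurable_EFinP; case: bL.
  - by apply/measurable_EFinP; case: bH.
  - move=> w _; rewrite lee_fin /H; apply: le_trans (binomial_remainder q A (n w)) _.
    by rewrite le_eqVlt; apply/orP; left; apply/eqP; rewrite /c1 -/p; ring.
rewrite /H expectD//; last exact: bounded_mfunD.
rewrite expectD//; [|exact: bounded_mfun_cst|exact: bounded_mfunZ].
rewrite expect_cst expectZ// n0 mulr0 addr0.
rewrite expectD// !expectZ; [|exact: bounded_mfunX|exact: bounded_mfunX].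
have yg := even_young q A M; rewrite -/p in yg.
have P0 : 0 <= 2 ^+ p :> R by exact: exprn_ge0.
have A0 : 0 <= A ^+ q.*2 by rewrite exprn_even_ge0//= odd_double.
have Ap : 0 <= A ^+ p by rewrite exprn_even_ge0//= odd_double.
have Mp : 0 <= M ^+ p by exact: exprn_ge0.
apply: (@le_trans _ _ (A ^+ p + (2 ^+ p * (Ca * t) * (A ^+ p + M ^+ p) + 2 ^+ p * (Cb * M ^+ p * t)))).
  apply: lerD => //; apply: lerD; last by apply: ler_wpM2l.
  apply: (@le_trans _ _ (2 ^+ p * A ^+ q.*2 * (Ca * M ^+ 2 * t))); first by apply: ler_wpM2l => //; exact: mulr_ge0.
  rewrite [leLHS](_ : _ = 2 ^+ p * (Ca * t) * (A ^+ q.*2 * M ^+ 2)); last by ring.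
  by apply: ler_wpM2l => //; apply: mulr_ge0 => //; apply: mulr_ge0 => //; exact: ltW.
have : 0 <= 2 ^+ p * Cb * t * A ^+ p by apply: mulr_ge0 => //; apply: mulr_ge0; [exact: mulr_ge0|exact: ltW].
by move: yg; clear; lra.
Qed.

End step_moment.

(** * Independence of the noise from the past *)

Section independence.
Context {R : realType} {d1 d2 d3 : measure_display}.
Context {Omega : measurableType d1} {S : measurableType d2} {U : measurableType d3}.
Variables (P : probability Omega R) (g : probability U R).

Lemma indep_integral (Y : Omega -> S) (W : Omega -> U) (h : S * U -> \bar R) :
  measurable_fun setT Y -> measurable_fun setT W ->
  (forall A B, measurable A -> measurable B -> P (Y @^-1` A `&` W @^-1` B) = (P (Y @^-1` A) * g B)%E) ->
  measurable_fun setT h -> (forall z, 0 <= h z)%E ->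
  (\int[P]_x h (Y x, W x) = \int[P]_x \int[g]_w h (Y x, w))%E.
Proof.
move=> mY mW ind mh h0.
pose Y' : {mfun Omega >-> S} := HB.pack Y (isMeasurableFun.Build _ _ _ _ Y mY).
have mZ : measurable_fun setT (fun x => (Y x, W x)) by apply/measurable_fun_pairP.
pose Z : {mfun Omega >-> (S * U)%type} := HB.pack (fun x => (Y x, W x)) (isMeasurableFun.Build _ _ _ _ _ mZ).
have -> : (\int[P]_x h (Y x, W x) = \int[distribution P Z]_z h z)%E.
  by rewrite /distribution ge0_integral_pushforward.
have -> : (\int[distribution P Z]_z h z = \int[(distribution P Y' \x g)%E]_z h z)%E.
  apply: eq_measure_integral => A mA _; apply/esym; apply: product_measure_unique => //.
rewrite fubini_tonelli1// /fubini_F /distribution ge0_integral_pushforward//.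
- exact: measurable_fun_fubini_tonelli_F.
- by move=> z _; exact: integral_ge0.
Qed.

End independence.

Section noise.
Context {R : realType} {d : nat} {disp : measure_display} {Omega : measurableType disp}.
Local Notation V := 'rV[R]_d.
Local Notation Vm := (@borelV R d).
Variables (P : probability Omega R) (g : probability Vm R) (N : nat) (W : nat -> Omega -> V).

Definition cylinder (k : nat) (C : nat -> set Vm) : set Omega := \bigcap_(j in `I_k) W j @^-1` C j.

(** Independence and common law in one product formula for the first [N] variables; prefixes follow
    by taking full sets for the others. *)
Definition iid_noise := (forall j, measurable_fun setT (W j : Omega -> Vm)) /\
  forall C : nat -> set Vm, (forall j, measurable (C j)) ->
    P (cylinder N C) = (\prod_(j < N) g (C j))%E.

Hypothesis noise : iid_noise.

Lemma iid_noise_prefix (k : nat) (C : nat -> set Vm) : (k <= N)%N -> (forall j, measurable (C j)) ->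
  P (cylinder k C) = (\prod_(j < k) g (C j))%E.
Proof.
move=> kN mC; pose C' j := if (j < k)%N then C j else setT.
have -> : cylinder k C = cylinder N C'.
  apply/seteqP; split => w h j /= jk; rewrite /C'.
    by case: ifPn => // jk'; exact: h.
  by have := h j (leq_trans jk kN); rewrite /C'/= jk.
rewrite noise.2; last by move=> j; rewrite /C'; case: ifPn.
rewrite (big_ord_widen _ (fun j => g (C j)) kN) [RHS]big_mkcond; apply: eq_bigr => j _.
by rewrite /C'; case: ifPn => // _; rewrite probability_setT.
Qed.

Definition cylinders k := [set A | exists2 C : nat -> set Vm, (forall j, measurable (C j)) & A = cylinder k C].

(** The sample space with the sigma-algebra of the first [k] noise variables; measurability on it
    expresses that the scheme is adapted. *)
Definition past k : Type := g_sigma_algebraType (cylinders k).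
HB.instance Definition _ k := Measurable.on (past k).

Lemma measurable_cylinder k C : (forall j, measurable (C j)) -> measurable (cylinder k C).
Proof.
move=> mC; apply: bigcap_measurableType => j _.
by rewrite -[X in measurable X]setTI; exact: noise.1.
Qed.

Lemma past_sub k (A : set Omega) : @measurable _ (past k) A -> measurable A.
Proof.
move: A; apply: smallest_sub; first exact: sigma_algebra_measurable.
by move=> _ [C mC ->]; exact: measurable_cylinder.
Qed.

Lemma past_mfun k dT (S : measurableType dT) (f : Omega -> S) :
  measurable_fun [set: past k] (f : past k -> S) -> measurable_fun [set: Omega] f.
Proof. by move=> mf _ A mA; apply: (@past_sub k); exact: mf. Qed.

Lemma past_mono k l (A : set Omega) : (k <= l)%N -> @measurable _ (past k) A -> @measurable _ (past l) A.
Proof.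
move=> kl; move: A; apply: smallest_sub; first exact: sigma_algebra_measurable.
move=> _ [C mC ->]; apply: sub_sigma_algebra; exists (fun j => if (j < k)%N then C j else setT).
  by move=> j; case: ifPn.
apply/seteqP; split => w h j /= jk; first by case: ifPn => // jk'; exact: h.
by have := h j (leq_trans jk kl); rewrite /= jk.
Qed.

Lemma past_mfun_mono k l dT (S : measurableType dT) (f : Omega -> S) : (k <= l)%N ->
  measurable_fun [set: past k] (f : past k -> S) -> measurable_fun [set: past l] (f : past l -> S).
Proof. by move=> kl mf _ A mA; apply: (past_mono kl); exact: mf. Qed.

Lemma past_noise k : measurable_fun [set: past k.+1] (W k : past k.+1 -> Vm).
Proof.
move=> _ A mA; rewrite setTI; apply: sub_sigma_algebra; exists (fun j => if j == k then A else setT).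
  by move=> j; case: ifPn.
apply/seteqP; split => [w h j /= _|w h]; first by case: eqP => // ->.
by have := h k (ltnSn k); rewrite /= eqxx.
Qed.

(** In the argument [A] both sides are finite measures on [past k], and they agree on the pi-system
    of cylinders. *)
Lemma past_indep k (A : set Omega) (B : set Vm) : (k < N)%N -> @measurable _ (past k) A -> measurable B ->
  P (A `&` W k @^-1` B) = (P A * g B)%E.
Proof.
move=> kN mA mB.
have mid : measurable_fun [set: Omega] (id : Omega -> past k) by move=> _ C mC; rewrite setTI; exact: past_sub mC.
have mWB : measurable (W k @^-1` B) by rewrite -[X in measurable X]setTI; exact: noise.1.
pose idk : {mfun Omega >-> past k} := HB.pack (id : Omega -> past k) (isMeasurableFun.Build _ _ _ _ _ mid).
have gB0 : (0 <= fine (g B)) by rewrite fine_ge0.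
pose m1 : {measure set (past k) -> \bar R} := pushforward (mrestr P mWB) idk.
pose m2 : {measure set (past k) -> \bar R} := mscale (NngNum gB0) (pushforward P idk).
have gBE : ((fine (g B))%:E = g B)%E by rewrite fineK// fin_num_measure.
have -> : P (A `&` W k @^-1` B) = m1 mid A by [].
have -> : (P A * g B)%E = m2 mid A.
  by have -> : m2 mid A = ((fine (g B))%:E * P A)%E; [by []|rewrite gBE muleC].
apply: (@measure_unique _ _ (past k) (cylinders k) (fun=> setT)) => //.
- move=> _ _ [C mC ->] [D mD ->]; exists (fun j => C j `&` D j); first by move=> j; exact: measurableI.
  apply/seteqP; split => w; first by move=> [hC hD] j jk; split; [exact: hC|exact: hD].
  by move=> h; split => j jk; case: (h j jk).
- by move=> _; exists (fun=> setT) => //; apply/seteqP; split => w.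
- by rewrite bigcup_const//; exists 0%N.
- move=> _ [C mC ->]; have -> : m2 mid (cylinder k C) = ((fine (g B))%:E * P (cylinder k C))%E by [].
  have -> : m1 mid (cylinder k C) = P (cylinder k C `&` W k @^-1` B) by [].
  rewrite gBE.
  have -> : cylinder k C `&` W k @^-1` B = cylinder k.+1 (fun j => if j == k then B else C j).
    apply/seteqP; split => w.
      move=> [hC hB] j /=; rewrite ltnS leq_eqVlt => /orP[/eqP ->|jk]; first by rewrite eqxx.
      by rewrite (ltn_eqF jk); exact: hC.
    move=> h; split; last by have := h k (ltnSn k); rewrite /= eqxx.
    by move=> j /= jk; have := h j (ltnW jk); rewrite /= (ltn_eqF jk).
  rewrite iid_noise_prefix//; last by move=> j; case: ifPn.
  rewrite big_ord_recr /= eqxx muleC iid_noise_prefix//; last exact: ltnW.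
  by congr (_ * _)%E; apply: eq_bigr => j _; rewrite (ltn_eqF (ltn_ord j)).
- move=> _; have -> : m1 mid setT = P (setT `&` W k @^-1` B) by [].
  by rewrite setTI; apply: le_lt_trans (probability_le1 _ _) _ => //; exact: ltry.
Qed.

(** Stands for conditioning on the past: the next noise variable is integrated out with everything
    earlier frozen. *)
Lemma one_step k (h : past k * Vm -> \bar R) : (k < N)%N ->
  measurable_fun setT h -> (forall z, 0 <= h z)%E ->
  (\int[P]_x h (x, W k x) = \int[P]_x \int[g]_w h (x, w))%E.
Proof.
move=> kN mh h0.
apply: (@indep_integral _ _ _ _ Omega (past k) Vm P g (id : Omega -> past k) (W k)) => //.
- by move=> _ C mC; rewrite setTI; exact: past_sub mC.
- exact: noise.1.
- by move=> A B mA mB; exact: past_indep.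
Qed.

End noise.

(** * Mixed differences over four moving points *)

Section rectangles.
Context {R : realType} {d : nat}.
Local Notation V := 'rV[R]_d.
Local Notation Vm := (@borelV R d).

(** The corners are arbitrary, since the flow does not map parallelograms to parallelograms:
    [rect id] of the images is the second difference of the flow. With suitably repeated corners it
    is a first difference, so one argument serves both moment bounds. *)
Definition rect (F : V -> V) (y : bool -> bool -> V) : V :=
  F (y true true) - F (y true false) - F (y false true) + F (y false false).

(** Comparable to the [p]-th power of the norm for even [p], and polynomial in each coordinate, so
    that the scalar binomial expansion applies. *)
Definition psum (p : nat) (v : V) : R := \sum_(i < d) v ord0 i ^+ p.

Lemma rowB (x y : V) i : (x - y) ord0 i = x ord0 i - y ord0 i.
Proof. by rewrite !mxE. Qed.

Lemma rectD (F G : V -> V) y : rect (fun z => F z + G z) y = rect F y + rect G y.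
Proof. by rewrite /rect; apply/rowP => i; rewrite !mxE; ring. Qed.

Lemma rect_id_shift (y : bool -> bool -> V) (w : V) : rect id (fun i j => y i j + w) = rect id y.
Proof. by rewrite /rect; apply/rowP => i; rewrite !mxE; ring. Qed.

Lemma psum_ge0 p v : ~~ odd p -> 0 <= psum p v.
Proof. by move=> ep; apply: sumr_ge0 => i _; exact: exprn_even_ge0. Qed.

Lemma norm_le_psum p v : (0 < p)%N -> ~~ odd p -> `|v| ^+ p <= psum p v.
Proof.
move=> p0 ep; apply: le_trans (norm_pow_le_sum v p0) _; apply: ler_sum => i _.
by rewrite -normrX ger0_norm// exprn_even_ge0.
Qed.

Lemma psum_le_norm p v : ~~ odd p -> psum p v <= d%:R * `|v| ^+ p.
Proof.
move=> ep; apply: (@le_trans _ _ (\sum_(i < d) `|v| ^+ p)); last by rewrite mulr_natl sumr_const card_ord.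
apply: ler_sum => i _; rewrite -(ger0_norm (exprn_even_ge0 _ ep)) normrX.
by apply: lerXn2r; rewrite ?nnegrE//; exact: coord_le_norm.
Qed.

Lemma continuous_measurable_VV (F : V -> V) : continuous F -> measurable_fun [set: Vm] (F : Vm -> Vm).
Proof.
move=> cF; apply: measurable_to_V => i; apply: (@continuous_measurable_V R d (fun x => F x ord0 i)).
by move=> x; apply: (@continuous_comp _ _ _ F (fun y : V => y ord0 i)); [exact: cF|exact: continuous_coord].
Qed.

Section measurability.
Context {dS : measure_display} {S : measurableType dS}.

Lemma measurable_addV (f g : S -> V) : measurable_fun [set: S] (f : S -> Vm) ->
  measurable_fun [set: S] (g : S -> Vm) -> measurable_fun [set: S] (fun s => f s + g s : Vm).
Proof.
move=> mf mg.
have mp : measurable_fun [set: S] (fun s => (f s, g s) : Vm * Vm) by apply/measurable_fun_pairP.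
exact: (measurableT_comp (@measurable_VD R d) mp).
Qed.

Lemma measurable_contV (F : V -> V) (f : S -> V) : continuous F -> measurable_fun [set: S] (f : S -> Vm) ->
  measurable_fun [set: S] (fun s => F (f s) : Vm).
Proof. by move=> cF mf; exact: (measurableT_comp (continuous_measurable_VV cF) mf). Qed.

Lemma measurable_subV (f g : S -> V) : measurable_fun [set: S] (f : S -> Vm) ->
  measurable_fun [set: S] (g : S -> Vm) -> measurable_fun [set: S] (fun s => f s - g s : Vm).
Proof.
move=> mf mg; apply: measurable_addV => //; apply: (measurable_contV (F := -%R)) => //.
by move=> x; exact: (@continuousN _ V V id x).
Qed.

Lemma measurable_rect (F : V -> V) (Y : S -> bool -> bool -> V) : continuous F ->
  (forall i j, measurable_fun [set: S] (fun s => Y s i j : Vm)) ->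
  measurable_fun [set: S] (fun s => rect F (Y s) : Vm).
Proof.
move=> cF mY; apply: measurable_addV; last exact: measurable_contV.
by do 2![apply: measurable_subV; last exact: measurable_contV]; exact: measurable_contV.
Qed.

Lemma measurable_psum p (f : S -> V) : measurable_fun [set: S] (f : S -> Vm) ->
  measurable_fun [set: S] (fun s => (psum p (f s))%:E).
Proof.
move=> mf; apply/measurable_EFinP; apply: measurable_sum => i.
by apply: measurable_funX; exact: (measurableT_comp (@measurable_coord R d i) mf).
Qed.

Lemma measurable_norm_powV p (f : S -> V) : measurable_fun [set: S] (f : S -> Vm) ->
  measurable_fun [set: S] (fun s => `|f s| ^+ p).
Proof. by move=> mf; apply: measurable_funX; exact: (measurableT_comp (@measurable_normV R d) mf). Qed.

End measurability.

Section gaussian_step.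
Variable (q : nat).
Let p := q.*2.+2.

(** Coordinatewise, [n i] is the deviation of a mixed difference of [v] from its Gaussian mean. Its
    mean is zero, and comparison with an independent copy of the noise bounds it by
    [M (|w| + C1 sqrt t)]. *)
Lemma gaussian_rect_step (gam : R -> probability Vm R) :
  (forall t : R, 0 < t -> gaussian_law (gam t) t) -> exists2 C : R, 0 <= C &
  forall (t : R), 0 < t -> t <= 1 ->
  forall (v : V -> V) (y : bool -> bool -> V) (M : R), vcb v -> 0 <= M ->
    (forall w w', `|rect v (fun i j => y i j + w) - rect v (fun i j => y i j + w')| <= M * `|w - w'|) ->
    (\int[gam t]_w (psum p (rect (fun z => z + v z)%R (fun i j => y i j + (w : V))%R))%:E <=
      ((1 + C * t) * psum p (rect (fun z => z + vheat gam t v z) y) + C * t * M ^+ p)%:E)%E.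
Proof.
move=> hgam.
have [C1 C10 hC1] := @gaussian_moment R d 1 isT.
have [C C0 hC] := @step_moment R d q C1 C10.
exists (C + C * d%:R); first by rewrite addr_ge0// mulr_ge0.
move=> t t0 t1 v y M cv M0 hM.
pose A := rect (fun z => z + vheat gam t v z) y.
pose n (i : 'I_d) (w : V) : R := rect v (fun i j => y i j + w) ord0 i - rect (vheat gam t v) y ord0 i.
have bv (i : 'I_d) z : bounded_mfun (fun w : Vm => v (z + (w : V)) ord0 i).
  by apply: (@heat_mfun R d (fun x => v x ord0 i) z); exact: vcb_coord.
have brect i : bounded_mfun (fun w : Vm => rect v (fun i j => y i j + (w : V)) ord0 i).
  rewrite (_ : (fun _ => _) = fun w : Vm => v (y true true + (w : V)) ord0 i - v (y true false + (w : V)) ord0 i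
     - v (y false true + (w : V)) ord0 i + v (y false false + (w : V)) ord0 i).
    by apply: bounded_mfunD => //; apply: bounded_mfunB => //; exact: bounded_mfunB.
  by apply/funext => w; rewrite /rect !mxE.
have Erect i : \int[gam t]_w rect v (fun i j => y i j + (w : V)) ord0 i = rect (vheat gam t v) y ord0 i.
  rewrite /rect /vheat !mxE /heat -!expectB//; last exact: bounded_mfunB.
  rewrite -expectD//; last by apply: bounded_mfunB => //; exact: bounded_mfunB.
  by apply: eq_Rintegral => w _; rewrite !mxE.
have bn i : bounded_mfun (n i : Vm -> R) by apply: bounded_mfunB => //; exact: bounded_mfun_cst.
have n0 i : \int[gam t]_w n i w = 0.
  by rewrite /n expectB// ?Erect ?expect_cst ?subrr//; exact: bounded_mfun_cst.
have mw : measurable_fun [set: Vm] (fun w : Vm => `|w : V|) by exact: measurable_normV.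
have iw : (\int[gam t]_w `|w : V|%:E <= (C1 * Num.sqrt t)%:E)%E.
  have := hC1 _ _ t0 (hgam _ t0); rewrite expr1; apply: le_trans.
  by under [leRHS]eq_integral do rewrite expr1.
have nb i w : `|n i w| <= M * (`|w| + C1 * Num.sqrt t).
  rewrite /n -Erect -(expect_cst (gam t) (rect v (fun i j => y i j + w) ord0 i)) -expectB//; last exact: bounded_mfun_cst.
  rewrite -lee_fin.
  have bb : bounded_mfun (fun w' : Vm => rect v (fun i j => y i j + w) ord0 i - rect v (fun i j => y i j + (w' : V)) ord0 i).
    by apply: bounded_mfunB => //; exact: bounded_mfun_cst.
  apply: (@le_trans _ _ (\int[gam t]_w' (M%:E * (`|w|%:E + `|w' : V|%:E)))%E).
    apply: (@le_trans _ _ (\int[gam t]_w' `|(rect v (fun i j => y i j + w) ord0 i - rect v (fun i j => y i j + (w' : V)) ord0 i)%:E|)%E).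
      rewrite -abse_EFin -expect_fin//.
      by apply: le_abse_integral => //; apply/measurable_EFinP; case: bb.
    apply: ge0_le_integral => //.
    - by apply: measurableT_comp => //; apply/measurable_EFinP; case: bb.
    - by apply: measurable_funeM; apply: emeasurable_funD => //; apply/measurable_EFinP.
    - move=> w' _; rewrite -EFinD -EFinM lee_fin.
      apply: (@le_trans _ _ (M * `|w - w'|)).
        apply: le_trans (hM w w'); apply: le_trans _ (coord_le_norm _ i).
        by rewrite rowB.
      by apply: ler_wpM2l => //; exact: ler_normB.
  have m1 : measurable_fun [set: Vm] (fun w' : Vm => `|w|%:E + `|w' : V|%:E)%E.
    by apply: emeasurable_funD => //; apply/measurable_EFinP.
  have m2 : measurable_fun [set: Vm] (fun w' : Vm => `|w' : V|%:E)%E by apply/measurable_EFinP.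
  have e1 (w' : Vm) : (0 <= `|w|%:E + `|w' : V|%:E :> \bar R)%E by rewrite -EFinD lee_fin addr_ge0.
  have e2 : (0 <= M%:E :> \bar R)%E by rewrite lee_fin.
  rewrite ge0_integralZl//.
  rewrite ge0_integralD//.
  rewrite integral_prob_cst EFinM; apply: lee_wpmul2l; first by rewrite lee_fin.
  by rewrite EFinD; apply: leeD.
have AE i w : rect (fun z => z + v z) (fun i j => y i j + w) ord0 i = A ord0 i + n i w.
  rewrite /A (rectD id v) (rectD id) rect_id_shift /n !mxE; ring.
have b1 i : bounded_mfun (fun w : Vm => (A ord0 i + n i (w : V)) ^+ p).
  by apply: bounded_mfunX; apply: bounded_mfunD => //; exact: bounded_mfun_cst.
have -> : (\int[gam t]_w (psum p (rect (fun z => z + v z)%R (fun i j => y i j + (w : V))%R))%:E =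
    \sum_(i < d) (\int[gam t]_w ((A ord0 i + n i (w : V)) ^+ p))%:E)%E.
  under eq_integral => w _.
    rewrite /psum; under eq_bigr => i _ do rewrite AE.
    rewrite -sumEFin; over.
  rewrite ge0_integral_sum//.
  - by apply: eq_bigr => i _; rewrite expect_fin.
  - by move=> i; apply/measurable_EFinP; case: (b1 i).
  - by move=> i w _; rewrite lee_fin exprn_even_ge0//= odd_double.
rewrite sumEFin lee_fin.
apply: (@le_trans _ _ (\sum_(i < d) ((1 + C * t) * A ord0 i ^+ p + C * t * M ^+ p))).
  by apply: ler_sum => i _; apply: (hC _ t t0 t1 (hgam _ t0) (n i)).
rewrite big_split/= -mulr_sumr sumr_const card_ord -mulr_natl.
have Mp : 0 <= M ^+ p by exact: exprn_ge0.
have S0 : 0 <= psum p A by apply: psum_ge0; rewrite /= odd_double.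
rewrite -/(psum p A).
have h1 : 0 <= C * d%:R * t * psum p A by apply: mulr_ge0 => //; apply: mulr_ge0; [exact: mulr_ge0|exact: ltW].
have h2 : 0 <= C * t * M ^+ p by apply: mulr_ge0 => //; apply: mulr_ge0 => //; exact: ltW.
rewrite -/A; move: h1 h2; clear; lra.
Qed.

End gaussian_step.

End rectangles.

Section scheme.
Context {R : realType} {d : nat}.
Local Notation V := 'rV[R]_d.

Fixpoint flow (f : nat -> V -> V) (w : nat -> V) (k m : nat) (x : V) : V :=
  if m is m'.+1 then
    let y := flow f w k m' x + w (k + m')%N in y + f (k + m')%N y
  else x.

Lemma flowD f w k m1 m2 x : flow f w k (m1 + m2) x = flow f w (k + m1) m2 (flow f w k m1 x).
Proof. by elim: m2 => [|m2 IH]; rewrite ?addn0// addnS /= IH addnA. Qed.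
End scheme.

Section random_step.
Context {R : realType} {d : nat} {disp : measure_display} {Omega : measurableType disp}.
Local Notation V := 'rV[R]_d.
Local Notation Vm := (@borelV R d).
Variable P : probability Omega R.
Variable gam : R -> probability Vm R.
Hypothesis hgam : forall t : R, 0 < t -> gaussian_law (gam t) t.

Lemma scheme_measurable (W : nat -> Omega -> V) (f : nat -> V -> V) (k m : nat) (Y : Omega -> V) :
  (forall j, continuous (f j)) -> measurable_fun [set: past W k] (Y : past W k -> Vm) ->
  measurable_fun [set: past W (k + m)] (fun w => flow f (W ^~ w) k m (Y w) : Vm).
Proof.
move=> cf mY; elim: m => [|m IH]; first by rewrite addn0.
rewrite addnS /=.
have m1 : measurable_fun [set: past W (k + m).+1]
   (fun w => flow f (W ^~ w) k m (Y w) + W (k + m)%N w : Vm).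
  apply: measurable_addV; last exact: past_noise.
  exact: (past_mfun_mono (leqnSn _) IH).
by apply: measurable_addV => //; exact: measurable_contV.
Qed.

Variable q : nat.
Let p := q.*2.+2.

(** With [v] as in the statement, [z + v z] is the new position plus [u] there, while
    [z + vheat gam t v z] is its mean before the step. The Lipschitz constant [M] is random; it may
    be controlled by the moment itself through [K0] and by an external term [G], the form that the
    Gronwall argument accepts. *)
Lemma random_step : exists2 C : R, 0 <= C &
  forall (t : R) N (W : nat -> Omega -> V), 0 < t -> t <= 1 -> iid_noise P (gam t) N W ->
  forall k (f u : V -> V) (Y : Omega -> bool -> bool -> V) (K0 : R) (G : Omega -> R) (s g0 : R), (k < N)%N ->
    vcb f -> vcb u -> 0 <= K0 -> measurable_fun [set: Omega] G ->
    (forall i j, measurable_fun [set: past W k] (fun w => Y w i j : Vm)) ->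
    let v := fun z => f z + u (z + f z) in
    (forall w, 0 <= G w) ->
    (forall w, exists2 M, 0 <= M &
       (forall a a', `|rect v (fun i j => Y w i j + a) - rect v (fun i j => Y w i j + a')| <= M * `|a - a'|) /\
       M ^+ p <= K0 * psum p (rect (fun z => z + vheat gam t v z) (Y w)) + G w) ->
    (\int[P]_w (psum p (rect (fun z => z + vheat gam t v z)%R (Y w)))%:E <= s%:E)%E ->
    (\int[P]_w (G w)%:E <= g0%:E)%E ->
    (\int[P]_w (psum p (rect (fun z => z + u z)%R (fun i j =>
         (Y w i j + W k w) + f (Y w i j + W k w))%R))%:E <= ((1 + C * (1 + K0) * t) * s + C * t * g0)%:E)%E.
Proof.
have [C C0 hC] := @gaussian_rect_step R d q gam hgam; exists C => //.
move=> t N W t0 t1 noise k f u Y K0 G s g0 kN cf cu K00 mG mY v G0 hM hs hg0.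
have cG : continuous (fun z : V => z + f z) by apply: continuous_idD; exact: cf.1.
have cv : vcb v by apply: vcbD => //; exact: vcb_comp.
have ep : ~~ odd p by rewrite /= odd_double.
pose h := fun z : past W k * Vm => (psum p (rect (fun z => z + v z) (fun i j => Y z.1 i j + (z.2 : V))))%:E.
have mh : measurable_fun setT h.
  apply: measurable_psum; apply: measurable_rect; first by apply: continuous_idD; exact: cv.1.
  move=> i j; apply: measurable_addV; last exact: measurable_snd.
  by have := measurableT_comp (mY i j) (@measurable_fst _ _ (past W k) Vm).
have h0 z : (0 <= h z)%E by rewrite lee_fin psum_ge0.
have -> : (\int[P]_w (psum p (rect (fun z => z + u z)%R (fun i j =>
         (Y w i j + W k w) + f (Y w i j + W k w))%R))%:E = \int[P]_w h (w, W k w))%E.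
  by apply: eq_integral => w _; rewrite /h /rect /v /= !addrA.
rewrite (one_step noise kN mh h0).
pose S := fun w => psum p (rect (fun z => z + vheat gam t v z) (Y w)).
have mS : measurable_fun [set: Omega] (fun w => (S w)%:E).
  apply: (@past_mfun _ _ _ _ P (gam t) N W noise k); apply: measurable_psum; apply: measurable_rect; last exact: mY.
  by apply: continuous_idD; exact: (vheat_vcb hgam t0 cv).1.
have S0 w : (0 <= (S w)%:E :> \bar R)%E by rewrite lee_fin psum_ge0.
have mG' : measurable_fun [set: Omega] (fun w => (G w)%:E) by apply/measurable_EFinP.
have c1 : 0 <= 1 + C * (1 + K0) * t by apply: addr_ge0 => //; apply: mulr_ge0; [apply: mulr_ge0 => //; exact: addr_ge0|exact: ltW].
have c2 : 0 <= C * t by apply: mulr_ge0 => //; exact: ltW.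
have m1 : measurable_fun [set: Omega] (fun w => (1 + C * (1 + K0) * t)%:E * (S w)%:E)%E by exact: measurable_funeM.
have m2 : measurable_fun [set: Omega] (fun w => (C * t)%:E * (G w)%:E)%E by exact: measurable_funeM.
apply: (@le_trans _ _ (\int[P]_w ((1 + C * (1 + K0) * t)%:E * (S w)%:E + (C * t)%:E * (G w)%:E))%E).
  apply: ge0_le_integral => //.
  - by move=> w _; exact: integral_ge0.
  - have := @measurable_fun_fubini_tonelli_F _ _ (past W k) Vm R (gam t) h mh h0.
    exact: (@past_mfun _ _ _ _ P (gam t) N W noise k).
  - exact: emeasurable_funD.
  - move=> w _; have [M M0 [hM1 hM2]] := hM w.
    apply: (le_trans (hC t t0 t1 v (Y w) M cv M0 hM1)); rewrite -!EFinM -EFinD lee_fin -/(S w).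
    have : C * t * M ^+ p <= C * t * (K0 * S w + G w) by exact: ler_wpM2l.
    by rewrite -/p; clear; lra.
have e1 (w : Omega) : [set: Omega] w -> (0 <= (1 + C * (1 + K0) * t)%:E * (S w)%:E :> \bar R)%E by move=> _; apply: mule_ge0 => //; rewrite lee_fin.
have e2 (w : Omega) : [set: Omega] w -> (0 <= (C * t)%:E * (G w)%:E :> \bar R)%E by move=> _; apply: mule_ge0 => //; rewrite lee_fin.
rewrite ge0_integralD//.
have e3 (w : Omega) : [set: Omega] w -> (0 <= (S w)%:E :> \bar R)%E by [].
have e4 (w : Omega) : [set: Omega] w -> (0 <= (G w)%:E :> \bar R)%E by rewrite lee_fin.
rewrite (ge0_integralZl_EFin _ _ e3 _ c1)// (ge0_integralZl_EFin _ _ e4 _ c2)//.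
by rewrite [leRHS]EFinD; apply: leeD; rewrite [leRHS]EFinM; apply: lee_wpmul2l => //; rewrite lee_fin.
Qed.

End random_step.

(** * Moment bounds on one short time window *)

Section window.
Context {R : realType} {d : nat} {disp : measure_display} {Omega : measurableType disp}.
Local Notation V := 'rV[R]_d.
Local Notation Vm := (@borelV R d).
Variable P : probability Omega R.
Variable gam : R -> probability Vm R.
Hypothesis hgam : forall t : R, 0 < t -> gaussian_law (gam t) t.
Hypothesis conv : forall (s t : R) (f : Vm -> \bar R), 0 < s -> 0 < t ->
  measurable_fun setT f -> (forall w, 0 <= f w)%E ->
  (\int[gam (s + t)]_w f w = \int[gam s]_w \int[gam t]_w' f ((w : V) + (w' : V))%R)%E.
Variables (b : R).
Hypotheses (b0 : 0 < b) (b1 : b < 1).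

Let sideH (y : bool -> bool -> V) : V := y true false - y false false.
Let sideL (y : bool -> bool -> V) : V := y false true - y false false.
(** The forcing in the equation for second differences: the two sides are first differences of the
    flow, and the second factor is the modulus in [C2b_weak]. *)
Definition side_product (y : bool -> bool -> V) : R := `|sideH y| * (`|sideL y| `^ b + `|sideL y|).

Lemma continuous_idV : continuous (id : V -> V).
Proof. by move=> x; exact: cvg_id. Qed.

Lemma side_product_ge0 y : 0 <= side_product y.
Proof. by rewrite /side_product mulr_ge0// addr_ge0// powR_ge0. Qed.

(** The fourth corner misses the parallelogram of the other three by [e = rect id y]. Its
    displacement costs a first difference of [u], the parallelogram itself a second one. *)
Lemma rect_value_close (u : V -> V) y : C2b b 2^-1 u ->
  `|rect u y| <= 2^-1 * `|rect id y| + 2^-1 * (`|sideH y| * `|sideL y|).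
Proof.
move=> [_ u1 u2 _].
set H := sideH y; set L := sideL y; set e := rect id y; set p := y false false.
have E1 : y true false = p + H by rewrite /H /sideH addrC subrK.
have E2 : y false true = p + L by rewrite /L /sideL addrC subrK.
have E3 : y true true = p + L + H + e.
  by rewrite /H /L /e /rect /sideH /sideL /p; apply/rowP => i; rewrite !mxE; ring.
have -> : rect u y = dif e u (p + L + H) + dif L (dif H u) p.
  by rewrite /rect E1 E2 E3 /dif; apply/rowP => i; rewrite !mxE; ring.
apply: le_trans (ler_normD _ _) _; apply: lerD; first exact: u1.
by apply: le_trans (u2 _ _ _) _; rewrite -mulrA (mulrC `|L|).
Qed.

(** Correcting the fourth corner by [e] splits the oscillation into a second difference of [v] along
    [e] and a third difference along both sides. *)
Lemma rect_osc (v : V -> V) y a a' : C2b_weak b 10 v ->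
  `|rect v (fun i j => y i j + a) - rect v (fun i j => y i j + a')| <=
    10 * (`|rect id y| + side_product y) * `|a - a'|.
Proof.
move=> [_ v1 v2 v3].
set H := sideH y; set L := sideL y; set e := rect id y; set p := y false false.
have E1 : y true false = p + H by rewrite /H /sideH addrC subrK.
have E2 : y false true = p + L by rewrite /L /sideL addrC subrK.
have E3 : y true true = p + L + H + e.
  by rewrite /H /L /e /rect /sideH /sideL /p; apply/rowP => i; rewrite !mxE; ring.
have -> : rect v (fun i j => y i j + a) - rect v (fun i j => y i j + a') =
   dif e (dif (a - a') v) (p + L + H + a') + dif H (dif L (dif (a - a') v)) (p + a').
  rewrite /rect E1 E2 E3 /dif.
  rewrite -/p.
  have -> : p + L + H + e + a = p + L + H + a' + e + (a - a') by apply/rowP => i; rewrite !mxE; ring.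
  have -> : p + L + H + e + a' = p + L + H + a' + e by apply/rowP => i; rewrite !mxE; ring.
  have -> : p + H + a = p + a' + H + (a - a') by apply/rowP => i; rewrite !mxE; ring.
  have -> : p + H + a' = p + a' + H by apply/rowP => i; rewrite !mxE; ring.
  have -> : p + L + a = p + a' + L + (a - a') by apply/rowP => i; rewrite !mxE; ring.
  have -> : p + L + a' = p + a' + L by apply/rowP => i; rewrite !mxE; ring.
  have -> : p + a = p + a' + (a - a') by apply/rowP => i; rewrite !mxE; ring.
  have -> : p + L + H + a' + (a - a') = p + a' + H + L + (a - a') by apply/rowP => i; rewrite !mxE; ring.
  have -> : p + L + H + a' = p + a' + H + L by apply/rowP => i; rewrite !mxE; ring.
  by apply/rowP => i; rewrite !mxE; ring.
apply: le_trans (ler_normD _ _) _.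
apply: le_trans (lerD (v2 _ _ _) (v3 _ _ _ _)) _.
rewrite /side_product -/H -/L le_eqVlt; apply/orP; left; apply/eqP; ring.
Qed.

Variable q : nat.
Let p := q.*2.+2.
Let ep : ~~ odd p. Proof. by rewrite /= odd_double. Qed.

Lemma side_le_product y : `|sideH y| * `|sideL y| <= side_product y.
Proof. by rewrite /side_product; apply: ler_wpM2l => //; rewrite lerDr powR_ge0. Qed.

(** The factor 1/2 on [|rect id y|] is absorbed on the left, which gives [|rect id y| <= 2 |A| + G]:
    the transform [z + u z] controls the mixed difference of the positions. *)
Lemma rect_osc_moment (v u : V -> V) y : C2b b 2^-1 u ->
  (10 * (`|rect id y| + side_product y)) ^+ p <=
    (40 ^+ p) * psum p (rect (fun z => z + u z) y) + 40 ^+ p * side_product y ^+ p.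
Proof.
move=> cu; set A := rect (fun z => z + u z) y; set G := side_product y.
have G0 : 0 <= G by exact: side_product_ge0.
have h1 : `|rect id y| <= 2 * `|A| + G.
  have := rect_value_close y cu; have := side_le_product y; rewrite -/G.
  have -> : rect id y = A - rect u y by rewrite /A (rectD id u) addrK.
  by have := ler_normB A (rect u y); lra.
apply: (@le_trans _ _ ((20 * (`|A| + G)) ^+ p)).
  apply: lerXn2r; rewrite ?nnegrE; [|apply: mulr_ge0 => //; exact: addr_ge0|by lra].
  by apply: mulr_ge0 => //; exact: addr_ge0.
rewrite exprMn; apply: (@le_trans _ _ (20 ^+ p * (2 ^+ p * (`|A| ^+ p + G ^+ p)))).
  by apply: ler_wpM2l; [exact: exprn_ge0|exact: expr_addr_le].
rewrite mulrA -exprMn -natrM [(20 * 2)%N]/= mulrDr; apply: lerD => //; apply: ler_wpM2l; first exact: exprn_ge0.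
exact: norm_le_psum.
Qed.

Lemma gronwall (S : nat -> \bar R) (c k s : R) m : 0 <= c -> 0 <= k -> 0 <= s -> (S 0%N <= s%:E)%E ->
  (forall i x, (i < m)%N -> 0 <= x -> (S i <= x%:E)%E -> (S i.+1 <= ((1 + c) * x + k)%:E)%E) ->
  (S m <= (expR (c * m%:R) * (s + m%:R * k))%:E)%E.
Proof.
move=> c0 k0 s0 hS0 hS.
have H i : (i <= m)%N -> (S i <= ((1 + c) ^+ i * (s + i%:R * k))%:E)%E.
  elim: i => [_|i IH im]; first by rewrite expr0 mul1r mul0r addr0.
  have c1 : 1 <= (1 + c) ^+ i by apply: exprn_ege1; rewrite lerDl.
  have x0 : 0 <= (1 + c) ^+ i * (s + i%:R * k) by rewrite mulr_ge0 ?addr_ge0 ?mulr_ge0// (le_trans _ c1).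
  apply: (le_trans (hS i _ im x0 (IH (ltnW im)))); rewrite lee_fin.
  have e1 : 1 <= (1 + c) ^+ i.+1 by apply: exprn_ege1; rewrite lerDl.
  have : k <= (1 + c) ^+ i.+1 * k by rewrite ler_peMl.
  by rewrite -natr1 exprS; lra.
apply: le_trans (H m (leqnn m)) _; rewrite lee_fin; apply: ler_wpM2r; first by rewrite addr_ge0// mulr_ge0.
rewrite mulrC expRM_natl; apply: lerXn2r; rewrite ?nnegrE ?addr_ge0 ?expR_ge0//.
exact: expR_ge1Dx.
Qed.

(** The tracked quantity is the mixed difference of position plus remaining value. Its mean is
    preserved by each step, so its moments grow by [1 + c t]; after [m] steps the remaining value is
    zero and the positions themselves are bounded. *)
Lemma window_moment : exists2 C : R, 1 <= C &
  forall (t : R) N (W : nat -> Omega -> V), 0 < t -> t <= 1 -> iid_noise P (gam t) N W ->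
  forall (f : nat -> V -> V) k m, (k + m <= N)%N -> m%:R * t <= 1 ->
    (forall j, vcb (f j)) -> (forall j, (j < m)%N -> C2b b 2^-1 (f (k + j)%N)) ->
    (forall j, (j <= m)%N -> C2b b 2^-1 (value gam f t (k + m) j)) ->
  forall (Y : Omega -> bool -> bool -> V) (s g0 : R), 0 <= s -> 0 <= g0 ->
    (forall i j, measurable_fun [set: past W k] (fun w => Y w i j : Vm)) ->
    let Z n w i j := flow f (W ^~ w) k n (Y w i j) in
    (forall n, (n <= m)%N -> (\int[P]_w (side_product (Z n w) ^+ p)%:E <= g0%:E)%E) ->
    (\int[P]_w (`|rect id (Y w)| ^+ p)%:E <= s%:E)%E ->
    (\int[P]_w (`|rect id (Z m w)| ^+ p)%:E <= (C * (s + g0))%:E)%E.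
Proof.
have [C C0 hC] := @random_step R d disp Omega P gam hgam q.
pose K := 40 ^+ p : R.
have K1 : 1 <= K by apply: exprn_ege1; rewrite ler1n.
have K0 : 0 <= K by exact: le_trans K1.
pose c := C * (1 + K); have c0 : 0 <= c by rewrite mulr_ge0// addr_ge0.
pose D : R := d%:R * 4 ^+ p + 1; have D1 : 1 <= D by rewrite lerDr mulr_ge0// exprn_ge0.
have D0 : 0 <= D by exact: le_trans D1.
exists (expR c * (D + c)).
  apply: (@le_trans _ _ (1 * (1 + 0))); first by rewrite mul1r addr0.
  by apply: ler_pM => //; [rewrite -expR0 ler_expR|apply: lerD].
move=> t N W t0 t1 noise f k m kmN mt cf Cf Cv Y s g0 s0 g00 mY Z hg hs.
have mZ n i j : measurable_fun [set: past W (k + n)] (fun w => Z n w i j : Vm).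
  by apply: scheme_measurable => // j'; exact: (cf j').1.
have mZ' n i j : measurable_fun [set: Omega] (fun w => Z n w i j : Vm).
  by apply: (@past_mfun _ _ _ _ P (gam t) N W noise (k + n)); exact: mZ.
pose Phi n := fun z : V => z + value gam f t (k + m) (m - n) z.
pose S n := (\int[P]_w (psum p (rect (Phi n) (Z n w)))%:E)%E.
have mside n : measurable_fun [set: Omega] (fun w => side_product (Z n w) ^+ p).
  apply: measurable_funX; apply: measurable_funM.
    by apply: (measurableT_comp (@measurable_normV R d)); exact: measurable_subV.
  have mL : measurable_fun [set: Omega] (fun w => `|sideL (Z n w)|).
    by apply: (measurableT_comp (@measurable_normV R d)); exact: measurable_subV.
  by apply: measurable_funD => //; exact: (measurableT_comp (measurable_powR b) mL).
have hS0 : (S 0%N <= (D * (s + g0))%:E)%E.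
  pose h := fun w => d%:R * 4 ^+ p * `|rect id (Y w)| ^+ p + d%:R * 2 ^+ p * side_product (Z 0%N w) ^+ p.
  have my : measurable_fun [set: Omega] (fun w => `|rect id (Y w)| ^+ p).
    by apply: measurable_norm_powV; apply: measurable_rect; [exact: continuous_idV|exact: mZ' 0%N].
  have d1 : 0 <= d%:R * 4 ^+ p :> R by rewrite mulr_ge0// exprn_ge0.
  apply: (@le_trans _ _ (\int[P]_w ((d%:R * 4 ^+ p)%:E * ((`|rect id (Y w)| ^+ p)%:E + (side_product (Z 0%N w) ^+ p)%:E)))%E).
    apply: ge0_le_integral => //.
    - by move=> w _; rewrite lee_fin psum_ge0.
    - apply: measurable_psum; apply: measurable_rect => //.
      by apply: continuous_idD; exact: (value_vcb hgam _ _ t0 cf).1.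
    - by apply: measurable_funeM; apply: emeasurable_funD; apply/measurable_EFinP.
    - move=> w _; rewrite -EFinD -EFinM lee_fin.
      apply: le_trans (psum_le_norm _ ep) _; rewrite -mulrA; apply: ler_wpM2l => //.
      have h1 := rect_value_close (Z 0%N w) (Cv _ (leq_subr 0 m)).
      have h2 := side_le_product (Z 0%N w).
      set e := `|rect id (Y w)|; set G := side_product _ in h2 *.
      have G0 : 0 <= G by exact: side_product_ge0.
      have e0 : 0 <= e by exact: normr_ge0.
      apply: (@le_trans _ _ ((2 * (e + G)) ^+ p)).
        apply: lerXn2r; rewrite ?nnegrE//; first by apply: mulr_ge0 => //; exact: addr_ge0.
        rewrite /Phi (rectD id); apply: le_trans (ler_normD _ _) _.
        have : 0 <= e by []. rewrite /e; move: h1 h2 G0; rewrite /Z /= -/e; clear; lra.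
      rewrite exprMn; apply: (@le_trans _ _ (2 ^+ p * (2 ^+ p * (e ^+ p + G ^+ p)))).
        by apply: ler_wpM2l; [exact: exprn_ge0|exact: expr_addr_le].
      by rewrite mulrA -exprMn -natrM.
  have a1 (w : Omega) : (0 <= (`|rect id (Y w)| ^+ p)%:E + (side_product (Z 0%N w) ^+ p)%:E :> \bar R)%E.
    by rewrite -EFinD lee_fin addr_ge0// exprn_ge0//; exact: side_product_ge0.
  have a2 (w : Omega) : (0 <= (`|rect id (Y w)| ^+ p)%:E :> \bar R)%E by rewrite lee_fin exprn_ge0.
  have a3 (w : Omega) : (0 <= (side_product (Z 0%N w) ^+ p)%:E :> \bar R)%E.
    by rewrite lee_fin exprn_ge0//; exact: side_product_ge0.
  have a4 : measurable_fun [set: Omega] (fun w => (`|rect id (Y w)| ^+ p)%:E) by apply/measurable_EFinP.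
  have a5 : measurable_fun [set: Omega] (fun w => (side_product (Z 0%N w) ^+ p)%:E) by apply/measurable_EFinP.
  have a6 : measurable_fun [set: Omega] (fun w => (`|rect id (Y w)| ^+ p)%:E + (side_product (Z 0%N w) ^+ p)%:E)%E.
    exact: emeasurable_funD.
  rewrite (ge0_integralZl_EFin _ _ _ _ d1)//.
  rewrite ge0_integralD//.
  apply: (@le_trans _ _ ((d%:R * 4 ^+ p)%:E * (s%:E + g0%:E))%E).
    by apply: lee_wpmul2l; [rewrite lee_fin|apply: leeD => //; exact: hg].
  rewrite -EFinD -EFinM lee_fin; apply: ler_wpM2r; first exact: addr_ge0.
  by rewrite lerDl.
have hSs i x : (i < m)%N -> 0 <= x -> (S i <= x%:E)%E -> (S i.+1 <= ((1 + c * t) * x + C * t * (K * g0))%:E)%E.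
  move=> im x0 hSi.
  pose u := value gam f t (k + m) (m - i.+1).
  pose v := fun z => f (k + i)%N z + u (z + f (k + i)%N z).
  (* The backward recursion identifies the value before step [i] with the Gaussian mean of [v]; the
     index of the drift in it is [(k + m) - (m - i) = k + i]. *)
  have vE z : value gam f t (k + m) (m - i) z = vheat gam t v z.
    rewrite -(subnSK im) /= /v /u.
    by have -> : (k + m - (m - i.+1).+1 = k + i)%N by rewrite subnSK// (subnBA _ (ltnW im)) addnAC addnK.
  have PhiE : Phi i = fun z => z + vheat gam t v z by apply/funext => z; rewrite /Phi vE.
  rewrite /S PhiE in hSi.
  have cu : C2b b 2^-1 u by apply: Cv; exact: leq_subr.
  have kiN : (k + i < N)%N by apply: leq_trans kmN; rewrite ltn_add2l.
  have Kside0 w : 0 <= K * side_product (Z i w) ^+ p by rewrite mulr_ge0// exprn_ge0//; exact: side_product_ge0.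
  have gg : (\int[P]_w (K * side_product (Z i w) ^+ p)%:E <= (K * g0)%:E)%E.
    under eq_integral do rewrite EFinM.
    rewrite (ge0_integralZl_EFin _ _ _ _ K0)//; last 2 first.
    - by move=> w _; rewrite lee_fin exprn_ge0//; exact: side_product_ge0.
    - by apply/measurable_EFinP.
    by rewrite [leRHS]EFinM; apply: lee_wpmul2l; [rewrite lee_fin|apply: hg; exact: ltnW].
  have := hC t N W t0 t1 noise (k + i)%N (f (k + i)%N) u (Z i) K (fun w => K * side_product (Z i w) ^+ p) x (K * g0) kiN (cf _) _ K0 _ (mZ i) Kside0 _ hSi gg.
  apply; first by case: cu.
    exact: measurable_funM.
  move=> w; exists (10 * (`|rect id (Z i w)| + side_product (Z i w))).
    by rewrite mulr_ge0// addr_ge0//; exact: side_product_ge0.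
  split => [a a'|]; first by apply: rect_osc; apply: comp_C2b => //; exact: Cf.
  rewrite -/v -PhiE; apply: rect_osc_moment => //; apply: Cv; exact: leq_subr.
have t00 : 0 <= t by exact: ltW.
have kk : 0 <= C * t * (K * g0) by apply: mulr_ge0; exact: mulr_ge0.
have ct : 0 <= c * t by exact: mulr_ge0.
have D2 : 0 <= D * (s + g0) by apply: mulr_ge0 => //; exact: addr_ge0.
have := gronwall ct kk D2 hS0 hSs.
rewrite /S /Phi subnn /=; move=> hm.
apply: (@le_trans _ _ (\int[P]_w (psum p (rect (fun z : V => z + 0)%R (Z m w)))%:E)%E).
  apply: ge0_le_integral => //.
  - apply/measurable_EFinP; by apply: measurable_norm_powV; apply: measurable_rect; [exact: continuous_idV|].
  - apply: measurable_psum; apply: measurable_rect => //; apply: continuous_idD; exact: cst_continuous.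
  - move=> w _; rewrite lee_fin; apply: le_trans (norm_le_psum _ _ ep) _ => //.
    by rewrite (_ : (fun z : V => z + 0) = id)//; apply/funext => z; rewrite addr0.
apply: (le_trans hm); rewrite lee_fin.
apply: (@le_trans _ _ (expR c * (D * (s + g0) + c * g0))).
  apply: ler_pM; [exact: expR_ge0|apply: addr_ge0 => //; apply: mulr_ge0 => //| |].
    by rewrite ler_expR -mulrA; rewrite -[leRHS]mulr1; apply: ler_wpM2l => //; rewrite mulrC.
  apply: lerD => //.
  have -> : m%:R * (C * t * (K * g0)) = C * K * g0 * (m%:R * t) by ring.
  apply: (@le_trans _ _ (C * K * g0 * 1)); first by apply: ler_wpM2l => //; apply: mulr_ge0 => //; exact: mulr_ge0.
  rewrite mulr1; apply: ler_wpM2r => //; rewrite /c; apply: ler_wpM2l => //; by rewrite lerDr.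
rewrite -mulrA; apply: ler_wpM2l; first exact: expR_ge0.
by rewrite [leRHS]mulrDl lerD2l; apply: ler_wpM2l => //; rewrite lerDr.
Qed.

End window.

(** * From short windows to the whole interval *)

Section chain.
Context {R : realType} {d : nat} {disp : measure_display} {Omega : measurableType disp}.
Local Notation V := 'rV[R]_d.
Local Notation Vm := (@borelV R d).
Variable P : probability Omega R.
Variable gam : R -> probability Vm R.
Hypothesis hgam : forall t : R, 0 < t -> gaussian_law (gam t) t.
Hypothesis conv : forall (s t : R) (f : Vm -> \bar R), 0 < s -> 0 < t ->
  measurable_fun setT f -> (forall w, 0 <= f w)%E ->
  (\int[gam (s + t)]_w f w = \int[gam s]_w \int[gam t]_w' f ((w : V) + (w' : V))%R)%E.
Variables (T a b rho Cw : R).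
Hypotheses (T0 : 0 < T) (a0 : 0 < a) (a1 : a < 1) (b0 : 0 < b) (ba : b < a)
  (Cw0 : 0 <= Cw) (sgrho : 1 - (a - b) / 2 < rho).

Definition drift_data (dl : R) (om : nat -> R) (psi : nat -> V -> V) :=
  [/\ forall j, 0 <= om j, forall j, vholder_bounded (om j) a (psi j) &
      forall k m, \sum_(0 <= i < m) om (k + i)%N <= Cw * (m%:R * dl) `^ rho].

Let b1 : b < 1. Proof. exact: lt_trans a1. Qed.

(** A window has [M0] steps, with [tau / 2 <= M0 * dl <= tau]. The number [r] of windows therefore
    depends on [T] and [tau] only, and each multiplies the bound by at most [2 * C]. *)
Lemma chain_moment q : exists2 tau : R, 0 < tau & exists2 C : R, 0 <= C &
  forall (dl : R) N (W : nat -> Omega -> V), 0 < dl -> dl <= tau -> N%:R * dl <= T -> iid_noise P (gam dl) N W ->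
  forall om psi, drift_data dl om psi -> let f := fun j => vheat gam dl (psi j) in
  forall k m, (k + m <= N)%N ->
  forall (Y : Omega -> bool -> bool -> V) (s g0 : R), 0 <= s -> 0 <= g0 ->
    (forall i j, measurable_fun [set: past W k] (fun w => Y w i j : Vm)) ->
    let Z n w i j := flow f (W ^~ w) k n (Y w i j) in
    (forall n, (n <= m)%N -> (\int[P]_w (side_product b (Z n w) ^+ q.*2.+2)%:E <= g0%:E)%E) ->
    (\int[P]_w (`|rect id (Y w)| ^+ q.*2.+2)%:E <= s%:E)%E ->
    (\int[P]_w (`|rect id (Z m w)| ^+ q.*2.+2)%:E <= (C * (s + g0))%:E)%E.
Proof.
have [tau1 tau10 hval] := value_regular hgam conv T0 a0 a1 b0 ba Cw0 sgrho.
have [tau2 tau20 hmol] := mollified_regular hgam conv T0 a0 a1 b0 ba Cw0 sgrho.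
have [C C1 hC] := window_moment P hgam b0 b1 q.
pose tau := Num.min 1 (Num.min tau1 tau2).
have tau0 : 0 < tau by rewrite !lt_min ltr01 tau10.
have tl1 : tau <= 1 by rewrite ge_min lexx.
have tl2 : tau <= tau1 by rewrite !ge_min lexx orbT.
have tl3 : tau <= tau2 by rewrite !ge_min lexx !orbT.
pose r := (Num.truncn (2 * T / tau)).+1.
have C0 : 0 <= C by exact: le_trans C1.
have C20 : 0 <= 2 * C by exact: mulr_ge0.
exists tau => //; exists ((2 * C) ^+ r); first exact: exprn_ge0.
move=> dl N W dl0 dltau NT noise om psi [om0 hpsi hom] f.
have cf j : vcb (f j) by apply: vheat_vcb => //; case: (hpsi j).
have hf j : vholder_bounded (om j) a (f j) by exact: vheat_vholder.
have om1 j : om j <= Cw * dl `^ rho by have := hom j 1%N; rewrite big_nat1 addn0 mul1r.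
have Cf j : C2b b 2^-1 (f j).
  by apply: (hmol dl (om j)) => //; exact: le_trans dltau tl3.
pose M0 := Num.truncn (tau / dl).
have td0 : 0 <= tau / dl by rewrite divr_ge0// ltW.
have /andP[M0a M0b] := truncn_itv td0; rewrite -/M0 in M0a M0b.
have M01 : (0 < M0)%N.
  rewrite lt0n; apply/eqP => M00; move: M0b; rewrite M00 ltNge => /negP; apply.
  by rewrite ler_pdivlMr// mul1r.
have M0dl : M0%:R * dl <= tau by rewrite -ler_pdivlMr.
have M0dl2 : tau <= 2 * (M0%:R * dl).
  have : tau < M0.+1%:R * dl by rewrite -ltr_pdivrMr.
  have : 1 * dl <= M0%:R * dl by apply: ler_wpM2r; [exact: ltW|rewrite ler1n].
  by rewrite -natr1 mulrDl; lra.
have rM0 : (N <= r * M0)%N.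
  rewrite -(ler_nat R) natrM -(ler_pM2r dl0); apply: le_trans NT _.
  have T2 : 0 <= 2 * T / tau by apply: divr_ge0; apply: ltW => //; exact: mulr_gt0.
  have /andP[_ /ltW] := truncn_itv T2; rewrite -/r.
  rewrite ler_pdivrMr// => h.
  have : r%:R * tau <= r%:R * (2 * (M0%:R * dl)) by apply: ler_wpM2l.
  by lra.
suff H : forall r' k m, (k + m <= N)%N -> (m <= r' * M0)%N ->
  forall (Y : Omega -> bool -> bool -> V) (s g0 : R), 0 <= s -> 0 <= g0 ->
    (forall i j, measurable_fun [set: past W k] (fun w => Y w i j : Vm)) ->
    let Z n w i j := flow f (W ^~ w) k n (Y w i j) in
    (forall n, (n <= m)%N -> (\int[P]_w (side_product b (Z n w) ^+ q.*2.+2)%:E <= g0%:E)%E) ->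
    (\int[P]_w (`|rect id (Y w)| ^+ q.*2.+2)%:E <= s%:E)%E ->
    (\int[P]_w (`|rect id (Z m w)| ^+ q.*2.+2)%:E <= ((2 * C) ^+ r' * (s + g0))%:E)%E.
  move=> k m kmN; apply: H => //; apply: leq_trans rM0; apply: leq_trans kmN; exact: leq_addl.
elim=> [|r' IH] k m kmN mr Y s g0 s0 g00 mY Z hg hs.
  move: mr; rewrite mul0n leqn0 => /eqP ->; rewrite expr0 mul1r.
  by apply: (le_trans hs); rewrite lee_fin lerDl.
pose m1 := minn m M0.
have m1m : (m1 <= m)%N by rewrite geq_minl.
have m1M : (m1 <= M0)%N by rewrite geq_minr.
have mE : m = (m1 + (m - m1))%N by rewrite subnKC.
have km1N : (k + m1 <= N)%N by apply: leq_trans kmN; rewrite leq_add2l.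
have m1tau : m1%:R * dl <= tau.
  by apply: le_trans M0dl; apply: ler_wpM2r; [exact: ltW|rewrite ler_nat].
have h1 : (\int[P]_w (`|rect id (Z m1 w)| ^+ q.*2.+2)%:E <= (C * (s + g0))%:E)%E.
  apply: (hC dl N W dl0 (le_trans dltau tl1) noise f k m1 km1N) => //.
  - exact: le_trans tl1.
  - move=> j jm; apply: (hval dl f om) => //; first exact: leq_trans (leq_addl _ _).
    apply: le_trans tl2; apply: le_trans m1tau; apply: ler_wpM2r; [exact: ltW|by rewrite ler_nat].
  - by move=> n nm; apply: hg; exact: leq_trans m1m.
have h2 := IH (k + m1)%N (m - m1)%N _ _ (fun w => Z m1 w) (C * (s + g0)) g0 _ g00 _ _ h1.
rewrite {1}mE.
have ZE n w i j : Z (m1 + n)%N w i j = flow f (W ^~ w) (k + m1) n (Z m1 w i j) by rewrite /Z flowD.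
have ZE' n w : Z (m1 + n)%N w = fun i j => flow f (W ^~ w) (k + m1) n (Z m1 w i j).
  by apply/funext => i; apply/funext => j; rewrite ZE.
under eq_integral do rewrite ZE'.
apply: le_trans; first apply: h2.
- by rewrite -addnA -mE.
- by rewrite leq_subLR /m1 /minn; case: ltnP => _; [exact: leq_addr|rewrite -mulSn].
- by rewrite mulr_ge0// addr_ge0.
- by move=> i j; apply: scheme_measurable => // j'; exact: (cf j').1.
- move=> n nm; have := hg (m1 + n)%N; rewrite {1}mE leq_add2l => /(_ nm).
  by under eq_integral do rewrite ZE'.
rewrite lee_fin exprSr -mulrA; apply: ler_wpM2l; first exact: exprn_ge0.
have : 1 * g0 <= C * g0 by exact: ler_wpM2r.
have : 0 <= C * s by exact: mulr_ge0.
by lra.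
Qed.

(** The rectangle with corners [x, y, y, y]: one side vanishes, so there is no forcing, and the
    mixed difference is [x - y] transported by the scheme. *)
Lemma two_point_moment q : exists2 tau : R, 0 < tau & exists2 C : R, 0 <= C &
  forall (dl : R) N (W : nat -> Omega -> V), 0 < dl -> dl <= tau -> N%:R * dl <= T -> iid_noise P (gam dl) N W ->
  forall om psi, drift_data dl om psi -> let f := fun j => vheat gam dl (psi j) in
  forall k m, (k + m <= N)%N -> forall x y,
    (\int[P]_w (`|flow f (W ^~ w) k m x - flow f (W ^~ w) k m y| ^+ q.*2.+2)%:E <= (C * `|x - y| ^+ q.*2.+2)%:E)%E.
Proof.
have [tau tau0 [C C0 hC]] := chain_moment q; exists tau => //; exists C => //.
move=> dl N W dl0 dltau NT noise om psi dd f k m kmN x y.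
pose Y (w : Omega) (i j : bool) := if i && j then x else y.
have -> : (\int[P]_w (`|flow f (W ^~ w) k m x - flow f (W ^~ w) k m y| ^+ q.*2.+2)%:E =
    \int[P]_w (`|rect id (fun i j => flow f (W ^~ w) k m (Y w i j))| ^+ q.*2.+2)%:E)%E.
  by apply: eq_integral => w _; rewrite /rect /Y /= subrK.
rewrite -[X in (_ <= (_ * X)%:E)%E]addr0.
apply: (hC dl N W dl0 dltau NT noise om psi dd k m kmN Y) => //.
- move=> n _; under eq_integral do rewrite /side_product /Y /= subrr normr0 mul0r expr0n /=.
  by rewrite integral_prob_cst.
- under eq_integral do rewrite /rect /Y /= subrK.
  by rewrite integral_prob_cst.
Qed.

Lemma exp2_double (p : nat) : 2 ^+ p.*2 = 4 ^+ p :> R.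
Proof. by rewrite -muln2 mulnC exprM -natrX. Qed.

(** After scaling by [h] and [l], the product is split by [x y <= x^2 + y^2], which is why moments
    of the double order enter. Since [l <= 1], the linear part of the modulus is also bounded by
    [l^b]. *)
Lemma side_moment_bound (p : nat) (H L h l : R) : 0 <= H -> 0 <= L -> 0 < h -> 0 < l -> l <= 1 ->
  (H * (L `^ b + L)) ^+ p <=
    (h * l `^ b) ^+ p * (4 ^+ p + ((h^-1 ^+ p.*2) * H ^+ p.*2 + 4 ^+ p * (2 / l) ^+ p.*2 * L ^+ p.*2)).
Proof.
move=> H0 L0 h0 l0 l1.
pose A := H / h; pose B := L / l.
have A0 : 0 <= A by apply: divr_ge0 => //; exact: ltW.
have B0 : 0 <= B by apply: divr_ge0 => //; exact: ltW.
have HE : H = h * A by rewrite /A mulrC divfK// gt_eqF.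
have LE : L = l * B by rewrite /B mulrC divfK// gt_eqF.
have lb : l <= l `^ b.
  by rewrite -{1}(powRr1 (ltW l0)); apply: ger_powR; [rewrite l0 l1|exact: ltW].
have Bb : B `^ b <= 1 + B.
  case: (leP B 1) => B1.
    apply: (@le_trans _ _ 1); last by rewrite lerDl.
    have <- : 1 `^ b = 1 :> R by rewrite powR1.
    by apply: ge0_ler_powR_base => //; exact: ltW.
  apply: (@le_trans _ _ B); last by rewrite lerDr.
  by rewrite -[leRHS](powRr1 B0); apply: ler_powR; exact: ltW.
have lb0 : 0 <= l `^ b by exact: powR_ge0.
have LL : L `^ b + L <= l `^ b * (1 + 2 * B).
  rewrite {1}LE (powRM _ (ltW l0) B0) LE.
  have : l `^ b * B `^ b <= l `^ b * (1 + B) by exact: ler_wpM2l.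
  have : l * B <= l `^ b * B by exact: ler_wpM2r.
  by lra.
have LL0 : 0 <= L `^ b + L by rewrite addr_ge0// powR_ge0.
apply: (@le_trans _ _ ((h * l `^ b) ^+ p * (A ^+ p * (1 + 2 * B) ^+ p))).
  rewrite -!exprMn; apply: lerXn2r; rewrite ?nnegrE.
  - exact: mulr_ge0.
  - apply: mulr_ge0; first by apply: mulr_ge0 => //; exact: ltW.
    by apply: mulr_ge0 => //; apply: addr_ge0 => //; exact: mulr_ge0.
  rewrite HE mulrACA; rewrite -mulrA -[leRHS]mulrA; apply: ler_wpM2l; first exact: ltW.
  exact: ler_wpM2l.
apply: ler_wpM2l; first by apply: exprn_ge0; apply: mulr_ge0 => //; exact: ltW.
have sq (x y : R) : x * y <= x ^+ 2 + y ^+ 2 by have := sqr_ge0 (x - y); have := sqr_ge0 x; have := sqr_ge0 y; nra.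
apply: le_trans (sq _ _) _.
have e1 (x : R) : (x ^+ p) ^+ 2 = x ^+ p.*2 by rewrite -exprM muln2.
rewrite !e1.
have e2 : A ^+ p.*2 = h^-1 ^+ p.*2 * H ^+ p.*2 by rewrite /A exprMn mulrC.
have e3 : (2 * B) ^+ p.*2 = (2 / l) ^+ p.*2 * L ^+ p.*2 by rewrite /B mulrCA mulrC exprMn.
have e4 : 2 ^+ p.*2 = 4 ^+ p :> R by exact: exp2_double.
have B2 : 0 <= 2 * B by exact: mulr_ge0.
have := expr_addr_le p.*2 ler01 B2; rewrite expr1n e3 e4 e2.
by lra.
Qed.

Lemma four_point_moment q : exists2 tau : R, 0 < tau & exists2 C : R, 0 <= C &
  forall (dl : R) N (W : nat -> Omega -> V), 0 < dl -> dl <= tau -> N%:R * dl <= T -> iid_noise P (gam dl) N W ->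
  forall om psi, drift_data dl om psi -> let f := fun j => vheat gam dl (psi j) in
  forall k m, (k + m <= N)%N -> forall x h l, 0 < `|h| -> 0 < `|l| -> `|l| <= 1 ->
    (\int[P]_w (`|rect id (fun i j => flow f (W ^~ w) k m
         (if i then (if j then x + h + l else x + h) else (if j then x + l else x)))%R| ^+ q.*2.+2)%:E <=
      (C * (`|h| * `|l| `^ b) ^+ q.*2.+2)%:E)%E.
Proof.
have [tau1 tau10 [C C0 hC]] := chain_moment q.
(* The exponent [2 (2 q + 1) + 2] equals [2 p] for [p = 2 q + 2]. *)
have [tau2 tau20 [C2 C20 hC2]] := two_point_moment (q.*2.+1).
pose p := q.*2.+2.
pose K : R := 4 ^+ p + (C2 + 4 ^+ p * (4 ^+ p * C2)).
have K0 : 0 <= K by apply: addr_ge0; [|apply: addr_ge0 => //; apply: mulr_ge0; [|apply: mulr_ge0 => //]]; exact: exprn_ge0.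
exists (Num.min tau1 tau2); first by rewrite lt_min tau10.
exists (C * K); first exact: mulr_ge0.
move=> dl N W dl0 dltau NT noise om psi dd f k m kmN x h l h0 l0 l1.
have /andP[dltau1 dltau2] : (dl <= tau1) && (dl <= tau2) by rewrite -le_min.
pose Y (w : Omega) (i j : bool) := if i then (if j then x + h + l else x + h) else (if j then x + l else x).
pose g0 := (`|h| * `|l| `^ b) ^+ p * K.
have g00 : 0 <= g0 by rewrite /g0 mulr_ge0// exprn_ge0// mulr_ge0// powR_ge0.
have cf j : vcb (f j) by apply: vheat_vcb => //; case: dd => _ /(_ j) [].
rewrite (_ : C * K * _ = C * (0 + g0)); last by rewrite add0r /g0; ring.
apply: (hC dl N W dl0 dltau1 NT noise om psi dd k m kmN Y) => //; last first.
- under eq_integral => w _.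
    rewrite /rect /Y /= (_ : _ + x = 0); last by apply/rowP => i; rewrite !mxE; ring.
    rewrite normr0 expr0n /=; over.
  by rewrite integral_prob_cst.
move=> n nm; pose Z z w := flow f (W ^~ w) k n z.
have knN : (k + n <= N)%N by apply: leq_trans kmN; rewrite leq_add2l.
have mZ z : measurable_fun [set: Omega] (fun w => Z z w : Vm).
  apply: (@past_mfun _ _ _ _ P (gam dl) N W noise (k + n)).
  apply: (@scheme_measurable R d disp Omega W f k n (fun=> z)); [by move=> j; exact: (cf j).1|exact: measurable_cst].
have mN z z' : measurable_fun [set: Omega] (fun w => `|Z z w - Z z' w|).
  by apply: (measurableT_comp (@measurable_normV R d)); exact: measurable_subV.
have mD z z' : measurable_fun [set: Omega] (fun w => (`|Z z w - Z z' w| ^+ p.*2)%:E).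
  by apply/measurable_EFinP; apply: measurable_norm_powV; exact: measurable_subV.
have eH := hC2 dl N W dl0 dltau2 NT noise om psi dd k n knN (x + h) x.
have eL := hC2 dl N W dl0 dltau2 NT noise om psi dd k n knN (x + l) x.
rewrite addrAC subrr add0r in eH; rewrite addrAC subrr add0r in eL.
pose c1 := `|h|^-1 ^+ p.*2; pose c2 := 4 ^+ p * (2 / `|l|) ^+ p.*2.
have c10 : 0 <= c1 by apply: exprn_ge0; rewrite invr_ge0.
have c20 : 0 <= c2 by apply: mulr_ge0; apply: exprn_ge0 => //; exact: divr_ge0.
pose c0 := (`|h| * `|l| `^ b) ^+ p.
have c00 : 0 <= c0 by rewrite exprn_ge0// mulr_ge0// powR_ge0.
have n1 (z z' : V) (w : Omega) : [set: Omega] w -> (0 <= (`|Z z w - Z z' w| ^+ p.*2)%:E :> \bar R)%E by rewrite lee_fin exprn_ge0.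
pose I w := ((4 ^+ p)%:E + (c1%:E * (`|Z (x + h)%R w - Z x w| ^+ p.*2)%:E + c2%:E * (`|Z (x + l)%R w - Z x w| ^+ p.*2)%:E))%E.
have mI1 : measurable_fun [set: Omega] (fun w => c1%:E * (`|Z (x + h)%R w - Z x w| ^+ p.*2)%:E)%E by exact: measurable_funeM.
have mI2 : measurable_fun [set: Omega] (fun w => c2%:E * (`|Z (x + l)%R w - Z x w| ^+ p.*2)%:E)%E by exact: measurable_funeM.
have mI12 : measurable_fun [set: Omega] (fun w => c1%:E * (`|Z (x + h)%R w - Z x w| ^+ p.*2)%:E + c2%:E * (`|Z (x + l)%R w - Z x w| ^+ p.*2)%:E)%E by exact: emeasurable_funD.
have mI : measurable_fun [set: Omega] I by exact: emeasurable_funD.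
have p1 (w : Omega) : [set: Omega] w -> (0 <= c1%:E * (`|Z (x + h)%R w - Z x w| ^+ p.*2)%:E :> \bar R)%E by move=> _; apply: mule_ge0; [rewrite lee_fin|exact: n1].
have p2 (w : Omega) : [set: Omega] w -> (0 <= c2%:E * (`|Z (x + l)%R w - Z x w| ^+ p.*2)%:E :> \bar R)%E by move=> _; apply: mule_ge0; [rewrite lee_fin|exact: n1].
have p12 (w : Omega) : [set: Omega] w -> (0 <= c1%:E * (`|Z (x + h)%R w - Z x w| ^+ p.*2)%:E + c2%:E * (`|Z (x + l)%R w - Z x w| ^+ p.*2)%:E :> \bar R)%E by move=> W0; apply: adde_ge0; [exact: p1|exact: p2].
have q4 : (0 <= (4 ^+ p)%:E :> \bar R)%E by rewrite lee_fin exprn_ge0.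
have pI (w : Omega) : [set: Omega] w -> (0 <= I w)%E by move=> W0; apply: adde_ge0 => //; exact: p12.
apply: (@le_trans _ _ (\int[P]_w (c0%:E * I w))%E).
  apply: ge0_le_integral => //.
  - by move=> w _; rewrite lee_fin exprn_ge0//; exact: side_product_ge0.
  - apply/measurable_EFinP; apply: measurable_funX; apply: measurable_funM.
      exact: (mN (x + h) x).
    have mL := mN (x + l) x.
    by apply: measurable_funD => //; exact: (measurableT_comp (measurable_powR b) mL).
  - exact: measurable_funeM.
  - move=> w _; apply: (@le_trans _ _ (c0 * (4 ^+ p + (c1 * `|Z (x + h) w - Z x w| ^+ p.*2 + c2 * `|Z (x + l) w - Z x w| ^+ p.*2)))%:E).
      by rewrite lee_fin; exact: (side_moment_bound p (normr_ge0 _) (normr_ge0 _) h0 l0 l1).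
    exact: lexx.
rewrite (ge0_integralZl_EFin _ _ pI mI c00)//.
rewrite /I ge0_integralD//.
rewrite integral_prob_cst ge0_integralD//.
rewrite (ge0_integralZl_EFin _ _ (n1 _ _) _ c10)// (ge0_integralZl_EFin _ _ (n1 _ _) _ c20)//.
apply: (@le_trans _ _ (c0%:E * ((4 ^+ p)%:E + (c1%:E * (C2 * `|h| ^+ p.*2)%:E + c2%:E * (C2 * `|l| ^+ p.*2)%:E)))%E).
  apply: lee_wpmul2l; first by rewrite lee_fin.
  apply: leeD => //; apply: leeD; apply: lee_wpmul2l; rewrite ?lee_fin//.
apply: (@le_trans _ _ (c0 * (4 ^+ p + (c1 * (C2 * `|h| ^+ p.*2) + c2 * (C2 * `|l| ^+ p.*2))))%:E); first exact: lexx.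
rewrite lee_fin /g0 -/c0; apply: ler_wpM2l => //.
rewrite /K /c1 /c2 -/p.
have u1 : `|h|^-1 ^+ p.*2 * (C2 * `|h| ^+ p.*2) = C2.
  by rewrite mulrCA -exprMn mulVf ?gt_eqF// expr1n mulr1.
have u2 : (2 / `|l|) ^+ p.*2 * (C2 * `|l| ^+ p.*2) = 4 ^+ p * C2.
  rewrite mulrCA -exprMn divfK ?gt_eqF// mulrC; congr (_ * _).
  exact: exp2_double.
by rewrite u1 -(mulrA (4 ^+ p)) u2.
Qed.

End chain.

(** * Lattice bounds for the scheme *)

Section borel_cantelli_union.
Context {R : realType} {disp : measure_display} {Omega : measurableType disp}.
Variable P : probability Omega R.

Lemma finite_union_bound (I : finType) (B : I -> set Omega) (c : R) : 0 <= c ->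
  (forall i, measurable (B i)) -> (forall i, P (B i) <= c%:E)%E ->
  measurable (\big[setU/set0]_i B i) /\ (P (\big[setU/set0]_i B i) <= (#|I|%:R * c)%:E)%E.
Proof.
move=> c0 mB hB; rewrite cardE.
have -> : index_enum I = enum I by rewrite enumT.
elim: (enum I) => [|i s [ms IH]]; first by rewrite big_nil measure0 mul0r.
rewrite big_cons; split; first exact: measurableU.
apply: (le_trans (measureU2 _ (mB i) ms)); rewrite [size _]/= -natr1 mulrDl mul1r EFinD addeC.
by apply: leeD; [exact: hB|exact: IH].
Qed.

(** There are [2^(D m)] events of probability [2^-((D + 1) m)] at level [m]; the spare power leaves
    a geometric series. *)
Lemma union_borel_cantelli (I : nat -> finType) (B : forall m, I m -> set Omega) (c : R) (D m1 : nat) : 0 <= c ->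
  (forall m i, measurable (B m i)) -> (forall m, (m1 <= m)%N -> (#|I m| <= 2 ^ (D * m))%N) ->
  (forall m i, (m1 <= m)%N -> (P (B m i) <= (c * (2^-1 ^+ m) ^+ D.+1)%:E)%E) ->
  {ae P, forall w, exists M, forall m i, (M <= m)%N -> ~ B m i w}.
Proof.
move=> c0 mB cB hB.
pose F m := if (m1 <= m)%N then \big[setU/set0]_i B m i else set0.
have mF m : measurable (F m).
  by rewrite /F; case: ifPn => // _; case: (finite_union_bound ler01 (mB m) (fun i => probability_le1 P (mB m i))).
have hF m : (P (F m) <= (c * 2^-1 ^+ m)%:E)%E.
  rewrite /F; case: ifPn => m1m; last by rewrite measure0 lee_fin mulr_ge0// exprn_ge0.
  have c1 : 0 <= c * (2^-1 ^+ m) ^+ D.+1 by rewrite mulr_ge0// !exprn_ge0.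
  have [_ h] := finite_union_bound c1 (mB m) (fun i => hB m i m1m).
  apply: (le_trans h); rewrite lee_fin mulrCA; apply: ler_wpM2l => //.
  rewrite exprS mulrCA; apply: ler_piMr; first exact: exprn_ge0.
  rewrite -exprM exprVn ler_pdivrMr ?exprn_gt0// mul1r.
  by rewrite -natrX ler_nat mulnC; exact: cB.
exists (lim_sup_set F); split.
- by apply: bigcap_measurable => // n _; exact: bigcup_measurable.
- apply: lim_sup_set_cvg0 => //.
  apply: (@le_lt_trans _ _ (\sum_(n <oo) (c * 2^-1 ^+ n)%:E)%E).
    by apply: lee_nneseries => [//|n _]; exact: hF.
  have h := @cvg_geometric_series R c 2^-1 _.
  rewrite (_ : (\sum_(n <oo) (c * 2^-1 ^+ n)%:E)%E = (c * (1 - 2^-1)^-1)%:E) ?ltry//.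
  apply/cvg_lim => //.
  rewrite (_ : (fun n => _) = EFin \o series (geometric c 2^-1)); last first.
    by apply/funext => n; rewrite /series /= sumEFin.
  apply: cvg_EFin; first by near=> n.
  by apply: h; rewrite ger0_norm// invf_lt1// ltr1n.
- move=> w /= hw n _; apply: contrapT => hn; apply: hw; exists (maxn n m1) => m i.
  rewrite geq_max => /andP[nm m1m] Bw; apply: hn; exists m => //; rewrite /F m1m.
  by rewrite (bigD1 i)//=; left.
Unshelve. all: by end_near.
Qed.

Lemma markov_norm (d p : nat) (D : Omega -> 'rV[R]_d) (s a : R) : 0 < a ->
  measurable_fun setT (D : Omega -> @borelV R d) ->
  (\int[P]_w (`|D w| ^+ p)%:E <= s%:E)%E ->
  measurable [set w : Omega | (a < `|D w|)%R] /\ (P [set w : Omega | (a < `|D w|)%R] <= (s / a ^+ p)%:E)%E.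
Proof.
move=> a0 mD hs; have mN : measurable_fun setT (fun w => `|D w|).
  by apply: (measurableT_comp (@measurable_normV R d)).
set A := [set w : Omega | (a < `|D w|)%R].
have mA : measurable A.
  have -> : A = (fun w => `|D w|) @^-1` `]a, +oo[ by apply/seteqP; split => w /=; rewrite in_itv/= andbT.
  by rewrite -[X in measurable X]setTI; exact: mN.
split => //; have ap : 0 < a ^+ p by exact: exprn_gt0.
have mp : measurable_fun setT (fun w => (`|D w| ^+ p)%:E) by apply/measurable_EFinP; exact: measurable_norm_powV.
have h : ((a ^+ p)%:E * P A <= s%:E)%E.
  rewrite -integral_cst//; apply: le_trans hs.
  apply: (@le_trans _ _ (\int[P]_(w in A) (`|D w| ^+ p)%:E)%E).
    apply: ge0_le_integral => //.
    - by move=> w _; rewrite lee_fin ltW.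
    - exact: measurable_funTS.
    - by move=> w Aw; rewrite lee_fin; apply: lerXn2r; rewrite ?nnegrE//; exact: ltW.
  by apply: ge0_subset_integral => // w _; rewrite lee_fin exprn_ge0.
by rewrite EFinM lee_pdivlMr// muleC.
Qed.

End borel_cantelli_union.

(** * Dyadic lattices and the events to be controlled *)

Section lattice.
Context {R : realType} {d : nat}.
Local Notation V := 'rV[R]_d.

Definition lat (m : nat) (z : 'I_d -> int) : V := \row_i ((z i)%:~R * 2^-1 ^+ m).
Definition unit_step (m : nat) (i : 'I_d) : V := 2^-1 ^+ m *: delta_mx ord0 i.

Lemma norm_unit_step m i : `|unit_step m i| = 2^-1 ^+ m :> R.
Proof.
have h0 : 0 <= 2^-1 ^+ m :> R by exact: exprn_ge0.
apply/eqP; rewrite eq_le; apply/andP; split.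
  apply: norm_le_coord => // j; rewrite !mxE eqxx /=; case: eqP => _; rewrite ?mulr1 ?mulr0 ?normr0//.
  by rewrite ger0_norm.
by apply: le_trans (coord_le_norm _ i); rewrite !mxE !eqxx mulr1 ger0_norm.
Qed.

(** In the mixed difference one step has the coarse length [2^-m'] and the other the lattice length
    [2^-m]. Divided by the coarse length, it controls the variation of a difference quotient on a
    finer scale. *)
Definition lattice_bounds (X : V -> V) (m : nat) (r1 r2 : R) (z : 'I_d -> int) : Prop := forall i j m',
  `|X (lat m z + unit_step m i) - X (lat m z)| <= r1 ^+ m /\
  ((m' <= m)%N -> `|rect id (fun u v => X (if u then (if v then lat m z + unit_step m' i + unit_step m j
       else lat m z + unit_step m' i) else (if v then lat m z + unit_step m j else lat m z)))|
     <= 2^-1 ^+ m' * r2 ^+ m).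

(** One index per event of level [m]: the grid level, first and last grid step, a lattice point in
    the cube of radius [m], two directions and the coarse level. The radius grows with [m], so that
    every bounded set is covered eventually. *)
Definition lattice_index (Lam m : nat) : finType :=
  ('I_(Lam * m).+1 * 'I_(2 ^ (Lam * m)).+1 * 'I_(2 ^ (Lam * m)).+1 *
   {ffun 'I_d -> 'I_(2 * (m * 2 ^ m)).+1} * 'I_d * 'I_d * 'I_m.+1)%type.

Definition lattice_exponent (Lam : nat) : nat := (Lam + 2 * Lam.+1 + 3 * d + d + d + 1)%N.

Lemma card_lattice_index Lam m : (1 <= m)%N -> (#|lattice_index Lam m| <= 2 ^ (lattice_exponent Lam * m))%N.
Proof.
move=> m1; rewrite /lattice_index !card_prod !card_ord card_ffun !card_ord /lattice_exponent.
have e1 n : (n.+1 <= 2 ^ n)%N by exact: ltn_expl.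
have two : (2 <= 2 ^ m)%N by exact: leq_trans (e1 m).
have e2 : ((2 ^ (Lam * m)).+1 <= 2 ^ (Lam.+1 * m))%N.
  rewrite mulSn expnD; apply: (@leq_trans (2 * 2 ^ (Lam * m))); first by rewrite mul2n -addnn -addn1 leq_add2l expn_gt0.
  exact: leq_mul.
have e3 : ((2 * (m * 2 ^ m)).+1 <= 2 ^ (3 * m))%N.
  apply: (@leq_trans (2 * (m.+1 * 2 ^ m))).
    by rewrite mulSn mulnDr -addn1 addnC leq_add2r muln_gt0 expn_gt0.
  have -> : (3 * m = m + (m + m))%N by rewrite mulSn mul2n -addnn.
  by rewrite !expnD; apply: leq_mul => //; exact: leq_mul.
have e4 : (d <= 2 ^ (d * m))%N.
  apply: (@leq_trans (2 ^ d)); first exact: ltnW (ltn_expl d (ltnSn 1)).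
  by rewrite leq_exp2l// leq_pmulr.
have pe x y e : (x <= y)%N -> (x ^ e <= y ^ e)%N by move=> xy; case: e => // e; rewrite leq_exp2r.
have -> : (2 ^ ((Lam + 2 * Lam.+1 + 3 * d + d + d + 1) * m) = 2 ^ (Lam * m) * (2 ^ (Lam.+1 * m) * 2 ^ (Lam.+1 * m)) *
    (2 ^ (3 * m)) ^ d * 2 ^ (d * m) * 2 ^ (d * m) * 2 ^ m)%N.
  by rewrite -expnM -!expnD; congr (2 ^ _)%N; lia.
apply: leq_mul; last exact: e1.
do 2![apply: leq_mul => //].
apply: leq_mul; last exact: pe.
by rewrite -mulnA; apply: leq_mul; [exact: e1|exact: leq_mul].
Qed.

End lattice.

Section lattice_event.
Context {R : realType} {d : nat} {disp : measure_display} {Omega : measurableType disp}.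
Local Notation V := 'rV[R]_d.
Local Notation Vm := (@borelV R d).
Variable P : probability Omega R.
Variable gam : R -> probability Vm R.
Hypothesis hgam : forall t : R, 0 < t -> gaussian_law (gam t) t.
Hypothesis conv : forall (s t : R) (f : Vm -> \bar R), 0 < s -> 0 < t ->
  measurable_fun setT f -> (forall w, 0 <= f w)%E ->
  (\int[gam (s + t)]_w f w = \int[gam s]_w \int[gam t]_w' f ((w : V) + (w' : V))%R)%E.
Variables (T a b rho Cw : R).
Hypotheses (T0 : 0 < T) (a0 : 0 < a) (a1 : a < 1) (b0 : 0 < b) (ba : b < a)
  (Cw0 : 0 <= Cw) (sgrho : 1 - (a - b) / 2 < rho).
Variables (W : nat -> nat -> Omega -> V) (om : nat -> nat -> R) (psi : nat -> nat -> V -> V).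
Hypothesis noise : forall n, iid_noise P (gam (T / 2 ^+ n)) (2 ^ n) (W n).
Hypothesis drift : forall n, drift_data a rho Cw (T / 2 ^+ n) (om n) (psi n).

Definition grid_flow (n : nat) (w : Omega) (k l : nat) (x : V) : V :=
  flow (fun j => vheat gam (T / 2 ^+ n) (psi n j)) (W n ^~ w) k (l - k) x.

Lemma powR_exprn (x c : R) m : 0 <= x -> (x ^+ m) `^ c = (x `^ c) ^+ m.
Proof. by move=> x0; rewrite -(powR_mulrn m x0) -(powR_mulrn m (powR_ge0 x c)) -!powRrM mulrC. Qed.

Lemma half_ratio (e1 e2 : R) (p D m : nat) : D.+1%:R <= p%:R * (e1 - e2) ->
  ((2^-1 `^ e1) ^+ m) ^+ p / ((2^-1 `^ e2) ^+ m) ^+ p <= (2^-1 ^+ m) ^+ D.+1 :> R.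
Proof.
move=> h; have h2 : 0 < 2^-1 :> R by rewrite invr_gt0.
have h20 : 0 <= 2^-1 :> R by exact: ltW.
rewrite -expr_div_n -expr_div_n -gt0_powRB// -!exprM !(mulnC m) !exprM.
apply: lerXn2r; rewrite ?nnegrE; [by apply: exprn_ge0; exact: powR_ge0|exact: exprn_ge0|].
rewrite -(powR_mulrn _ (powR_ge0 _ _)) -powRrM -(powR_mulrn _ h20); apply: ger_powR; last by rewrite mulrC.
by rewrite h2 invf_le1// ler1n.
Qed.

Lemma measurable_grid_flow n k l x : measurable_fun setT (fun w => grid_flow n w k l x : Vm).
Proof.
apply: (@past_mfun _ _ _ _ P _ _ (W n) (noise n) (k + (l - k))).
apply: (@scheme_measurable R d disp Omega (W n) _ k (l - k) (fun=> x)); last exact: measurable_cst.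
move=> j; have [_ /(_ j) [cp _ _] _] := drift n.
by case: (@vheat_vcb R d gam hgam (T / 2 ^+ n) (psi n j)) => //; rewrite divr_gt0// exprn_gt0.
Qed.

(** By Markov's inequality an event of level [m] has probability of order [2^-(m p kap)], where
    [kap] is the loss in the exponents; in the mixed difference the coarse length cancels. High
    moments make this smaller than the number of events permits. *)
Lemma lattice_event (Lam : nat) (g be : R) : g < 1 -> be < b -> exists n1,
  {ae P, forall w, exists M, forall m, (M <= m)%N -> forall n k l, (n1 <= n)%N -> (n <= Lam * m)%N ->
    (k <= l)%N -> (l <= 2 ^ n)%N -> forall z : 'I_d -> int, (forall i, `|z i| <= (m * 2 ^ m)%:Z) ->
    lattice_bounds (grid_flow n w k l) m (2^-1 `^ g) (2^-1 `^ be) z}.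
Proof.
move=> g1 beb.
pose D := @lattice_exponent d Lam.
pose kap := Num.min (1 - g) (b - be).
have kap0 : 0 < kap by rewrite lt_min !subr_gt0 g1.
(* Ensures [p * kap >= D + 1], the requirement of the union bound. *)
pose q := Num.truncn (D.+1%:R / kap).
pose p := q.*2.+2.
have pk : D.+1%:R <= p%:R * kap.
  have Dk : 0 <= D.+1%:R / kap by apply: divr_ge0 => //; exact: ltW.
  have /andP[_ h] := truncn_itv Dk.
  rewrite -ler_pdivrMr//; apply: ltW; apply: lt_le_trans h _.
  rewrite ler_nat -/q /p ltnS; apply: leq_trans (leqnSn _).
  by rewrite -addnn leq_addr.
have pk1 : D.+1%:R <= p%:R * (1 - g) by apply: le_trans pk _; apply: ler_wpM2l => //; rewrite /kap ge_min lexx.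
have pk2 : D.+1%:R <= p%:R * (b - be) by apply: le_trans pk _; apply: ler_wpM2l => //; rewrite /kap ge_min lexx orbT.
have [tau1 tau10 [C1 C10 hC1]] := two_point_moment P hgam conv T0 a0 a1 b0 ba Cw0 sgrho q.
have [tau2 tau20 [C2 C20 hC2]] := four_point_moment P hgam conv T0 a0 a1 b0 ba Cw0 sgrho q.
pose tau := Num.min tau1 tau2; have tau0 : 0 < tau by rewrite lt_min tau10.
pose n1 := Num.truncn (T / tau).
have dl0 n : 0 < T / 2 ^+ n by rewrite divr_gt0// exprn_gt0.
have dlT n : (2 ^ n)%N%:R * (T / 2 ^+ n) <= T by rewrite natrX mulrC divfK// expf_neq0.
have dltau n : (n1 <= n)%N -> T / 2 ^+ n <= tau.
  move=> nn; have Tt : 0 <= T / tau by rewrite divr_ge0// ltW.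
  have /andP[_ h] := truncn_itv Tt.
  rewrite ler_pdivrMr ?exprn_gt0// mulrC -ler_pdivrMr//; apply: le_trans (ltW h) _.
  by rewrite -natrX ler_nat; apply: leq_trans (ltn_expl n (ltnSn 1)).
exists n1.
(* The index stores coordinates as naturals; subtracting [m * 2 ^ m] recovers the signed lattice
   point. *)
pose zz m (x : {ffun 'I_d -> 'I_(2 * (m * 2 ^ m)).+1}) : 'I_d -> int := fun i => (x i : nat)%:Z - (m * 2 ^ m)%:Z.
pose D1 n k l m z i w := grid_flow n w k l (lat m z + unit_step m i) - grid_flow n w k l (lat m z).
pose D2 n k l m z i j m' w := rect id (fun u v => grid_flow n w k l
   (if u then (if v then lat m z + unit_step m' i + unit_step m j
         else lat m z + unit_step m' i) else (if v then lat m z + unit_step m j else lat m z))).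
pose B m (t : @lattice_index d Lam m) : set Omega :=
  let: (n, k, l, x, i, j, m') := t in
  if [&& (n1 <= n)%N, (k <= l)%N & (l <= 2 ^ n)%N] then
    [set w : Omega | ((2^-1 `^ g) ^+ m < `|D1 n k l m (zz m x) i w|)%R] `|`
    [set w : Omega | (2^-1 ^+ m' * (2^-1 `^ be) ^+ m < `|D2 n k l m (zz m x) i j m' w|)%R]
  else set0.
have hpow : 0 < 2^-1 :> R by rewrite invr_gt0.
have mD1 n k l m z i : measurable_fun setT (D1 n k l m z i : Omega -> Vm).
  by apply: measurable_subV; exact: measurable_grid_flow.
have mD2 n k l m z i j m' : measurable_fun setT (D2 n k l m z i j m' : Omega -> Vm).
  apply: measurable_rect; first exact: continuous_idV.
  by move=> u v; exact: measurable_grid_flow.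
have B1 n k l m z i : (n1 <= n)%N -> (k <= l)%N -> (l <= 2 ^ n)%N ->
  (P [set w : Omega | ((2^-1 `^ g) ^+ m < `|D1 n k l m z i w|)%R] <= (C1 * (2^-1 ^+ m) ^+ D.+1)%:E)%E.
  move=> nn kl lN; have tt := dltau n nn.
  have tt1 : T / 2 ^+ n <= tau1 by apply: le_trans tt _; rewrite ge_min lexx.
  have kln : (k + (l - k) <= 2 ^ n)%N by rewrite subnKC.
  have h := hC1 _ _ _ (dl0 n) tt1 (dlT n) (noise n) _ _ (drift n) k (l - k)%N kln (lat m z + unit_step m i) (lat m z).
  have a0' : 0 < (2^-1 `^ g) ^+ m :> R by rewrite exprn_gt0// powR_gt0.
  have [_ h2] := markov_norm a0' (mD1 n k l m z i) h.
  apply: (le_trans h2); rewrite lee_fin -mulrA; apply: ler_wpM2l => //.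
  rewrite addrAC subrr add0r norm_unit_step; have := half_ratio m pk1; by rewrite powRr1// ltW.
have B2 n k l m z i j m' : (n1 <= n)%N -> (k <= l)%N -> (l <= 2 ^ n)%N ->
  (P [set w : Omega | (2^-1 ^+ m' * (2^-1 `^ be) ^+ m < `|D2 n k l m z i j m' w|)%R] <= (C2 * (2^-1 ^+ m) ^+ D.+1)%:E)%E.
  move=> nn kl lN; have tt := dltau n nn.
  have tt2 : T / 2 ^+ n <= tau2 by apply: le_trans tt _; rewrite ge_min lexx orbT.
  have kln : (k + (l - k) <= 2 ^ n)%N by rewrite subnKC.
  have u1 : 0 < `|unit_step (R := R) m' i| by rewrite norm_unit_step exprn_gt0.
  have u2 : 0 < `|unit_step (R := R) m j| by rewrite norm_unit_step exprn_gt0.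
  have u3 : `|unit_step (R := R) m j| <= 1 by rewrite norm_unit_step exprn_ile1// ?ltW// invf_lt1// ltr1n.
  have h := hC2 _ _ _ (dl0 n) tt2 (dlT n) (noise n) _ _ (drift n) k (l - k)%N kln (lat m z) _ _ u1 u2 u3.
  have a0' : 0 < 2^-1 ^+ m' * (2^-1 `^ be) ^+ m :> R by rewrite mulr_gt0// exprn_gt0// powR_gt0.
  have [_ h2] := markov_norm a0' (mD2 n k l m z i j m') h.
  apply: (le_trans h2); rewrite lee_fin -mulrA; apply: ler_wpM2l => //.
  rewrite !norm_unit_step (powR_exprn _ _ (ltW hpow)) !exprMn invfM mulrACA divff ?mul1r ?expf_neq0 ?gt_eqF//.
  exact: half_ratio.
have ms (f : Omega -> V) (c : R) : measurable_fun setT (f : Omega -> Vm) -> measurable [set w : Omega | (c < `|f w|)%R].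
  move=> mf; have -> : [set w : Omega | (c < `|f w|)%R] = (fun w => `|f w|) @^-1` `]c, +oo[.
    by apply/seteqP; split => w /=; rewrite in_itv/= andbT.
  rewrite -[X in measurable X]setTI; apply: (measurableT_comp (@measurable_normV R d) mf) => //.
have mB m t : measurable (B m t).
  case: t => [[[[[[n k] l] x] i] j] m'] /=; rewrite /B; case: ifPn => // _.
  by apply: measurableU; apply: ms.
have hB m t : (1 <= m)%N -> (P (B m t) <= ((C1 + C2) * (2^-1 ^+ m) ^+ D.+1)%:E)%E.
  move=> _; have := mB m t.
  case: t => [[[[[[n k] l] x] i] j] m'] /=; rewrite /B; case: ifPn => [/and3P[nn kl lN] _|_ _]; last first.
    by rewrite measure0 lee_fin mulr_ge0 ?addr_ge0// !exprn_ge0.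
  rewrite mulrDl EFinD; apply: le_trans (leeD (B1 n k l m (zz m x) i nn kl lN) (B2 n k l m (zz m x) i j m' nn kl lN)).
  by apply: measureU2; apply: ms.
have C120 : 0 <= C1 + C2 by exact: addr_ge0.
have := union_borel_cantelli C120 mB (@card_lattice_index d Lam) hB.
apply: filterS => w [M hM]; exists M => m Mm n k l nn nL kl lN z hz i j m'.
have xP i' : (absz (z i' + (m * 2 ^ m)%:Z)%R < (2 * (m * 2 ^ m)).+1)%N.
  by have := hz i'; rewrite ltnS; move: (m * 2 ^ m)%N (z i') => K zi; clear; lia.
pose x : {ffun 'I_d -> 'I_(2 * (m * 2 ^ m)).+1} := [ffun i' => Ordinal (xP i')].
have zE : zz m x = z.
  by apply/funext => i'; rewrite /zz /x ffunE /=; have := hz i'; move: (m * 2 ^ m)%N (z i') => K zi; clear; lia.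
have lL : (l < (2 ^ (Lam * m)).+1)%N by rewrite ltnS; apply: leq_trans lN _; rewrite leq_exp2l.
have kL : (k < (2 ^ (Lam * m)).+1)%N by exact: leq_ltn_trans lL.
have nL' : (n < (Lam * m).+1)%N by [].
have H mm (hm : (mm < m.+1)%N) : ~ ([set w : Omega | ((2^-1 `^ g) ^+ m < `|D1 n k l m z i w|)%R] `|`
    [set w : Omega | (2^-1 ^+ mm * (2^-1 `^ be) ^+ m < `|D2 n k l m z i j mm w|)%R]) w.
  have := hM m (Ordinal nL', Ordinal kL, Ordinal lL, x, i, j, Ordinal hm) Mm.
  by rewrite /B /= nn kl lN /= zE.
split.
  rewrite leNgt; apply/negP => h; apply: (H 0%N) => //; by left.
move=> mm; rewrite leNgt; apply/negP => h; apply: (H m') => //; by right.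
Qed.

End lattice_event.

(** * Pathwise convergence of the scheme *)

Section chaining.
Context {R : realType} {d e : nat}.
Local Notation V := 'rV[R]_d.
Local Notation U := 'rV[R]_e.

Definition flr (m : nat) (x : V) : 'I_d -> int := fun i => Num.floor (x ord0 i * 2 ^+ m).

Lemma half_pow_gt0 (m : nat) : 0 < 2^-1 ^+ m :> R.
Proof. by rewrite exprn_gt0// invr_gt0. Qed.

Lemma half_powM (m : nat) : 2^-1 ^+ m * 2 ^+ m = 1 :> R.
Proof. by rewrite -exprMn mulVf// expr1n. Qed.

Lemma lat_flr_close m (x : V) : `|lat m (flr m x) - x| <= 2^-1 ^+ m.
Proof.
have h0 := half_pow_gt0 m; apply: norm_le_coord; first exact: ltW.
move=> i; rewrite !mxE /flr; have /andP[h1 h2] := floor_itv (x ord0 i * 2 ^+ m).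
rewrite intrD in h2.
have xE : x ord0 i = x ord0 i * 2 ^+ m * 2^-1 ^+ m by rewrite -mulrA (mulrC (2 ^+ m)) half_powM mulr1.
rewrite [X in _ - X]xE -mulrBl normrM (ger0_norm (ltW h0)) -[leRHS]mul1r.
apply: ler_wpM2r; first exact: ltW.
by rewrite ler_norml; apply/andP; split; move: h1 h2; clear; lra.
Qed.

Lemma lat_flr_double m (x : V) : lat m.+1 (fun i => 2 * flr m x i) = lat m (flr m x) :> V.
Proof.
apply/rowP => i; rewrite !mxE exprS intrM mulrACA mulfV ?mul1r//.
Qed.

Lemma flr_step m (x : V) i : `|2 * flr m x i - flr m.+1 x i| <= 1.
Proof.
rewrite /flr; have /andP[h1 h2] := floor_itv (x ord0 i * 2 ^+ m).
have /andP[h3 h4] := floor_itv (x ord0 i * 2 ^+ m.+1).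
move: h1 h2 h3 h4; rewrite exprS (mulrCA _ 2); set y := x ord0 i * 2 ^+ m.
move: (Num.floor y) (Num.floor (2 * y)) => a b; rewrite !intrD => h1 h2 h3 h4.
have H1 : (b%:~R < (2 * a + 2)%:~R :> R) by rewrite intrD intrM; lra.
have H2 : ((2 * a)%:~R < (b + 1)%:~R :> R) by rewrite intrD intrM; lra.
by rewrite !ltr_int in H1 H2; lia.
Qed.

Lemma flr_close m (x y : V) i : `|x - y| <= 2^-1 ^+ m -> `|flr m x i - flr m y i| <= 1.
Proof.
move=> xy; rewrite /flr; have /andP[h1 h2] := floor_itv (x ord0 i * 2 ^+ m).
have /andP[h3 h4] := floor_itv (y ord0 i * 2 ^+ m).
have h : `|x ord0 i * 2 ^+ m - y ord0 i * 2 ^+ m| <= 1.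
  rewrite -mulrBl normrM (ger0_norm (exprn_ge0 _ _))// -[leRHS](half_powM m); apply: ler_wpM2r; first exact: exprn_ge0.
  by apply: le_trans xy; apply: le_trans (coord_le_norm _ i); rewrite rowB.
move: h1 h2 h3 h4 h; move: (x ord0 i * _) (y ord0 i * _) => u v.
rewrite ler_norml => h1 h2 h3 h4 /andP[h5 h6].
move: h1 h2 h3 h4; move: (Num.floor u) (Num.floor v) => a b; rewrite !intrD => h1 h2 h3 h4.
have H1 : (a%:~R < (b + 2)%:~R :> R) by rewrite intrD; lra.
have H2 : (b%:~R < (a + 2)%:~R :> R) by rewrite intrD; lra.
by rewrite !ltr_int in H1 H2; lia.
Qed.

Variables (r : R).
Hypotheses (r0 : 0 < r) (r1 : r < 1).

Section one_function.
Variables (F : V -> U) (A Q : R) (M : nat).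
Hypothesis A0 : 0 <= A.
Hypothesis hF : forall m, (M <= m)%N -> forall z : 'I_d -> int, `|lat m z : V| <= Q ->
  forall i, `|F (lat m z + unit_step m i) - F (lat m z)| <= A * r ^+ m.

(** One coordinate is changed at a time. The hybrid points take each coordinate from [z] or [z'], so
    in the sup norm they do not leave the ball of radius [Q]. *)
Lemma lat_neighbour m (z z' : 'I_d -> int) : (M <= m)%N -> (forall i, `|z i - z' i| <= 1) ->
  `|lat m z : V| <= Q -> `|lat m z' : V| <= Q -> `|F (lat m z) - F (lat m z')| <= d%:R * (A * r ^+ m).
Proof.
move=> Mm zz' zQ zQ'.
pose hyb j : 'I_d -> int := fun i => if (i < j)%N then z' i else z i.
have hybQ j : `|lat m (hyb j) : V| <= Q.
  apply: norm_le_coord; first exact: le_trans zQ.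
  move=> i; rewrite mxE /hyb; case: ifP => _.
    by apply: le_trans zQ'; apply: le_trans (coord_le_norm _ i); rewrite mxE.
  by apply: le_trans zQ; apply: le_trans (coord_le_norm _ i); rewrite mxE.
have Ar : 0 <= A * r ^+ m by rewrite mulr_ge0// exprn_ge0// ltW.
have H j : (j <= d)%N -> `|F (lat m z) - F (lat m (hyb j))| <= j%:R * (A * r ^+ m).
  elim: j => [|j IH] jd.
    by rewrite (_ : hyb 0%N = z) ?subrr ?normr0 ?mul0r//; apply/funext => i; rewrite /hyb ltn0.
  pose i0 := Ordinal jd.
  have E i : i != i0 -> hyb j.+1 i = hyb j i.
    move=> ii; rewrite /hyb ltnS leq_eqVlt; case: eqP => //= ij.
    by move: ii; rewrite -val_eqE /= ij eqxx.
  have Ez : hyb j i0 = z i0 by rewrite /hyb /= ltnn.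
  have Ez' : hyb j.+1 i0 = z' i0 by rewrite /hyb /= ltnSn.
  rewrite -natr1 mulrDl mul1r -(subrKA (F (lat m (hyb j)))).
  apply: le_trans (ler_normD _ _) _; apply: lerD; first exact: IH (ltnW jd).
  have : z i0 = z' i0 \/ (z' i0 = z i0 + 1 \/ z i0 = z' i0 + 1) by have := zz' i0; clear; lia.
  move=> [zE|[zE|zE]].
  - rewrite (_ : hyb j.+1 = hyb j) ?subrr ?normr0//; apply/funext => i.
    by case: (eqVneq i i0) => [->|/E//]; rewrite Ez Ez'.
  - have -> : lat m (hyb j.+1) = lat m (hyb j) + unit_step m i0 :> V.
      apply/rowP => i; rewrite !mxE eqxx /=; case: (eqVneq i i0) => [->|/E ->]; last by rewrite mulr0 addr0.
      by rewrite Ez Ez' zE intrD mulrDl mulr1 mul1r.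
    by rewrite distrC; exact: hF.
  - have -> : lat m (hyb j) = lat m (hyb j.+1) + unit_step m i0 :> V.
      apply/rowP => i; rewrite !mxE eqxx /=; case: (eqVneq i i0) => [->|/E ->]; last by rewrite mulr0 addr0.
      by rewrite Ez Ez' zE intrD mulrDl mulr1 mul1r.
    exact: hF.
have := H d (leqnn d); rewrite (_ : hyb d = z')//.
by apply/funext => i; rewrite /hyb ltn_ord.
Qed.

Lemma lat_flr_norm m x : `|x| <= Q - 1 -> `|lat m (flr m x) : V| <= Q.
Proof.
move=> xQ; have := lat_flr_close m x.
have m1 : 2^-1 ^+ m <= 1 :> R by rewrite exprn_ile1// invf_le1// ler1n.
have := ler_normD (lat m (flr m x) - x) x; rewrite subrK.
by lra.
Qed.

(** Kolmogorov's chaining: consecutive dyadic roundings of [x] are neighbours on the finer lattice,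
    and their differences form a geometric series. Rounding moves a point by at most 1, hence
    [Q - 1]. *)
Lemma chain_to_point m x : continuous F -> (M <= m)%N -> `|x| <= Q - 1 ->
  `|F (lat m (flr m x)) - F x| <= d%:R * A * (1 - r)^-1 * r ^+ m.
Proof.
move=> cF Mm xQ; have rr : 0 < 1 - r by rewrite subr_gt0.
have B0 : 0 <= d%:R * A by rewrite mulr_ge0.
have step k : `|F (lat m (flr m x)) - F (lat (m + k) (flr (m + k) x))| <=
    d%:R * A * r ^+ m * (1 - r ^+ k) / (1 - r).
  elim: k => [|k IH]; first by rewrite addn0 expr0 !subrr normr0 mulr0 mul0r.
  rewrite -(subrKA (F (lat (m + k) (flr (m + k) x)))); apply: le_trans (ler_normD _ _) _.
  have h : `|F (lat (m + k) (flr (m + k) x)) - F (lat (m + k.+1) (flr (m + k.+1) x))| <= d%:R * (A * r ^+ (m + k.+1)).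
    rewrite addnS -lat_flr_double; apply: lat_neighbour.
    - exact: leq_trans (leq_trans Mm (leq_addr _ _)) (leqnSn _).
    - by move=> i; exact: flr_step.
    - by rewrite lat_flr_double; exact: lat_flr_norm.
    - exact: lat_flr_norm.
  apply: le_trans (lerD IH h) _.
  have Ek : d%:R * A * r ^+ m * (1 - r ^+ k.+1) / (1 - r) = d%:R * A * r ^+ m * (1 - r ^+ k) / (1 - r) + d%:R * A * r ^+ (m + k).
    by rewrite exprS exprD; field; rewrite gt_eqF.
  rewrite Ek; apply: lerD => //; rewrite mulrA; apply: ler_wpM2l => //.
  by rewrite addnS exprS; apply: ler_piMl; [apply: exprn_ge0|]; exact: ltW.
apply/ler_addgt0Pr => eps eps0.
have /(@cvgrPdist_lt R U V (nbhs x) _ F (F x)) /(_ _ eps0) := cF x.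
rewrite -nbhs_ballE => -[del /= del0 hdel].
have [k hk] : exists k, 2^-1 ^+ k < del :> R.
  exists (Num.truncn del^-1).+1; have di : 0 <= del^-1 by rewrite invr_ge0 ltW.
  have /andP[_ h] := truncn_itv di.
  rewrite exprVn -[ltRHS]invrK ltf_pV2 ?posrE ?exprn_gt0 ?invr_gt0//.
  by apply: lt_trans h _; rewrite -natrX ltr_nat ltn_expl.
have hb : ball x del (lat (m + k) (flr (m + k) x)).
  rewrite -ball_normE /ball_ /= distrC; apply: le_lt_trans (lat_flr_close _ _) _; apply: le_lt_trans hk.
  by rewrite exprD; apply: ler_piMl; [apply/ltW/half_pow_gt0|rewrite exprn_ile1// invf_le1// ler1n].
have h3 := hdel _ hb; rewrite -(subrKA (F (lat (m + k) (flr (m + k) x)))).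
apply: le_trans (ler_normD _ _) _; apply: lerD; last by rewrite distrC ltW.
apply: le_trans (step k) _; rewrite -[leRHS]mulrAC -[leLHS]mulrAC; rewrite -!mulrA.
apply: ler_wpM2l => //; apply: ler_wpM2l => //.
apply: ler_wpM2l; first by apply: exprn_ge0; exact: ltW.
apply: ler_piMr; first by rewrite invr_ge0 ltW.
by rewrite lerBlDr lerDl exprn_ge0// ltW.
Qed.

Lemma chaining m x y : continuous F -> (M <= m)%N -> `|x| <= Q - 1 -> `|y| <= Q - 1 -> `|x - y| <= 2^-1 ^+ m ->
  `|F x - F y| <= (d%:R * (1 + 2 * (1 - r)^-1)) * A * r ^+ m.
Proof.
move=> cF Mm xQ yQ xy.
have h1 := chain_to_point cF Mm xQ; have h2 := chain_to_point cF Mm yQ.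
have h3 : `|F (lat m (flr m x)) - F (lat m (flr m y))| <= d%:R * (A * r ^+ m).
  by apply: lat_neighbour => //; [move=> i; exact: flr_close|exact: lat_flr_norm|exact: lat_flr_norm].
rewrite (_ : F x - F y = - (F (lat m (flr m x)) - F x) + (F (lat m (flr m x)) - F (lat m (flr m y))) + (F (lat m (flr m y)) - F y)); last first.
  by apply/rowP => i; rewrite !mxE; ring.
apply: le_trans (ler_normD _ _) _; apply: le_trans (lerD (ler_normD _ _) (lexx _)) _; rewrite normrN.
apply: le_trans (lerD (lerD h1 h3) h2) _.
by rewrite le_eqVlt; apply/orP; left; apply/eqP; ring.
Qed.

End one_function.
End chaining.

Section dyadic.
Context {R : realType}.

Lemma half_pow_le1 (n : nat) : 2^-1 ^+ n <= 1 :> R.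
Proof. by rewrite exprn_ile1// invf_le1// ler1n. Qed.

Lemma half_pow_lt (del : R) : 0 < del -> exists k, 2^-1 ^+ k < del.
Proof.
move=> del0; exists (Num.truncn del^-1).+1; have di : 0 <= del^-1 by rewrite invr_ge0 ltW.
have /andP[_ h] := truncn_itv di.
rewrite exprVn -[ltRHS]invrK ltf_pV2 ?posrE ?exprn_gt0 ?invr_gt0//.
by apply: lt_trans h _; rewrite -natrX ltr_nat ltn_expl.
Qed.

Lemma dyadic_scale (del : R) m0 : 0 < del -> del <= 2^-1 ^+ m0 ->
  exists m, [/\ (m0 <= m)%N, 2^-1 ^+ m.+1 < del & del <= 2^-1 ^+ m].
Proof.
move=> del0 delm0; have h := half_pow_lt del0.
case: (ex_minnP h) => -[|j] hj jmin.
  by move: hj; rewrite expr0 ltNge (le_trans delm0 (half_pow_le1 _)).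
exists j; have jd : del <= 2^-1 ^+ j by rewrite leNgt; apply/negP => /jmin; rewrite ltnn.
split => //; have : 2^-1 ^+ j.+1 < 2^-1 ^+ m0 :> R by exact: lt_le_trans delm0.
by rewrite ltr_iXn2l ?ltnS// ?invr_gt0// invf_lt1// ltr1n.
Qed.

Lemma half_powR_small (c kap : R) : 0 < kap -> exists n0, forall n, (n0 <= n)%N -> c * (2^-1 ^+ n) `^ kap <= 1.
Proof.
move=> k0; have h2 : 0 < 2^-1 :> R by rewrite invr_gt0.
have q1 : `|2^-1 `^ kap| < 1 :> R.
  rewrite ger0_norm ?powR_ge0// -[ltRHS](powRr0 2^-1).
  by rewrite /powR !gt_eqF// ltr_expR mul0r pmulr_rlt0// ln_lt0// h2 invf_lt1// ltr1n.
have c0 : 0 < (`|c| + 1)^-1 by rewrite invr_gt0 ltr_wpDl.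
have /cvgrPdist_lt /(_ _ c0) [n0 _ H] := cvg_expr q1.
exists n0 => n nn; have := H n nn; rewrite /= sub0r normrN (powR_exprn _ _ (ltW h2)) => h.
apply: le_trans (ler_norm _) _; rewrite normrM.
apply: (@le_trans _ _ ((`|c| + 1) * (`|c| + 1)^-1)); last by rewrite mulfV// gt_eqF// ltr_wpDl.
by apply: ler_pM => //; [rewrite lerDl|exact: ltW].
Qed.

(** The scheme of level [n] is controlled at distances up to [2^-(M + n / Lam)], because of
    [n <= Lam m]. If [1 / Lam < kap], an error of order [2^-(n kap)] eventually falls into that
    range. *)
Lemma half_powR_scale (c kap : R) (M Lam : nat) : 0 <= c -> (0 < Lam)%N -> Lam%:R^-1 < kap ->
  exists n0, forall n, (n0 <= n)%N -> c * (2^-1 ^+ n) `^ kap <= 2^-1 ^+ (M + n %/ Lam).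
Proof.
move=> c0 L0 Lk; have h2 : 0 < 2^-1 :> R by rewrite invr_gt0.
have k0 : 0 < kap - Lam%:R^-1 by rewrite subr_gt0.
have [n0 hn0] := half_powR_small (c * 2 ^+ M) k0; exists n0 => n nn.
have en : 0 < 2^-1 ^+ n :> R by exact: half_pow_gt0.
have -> : (2^-1 ^+ n) `^ kap = (2^-1 ^+ n) `^ (kap - Lam%:R^-1) * (2^-1 ^+ n) `^ Lam%:R^-1 :> R.
  by rewrite -gt0_powRD// subrK.
have h1 : (2^-1 ^+ n) `^ Lam%:R^-1 <= 2^-1 ^+ (n %/ Lam) :> R.
  rewrite -(powR_mulrn n (ltW h2)) -powRrM -(powR_mulrn (n %/ Lam) (ltW h2)).
  apply: ger_powR; first by rewrite h2 invf_le1// ler1n.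
  by rewrite ler_pdivlMr ?ltr0n// -natrM ler_nat leq_trunc_div.
rewrite exprD mulrA; apply: ler_pM => //; rewrite ?mulr_ge0 ?powR_ge0//.
by have := hn0 n nn; rewrite mulrAC -ler_pdivlMr ?exprn_gt0// mul1r -exprVn.
Qed.

Lemma powR_le_base (T x p q : R) : 0 <= x -> x <= T -> 0 < p -> p <= q -> x `^ q <= T `^ (q - p) * x `^ p.
Proof.
move=> x0 xT p0 pq; case: (eqVneq x 0) => [->|x00].
  rewrite !powR0 ?mulr0// ?gt_eqF//; exact: lt_le_trans pq.
have xp : 0 < x by rewrite lt_neqAle eq_sym x00.
have -> : x `^ q = x `^ (q - p) * x `^ p by rewrite -gt0_powRD// subrK.
apply: ler_wpM2r; first exact: powR_ge0.
by apply: ge0_ler_powR_base => //; rewrite subr_ge0.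
Qed.

End dyadic.

(** * The scheme along one fixed path *)

Section path_flow.
Context {R : realType} {d : nat}.
Local Notation V := 'rV[R]_d.
Variables (T al rho h Cw CW Kf : R).
Hypotheses (T0 : 0 < T) (al0 : 0 < al) (al1 : al <= 1) (h0 : 0 < h) (h12 : h <= 2^-1) (hrho : h <= rho)
  (Cw0 : 0 <= Cw) (CW0 : 0 <= CW) (Kf0 : 0 <= Kf).
Let theta := rho + al * h.
Hypothesis theta1 : 1 < theta.

Definition mesh (n : nat) : R := T / 2 ^+ n.
Definition tick (n j : nat) : R := j%:R * mesh n.

(** All that the pathwise part takes from the sample point and the drift. The power [al / 2] in
    [step_close] comes from mollifying an [al]-Hoelder function at a heat time equal to the mesh. *)
Record path_data (W : R -> V) (wt : R -> R) (psi : R -> R -> V -> V) (f : nat -> nat -> V -> V) : Prop := PathData {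
  weight_mono : forall s t, s <= t -> wt s <= wt t;
  weight_rho : forall s t, s <= t -> wt t - wt s <= Cw * (t - s) `^ rho;
  drift_bound : forall s t z, s <= t -> `|psi s t z| <= wt t - wt s;
  drift_holder : forall s t z z', s <= t -> `|psi s t z - psi s t z'| <= (wt t - wt s) * `|z - z'| `^ al;
  drift_add : forall s u t z, s <= u -> u <= t -> psi s t z = psi s u z + psi u t z;
  path_holder : forall s t, 0 <= s -> s <= t -> t <= T -> `|W t - W s| <= CW * (t - s) `^ h;
  step_bound : forall n j z, `|f n j z| <= wt (tick n j.+1) - wt (tick n j);
  step_close : forall n j z, `|f n j z - psi (tick n j) (tick n j.+1) z| <=
     Kf * (wt (tick n j.+1) - wt (tick n j)) * mesh n `^ (al / 2);
  step_cont : forall n j, continuous (f n j) }.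

Lemma mesh_gt0 n : 0 < mesh n. Proof. by rewrite divr_gt0// exprn_gt0. Qed.

Lemma meshE n : mesh n = T * 2^-1 ^+ n. Proof. by rewrite /mesh exprVn. Qed.

Lemma tickS n j : tick n j.+1 = tick n j + mesh n.
Proof. by rewrite /tick -natr1 mulrDl mul1r. Qed.

Lemma tickD n j m : tick n (j + m) = tick n j + m%:R * mesh n.
Proof. by rewrite /tick natrD mulrDl. Qed.

Lemma tick_le n j m : (j <= m)%N -> tick n j <= tick n m.
Proof. by move=> jm; apply: ler_wpM2r; [exact/ltW/mesh_gt0|rewrite ler_nat]. Qed.

Lemma tick_ge0 n j : 0 <= tick n j.
Proof. by rewrite /tick mulr_ge0// ltW// mesh_gt0. Qed.

Lemma tick_end n : tick n (2 ^ n) = T.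
Proof. by rewrite /tick /mesh natrX mulrC divfK// expf_neq0. Qed.

Lemma tick_leT n j : (j <= 2 ^ n)%N -> tick n j <= T.
Proof. by move=> jn; rewrite -(tick_end n); exact: tick_le. Qed.

Lemma tick_double n j : tick n.+1 (2 * j) = tick n j.
Proof.
rewrite /tick /mesh exprS natrM; field; exact: expf_neq0.
Qed.

Variables (W : R -> V) (wt : R -> R) (psi : R -> R -> V -> V) (f : nat -> nat -> V -> V).
Hypothesis data : path_data W wt psi f.

Definition path_flow (n k m : nat) (x : V) : V :=
  flow (f n) (fun j => W (tick n j.+1) - W (tick n j)) k m x.

Lemma path_flowD n k m1 m2 x : path_flow n k (m1 + m2) x = path_flow n (k + m1) m2 (path_flow n k m1 x).
Proof. exact: flowD. Qed.

Lemma path_flow_continuous n k m : continuous (path_flow n k m).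
Proof.
elim: m => [|m IH]; first exact: continuous_idV.
have c1 : continuous (fun x : V => path_flow n k m x + (W (tick n (k + m).+1) - W (tick n (k + m)))).
  by move=> x; apply: (@continuous_comp _ _ _ (path_flow n k m) (fun z : V => z + _)); [exact: IH|exact: continuous_addr].
have cG := continuous_idD (step_cont data (n := n) (j := (k + m)%N)).
by move=> x; exact: (continuous_comp (c1 x) (cG _)).
Qed.

Lemma flow_drift n k m x :
  `|path_flow n k m x - x - (W (tick n (k + m)) - W (tick n k))| <= wt (tick n (k + m)) - wt (tick n k).
Proof.
elim: m => [|m IH]; first by rewrite addn0 !subrr normr0.
rewrite /path_flow /= -/(path_flow n k m x) addnS.
set y := path_flow n k m x in IH *; set z := y + _.
rewrite (_ : z + _ - x - _ = (y - x - (W (tick n (k + m)) - W (tick n k))) + f n (k + m)%N z); last first.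
  by rewrite /z; apply/rowP => i; rewrite !mxE; ring.
apply: le_trans (ler_normD _ _) _.
by have := step_bound data n (k + m) z; move: IH; lra.
Qed.

Let CA := CW + Cw * T `^ (rho - h).
Let CA0 : 0 <= CA. Proof. by rewrite addr_ge0// mulr_ge0// powR_ge0. Qed.

Lemma weight_h s t : 0 <= s -> s <= t -> t <= T -> wt t - wt s <= Cw * T `^ (rho - h) * (t - s) `^ h.
Proof.
move=> s0 st tT; apply: le_trans (weight_rho data st) _; rewrite -mulrA; apply: ler_wpM2l => //.
by apply: powR_le_base => //; [rewrite subr_ge0|lra].
Qed.

Lemma flow_mid n k m i x : (k + m <= 2 ^ n)%N -> (i < m)%N ->
  `|path_flow n k i x + (W (tick n (k + i).+1) - W (tick n (k + i))) - x| <= CA * (m%:R * mesh n) `^ h.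
Proof.
move=> kmn im.
have tk0 := tick_ge0 n k; have mg := mesh_gt0 n.
have e1 : tick n (k + i).+1 - tick n k <= m%:R * mesh n.
  by rewrite -addnS tickD addrAC subrr add0r; apply: ler_wpM2r; [exact: ltW|rewrite ler_nat].
have e2 : tick n k <= tick n (k + i).+1 by apply: tick_le; rewrite -addnS leq_addr.
have e3 : tick n (k + i).+1 <= T by apply: tick_leT; apply: leq_trans kmn; rewrite -addnS leq_add2l.
have e4 : tick n k <= tick n (k + i) by apply: tick_le; rewrite leq_addr.
have e5 : tick n (k + i) <= tick n (k + i).+1 by exact: tick_le.
rewrite (_ : _ - x = (path_flow n k i x - x - (W (tick n (k + i)) - W (tick n k))) + (W (tick n (k + i).+1) - W (tick n k))); last first.
  by apply/rowP => j; rewrite !mxE; ring.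
apply: le_trans (ler_normD _ _) _; rewrite /CA mulrDl addrC.
have pw : (tick n (k + i).+1 - tick n k) `^ h <= (m%:R * mesh n) `^ h.
  by apply: ge0_ler_powR_base; rewrite ?subr_ge0//; exact: ltW.
apply: lerD.
  by apply: le_trans (path_holder data tk0 e2 e3) _; exact: ler_wpM2l.
apply: le_trans (flow_drift n k i x) _.
apply: (@le_trans _ _ (wt (tick n (k + i).+1) - wt (tick n k))); first by rewrite lerD2r; exact: weight_mono data _ _ e5.
apply: le_trans (weight_h tk0 e2 e3) _; apply: ler_wpM2l => //.
by rewrite mulr_ge0// powR_ge0.
Qed.

Lemma flow_close n k m x : (k + m <= 2 ^ n)%N -> `|path_flow n k m x - x| <= CA * (m%:R * mesh n) `^ h.
Proof.
move=> kmn.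
have tk0 := tick_ge0 n k; have mg := mesh_gt0 n.
have e2 : tick n k <= tick n (k + m) by apply: tick_le; rewrite leq_addr.
have e3 : tick n (k + m) <= T by apply: tick_leT.
have e1 : m%:R * mesh n = tick n (k + m) - tick n k by rewrite tickD addrAC subrr add0r.
rewrite (_ : _ - x = (path_flow n k m x - x - (W (tick n (k + m)) - W (tick n k))) + (W (tick n (k + m)) - W (tick n k))); last first.
  by apply/rowP => j; rewrite !mxE; ring.
apply: le_trans (ler_normD _ _) _; rewrite /CA mulrDl addrC e1.
apply: lerD; first exact: (path_holder data tk0 e2 e3).
by apply: le_trans (flow_drift n k m x) _; exact: weight_h.
Qed.

Lemma drift_refl s z : psi s s z = 0.
Proof. by apply/normr0_eq0/eqP; rewrite eq_le normr_ge0 andbT; have := drift_bound data z (lexx s); rewrite subrr. Qed.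

(** Replacing the successive evaluation points by [x] costs the displacement to the power [al] times
    the weight, which has order [theta = rho + al * h]. The mollification error fits because
    [h <= 1/2] and the mesh is at most the time elapsed. *)
Lemma flow_expansion : exists2 CB, 0 <= CB & forall n k m x, (k + m <= 2 ^ n)%N ->
  `|path_flow n k m x - x - (W (tick n (k + m)) - W (tick n k)) - psi (tick n k) (tick n (k + m)) x|
    <= CB * (m%:R * mesh n) `^ theta.
Proof.
pose CD := CA `^ al + Kf * T `^ (al / 2 - al * h).
have CD0 : 0 <= CD by rewrite addr_ge0 ?mulr_ge0 ?powR_ge0.
exists (Cw * CD); first exact: mulr_ge0.
move=> n k m x kmn; have mg := mesh_gt0 n; have tk0 := tick_ge0 n k.
have md0 : 0 <= m%:R * mesh n by rewrite mulr_ge0// ltW.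
case: (posnP m) => [->|m0].
  rewrite addn0 !subrr drift_refl subr0 normr0 mulr_ge0 ?powR_ge0// mulr_ge0//.
have md : 0 < m%:R * mesh n by rewrite mulr_gt0// ltr0n.
pose D := (CA * (m%:R * mesh n) `^ h) `^ al + Kf * mesh n `^ (al / 2).
have D0 : 0 <= D by rewrite addr_ge0 ?mulr_ge0 ?powR_ge0.
have H i : (i <= m)%N -> `|path_flow n k i x - x - (W (tick n (k + i)) - W (tick n k)) - psi (tick n k) (tick n (k + i)) x|
    <= (wt (tick n (k + i)) - wt (tick n k)) * D.
  elim: i => [_|i IH im]; first by rewrite addn0 !subrr drift_refl subr0 normr0 mul0r.
  have e4 : tick n k <= tick n (k + i) by apply: tick_le; rewrite leq_addr.
  have e5 : tick n (k + i) <= tick n (k + i).+1 by exact: tick_le.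
  have wp : 0 <= wt (tick n (k + i).+1) - wt (tick n (k + i)) by rewrite subr_ge0; exact: weight_mono data _ _ e5.
  rewrite /path_flow /= -/(path_flow n k i x) addnS.
  rewrite (drift_add data x e4 e5).
  set y := path_flow n k i x in IH *; set z := y + _.
  have zx : `|z - x| <= CA * (m%:R * mesh n) `^ h by exact: flow_mid.
  rewrite (_ : z + _ - x - _ - _ = (y - x - (W (tick n (k + i)) - W (tick n k)) - psi (tick n k) (tick n (k + i)) x)
     + (f n (k + i)%N z - psi (tick n (k + i)) (tick n (k + i).+1) z)
     + (psi (tick n (k + i)) (tick n (k + i).+1) z - psi (tick n (k + i)) (tick n (k + i).+1) x)); last first.
    by rewrite /z; apply/rowP => j; rewrite !mxE; ring.
  apply: le_trans (ler_normD _ _) _; apply: le_trans (lerD (ler_normD _ _) (lexx _)) _.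
  have s1 := IH (ltnW im); have s2 := step_close data n (k + i) z.
  have s3 : `|psi (tick n (k + i)) (tick n (k + i).+1) z - psi (tick n (k + i)) (tick n (k + i).+1) x| <=
     (wt (tick n (k + i).+1) - wt (tick n (k + i))) * (CA * (m%:R * mesh n) `^ h) `^ al.
    apply: le_trans (drift_holder data _ _ e5) _; apply: ler_wpM2l => //.
    by apply: ge0_ler_powR_base => //; exact: ltW.
  apply: le_trans (lerD (lerD s1 s2) s3) _; rewrite /D; clear.
  by rewrite le_eqVlt; apply/orP; left; apply/eqP; ring.
apply: le_trans (H m (leqnn m)) _.
have e2 : tick n k <= tick n (k + m) by apply: tick_le; rewrite leq_addr.
have w1 := weight_rho data e2; rewrite tickD addrAC subrr add0r -tickD in w1.
have mT : m%:R * mesh n <= T.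
  by have := tick_leT kmn; rewrite tickD; lra.
have m1d : mesh n <= m%:R * mesh n.
  by rewrite -[leLHS]mul1r; apply: ler_wpM2r; [exact: ltW|rewrite ler1n].
have hal : 0 < al * h by exact: mulr_gt0.
have D1 : D <= CD * (m%:R * mesh n) `^ (al * h).
  rewrite /D /CD [leRHS]mulrDl; apply: lerD.
    by rewrite (powRM _ CA0 (powR_ge0 _ _)) -powRrM (mulrC h).
  rewrite -mulrA; apply: ler_wpM2l => //.
  apply: (@le_trans _ _ ((m%:R * mesh n) `^ (al / 2))).
    by apply: ge0_ler_powR_base => //; [rewrite divr_ge0// ltW|exact: ltW].
  by apply: powR_le_base => //; apply: ler_wpM2l => //; exact: ltW.
apply: (@le_trans _ _ (Cw * (m%:R * mesh n) `^ rho * (CD * (m%:R * mesh n) `^ (al * h)))).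
  by apply: ler_pM => //; rewrite subr_ge0; exact: weight_mono data _ _ e2.
rewrite /theta gt0_powRD//; clear.
by rewrite le_eqVlt; apply/orP; left; apply/eqP; ring.
Qed.

End path_flow.

(** The numbers [u n - D n] lie below all [u m + D m], so their supremum serves as the limit. *)
Lemma geometric_limit (R : realType) (u : nat -> R) (C q : R) (n0 : nat) : 0 <= C -> 0 <= q -> q < 1 ->
  (forall n, (n0 <= n)%N -> `|u n.+1 - u n| <= C * q ^+ n) ->
  exists l, forall n, (n0 <= n)%N -> `|u n - l| <= C / (1 - q) * q ^+ n.
Proof.
move=> C0 q0 q1 hu; have qq : 0 < 1 - q by rewrite subr_gt0.
pose D n := C / (1 - q) * q ^+ n.
have D0 n : 0 <= D n by rewrite mulr_ge0 ?exprn_ge0// divr_ge0// ltW.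
have DS n : D n = D n.+1 + C * q ^+ n by rewrite /D exprS; field; rewrite gt_eqF.
have up n k : (n0 <= n)%N -> u n - D n <= u (n + k)%N - D (n + k)%N /\ u (n + k)%N + D (n + k)%N <= u n + D n.
  move=> nn; elim: k => [|k [IH1 IH2]]; first by rewrite addn0.
  have := hu (n + k)%N (leq_trans nn (leq_addr _ _)).
  rewrite addnS ler_norml => /andP[h1 h2]; have := DS (n + k)%N.
  by split; move: IH1 IH2 h1 h2; lra.
have cross n m : (n0 <= n)%N -> (n0 <= m)%N -> u n - D n <= u m + D m.
  move=> nn mm; have [h1 _] := up n m nn; have [_ h2] := up m n mm; have := D0 (n + m)%N.
  by rewrite (addnC m n) in h2; lra.
pose S := [set z | exists2 n, (n0 <= n)%N & z = u n - D n].
have S0 : S !=set0 by exists (u n0 - D n0); exists n0.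
have ubS : has_ubound S by exists (u n0 + D n0) => _ [n nn ->]; exact: cross.
exists (sup S) => n nn; rewrite ler_norml -/(D n).
have h1 : u n - D n <= sup S by apply: ub_le_sup => //; exists n.
have h2 : sup S <= u n + D n by apply: ge_sup => // _ [m mm ->]; exact: cross.
by apply/andP; split; lra.
Qed.

Lemma half_powR_lt1 (R : realType) (g : R) : 0 < g -> 2^-1 `^ g < 1.
Proof.
move=> g0; have h2 : 0 < 2^-1 :> R by rewrite invr_gt0.
rewrite /powR gt_eqF// -[ltRHS]expR0 ltr_expR pmulr_rlt0//; apply: ln_lt0; apply/andP; split => //.
by rewrite invf_lt1// ltr1n.
Qed.

Lemma half_gap (R : realType) (t : R) : 1 < t -> (1 + (t - 1) / 2) / t < 1.
Proof. by move=> t1; rewrite ltr_pdivrMr ?(lt_trans _ t1)//; lra. Qed.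

Lemma three_gap (R : realType) (CH C u w v z1 z2 z3 : R) : z1 <= C * u -> z2 <= C * u -> z3 <= CH * v ->
  C * u <= C * (w * v) -> z3 + z1 + z2 <= (CH + 2 * (C * w)) * v.
Proof.
move=> h1 h2 h3 h4; have -> : (CH + 2 * (C * w)) * v = CH * v + 2 * (C * (w * v)) by ring.
by lra.
Qed.

Lemma rect_gap (R : realType) d (a g : bool -> bool -> 'rV[R]_d) : rect id g =
  rect id a - ((a true true - g true true) - (a true false - g true false) - (a false true - g false true) + (a false false - g false false)).
Proof. by rewrite /rect; apply/rowP => i; rewrite !mxE; ring. Qed.

(** * Convergence of the scheme and the limit flow along one path *)

Section limit_flow.
Context {R : realType} {d : nat}.
Local Notation V := 'rV[R]_d.
Variables (T al rho h Cw CW Kf : R).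
Hypotheses (T0 : 0 < T) (al0 : 0 < al) (al1 : al <= 1) (h0 : 0 < h) (h12 : h <= 2^-1) (hrho : h <= rho)
  (Cw0 : 0 <= Cw) (CW0 : 0 <= CW) (Kf0 : 0 <= Kf).
Let theta := rho + al * h.
Hypothesis theta1 : 1 < theta.
Variables (W : R -> V) (wt : R -> R) (psi : R -> R -> V -> V) (f : nat -> nat -> V -> V).
Hypothesis data : path_data T al rho h Cw CW Kf W wt psi f.

Definition fltick (n : nat) (t : R) : nat := Num.truncn (t / mesh T n).
(** The first grid index not before [s], obtained by reflecting [fltick] at [T]. Rounding both ends
    inwards keeps the scheme inside [[s, t]], which adaptedness needs later. *)
Definition cetick (n : nat) (s : R) : nat := (2 ^ n - fltick n (T - s))%N.

Let mesh0 n : 0 < mesh T n. Proof. exact: mesh_gt0. Qed.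

Lemma tick_lt n j m : tick T n j < tick T n m -> (j < m)%N.
Proof. by rewrite !ltnNge => h1; apply/negP => /(tick_le T0 n); rewrite leNgt h1. Qed.

Lemma fltick_itv n t : 0 <= t -> tick T n (fltick n t) <= t < tick T n (fltick n t).+1.
Proof.
move=> t0; have tm : 0 <= t / mesh T n by rewrite divr_ge0// ltW.
by have := truncn_itv tm; rewrite /tick ler_pdivlMr// ltr_pdivrMr.
Qed.

Lemma fltick_le n t : 0 <= t -> t <= T -> (fltick n t <= 2 ^ n)%N.
Proof.
move=> t0 tT; have /andP[h1 _] := fltick_itv n t0.
rewrite -ltnS; apply: (@tick_lt n); apply: le_lt_trans h1 _; apply: le_lt_trans tT _.
by rewrite tickS tick_end ltrDl.
Qed.

Lemma fltick_double n t : 0 <= t -> (2 * fltick n t <= fltick n.+1 t <= 2 * fltick n t + 1)%N.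
Proof.
move=> t0; have /andP[h1 h2] := fltick_itv n t0; have /andP[h3 h4] := fltick_itv n.+1 t0.
rewrite -(tick_double T n) in h1; rewrite -(tick_double T n) in h2.
have l1 := tick_lt (le_lt_trans h1 h4); have l2 := tick_lt (le_lt_trans h3 h2).
by apply/andP; split; move: l1 l2; clear; lia.
Qed.

Lemma cetick_le n s : (cetick n s <= 2 ^ n)%N. Proof. exact: leq_subr. Qed.

Lemma tick_cetick n s : 0 <= s -> s <= T -> tick T n (cetick n s) = T - tick T n (fltick n (T - s)).
Proof.
move=> s0 sT; rewrite /cetick /tick natrB; last by apply: fltick_le; lra.
by rewrite mulrBl -/(tick T n (2 ^ n)) tick_end.
Qed.

Lemma cetick_itv n s : 0 <= s -> s <= T -> s <= tick T n (cetick n s) < s + mesh T n.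
Proof.
move=> s0 sT; rewrite tick_cetick//; have Ts : 0 <= T - s by rewrite subr_ge0.
by have /andP[] := fltick_itv n Ts; rewrite tickS => h1 h2; apply/andP; split; lra.
Qed.

Lemma cetick_double n s : 0 <= s -> s <= T -> (2 * cetick n s - 1 <= cetick n.+1 s <= 2 * cetick n s)%N.
Proof.
move=> s0 sT; rewrite /cetick expnS; have Ts : 0 <= T - s by rewrite subr_ge0.
have := fltick_double n Ts; have := @fltick_le n _ Ts.
have TsT : T - s <= T by lra.
move=> /(_ TsT); move: (2 ^ n)%N (fltick n _) (fltick n.+1 _) => a b c; clear; lia.
Qed.

Local Notation pflow := (path_flow T W f).
(** Truncated subtraction makes this the identity when no grid step fits between [s] and [t]. *)
Definition approx (n : nat) (s t : R) (x : V) : V := pflow n (cetick n s) (fltick n t - cetick n s) x.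

(** A one-step error [2^-(n theta)] seen through a [gm]-Hoelder flow becomes [2^-(n (1 + kap))], and
    the sum of [2^n] of them is [2^-(n kap)]. *)
Let kap := (theta - 1) / 2.
Let gm := (1 + kap) / theta.
Let kap0 : 0 < kap. Proof. by rewrite divr_gt0// subr_gt0. Qed.
Let theta0 : 0 < theta. Proof. exact: lt_trans theta1. Qed.
Let gm0 : 0 < gm. Proof. by rewrite divr_gt0// addr_gt0. Qed.
Let gm1 : gm < 1. Proof. exact: half_gap. Qed.
Let gmtheta : gm * theta = 1 + kap. Proof. by rewrite /gm divfK// gt_eqF. Qed.
(** The rate [kap] belongs to the telescoped errors, the rate [h * gm] to a displacement over one
    mesh at the initial time, transported by the [gm]-Hoelder flow. *)
Definition cauchy_exponent := Num.min kap (h * gm).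
Let kc := cauchy_exponent.
Let kc0 : 0 < kc. Proof. by rewrite lt_min kap0 mulr_gt0. Qed.
Let kch : kc <= h. Proof. by rewrite ge_min; apply/orP; right; apply: ler_piMr; exact: ltW. Qed.
Let kcgm : kc <= h * gm. Proof. by rewrite ge_min lexx orbT. Qed.
Let kck : kc <= kap. Proof. by rewrite ge_min lexx. Qed.

Variables (n1 Lam M0 : nat).
Hypotheses (Lam0 : (0 < Lam)%N) (LamK : Lam%:R^-1 < kc).
Hypothesis lattice : forall m n, (M0 <= m)%N -> (n1 <= n)%N -> (n <= Lam * m)%N -> forall k l, (k + l <= 2 ^ n)%N ->
  forall z : 'I_d -> int, (forall i, `|z i| <= (m * 2 ^ m)%:Z) -> forall i,
  `|pflow n k l (lat m z + unit_step m i) - pflow n k l (lat m z)| <= (2^-1 `^ gm) ^+ m.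

Let r : R := 2^-1 `^ gm.
Let h2 : 0 < 2^-1 :> R. Proof. by rewrite invr_gt0. Qed.
Let r0 : 0 < r. Proof. exact: powR_gt0. Qed.
Let r1 : r < 1.
Proof. exact: half_powR_lt1. Qed.

Lemma lattice_range (m : nat) (K : R) (z : 'I_d -> int) : `|lat m z : V| <= K -> K <= m%:R ->
  forall i, `|z i| <= (m * 2 ^ m)%:Z.
Proof.
move=> zK Km i; have := le_trans (coord_le_norm (lat m z : V) i) (le_trans zK Km).
rewrite mxE normrM (ger0_norm (ltW (half_pow_gt0 m))) exprVn ler_pdivrMr ?exprn_gt0//.
by rewrite -natrX -natrM -intr_norm pmulrn ler_int.
Qed.

(** Chaining from the lattice bounds. [MK] depends on the radius [K] because level [m] covers only
    the cube of radius [m], and [n %/ Lam] enforces [n <= Lam * m] at all scales that are used. *)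
Lemma flow_holder : exists2 CH, 0 <= CH & forall K : R, exists MK, forall n k l x y, (n1 <= n)%N -> (k + l <= 2 ^ n)%N ->
  `|x| <= K -> `|y| <= K -> `|x - y| <= 2^-1 ^+ (MK + n %/ Lam) -> `|pflow n k l x - pflow n k l y| <= CH * `|x - y| `^ gm.
Proof.
pose C := d%:R * (1 + 2 * (1 - r)^-1).
have C0 : 0 <= C by apply: mulr_ge0 => //; apply: addr_ge0 => //; apply: mulr_ge0 => //; rewrite invr_ge0 subr_ge0; exact: ltW.
exists (C / r); first by rewrite divr_ge0// ltW.
move=> K; pose MK := (maxn M0 (Num.truncn (`|K| + 1)).+1).+1; exists MK.
move=> n k l x y nn kl xK yK xy.
have [->|xny] := eqVneq x y; first by rewrite !subrr normr0 mulr_ge0 ?powR_ge0// divr_ge0// ltW.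
have xy0 : 0 < `|x - y| by rewrite normr_gt0 subr_eq0.
have [m [mM hm1 hm2]] := dyadic_scale xy0 xy.
have K1 : 0 <= `|K| + 1 by rewrite addr_ge0.
have hF m' : (MK + n %/ Lam <= m')%N -> forall z : 'I_d -> int, `|lat m' z : V| <= K + 1 ->
   forall i, `|pflow n k l (lat m' z + unit_step m' i) - pflow n k l (lat m' z)| <= 1 * r ^+ m'.
  move=> mm z zK i; rewrite mul1r.
  have MKm : (MK <= m')%N by apply: leq_trans mm; exact: leq_addr.
  apply: lattice => //.
  - by apply: leq_trans MKm; rewrite /MK; apply: leq_trans (leq_maxl _ _) (leqnSn _).
  - have : (n %/ Lam < m')%N by apply: leq_trans mm; rewrite -[X in (X < _)%N]add0n ltn_add2r.
    by rewrite ltn_divLR// mulnC => /ltnW.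
  - apply: lattice_range zK _; apply: (@le_trans _ _ (`|K| + 1)); first by rewrite lerD2r ler_norm.
    have /andP[_ /ltW hh] := truncn_itv K1; apply: le_trans hh _; rewrite ler_nat.
    by apply: leq_trans MKm; rewrite /MK; apply: leq_trans (leq_maxr _ _) (leqnSn _).
have := chaining r0 r1 ler01 hF (path_flow_continuous data (n := n) (k := k) (m := l)) mM.
rewrite addrK => /(_ x y xK yK hm2) h3; apply: le_trans h3 _; rewrite mulr1 -/C -[leRHS]mulrA; apply: ler_wpM2l => //.
rewrite ler_pdivlMl// -exprS -(powR_exprn _ _ (ltW h2)).
by apply: ge0_ler_powR_base; [exact: ltW|apply/ltW/half_pow_gt0|exact: ltW].
Qed.

Lemma flow_norm n k m x : (k + m <= 2 ^ n)%N ->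
  `|pflow n k m x| <= `|x| + (CW + Cw * T `^ (rho - h)) * T `^ h.
Proof.
move=> kmn; rewrite -lerBlDl; apply: le_trans (lerB_dist _ _) _.
apply: le_trans (flow_close T0 h0 hrho Cw0 data x kmn) _.
apply: ler_wpM2l; first by rewrite addr_ge0// mulr_ge0// powR_ge0.
apply: ge0_ler_powR_base; [exact: ltW|by rewrite mulr_ge0// ltW|].
by have := tick_leT T0 kmn; rewrite tickD; have := tick_ge0 T0 n k; lra.
Qed.

(** Telescoping: [A j] follows the given orbit up to step [j] and the scheme afterwards.
    Neighbouring terms differ by one local error transported by the almost Lipschitz scheme. *)
Lemma compare (K E : R) : 0 <= E -> exists2 C, 0 <= C & exists n0, forall n, (n0 <= n)%N -> forall k m, (k + m <= 2 ^ n)%N ->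
  forall Y : nat -> V, (forall j, (j <= m)%N -> `|Y j| <= K) ->
  (forall j, (j < m)%N -> `|Y j.+1 - pflow n (k + j) 1 (Y j)| <= E * (2^-1 ^+ n) `^ theta) ->
  `|Y m - pflow n k m (Y 0%N)| <= C * (2^-1 ^+ n) `^ kap.
Proof.
move=> E0; have [CH CH0 hH] := flow_holder; have [MK hMK] := hH (K + E).
have Lt : Lam%:R^-1 < theta.
  by apply: lt_trans LamK _; apply: le_lt_trans kck _; rewrite /kap; move: theta1; lra.
have [n0 hn0] := half_powR_scale MK E0 Lam0 Lt.
exists (CH * E `^ gm); first by rewrite mulr_ge0// powR_ge0.
exists (maxn n0 n1) => n; rewrite geq_max => /andP[nn0 nn1] k m kmn Y YK hY.
have en := @half_pow_gt0 R n; have en1 := @half_pow_le1 R n.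
have c0 : 0 <= CH * E `^ gm * (2^-1 ^+ n) `^ (1 + kap) by rewrite !mulr_ge0// powR_ge0.
pose A j := pflow n (k + j) (m - j) (Y j).
have step j : (j < m)%N -> `|A j.+1 - A j| <= CH * E `^ gm * (2^-1 ^+ n) `^ (1 + kap).
  move=> jm; have -> : A j = pflow n (k + j).+1 (m - j.+1) (pflow n (k + j) 1 (Y j)).
    have E1 : (1 + (m - j.+1) = m - j)%N by rewrite add1n subnSK.
    by rewrite /A -E1 path_flowD (addn1 (k + j)).
  rewrite /A addnS.
  have hj := hY j jm; have Yj := YK j.+1 jm.
  have eE : E * (2^-1 ^+ n) `^ theta <= E.
    apply: ler_piMr => //; rewrite -[leRHS](powRr0 (2^-1 ^+ n)); apply: ger_powR; last exact: ltW.
    by rewrite en en1.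
  apply: le_trans (hMK n _ _ _ _ nn1 _ _ _ _) _.
  - by rewrite addSnnS subnSK// -addnA subnKC// ltnW.
  - by apply: le_trans Yj _; rewrite lerDl.
  - have := ler_normB (Y j.+1) (Y j.+1 - pflow n (k + j) 1 (Y j)); rewrite opprB addrC subrK.
    by move: hj eE Yj; lra.
  - exact: le_trans hj (hn0 n nn0).
  rewrite -mulrA; apply: ler_wpM2l => //.
  apply: (@le_trans _ _ ((E * (2^-1 ^+ n) `^ theta) `^ gm)); first by apply: ge0_ler_powR_base => //; exact: ltW.
  by rewrite (powRM _ E0 (powR_ge0 _ _)) -powRrM mulrC (mulrC theta) gmtheta mulrC.
have H j : (j <= m)%N -> `|A j - A 0%N| <= j%:R * (CH * E `^ gm * (2^-1 ^+ n) `^ (1 + kap)).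
  elim: j => [_|j IH jm]; first by rewrite subrr normr0 mul0r.
  rewrite -natr1 mulrDl mul1r -(subrKA (A j)) addrC; apply: le_trans (ler_normD _ _) _.
  by apply: lerD; [exact: IH (ltnW jm)|exact: step].
have := H m (leqnn m); rewrite /A subnn addn0 subn0 => h3.
apply: le_trans h3 _; rewrite mulrCA; apply: ler_wpM2l; first by rewrite mulr_ge0// powR_ge0.
rewrite gt0_powRD// (powRr1 (ltW en)) mulrA; apply: ler_piMl; first exact: powR_ge0.
rewrite exprVn ler_pdivrMr ?exprn_gt0// mul1r -natrX ler_nat.
by apply: leq_trans kmn; rewrite leq_addl.
Qed.

Let CA := CW + Cw * T `^ (rho - h).
Let CA0 : 0 <= CA. Proof. by rewrite addr_ge0// mulr_ge0// powR_ge0. Qed.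
Let e0 n : 0 < (2^-1 : R) ^+ n. Proof. exact: half_pow_gt0. Qed.

Lemma half_powR_le (p q : R) n : p <= q -> (2^-1 ^+ n) `^ q <= (2^-1 ^+ n) `^ p :> R.
Proof. by move=> pq; apply: ger_powR => //; rewrite half_pow_gt0 half_pow_le1. Qed.

Lemma mesh_powR n p : mesh T n `^ p = T `^ p * (2^-1 ^+ n) `^ p.
Proof. by rewrite meshE powRM// ltW. Qed.

Lemma flow_small n n' j m y : (j + m <= 2 ^ n')%N -> m%:R * mesh T n' <= mesh T n ->
  `|pflow n' j m y - y| <= CA * T `^ h * (2^-1 ^+ n) `^ h.
Proof.
move=> jm mm; apply: le_trans (flow_close T0 h0 hrho Cw0 data y jm) _.
rewrite -mulrA -mesh_powR; apply: ler_wpM2l => //.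
by apply: ge0_ler_powR_base => //; [exact: ltW|rewrite mulr_ge0// ltW].
Qed.

(** Read at coarse grid times, the finer scheme is an approximate orbit of the coarser one, since
    both have the same expansion over one coarse step. The rounded ends of the two levels differ by
    at most one fine step each. *)
Lemma approx_step K : exists2 C, 0 <= C & exists n0, forall n, (n0 <= n)%N -> forall (s t : R) (x : V), 0 <= s -> s <= t -> t <= T ->
  `|x| <= K -> `|approx n.+1 s t x - approx n s t x| <= C * (2^-1 ^+ n) `^ kc.
Proof.
have [CH CH0 hH] := flow_holder.
have [CB CB0 hB] := flow_expansion T0 al0 h0 h12 hrho Cw0 CW0 Kf0 data.
pose B0 := CA * T `^ h; have B00 : 0 <= B0 by rewrite mulr_ge0// powR_ge0.
have [MK hMK] := hH (K + B0).
pose E := 2 * CB * T `^ theta; have E0 : 0 <= E by rewrite !mulr_ge0// powR_ge0.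
have [C1 C10 [nc hc]] := compare (K + B0 + B0) E0.
have Lh : Lam%:R^-1 < h by exact: lt_le_trans kch.
have [ns hs] := half_powR_scale MK B00 Lam0 Lh.
exists (B0 + C1 + CH * B0 `^ gm); first by rewrite !addr_ge0// mulr_ge0// powR_ge0.
exists (maxn (maxn nc ns) n1) => n; rewrite !geq_max => /andP[/andP[nnc nns] nn1] s t x s0 st tT xK.
have sT : s <= T by exact: le_trans tT.
have t0 : 0 <= t by exact: le_trans st.
have me := e0 n.
have meshS : 2 * mesh T n.+1 = mesh T n by rewrite /mesh exprS; field; rewrite expf_neq0.
have p1 : (2^-1 ^+ n) `^ h <= (2^-1 ^+ n) `^ kc :> R by exact: half_powR_le.
have p2 : (2^-1 ^+ n) `^ kap <= (2^-1 ^+ n) `^ kc :> R by exact: half_powR_le.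
have p3 : (2^-1 ^+ n) `^ (h * gm) <= (2^-1 ^+ n) `^ kc :> R by exact: half_powR_le.
have pk0 : 0 <= (2^-1 ^+ n) `^ kc :> R by exact: powR_ge0.
have g0 : 0 <= B0 `^ gm by exact: powR_ge0.
have /andP[k1 k2] := cetick_double n s0 sT; have /andP[l1 l2] := fltick_double n t0.
have kN := cetick_le n s; have lN := fltick_le n t0 tT; have lN' := fltick_le n.+1 t0 tT.
have /andP[ks1 ks2] := cetick_itv n s0 sT; have /andP[ks3 ks4] := cetick_itv n.+1 s0 sT.
have /andP[lt1 lt2] := fltick_itv n t0; have /andP[lt3 lt4] := fltick_itv n.+1 t0.
rewrite /approx; move: (cetick n s) (fltick n t) (cetick n.+1 s) (fltick n.+1 t) k1 k2 l1 l2 kN lN lN' ks1 ks2 ks3 ks4 lt1 lt2 lt3 lt4.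
move=> k l k' l' k1 k2 l1 l2 kN lN lN' ks1 ks2 ks3 ks4 lt1 lt2 lt3 lt4.
(* If no coarse step fits, the coarse scheme is the identity and the fine one runs for at most one
   coarse mesh. *)
have [kl|lk] := leqP k l; last first.
  have -> : (l - k = 0)%N by apply/eqP; rewrite subn_eq0 ltnW.
  rewrite /path_flow [X in _ - X]/=.
  have [lk'|kl'] := leqP l' k'.
    have -> : (l' - k' = 0)%N by apply/eqP; rewrite subn_eq0.
    by rewrite /= subrr normr0 mulr_ge0// !addr_ge0// mulr_ge0.
  have b1 : (k' + (l' - k') <= 2 ^ n.+1)%N by rewrite subnKC// ltnW.
  apply: le_trans (@flow_small n n.+1 k' (l' - k') x b1 _) _.
    have -> : (l' - k')%:R * mesh T n.+1 = tick T n.+1 l' - tick T n.+1 k'.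
      by rewrite -[in tick T n.+1 l'](subnKC (ltnW kl')) tickD addrAC subrr add0r.
    have := tick_le T0 n lk; rewrite -/(tick T n k) => tlk.
    by move: ks2 ks3 lt2 lt3 tlk; lra.
  rewrite -/B0; apply: le_trans (ler_wpM2l B00 p1) _; apply: ler_wpM2r => //.
  by rewrite -addrA lerDl addr_ge0// mulr_ge0.
pose x' := pflow n.+1 k' (2 * k - k') x.
pose Y j := pflow n.+1 (2 * k) (2 * j) x'.
have E1 : pflow n.+1 k' (l' - k') x = pflow n.+1 (2 * l) (l' - 2 * l) (Y (l - k)%N).
  have -> : (l' - k' = (2 * k - k') + (2 * (l - k) + (l' - 2 * l)))%N by move: k2 l1 kl; clear; lia.
  rewrite path_flowD -/x' subnKC// path_flowD -/(Y _); congr (pflow _ _ _ _).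
  by move: kl; clear; lia.
have kk : (k' + (2 * k - k') <= 2 ^ n.+1)%N by rewrite subnKC// expnS leq_mul2l kN orbT.
have meshS0 := mesh0 n.+1.
have x'x : `|x' - x| <= B0 * (2^-1 ^+ n) `^ h.
  apply: (@flow_small n) => //; rewrite -meshS; apply: ler_wpM2r; first exact: ltW.
  by rewrite ler_nat; move: k1; clear; lia.
have x'K : `|x'| <= K + B0.
  by apply: le_trans (flow_norm _ kk) _; rewrite lerD2r.
have YK j : (j <= l - k)%N -> `|Y j| <= K + B0 + B0.
  move=> jlk; apply: le_trans (flow_norm _ _) _; last by rewrite lerD2r.
  by rewrite expnS -mulnDr leq_mul2l /=; apply: leq_trans lN; move: jlk kl; clear; lia.
have meshp : mesh T n `^ theta = T `^ theta * (2^-1 ^+ n) `^ theta by exact: mesh_powR.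
have hY j : (j < l - k)%N -> `|Y j.+1 - pflow n (k + j) 1 (Y j)| <= E * (2^-1 ^+ n) `^ theta.
  move=> jlk.
  have kj : (k + j + 1 <= 2 ^ n)%N by apply: leq_trans lN; move: jlk kl; clear; lia.
  have kj2 : (2 * (k + j) + 2 <= 2 ^ n.+1)%N by rewrite expnS -mulnSr leq_mul2l -[X in (X <= _)%N]addn1 kj.
  have YS : Y j.+1 = pflow n.+1 (2 * (k + j)) 2 (Y j) by rewrite /Y mulnSr path_flowD mulnDr.
  have b1 := hB n.+1 (2 * (k + j))%N 2 (Y j) kj2.
  have b2 := hB n (k + j)%N 1%N (Y j) kj.
  rewrite -YS -mulnSr !tick_double meshS in b1.
  rewrite mul1r addn1 in b2.
  have -> : Y j.+1 - pflow n (k + j) 1 (Y j) =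
    (Y j.+1 - Y j - (W (tick T n (k + j).+1) - W (tick T n (k + j))) - psi (tick T n (k + j)) (tick T n (k + j).+1) (Y j))
    - (pflow n (k + j) 1 (Y j) - Y j - (W (tick T n (k + j).+1) - W (tick T n (k + j))) - psi (tick T n (k + j)) (tick T n (k + j).+1) (Y j)).
    by apply/rowP => i; rewrite !mxE; ring.
  apply: le_trans (ler_normB _ _) _; apply: le_trans (lerD b1 b2) _.
  rewrite -/theta meshp /E -mulrA; move: (T `^ theta * _) => Z.
  by rewrite le_eqVlt; apply/orP; left; apply/eqP; rewrite -mulrA; ring.
have klN : (k + (l - k) <= 2 ^ n)%N by rewrite subnKC.
have c1 := hc n nnc k (l - k)%N klN Y YK hY.
have Y0 : Y 0%N = x' by rewrite /Y muln0.
rewrite Y0 in c1.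
have c2 : `|pflow n k (l - k) x' - pflow n k (l - k) x| <= CH * (B0 `^ gm * (2^-1 ^+ n) `^ (h * gm)).
  apply: le_trans (hMK n k (l - k)%N x' x nn1 klN x'K _ _) _.
  - by apply: le_trans xK _; rewrite lerDl.
  - exact: le_trans x'x (hs n nns).
  apply: ler_wpM2l => //; apply: (@le_trans _ _ ((B0 * (2^-1 ^+ n) `^ h) `^ gm)).
    by apply: ge0_ler_powR_base => //; exact: ltW.
  by rewrite (powRM _ B00 (powR_ge0 _ _)) -powRrM.
have c3 : `|pflow n.+1 (2 * l) (l' - 2 * l) (Y (l - k)%N) - Y (l - k)%N| <= B0 * (2^-1 ^+ n) `^ h.
  apply: (@flow_small n); first by rewrite subnKC.
  rewrite -meshS; apply: ler_wpM2r; first exact: ltW.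
  by rewrite ler_nat; move: l2; clear; lia.
rewrite E1 (_ : _ - _ = (pflow n.+1 (2 * l) (l' - 2 * l) (Y (l - k)%N) - Y (l - k)%N) + (Y (l - k)%N - pflow n k (l - k) x')
  + (pflow n k (l - k) x' - pflow n k (l - k) x)); last by apply/rowP => i; rewrite !mxE; ring.
apply: le_trans (ler_normD _ _) _; apply: le_trans (lerD (ler_normD _ _) (lexx _)) _.
rewrite !mulrDl; apply: lerD; first apply: lerD.
- by apply: le_trans c3 _; exact: ler_wpM2l.
- by apply: le_trans c1 _; exact: ler_wpM2l.
- by apply: le_trans c2 _; rewrite -mulrA; apply: ler_wpM2l => //; exact: ler_wpM2l.
Qed.

Let expansionT := flow_expansion T0 al0 h0 h12 hrho Cw0 CW0 Kf0 data.

Definition limit_flow (s t : R) (x : V) : V := lim (approx n s t x @[n --> \oo]).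
Local Notation X := limit_flow.

Lemma half_pow_mono n m : (n <= m)%N -> 2^-1 ^+ m <= 2^-1 ^+ n :> R.
Proof.
by move=> nm; rewrite -(subnK nm) exprD; apply: ler_piMl; [apply/ltW/half_pow_gt0|exact: half_pow_le1].
Qed.

Lemma half_powR_limit (a b c p : R) n0 : 0 < p ->
  (forall n, (n0 <= n)%N -> a <= b + c * (2^-1 ^+ n) `^ p) -> a <= b.
Proof.
move=> p0 H; apply/ler_addgt0Pr => eps eps0.
have [n2 hn2] := half_powR_small (c / eps) p0.
have := H _ (leq_maxl n0 n2); have := hn2 _ (leq_maxr n0 n2).
by rewrite mulrAC ler_pdivrMr// mul1r; lra.
Qed.

Lemma approx_limit K : exists2 C, 0 <= C & exists n0, forall n, (n0 <= n)%N -> forall (s t : R) (x : V), 0 <= s -> s <= t -> t <= T ->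
  `|x| <= K -> `|approx n s t x - X s t x| <= C * (2^-1 ^+ n) `^ kc.
Proof.
have [C C0 [n0 hn0]] := approx_step K.
pose q : R := 2^-1 `^ kc; have q0 : 0 < q by exact: powR_gt0.
have q1 : q < 1 by exact: half_powR_lt1.
have qE n : (2^-1 ^+ n) `^ kc = q ^+ n by rewrite powR_exprn// ltW.
have C1 : 0 <= C / (1 - q) by rewrite divr_ge0// subr_ge0 ltW.
exists (C / (1 - q)) => //; exists n0 => n nn s t x s0 st tT xK; rewrite qE.
have hu i k : (n0 <= k)%N -> `|approx k.+1 s t x ord0 i - approx k s t x ord0 i| <= C * q ^+ k.
  move=> kk; apply: le_trans (_ : _ <= `|approx k.+1 s t x - approx k s t x|) _.
    by rewrite -rowB; exact: coord_le_norm.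
  by rewrite -qE; exact: hn0.
have /choice[l hl] : forall i, exists l, forall k, (n0 <= k)%N -> `|approx k s t x ord0 i - l| <= C / (1 - q) * q ^+ k.
  by move=> i; apply: geometric_limit (hu i) => //; exact: ltW.
pose L : V := \row_i l i.
have HL k : (n0 <= k)%N -> `|approx k s t x - L| <= C / (1 - q) * q ^+ k.
  move=> kk; apply: norm_le_coord; first by rewrite mulr_ge0// exprn_ge0// ltW.
  by move=> i; rewrite rowB mxE; exact: hl.
suff -> : X s t x = L by exact: HL.
apply: cvg_lim => //; apply/(@cvgrPdist_lt R V nat \oo _ _ L) => eps eps0.
have [n2 hn2] := half_powR_small (C / (1 - q) * 2 / eps) kc0.
exists (maxn n0 n2) => // k /=; rewrite geq_max => /andP[k0 k2].
rewrite distrC; apply: le_lt_trans (HL k k0) _; have := hn2 k k2.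
rewrite qE mulrAC ler_pdivrMr// mul1r mulrAC => hh; move: hh eps0; move: (_ * q ^+ k) => z; lra.
Qed.

Lemma tick_ltn n j m : (j < m)%N -> tick T n j < tick T n m.
Proof. by move=> jm; rewrite /tick ltr_pM2r// ltr_nat. Qed.

Lemma ticks_ordered (s t : R) : 0 <= s -> s < t -> t <= T -> exists n0, forall n, (n0 <= n)%N -> (cetick n s <= fltick n t)%N.
Proof.
move=> s0 st tT; have ts : 0 < (t - s) / (2 * T) by rewrite divr_gt0 ?subr_gt0// mulr_gt0.
have [n0 hn0] := half_pow_lt ts; exists n0 => n nn.
have sT : s <= T by apply: ltW; exact: lt_le_trans tT.
have t0 : 0 <= t by apply: ltW; exact: le_lt_trans st.
have /andP[_ h1] := cetick_itv n s0 sT; have /andP[_ h3] := fltick_itv n t0.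
have : 2^-1 ^+ n <= 2^-1 ^+ n0 :> R by exact: half_pow_mono.
move=> h4; have h5 := le_lt_trans h4 hn0; rewrite ltr_pdivlMr ?mulr_gt0// in h5.
rewrite leqNgt; apply/negP => /tick_le => /(_ R T T0 n); rewrite tickS in h3 *.
by move: h1 h3 h5; rewrite meshE; lra.
Qed.

Lemma limit_flow_refl (s : R) x : 0 <= s -> s <= T -> X s s x = x.
Proof.
move=> s0 sT; have H n : approx n s s x = x.
  rewrite /approx; suff -> : (fltick n s - cetick n s = 0)%N by [].
  apply/eqP; rewrite subn_eq0 leqNgt; apply/negP => /(tick_ltn n).
  by have /andP[h1 _] := fltick_itv n s0; have /andP[h3 _] := cetick_itv n s0 sT; move: h1 h3; lra.
rewrite /limit_flow; under eq_fun do rewrite H.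
exact: lim_cst.
Qed.

Lemma ticks_length n (s t : R) : 0 <= s -> s <= t -> t <= T ->
  (fltick n t - cetick n s)%:R * mesh T n <= t - s.
Proof.
move=> s0 st tT; have sT := le_trans st tT; have t0 := le_trans s0 st.
have [lk|kl] := leqP (fltick n t) (cetick n s).
  by have /eqP -> := lk; rewrite mul0r subr_ge0.
have -> : (fltick n t - cetick n s)%:R * mesh T n = tick T n (fltick n t) - tick T n (cetick n s).
  by rewrite -[in tick T n (fltick n t)](subnKC (ltnW kl)) tickD addrAC subrr add0r.
have /andP[h1 _] := cetick_itv n s0 sT; have /andP[h3 _] := fltick_itv n t0.
by apply: lerB.
Qed.

Lemma ticks_range n (s t : R) : 0 <= t -> t <= T -> (cetick n s + (fltick n t - cetick n s) <= 2 ^ n)%N.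
Proof.
move=> t0 tT; have := fltick_le n t0 tT; have := cetick_le n s; clear; lia.
Qed.

Lemma approx_close n (s t : R) x : 0 <= s -> s <= t -> t <= T -> `|approx n s t x - x| <= CA * (t - s) `^ h.
Proof.
move=> s0 st tT; have t0 := le_trans s0 st.
apply: le_trans (flow_close T0 h0 hrho Cw0 data x (ticks_range n s t0 tT)) _.
apply: ler_wpM2l => //; apply: ge0_ler_powR_base; [exact: ltW|by rewrite mulr_ge0// ltW|exact: ticks_length].
Qed.

Lemma limit_flow_close (s t : R) x : 0 <= s -> s <= t -> t <= T -> `|X s t x - x| <= CA * (t - s) `^ h.
Proof.
move=> s0 st tT; have [C C0 [n0 hn0]] := approx_limit `|x|.
apply: (@half_powR_limit _ _ C kc n0) => // n nn.
have := hn0 n nn s t x s0 st tT (lexx _); have := approx_close n x s0 st tT.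
have := ler_normB (approx n s t x - x) (approx n s t x - X s t x).
rewrite (_ : _ - x - _ = X s t x - x); last by apply/rowP => i; rewrite !mxE; ring.
by lra.
Qed.

(** The expansion of the scheme holds between the rounded ends. The two remaining slivers are
    shorter than the mesh, and their noise and drift vanish as [n] grows. *)
Lemma limit_flow_expansion : exists2 CX, 0 <= CX & forall (s t : R) (x : V), 0 <= s -> s <= t -> t <= T ->
  `|X s t x - x - (W t - W s) - psi s t x| <= CX * (t - s) `^ theta.
Proof.
have [CB CB0 hB] := expansionT; exists CB => // s t x s0 st tT.
have [ts|st'] := leP t s.
  have -> : t = s by apply/eqP; rewrite eq_le ts st.
  rewrite limit_flow_refl ?(le_trans st)// (drift_refl data) !subrr normr0 mulr_ge0// powR_ge0.
have [C C0 [n0 hn0]] := approx_limit `|x|; have [n2 hn2] := ticks_ordered s0 st' tT.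
pose c := C + (CW * T `^ h + CW * T `^ h + (Cw * T `^ rho + Cw * T `^ rho)).
apply: (@half_powR_limit _ _ c kc (maxn n0 n2)) => // n; rewrite geq_max => /andP[nn0 nn2].
have sT := le_trans st tT; have t0 := le_trans s0 st.
have kl := hn2 n nn2; have h1 := hn0 n nn0 s t x s0 st tT (lexx _).
have b := hB n (cetick n s) (fltick n t - cetick n s)%N x (ticks_range n s t0 tT).
rewrite subnKC// in b.
have /andP[k1 k2] := cetick_itv n s0 sT; have /andP[l1 l2] := fltick_itv n t0.
have tl := tick_le T0 n kl.
rewrite tickS in l2.
have lenp : ((fltick n t - cetick n s)%:R * mesh T n) `^ theta <= (t - s) `^ theta.
  by apply: ge0_ler_powR_base; [exact: ltW|rewrite mulr_ge0// ltW|exact: ticks_length].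
move: b h1; rewrite /approx; set y := path_flow _ _ _ _ _ _ _.
set k := tick T n (cetick n s) in k1 k2 tl *; set l := tick T n (fltick n t) in l1 l2 tl * => b h1.
have pk : (2^-1 ^+ n) `^ h <= (2^-1 ^+ n) `^ kc :> R by exact: half_powR_le.
have prho : (2^-1 ^+ n) `^ rho <= (2^-1 ^+ n) `^ kc :> R by apply: half_powR_le; exact: le_trans hrho.
have mT (a p : R) : 0 <= a -> a <= mesh T n -> 0 <= p -> a `^ p <= T `^ p * (2^-1 ^+ n) `^ p.
  by move=> a0 am p0; rewrite -mesh_powR//; exact: ge0_ler_powR_base.
have rho0 : 0 <= rho by apply: le_trans hrho; exact: ltW.
have kT : k <= T by move: tl l1 tT; lra.
have l0 : 0 <= l by exact: tick_ge0.
have sk : k - s <= mesh T n by move: k2; lra.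
have lt : t - l <= mesh T n by move: l2; lra.
have k0 : 0 <= k by exact: tick_ge0.
have aux (a p c' : R) : 0 <= a -> a <= mesh T n -> 0 <= p -> kc <= p -> 0 <= c' -> c' * a `^ p <= c' * T `^ p * (2^-1 ^+ n) `^ kc.
  move=> a0 am p0 kp c0; rewrite -mulrA; apply: ler_wpM2l => //.
  apply: le_trans (mT a p a0 am p0) _; apply: ler_wpM2l; first exact: powR_ge0.
  exact: half_powR_le.
have w1 : `|W t - W l| <= CW * T `^ h * (2^-1 ^+ n) `^ kc.
  apply: le_trans (path_holder data l0 l1 tT) _; apply: aux => //; [by rewrite subr_ge0|exact: ltW].
have w2 : `|W k - W s| <= CW * T `^ h * (2^-1 ^+ n) `^ kc.
  apply: le_trans (path_holder data s0 k1 kT) _; apply: aux => //; [by rewrite subr_ge0|exact: ltW].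
have krho : kc <= rho by exact: le_trans hrho.
have d1 : `|psi l t x| <= Cw * T `^ rho * (2^-1 ^+ n) `^ kc.
  apply: le_trans (drift_bound data x l1) _; apply: le_trans (weight_rho data l1) _; apply: aux => //; by rewrite subr_ge0.
have d2 : `|psi s k x| <= Cw * T `^ rho * (2^-1 ^+ n) `^ kc.
  apply: le_trans (drift_bound data x k1) _; apply: le_trans (weight_rho data k1) _; apply: aux => //; by rewrite subr_ge0.
have ps : psi s t x = psi s k x + (psi k l x + psi l t x).
  by rewrite (drift_add data x k1 (le_trans tl l1)) (drift_add data x tl l1).
rewrite (_ : _ - psi s t x = (y - x - (W l - W k) - psi k l x) - (y - X s t x) - ((W t - W l) + (W k - W s)) - (psi s k x + psi l t x)); last first.
  by rewrite ps; apply/rowP => i; rewrite !mxE; ring.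
apply: le_trans (ler_normB _ _) _; apply: le_trans (lerD (ler_normB _ _) (ler_normD _ _)) _.
apply: le_trans (lerD (lerD (ler_normB _ _) (ler_normD _ _)) (lexx _)) _.
have b' : CB * ((fltick n t - cetick n s)%:R * mesh T n) `^ theta <= CB * (t - s) `^ theta by exact: ler_wpM2l.
apply: le_trans (lerD (lerD (lerD (le_trans b b') h1) (lerD w1 w2)) (lerD d2 d1)) _.
by rewrite /c le_eqVlt; apply/orP; left; apply/eqP; ring.
Qed.

Let T00 : 0 <= T. Proof. exact: ltW. Qed.
Let theta00 : 0 <= theta. Proof. exact: ltW. Qed.
Let h00 : 0 <= h. Proof. exact: ltW. Qed.
Let gm00 : 0 <= gm. Proof. exact: ltW. Qed.
Let B0 := CA * T `^ h.
Let B00 : 0 <= B0. Proof. by rewrite mulr_ge0// powR_ge0. Qed.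
Let LamH : Lam%:R^-1 < h. Proof. exact: lt_le_trans kch. Qed.

Lemma eq_half_powR (x y : V) (c p : R) n0 : 0 < p ->
  (forall n, (n0 <= n)%N -> `|x - y| <= c * (2^-1 ^+ n) `^ p) -> x = y.
Proof.
move=> p0 H; apply/eqP; rewrite -subr_eq0 -normr_le0; apply: (@half_powR_limit _ _ c p n0) => // n nn.
by rewrite add0r; exact: H.
Qed.

(** The level [n] is tied to the distance of the points: large enough for the convergence error to
    be smaller than the claimed bound, small enough for the Hoelder bound of the scheme to apply. *)
Lemma limit_flow_holder K : exists2 C, 0 <= C & exists M, forall (s t : R) (x y : V), 0 <= s -> s <= t -> t <= T ->
  `|x| <= K -> `|y| <= K -> `|x - y| <= 2^-1 ^+ M -> `|X s t x - X s t y| <= C * `|x - y| `^ gm.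
Proof.
have [CH CH0 hH] := flow_holder; have [MK hMK] := hH K; have [C C0 [n0 hn0]] := approx_limit K.
pose c := CH + 2 * (C * (2 ^+ MK * 2)).
have c0 : 0 <= c by apply: addr_ge0 => //; apply: mulr_ge0 => //; apply: mulr_ge0 => //; apply: mulr_ge0 => //; exact: exprn_ge0.
exists c => //; exists (MK + (n0 + n1))%N => s t x y s0 st tT xK yK xy.
have [->|xny] := eqVneq x y; first by rewrite !subrr normr0 mulr_ge0// powR_ge0.
have xy0 : 0 < `|x - y| by rewrite normr_gt0 subr_eq0.
have [m [mM h1 h3]] := dyadic_scale xy0 xy.
pose k := (m - MK)%N.
have mE : (MK + k = m)%N by rewrite subnKC// (leq_trans (leq_addr _ _) mM).
have kn : (n0 + n1 <= k)%N by rewrite -(leq_add2l MK) mE.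
pose n := (Lam * k)%N.
have kLn : (k <= n)%N by rewrite /n leq_pmull.
have nn0 : (n0 <= n)%N by apply: leq_trans (leq_trans kn kLn); exact: leq_addr.
have nn1 : (n1 <= n)%N by apply: leq_trans (leq_trans kn kLn); exact: leq_addl.
have a1 := hn0 n nn0 s t x s0 st tT xK; have a2 := hn0 n nn0 s t y s0 st tT yK.
have t0 := le_trans s0 st.
have a3 : `|approx n s t x - approx n s t y| <= CH * `|x - y| `^ gm.
  by apply: hMK => //; [exact: (ticks_range)|rewrite /n mulKn// mE].
have en : (2^-1 ^+ n) `^ kc <= 2 ^+ MK * 2 * `|x - y| `^ gm.
  have e1 : (2^-1 ^+ n) `^ kc <= 2^-1 ^+ k :> R.
    rewrite /n mulnC exprM (powR_exprn _ _ (ltW (e0 k))) -(powR_mulrn Lam (powR_ge0 _ _)) -powRrM.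
    rewrite -[leRHS](powRr1 (ltW (e0 k))); apply: half_powR_le.
    by rewrite -ler_pdivrMr ?ltr0n// mul1r ltW.
  apply: le_trans e1 _.
  have e2 : 2^-1 ^+ k = 2 ^+ MK * 2 * 2^-1 ^+ m.+1 :> R.
    rewrite -mE exprS exprD; have := half_powM (R := R) MK.
    by move: (2^-1 ^+ MK) (2 ^+ MK) (2^-1 ^+ k) => a1' a2' a3' aa; rewrite [RHS](_ : _ = (a1' * a2') * a3'); [rewrite aa mul1r|field].
  rewrite e2; apply: ler_wpM2l; first by rewrite mulr_ge0// exprn_ge0.
  apply: le_trans (ltW h1) _; rewrite -[leLHS](powRr1 (ltW xy0)); apply: ger_powR; last exact: ltW.
  by rewrite xy0 (le_trans h3)// half_pow_le1.
rewrite (_ : X s t x - X s t y = (approx n s t x - approx n s t y) - (approx n s t x - X s t x) + (approx n s t y - X s t y)); last first.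
  by apply/rowP => i; rewrite !mxE; ring.
apply: le_trans (ler_normD _ _) _; apply: le_trans (lerD (ler_normB _ _) (lexx _)) _.
have := ler_wpM2l C0 en; rewrite /c; move: a1 a2 a3.
move: (`|approx n s t x - X s t x|) (`|approx n s t y - X s t y|) (`|approx n s t x - approx n s t y|) => z1 z2 z3.
exact: three_gap.
Qed.

(** The scheme has the flow property exactly at grid times. At [q] the roundings down and up differ
    by at most one step; it moves the point slightly, and the Hoelder bound carries this to time
    [t]. *)
Lemma limit_flow_flow (s q t : R) (x : V) : 0 <= s -> s <= q -> q <= t -> t <= T -> X s t x = X q t (X s q x).
Proof.
move=> s0 sq qt tT.
have st' := le_trans sq qt; have q0 := le_trans s0 sq; have qT := le_trans qt tT; have sT := le_trans sq qT; have t0 := le_trans q0 qt.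
have [qs|sq'] := leP q s.
  by have -> : q = s by [apply/eqP; rewrite eq_le qs sq]; rewrite limit_flow_refl.
have [tq|qt'] := leP t q.
  have tE : t = q by apply/eqP; rewrite eq_le tq qt.
  by rewrite tE limit_flow_refl.
pose z := X s q x.
have [CH CH0 hH] := flow_holder.
have [C C0 [n0 hn0]] := approx_limit (`|x| + `|z|).
pose K := `|x| + `|z| + (B0 + C).
have [MK hMK] := hH K.
have [na ha] := ticks_ordered s0 sq' qT; have [nb hb] := ticks_ordered q0 qt' tT.
have BC0 : 0 <= B0 + C by exact: addr_ge0.
have [ns hs] := half_powR_scale MK BC0 Lam0 LamK.
have gk : 0 < kc * gm by exact: mulr_gt0.
pose c := C + CH * (B0 + C) `^ gm + C.
apply: (@eq_half_powR _ _ c (kc * gm) (maxn (maxn na nb) (maxn (maxn n0 ns) n1))) => // n.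
rewrite !geq_max => /andP[/andP[nna nnb] /andP[/andP[nn0 nns] nn1]].
have en := e0 n; have en1 := @half_pow_le1 R n.
have kl := ha n nna; have ql := hb n nnb.
have z1 : `|x| <= `|x| + `|z| by rewrite lerDl.
have z2 : `|z| <= `|x| + `|z| by rewrite lerDr.
have b1 := hn0 n nn0 s t x s0 st' tT z1; have b2 := hn0 n nn0 q t z q0 qt tT z2.
have b3 := hn0 n nn0 s q x s0 sq qT z1.
have ab : (fltick n q <= cetick n q <= (fltick n q).+1)%N.
  have /andP[i1 i2] := fltick_itv n q0; have /andP[i3 i4] := cetick_itv n q0 qT.
  rewrite leqNgt; apply/andP; split; first by apply/negP => /(tick_ltn n); move: i1 i3; lra.
  rewrite -ltnS; apply: (@tick_lt n); rewrite 2!tickS; rewrite tickS in i2; move: i2 i4; lra.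
have /andP[ab1 ab2] := ab.
have cN := cetick_le n q; have lN := fltick_le n t0 tT.
pose y := pflow n (fltick n q) (cetick n q - fltick n q) (approx n s q x).
have AE : approx n s t x = pflow n (cetick n q) (fltick n t - cetick n q) y.
  rewrite /y /approx; have -> : (fltick n t - cetick n s = (fltick n q - cetick n s) + ((cetick n q - fltick n q) + (fltick n t - cetick n q)))%N.
    by move: ab1 kl ql; clear; lia.
  by rewrite path_flowD subnKC// path_flowD subnKC.
have yz : `|y - z| <= (B0 + C) * (2^-1 ^+ n) `^ kc.
  rewrite -(subrKA (approx n s q x)); apply: le_trans (ler_normD _ _) _; rewrite mulrDl; apply: lerD => //.
  apply: (@le_trans _ _ (B0 * (2^-1 ^+ n) `^ h)).
    apply: (@flow_small n); first by rewrite subnKC.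
    rewrite -[leRHS]mul1r; apply: ler_wpM2r; first exact: ltW.
    by rewrite lern1; move: ab2; clear; lia.
  by apply: ler_wpM2l => //; exact: half_powR_le.
have yK : `|y| <= K.
  have : (B0 + C) * (2^-1 ^+ n) `^ kc <= (B0 + C) * 1.
    apply: ler_wpM2l => //; rewrite -[leRHS](powRr0 (2^-1 ^+ n)); apply: half_powR_le; exact: ltW.
  have := ler_normD (y - z) z; rewrite subrK; have := normr_ge0 x; rewrite /K; move: yz; lra.
have zK : `|z| <= K by rewrite /K; have := normr_ge0 x; lra.
have d1 : `|approx n s t x - approx n q t z| <= CH * `|y - z| `^ gm.
  rewrite AE; apply: hMK => //; first exact: (ticks_range).
  exact: le_trans yz (hs n nns).
have d2 : `|y - z| `^ gm <= (B0 + C) `^ gm * (2^-1 ^+ n) `^ (kc * gm).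
  apply: (@le_trans _ _ (((B0 + C) * (2^-1 ^+ n) `^ kc) `^ gm)); first exact: ge0_ler_powR_base.
  by rewrite (powRM _ BC0 (powR_ge0 _ _)) -powRrM.
have d3 : (2^-1 ^+ n) `^ kc <= (2^-1 ^+ n) `^ (kc * gm) :> R.
  by apply: half_powR_le; apply: ler_piMr; exact: ltW.
rewrite -/z (_ : X s t x - X q t z = (approx n s t x - approx n q t z) - (approx n s t x - X s t x) + (approx n q t z - X q t z)); last first.
  by apply/rowP => i; rewrite !mxE; ring.
apply: le_trans (ler_normD _ _) _; apply: le_trans (lerD (ler_normB _ _) (lexx _)) _.
apply: le_trans (lerD (lerD d1 b1) b2) _.
have d4 : CH * `|y - z| `^ gm <= CH * ((B0 + C) `^ gm * (2^-1 ^+ n) `^ (kc * gm)) by exact: ler_wpM2l.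
have d5 : C * (2^-1 ^+ n) `^ kc <= C * (2^-1 ^+ n) `^ (kc * gm) by exact: ler_wpM2l.
by rewrite /c -/kc; move: d4 d5; lra.
Qed.

(** Sampled on the grid, [Y] is an approximate orbit of the scheme, as both have the expansion with
    the same [psi]. The rest of the error comes from rounding [s] and [t] to the grid. *)
Lemma limit_flow_unique (s t E K : R) (Y : R -> V) : 0 <= s -> s <= t -> t <= T -> 0 <= E ->
  (forall u, s <= u -> u <= t -> `|Y u| <= K) ->
  (forall u v, s <= u -> u <= v -> v <= t -> `|Y v - Y u - (W v - W u) - psi u v (Y u)| <= E * (v - u) `^ theta) ->
  Y t = X s t (Y s).
Proof.
move=> s0 st tT E0 YK hY; have sT := le_trans st tT; have t0 := le_trans s0 st.
have [ts|st'] := leP t s.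
  by have tE : t = s by [apply/eqP; rewrite eq_le ts st]; rewrite tE limit_flow_refl.
have [CB CB0 hB] := expansionT.
have EB0 : 0 <= (E + CB) * T `^ theta by rewrite mulr_ge0 ?addr_ge0// powR_ge0.
have [C1 C10 [nc hc]] := compare K EB0.
have [C C0 [n0 hn0]] := approx_limit K.
have [CH CH0 hH] := flow_holder; have [MK hMK] := hH K.
have [nb hb] := ticks_ordered s0 st' tT.
pose F := (E * T `^ (theta - h) + CA) * T `^ h.
have F0 : 0 <= F by rewrite mulr_ge0 ?addr_ge0 ?mulr_ge0 ?powR_ge0.
have [ns hs] := half_powR_scale MK F0 Lam0 LamH.
have gk : 0 < kc * gm by exact: mulr_gt0.
pose c := F + C1 + CH * F `^ gm + C.
have hth : h <= theta by apply: ltW; apply: le_lt_trans theta1; move: h12; lra.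
have small u v n : s <= u -> u <= v -> v <= t -> v - u <= mesh T n -> `|Y v - Y u| <= F * (2^-1 ^+ n) `^ h.
  move=> su uv vt uvm; have u0 := le_trans s0 su; have vT := le_trans vt tT; have vu : 0 <= v - u by rewrite subr_ge0.
  have a1 := hY u v su uv vt; have a2 := path_holder data u0 uv vT.
  have a3 : `|psi u v (Y u)| <= Cw * T `^ (rho - h) * (v - u) `^ h.
    by apply: le_trans (drift_bound data _ uv) _; exact: (weight_h h0 hrho Cw0 data).
  have a4 : E * (v - u) `^ theta <= E * (T `^ (theta - h) * (v - u) `^ h).
    by apply: ler_wpM2l => //; apply: powR_le_base => //; lra.
  have a5 : (v - u) `^ h <= T `^ h * (2^-1 ^+ n) `^ h by rewrite -mesh_powR//; exact: ge0_ler_powR_base.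
  rewrite (_ : Y v - Y u = (Y v - Y u - (W v - W u) - psi u v (Y u)) + (W v - W u) + psi u v (Y u)); last first.
    by apply/rowP => i; rewrite !mxE; ring.
  apply: le_trans (ler_normD _ _) _; apply: le_trans (lerD (ler_normD _ _) (lexx _)) _.
  apply: (@le_trans _ _ ((E * T `^ (theta - h) + CA) * (v - u) `^ h)).
    by rewrite /CA; move: a1 a2 a3 a4; move: ((v - u) `^ h) (T `^ (theta - h)) (T `^ (rho - h)) => p1 p2 p3; lra.
  rewrite /F -mulrA; apply: ler_wpM2l => //.
  by rewrite addr_ge0// mulr_ge0// powR_ge0.
apply: (@eq_half_powR _ _ c (kc * gm) (maxn (maxn n0 nb) (maxn (maxn nc ns) n1))) => // n.
rewrite !geq_max => /andP[/andP[nn0 nnb] /andP[/andP[nnc nns] nn1]].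
have kl := hb n nnb; have me := mesh0 n.
have /andP[k1 k2] := cetick_itv n s0 sT; have /andP[l1 l2] := fltick_itv n t0.
have rng := ticks_range n s t0 tT.
have YsK : `|Y s| <= K by exact: YK.
have b1 := hn0 n nn0 s t (Y s) s0 st tT YsK.
move: rng b1; rewrite /approx; move: (cetick n s) (fltick n t) kl k1 k2 l1 l2 => k l kl k1 k2 l1 l2 rng b1.
have tkj j : (j <= l - k)%N -> s <= tick T n (k + j) /\ tick T n (k + j) <= t.
  move=> jl; split; first by apply: le_trans k1 _; apply: tick_le => //; exact: leq_addr.
  by apply: le_trans l1; apply: tick_le => //; move: jl kl; clear; lia.
pose Z j := Y (tick T n (k + j)).
have ZK j : (j <= l - k)%N -> `|Z j| <= K by move=> jl; have [? ?] := tkj j jl; exact: YK.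
have hZ j : (j < l - k)%N -> `|Z j.+1 - pflow n (k + j) 1 (Z j)| <= (E + CB) * T `^ theta * (2^-1 ^+ n) `^ theta.
  move=> jl; have [u1 u2] := tkj j (ltnW jl); have [v1 v2] := tkj j.+1 jl.
  have kj : (k + j + 1 <= 2 ^ n)%N by apply: leq_trans rng; move: jl; clear; lia.
  have c1 := hB n (k + j)%N 1%N (Z j) kj.
  have tt : tick T n (k + j.+1) - tick T n (k + j) = mesh T n by rewrite addnS tickS addrAC subrr add0r.
  have uv : tick T n (k + j) <= tick T n (k + j.+1) by apply: tick_le => //; rewrite addnS.
  have c2 := hY _ _ u1 uv v2; rewrite tt -/(Z j) -/(Z j.+1) in c2.
  rewrite mul1r addn1 -addnS in c1.
  have -> : Z j.+1 - pflow n (k + j) 1 (Z j) =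
    (Z j.+1 - Z j - (W (tick T n (k + j.+1)) - W (tick T n (k + j))) - psi (tick T n (k + j)) (tick T n (k + j.+1)) (Z j))
    - (pflow n (k + j) 1 (Z j) - Z j - (W (tick T n (k + j.+1)) - W (tick T n (k + j))) - psi (tick T n (k + j)) (tick T n (k + j.+1)) (Z j)).
    by apply/rowP => i; rewrite !mxE; ring.
  apply: le_trans (ler_normB _ _) _; apply: le_trans (lerD c2 c1) _.
  by rewrite -mulrDl -mulrA -mesh_powR.
have c1 := hc n nnc k (l - k)%N rng Z ZK hZ.
have c2 : `|pflow n k (l - k) (Z 0%N) - pflow n k (l - k) (Y s)| <= CH * (F `^ gm * (2^-1 ^+ n) `^ (h * gm)).
  have sm : `|Z 0%N - Y s| <= F * (2^-1 ^+ n) `^ h.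
    rewrite /Z addn0; have [u1 u2] := tkj 0%N (leq0n _); rewrite addn0 in u1 u2.
    by apply: small => //; move: k2; lra.
  apply: le_trans (hMK n k (l - k)%N _ _ nn1 rng (ZK 0%N (leq0n _)) YsK _) _; first exact: le_trans sm (hs n nns).
  apply: ler_wpM2l => //; apply: (@le_trans _ _ ((F * (2^-1 ^+ n) `^ h) `^ gm)).
    exact: ge0_ler_powR_base.
  by rewrite (powRM _ F0 (powR_ge0 _ _)) -powRrM.
have c3 : `|Y t - Z (l - k)%N| <= F * (2^-1 ^+ n) `^ h.
  rewrite /Z subnKC//; apply: small => //; last by rewrite tickS in l2; move: l2; lra.
  by have [] := tkj (l - k)%N (leqnn _); rewrite subnKC.
have p1 : (2^-1 ^+ n) `^ h <= (2^-1 ^+ n) `^ (kc * gm) :> R.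
  apply: half_powR_le; apply: le_trans kch; apply: ler_piMr; exact: ltW.
have p2 : (2^-1 ^+ n) `^ kap <= (2^-1 ^+ n) `^ (kc * gm) :> R.
  apply: half_powR_le; apply: le_trans kck; apply: ler_piMr; exact: ltW.
have p3 : (2^-1 ^+ n) `^ (h * gm) <= (2^-1 ^+ n) `^ (kc * gm) :> R.
  by apply: half_powR_le; apply: ler_wpM2r.
have p4 : (2^-1 ^+ n) `^ kc <= (2^-1 ^+ n) `^ (kc * gm) :> R.
  apply: half_powR_le; apply: ler_piMr; exact: ltW.
rewrite (_ : Y t - X s t (Y s) = (Y t - Z (l - k)%N) + (Z (l - k)%N - pflow n k (l - k) (Z 0%N)) + (pflow n k (l - k) (Z 0%N) - pflow n k (l - k) (Y s))
   + (pflow n k (l - k) (Y s) - X s t (Y s))); last by apply/rowP => i; rewrite !mxE; ring.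
apply: le_trans (ler_normD _ _) _; apply: le_trans (lerD (ler_normD _ _) (lexx _)) _.
apply: le_trans (lerD (lerD (ler_normD _ _) (lexx _)) (lexx _)) _.
rewrite /c !mulrDl; apply: lerD; first apply: lerD; first apply: lerD.
- by apply: le_trans c3 _; exact: ler_wpM2l.
- by apply: le_trans c1 _; exact: ler_wpM2l.
- by apply: le_trans c2 _; rewrite -mulrA; apply: ler_wpM2l => //; apply: ler_wpM2l => //; exact: powR_ge0.
- by apply: le_trans b1 _; exact: ler_wpM2l.
Qed.

(** At [n = Lam * m] the convergence error is [2^-(Lam m kc) <= 2^-(2 m)], below the bound
    [2^-m' 2^-(be m)] for all [m' <= m]; this is the reason for [2 <= Lam * kc]. *)
Lemma limit_second_difference (be : R) (M2 : nat) : 0 < be -> be <= 1 -> 2 <= Lam%:R * kc ->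
  (forall m n, (M2 <= m)%N -> (n1 <= n)%N -> (n <= Lam * m)%N -> forall k l, (k + l <= 2 ^ n)%N ->
   forall z : 'I_d -> int, (forall i, `|z i| <= (m * 2 ^ m)%:Z) ->
   lattice_bounds (pflow n k l) m (2^-1 `^ gm) (2^-1 `^ be) z) ->
  forall K, exists2 C, 0 <= C & exists M, forall m, (M <= m)%N -> forall (s t : R), 0 <= s -> s <= t -> t <= T ->
    forall z : 'I_d -> int, `|lat m z : V| <= K -> forall i j m', (m' <= m)%N ->
    `|rect id (fun u v => X s t (if u then (if v then lat m z + unit_step m' i + unit_step m j
       else lat m z + unit_step m' i) else (if v then lat m z + unit_step m j else lat m z)))|
     <= C * (2^-1 ^+ m' * (2^-1 `^ be) ^+ m).
Proof.
move=> be0 be1 Lk hev K.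
have [C C0 [n0 hn0]] := approx_limit (K + 2).
exists (1 + 4 * C); first by rewrite addr_ge0// mulr_ge0.
have K1 : 0 <= `|K| by [].
exists (maxn (maxn M2 (Num.truncn `|K|).+1) (maxn n0 n1)) => m; rewrite !geq_max => /andP[/andP[mM2 mK] /andP[mn0 mn1]].
move=> s t s0 st tT z zK i j m' m'm.
have t0 := le_trans s0 st.
pose n := (Lam * m)%N.
have mn : (m <= n)%N by rewrite /n leq_pmull.
have rng := ticks_range n s t0 tT.
have zr : forall i, `|z i| <= (m * 2 ^ m)%:Z.
  apply: lattice_range zK _; apply: le_trans (ler_norm _) _.
  have /andP[_ /ltW hh] := truncn_itv K1; apply: le_trans hh _; by rewrite ler_nat.
have [_ /(_ m'm)] := hev m n mM2 (leq_trans mn1 mn) (leqnn _) _ _ rng z zr i j m'.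
pose pt (u v : bool) : V := if u then (if v then lat m z + unit_step m' i + unit_step m j
       else lat m z + unit_step m' i) else (if v then lat m z + unit_step m j else lat m z).
have u1 m'' i' : `|unit_step m'' i' : V| <= 1 by rewrite norm_unit_step half_pow_le1.
have ptK u v : `|pt u v| <= K + 2.
  rewrite /pt; case: u; case: v.
  - apply: le_trans (ler_normD _ _) _; have := ler_normD (lat m z) (unit_step m' i : V).
    by have := u1 m j; have := u1 m' i; move: zK; lra.
  - by apply: le_trans (ler_normD _ _) _; have := u1 m' i; move: zK; lra.
  - by apply: le_trans (ler_normD _ _) _; have := u1 m j; move: zK; lra.
  - by move: zK; lra.
have er u v : `|approx n s t (pt u v) - X s t (pt u v)| <= C * (2^-1 ^+ m' * (2^-1 `^ be) ^+ m).
  apply: le_trans (hn0 n (leq_trans mn0 mn) s t _ s0 st tT (ptK u v)) _; apply: ler_wpM2l => //.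
  apply: (@le_trans _ _ (2^-1 ^+ m * 2^-1 ^+ m)).
    rewrite /n mulnC exprM (powR_exprn _ _ (ltW (e0 m))) -(powR_mulrn Lam (powR_ge0 _ _)) -powRrM.
    rewrite -expr2 -(powR_mulrn 2 (ltW (e0 m))); apply: half_powR_le.
    by rewrite mulrC.
  apply: ler_pM; [exact: ltW|exact: ltW|exact: half_pow_mono|].
  rewrite -powR_exprn; last exact: ltW.
  by rewrite -[leLHS](powRr1 (ltW (e0 m))); exact: half_powR_le.
rewrite -/(pt _ _).
pose D u v := approx n s t (pt u v) - X s t (pt u v).
move=> h3.
have -> : rect id (fun u v => X s t (pt u v)) = rect id (fun u v => approx n s t (pt u v)) - (D true true - D true false - D false true + D false false).
  exact: rect_gap.
apply: le_trans (ler_normB _ _) _.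
apply: le_trans (lerD h3 (ler_normD _ _)) _; apply: le_trans (lerD (lexx _) (lerD (ler_normB _ _) (lexx _))) _.
apply: le_trans (lerD (lexx _) (lerD (lerD (ler_normB _ _) (lexx _)) (lexx _))) _.
apply: le_trans (lerD (lexx _) (lerD (lerD (lerD (er true true) (er true false)) (er false true)) (er false false))) _.
by rewrite le_eqVlt; apply/orP; left; apply/eqP; ring.
Qed.

End limit_flow.

(** * Continuity and inversion of the limit flow *)

Lemma holder_product (R : realType) (C A p q h x y : R) : 0 <= C -> 0 <= A -> 0 < p -> 0 < q -> 0 < h -> 0 <= x -> 0 <= y ->
  y <= A * x `^ h -> C * x `^ p * y `^ q <= C * A `^ q * x `^ (p + q * h).
Proof.
move=> C0 A0 p0 q0 h0 x0 y0 yx.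
have -> : x `^ (p + q * h) = x `^ p * (x `^ h) `^ q.
  by rewrite -powRrM (mulrC h) powRD// gt_eqF// addr_gt0// mulr_gt0.
rewrite -[leLHS]mulrA -[leRHS]mulrA; apply: ler_wpM2l => //; rewrite [leRHS]mulrCA; apply: ler_wpM2l; first exact: powR_ge0.
by rewrite -(powRM _ A0 (powR_ge0 _ _)); apply: ge0_ler_powR_base => //; exact: ltW.
Qed.

Section solution_flow.
Context {R : realType} {d : nat}.
Local Notation V := 'rV[R]_d.
Variables (T rho al h gm : R).
Hypotheses (T0 : 0 < T) (rho0 : 0 < rho) (al0 : 0 < al) (h0 : 0 < h) (gm0 : 0 < gm).

(* The last clause is uniqueness for the integral equation in the nonlinear Young sense. *)
Record solution_flow (W : R -> V) (psi : R -> R -> V -> V) (X : R -> R -> V -> V) : Prop := SolutionFlow {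
  sf_refl : forall s x, 0 <= s -> s <= T -> X s s x = x;
  sf_flow : forall s q t x, 0 <= s -> s <= q -> q <= t -> t <= T -> X s t x = X q t (X s q x);
  sf_close : exists2 C, 0 <= C & forall s t x, 0 <= s -> s <= t -> t <= T -> `|X s t x - x| <= C * (t - s) `^ h;
  sf_holder : forall K, exists2 C, 0 <= C & exists M, forall s t x y, 0 <= s -> s <= t -> t <= T ->
    `|x| <= K -> `|y| <= K -> `|x - y| <= 2^-1 ^+ M -> `|X s t x - X s t y| <= C * `|x - y| `^ gm;
  sf_expansion : exists2 C, 0 <= C & forall s t x, 0 <= s -> s <= t -> t <= T ->
    `|X s t x - x - (W t - W s) - psi s t x| <= C * (t - s) `^ (rho + al * h);
  sf_unique : forall s t E K (Y : R -> V), 0 <= s -> s <= t -> t <= T -> 0 <= E ->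
    (forall u, s <= u -> u <= t -> `|Y u| <= K) ->
    (forall u v, s <= u -> u <= v -> v <= t ->
      `|Y v - Y u - (W v - W u) - psi u v (Y u)| <= E * (v - u) `^ (rho + al * h)) ->
    Y t = X s t (Y s) }.

(** Joint uniform continuity on bounded sets, a quantitative form of [continuous_stx] that passes
    directly through time reversal. *)
Definition locally_uniform (X : R -> R -> V -> V) := forall K e, 0 < e -> exists2 dl, 0 < dl &
  forall s t x s' t' x', ordered_times T s t -> ordered_times T s' t' -> `|x| <= K -> `|x'| <= K ->
  `|s - s'| <= dl -> `|t - t'| <= dl -> `|x - x'| <= dl -> `|X s t x - X s' t' x'| <= e.

Lemma powR_small (c p e : R) : 0 <= c -> 0 < p -> 0 < e ->
  exists2 dl, 0 < dl & forall u, 0 <= u -> u <= dl -> c * u `^ p <= e.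
Proof.
move=> c0 p0 e0; have c1 : 0 < c + 1 by rewrite ltr_wpDl.
exists ((e / (c + 1)) `^ p^-1); first by rewrite powR_gt0// divr_gt0.
move=> u u0 ud; have ec : 0 <= e / (c + 1) by rewrite divr_ge0// ltW.
have : u `^ p <= e / (c + 1).
  have -> : e / (c + 1) = ((e / (c + 1)) `^ p^-1) `^ p by rewrite -powRrM mulVf ?powRr1// gt_eqF.
  by apply: ge0_ler_powR_base => //; exact: ltW.
rewrite ler_pdivlMr// => H; apply: le_trans H; rewrite mulrC; apply: ler_wpM2l; first exact: powR_ge0.
by rewrite lerDl.
Qed.

Lemma locally_uniform_stx X : locally_uniform X -> continuous_stx T X.
Proof.
move=> H; apply/subspace_continuousP => -[[s t] x] /= A.
apply/cvgrPdist_le => e e0; have [dl dl0 hdl] := H (`|x| + 1) e e0.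
apply/nbhs_ballP; exists (Num.min dl 1); first by rewrite /= lt_min dl0 ltr01.
move=> [[s' t'] x'] [[/= b1 b2] b3] /= A'.
move: b1 b2 b3; rewrite -!ball_normE /= => /ltW + /ltW + /ltW.
rewrite !le_min => /andP[b1 _] /andP[b2 _] /andP[b3 b4].
apply: hdl => //; first by rewrite lerDl.
have := ler_normB x (x - x'); rewrite opprB addrC subrK; lra.
Qed.

Section one_flow.
Variables (W : R -> V) (psi : R -> R -> V -> V) (X : R -> R -> V -> V).
Hypothesis sf : solution_flow W psi X.

(** Both flows are compared on the common interval [[a, b]], from the later start to the earlier
    end: cutting off the ends costs [eta] twice for each flow, the initial points once, hence
    [e / 5]. If the intervals do not meet, both are short and both flows are near the identity. *)
Lemma solution_flow_uniform : locally_uniform X.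
Proof.
move=> K e e0; have [CA CA0 hC] := sf_close sf.
pose K1 := K + CA * T `^ h; have B0 : 0 <= CA * T `^ h by rewrite mulr_ge0// powR_ge0.
have [C C0 [M hM]] := sf_holder sf K1.
pose eta := e / 5; have eta0 : 0 < eta by rewrite divr_gt0.
have [d1 d10 h1] := powR_small C0 gm0 eta0.
have m0 : 0 < Num.min d1 (Num.min (2^-1 ^+ M) eta) by rewrite !lt_min d10 half_pow_gt0 eta0.
have [d2 d20 h2] := powR_small CA0 h0 m0.
exists (Num.min d2 (Num.min d1 (Num.min (2^-1 ^+ M) eta))); first by rewrite !lt_min d20 d10 half_pow_gt0 eta0.
have KK1 : K <= K1 by rewrite lerDl.
have h2' u : 0 <= u -> u <= d2 -> [/\ CA * u `^ h <= d1, CA * u `^ h <= 2^-1 ^+ M & CA * u `^ h <= eta].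
  by move=> u0 ud; have := h2 u u0 ud; rewrite !le_min => /and3P[].
have nb s t x : 0 <= s -> s <= t -> t <= T -> `|x| <= K -> `|X s t x| <= K1.
  move=> s0 st tT xK; rewrite -[X s t x](subrK x); apply: le_trans (ler_normD _ _) _.
  rewrite addrC; apply: lerD => //; apply: le_trans (hC s t x s0 st tT) _; apply: ler_wpM2l => //.
  by apply: ge0_ler_powR_base; [exact: ltW|rewrite subr_ge0|move: s0 tT; lra].
have sub s a b t x : 0 <= s -> s <= a -> a <= b -> b <= t -> t <= T -> a - s <= d2 -> t - b <= d2 -> `|x| <= K ->
   `|X s t x - X a b x| <= eta + eta.
  move=> s0 sa ab bt tT as_ tb xK; have a0 := le_trans s0 sa; have sb := le_trans sa ab.
  have bT := le_trans bt tT; have aT := le_trans ab bT; have b0 := le_trans a0 ab.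
  rewrite (sf_flow sf x s0 sb bt tT) -(subrKA (X s b x)); apply: le_trans (ler_normD _ _) _.
  have i1 : 0 <= t - b by rewrite subr_ge0.
  have i2 : 0 <= a - s by rewrite subr_ge0.
  apply: lerD.
    by apply: le_trans (hC b t _ b0 bt tT) _; have [] := h2' _ i1 tb.
  have [j1 j2 j3] := h2' _ i2 as_.
  have k1 := hC s a x s0 sa aT.
  rewrite (sf_flow sf x s0 sa ab bT); apply: le_trans (hM a b _ _ a0 ab bT _ _ _) _.
  - exact: nb.
  - exact: le_trans KK1.
  - exact: le_trans k1 j2.
  - by apply: h1 => //; exact: le_trans k1 j1.
move=> s t x s' t' x' [s0 st tT] [s'0 st' tT'] xK xK'; rewrite !le_min => /andP[ss _] /andP[tt _].
move=> /and4P[_ xx1 xx2 xx3].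
have eE : e = (eta + eta) + eta + (eta + eta) by rewrite /eta; field.
have [ss1 ss2] : s - s' <= d2 /\ s' - s <= d2.
  by split; apply: le_trans ss; [exact: ler_norm|rewrite distrC; exact: ler_norm].
have [tt1 tt2] : t - t' <= d2 /\ t' - t <= d2.
  by split; apply: le_trans tt; [exact: ler_norm|rewrite distrC; exact: ler_norm].
have [a [sa sa' as1 as2 aE]] : exists a, [/\ s <= a, s' <= a, a - s <= d2, a - s' <= d2 & a = s \/ a = s'].
  by case: (leP s s') => [i|/ltW i]; [exists s'; split => //; [rewrite subrr ltW|right]|exists s; split => //; [rewrite subrr ltW|left]].
have [b [bt bt' tb1 tb2 bE]] : exists b, [/\ b <= t, b <= t', t - b <= d2, t' - b <= d2 & b = t \/ b = t'].
  by case: (leP t t') => [i|/ltW i]; [exists t; split => //; [rewrite subrr ltW|left]|exists t'; split => //; [rewrite subrr ltW|right]].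
have [ab|ba] := leP a b.
  have a0 := le_trans s0 sa; have bT := le_trans bt tT.
  rewrite (_ : X s t x - X s' t' x' = (X s t x - X a b x) + (X a b x - X a b x') - (X s' t' x' - X a b x')); last first.
    by apply/rowP => i; rewrite !mxE; ring.
  apply: le_trans (ler_normB _ _) _; apply: le_trans (lerD (ler_normD _ _) (lexx _)) _.
  rewrite eE; apply: lerD; last exact: sub.
  apply: lerD; first exact: sub.
  apply: le_trans (hM a b x x' a0 ab bT _ _ xx2) _; [exact: le_trans KK1|exact: le_trans KK1|].
  exact: h1.
have [q1 q2] : t - s <= d2 /\ t' - s' <= d2.
  case: aE bE ba => ->; case=> -> ba.
  - by move: (lt_le_trans ba st); rewrite ltxx.
  - by split; [apply: le_trans tt1; rewrite lerD2l lerN2|apply: le_trans ss1; rewrite lerD2r]; exact: ltW.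
  - by split; [apply: le_trans ss2; rewrite lerD2r|apply: le_trans tt2; rewrite lerD2l lerN2]; exact: ltW.
  - by move: (lt_le_trans ba st'); rewrite ltxx.
have i1 : 0 <= t - s by rewrite subr_ge0.
have i2 : 0 <= t' - s' by rewrite subr_ge0.
have [_ _ j1] := h2' _ i1 q1; have [_ _ j2] := h2' _ i2 q2.
have k1 := hC s t x s0 st tT; have k2 := hC s' t' x' s'0 st' tT'.
rewrite (_ : X s t x - X s' t' x' = (X s t x - x) + (x - x') - (X s' t' x' - x')); last by apply/rowP => i; rewrite !mxE; ring.
apply: le_trans (ler_normB _ _) _; apply: le_trans (lerD (ler_normD _ _) (lexx _)) _.
by move: k1 k2 j1 j2 xx3 eE eta0; lra.
Qed.

End one_flow.

(** * Inversion by time reversal *)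

Section reversal.
Variables (W W' : R -> V) (psi psi' : R -> R -> V -> V) (X X' : R -> R -> V -> V) (Cd : R).
Hypotheses (sf : solution_flow W psi X) (sf' : solution_flow W' psi' X').
Hypothesis Cd0 : 0 <= Cd.
Hypothesis psi_holder : forall u v z z', u <= v -> `|psi u v z - psi u v z'| <= Cd * (v - u) `^ rho * `|z - z'| `^ al.
Hypothesis W_rev : forall u, 0 <= u -> u <= T -> W' u = - W (T - u).
Hypothesis psi_rev : forall u v z, psi' u v z = psi (T - v) (T - u) (- z).

(** The reflected backward path [- X s (T - u) x] has the expansion for the reversed data: the drift
    is now frozen at the later end of the original interval, which changes it by order [theta].
    Uniqueness for the reversed flow identifies the path. *)
Lemma reversed_flow s t x : ordered_times T s t -> X' (T - t) (T - s) (- X s t x) = - x.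
Proof.
move=> [s0 st tT]; have sT := le_trans st tT; have t0 := le_trans s0 st.
have [CA CA0 hC] := sf_close sf; have [CX CX0 hX] := sf_expansion sf.
have hth : 0 < rho + al * h by rewrite addr_gt0// mulr_gt0.
pose E := CX + Cd * CA `^ al.
have E0 : 0 <= E by rewrite addr_ge0// mulr_ge0// powR_ge0.
pose Y u := - X s (T - u) x.
have e1 : Y (T - s) = - x by rewrite /Y subKr (sf_refl sf).
have e2 : Y (T - t) = - X s t x by rewrite /Y subKr.
rewrite -e1 -e2; symmetry.
have i1 : 0 <= T - t by rewrite subr_ge0.
have i2 : T - t <= T - s by rewrite lerD2l lerN2.
have i3 : T - s <= T by rewrite gerBl.
apply: (@sf_unique _ _ _ sf' _ _ E (`|x| + CA * T `^ h) Y i1 i2 i3 E0).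
  move=> u tu us; rewrite /Y normrN -[X s _ x](subrK x); apply: le_trans (ler_normD _ _) _.
  rewrite addrC; apply: lerD => //; apply: le_trans (hC _ _ x s0 _ _) _; [move: us; lra|move: tu i1; lra|].
  apply: ler_wpM2l => //.
  by apply: ge0_ler_powR_base; [exact: ltW|move: us; lra|move: s0 tu i1; lra].
move=> u v tu uv vs.
have u0 : 0 <= u := le_trans i1 tu; have uT : u <= T by move: uv vs i3; lra.
have v0 := le_trans u0 uv; have vT := le_trans vs i3.
rewrite (W_rev u0 uT) (W_rev v0 vT) psi_rev /Y opprK.
pose u' := T - v; pose v' := T - u; rewrite -/u' -/v'.
have su' : s <= u' by rewrite /u'; move: vs; lra.
have uv' : u' <= v' by rewrite /u' /v'; lra.
have vt' : v' <= t by rewrite /v'; move: tu; lra.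
have u'0 := le_trans s0 su'; have v'T := le_trans vt' tT.
have -> : v - u = v' - u' by rewrite /u' /v'; ring.
rewrite (sf_flow sf x s0 su' uv' v'T); set z := X s u' x.
have k1 := hX u' v' z u'0 uv' v'T; have k2 := hC u' v' z u'0 uv' v'T.
have k3 := psi_holder z (X u' v' z) uv'.
have vu : 0 <= v' - u' by rewrite subr_ge0.
have k4 : Cd * (v' - u') `^ rho * `|z - X u' v' z| `^ al <= Cd * CA `^ al * (v' - u') `^ (rho + al * h).
  by apply: holder_product => //; rewrite distrC.
rewrite (_ : - z + X u' v' z - (- W u' - - W v') - psi u' v' (X u' v' z) =
   (X u' v' z - z - (W v' - W u') - psi u' v' z) + (psi u' v' z - psi u' v' (X u' v' z))); last first.
  by apply/rowP => i; rewrite !mxE; ring.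
apply: le_trans (ler_normD _ _) _; rewrite mulrDl; apply: lerD => //.
exact: le_trans k3 k4.
Qed.

End reversal.

Lemma reversed_inverse W W' psi psi' X X' Cd : solution_flow W psi X -> solution_flow W' psi' X' -> 0 <= Cd ->
  (forall u v z z', u <= v -> `|psi u v z - psi u v z'| <= Cd * (v - u) `^ rho * `|z - z'| `^ al) ->
  (forall u, 0 <= u -> u <= T -> W' u = - W (T - u)) ->
  (forall u v z, psi' u v z = psi (T - v) (T - u) (- z)) ->
  inverse_family T X (fun s t y => - X' (T - t) (T - s) (- y)).
Proof.
move=> sf sf' Cd0 ph Wr pr s t /[dup] o [s0 st tT]; split=> x.
  by rewrite (reversed_flow sf sf' Cd0 ph Wr pr)// opprK.
have o' : ordered_times T (T - t) (T - s).
  by split; [rewrite subr_ge0|rewrite lerD2l lerN2|rewrite gerBl].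
have := reversed_flow sf' sf Cd0 _ _ _ (- x) o'; rewrite !subKr opprK; apply.
- move=> u v z z' uv; rewrite !pr.
  have -> : v - u = (T - u) - (T - v) by ring.
  have -> : `|z - z'| = `|- z - - z'| by rewrite -opprD normrN.
  by apply: ph; rewrite lerD2l lerN2.
- by move=> u u0 uT; rewrite Wr ?subKr ?opprK// ?subr_ge0// gerBl.
- by move=> u v z; rewrite pr !subKr opprK.
Qed.

Lemma reversed_uniform X' : locally_uniform X' -> locally_uniform (fun s t y => - X' (T - t) (T - s) (- y)).
Proof.
move=> H K e e0; have [dl dl0 hdl] := H K e e0; exists dl => // s t x s' t' x' [s0 st tT] [s0' st' tT'] xK xK' ss tt xx.
rewrite -opprD normrN; apply: hdl; rewrite ?normrN//.
- by split; [rewrite subr_ge0|rewrite lerD2l lerN2|rewrite gerBl].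
- by split; [rewrite subr_ge0|rewrite lerD2l lerN2|rewrite gerBl].
- by rewrite (_ : T - t - (T - t') = - (t - t')) ?normrN//; ring.
- by rewrite (_ : T - s - (T - s') = - (s - s')) ?normrN//; ring.
- by rewrite -opprD normrN.
Qed.

End solution_flow.

(** * Differentiability from second differences *)

Section matrix_norm.
Context {R : realType} {m n : nat}.
Implicit Types A : 'M[R]_(m, n).

Lemma mx_entry_le_norm A i j : `|A i j| <= `|A|.
Proof. by rewrite [leRHS]/Num.Def.normr /= mx_normrE; apply: le_trans (le_bigmax _ _ (i, j)). Qed.

Lemma mx_norm_le A c : 0 <= c -> (forall i j, `|A i j| <= c) -> `|A| <= c.
Proof.
by move=> c0 h; rewrite [leLHS]/Num.Def.normr /= mx_normrE; apply: bigmax_le => // -[i j] _ /=.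
Qed.

Lemma mulmx_norm_le (v : 'rV[R]_m) A : `|v *m A| <= m%:R * `|A| * `|v|.
Proof.
apply: norm_le_coord => [|j]; first by rewrite !mulr_ge0.
rewrite mxE; apply: le_trans (ler_norm_sum _ _ _) _.
rewrite -mulrA mulr_natl -[leRHS](_ : \sum_(i < m) (`|A| * `|v|) = _); last by rewrite sumr_const card_ord.
by apply: ler_sum => i _; rewrite normrM mulrC; apply: ler_pM => //; [exact: mx_entry_le_norm|exact: coord_le_norm].
Qed.

Lemma mulmxr_continuous A : continuous (mulmxr A : 'rV[R]_m -> 'rV[R]_n).
Proof.
suff H : (mulmxr A : 'rV[R]_m -> 'rV[R]_n) v @[v --> (0 : 'rV[R]_m)] --> (0 : 'rV[R]_n).
  by apply: continuousfor0_continuous; rewrite /prop_for /continuous_at; move: H; rewrite -[X in _ --> X -> _](mul0mx _ A).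
apply/(@cvgrPdist_lt R 'rV[R]_n 'rV[R]_m (nbhs (0 : 'rV[R]_m)) _ (fun v => v *m A) 0) => e e0.
have c0 : 0 < m%:R * `|A| + 1 by rewrite ltr_wpDl// mulr_ge0.
apply/nbhs_ballP; exists (e / (m%:R * `|A| + 1)); first by rewrite /= divr_gt0.
move=> v; rewrite -ball_normE /= sub0r normrN => hv.
rewrite sub0r normrN; apply: le_lt_trans (mulmx_norm_le _ _) _.
move: hv; rewrite ltr_pdivlMr// => hv; apply: le_lt_trans hv; rewrite mulrC.
by apply: ler_wpM2l => //; rewrite lerDl.
Qed.

End matrix_norm.

(** * First-order Taylor expansion on dyadic scales *)

Section taylor.
Context {R : realType} {d : nat}.
Local Notation V := 'rV[R]_d.
Variable be : R.
Hypotheses (be0 : 0 < be) (be1 : be <= 1).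
Let r : R := 2^-1 `^ be.
Let h2 : 0 < 2^-1 :> R. Proof. by rewrite invr_gt0. Qed.
Let r0 : 0 < r. Proof. exact: powR_gt0. Qed.
Let r1 : r < 1.
Proof. exact: half_powR_lt1. Qed.
Let e0 n : 0 < (2^-1 : R) ^+ n. Proof. exact: half_pow_gt0. Qed.

(** A first-order expansion with remainder of order [1 + be], uniform on bounded sets, together with
    the Hoelder bound for the candidate [g] of the Jacobian. Vectors are rows, so [g] acts from the
    right. *)
Definition taylor (G : V -> V) := exists g : V -> 'M[R]_d, forall K, exists2 C : R, 0 <= C & exists M, forall (m : nat) (x y : V),
  (M <= m)%N -> `|x| <= K -> `|y| <= K -> `|x - y| <= 2^-1 ^+ m ->
  `|G y - G x - (y - x) *m g x| <= C * (2^-1 ^+ m * r ^+ m) /\ `|g x - g y| <= C * r ^+ m.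

(** The inverse flow is a reversed flow conjugated by [x -> - x]; the two signs cancel in the
    derivative. *)
Lemma taylor_opp G : taylor G -> taylor (fun x => - G (- x)).
Proof.
move=> [g hg]; exists (fun x => g (- x)) => K; have [C C0 [M hM]] := hg K; exists C => //; exists M => m x y Mm xK yK xy.
have [|||h1 h3] := hM m (- x) (- y) Mm; rewrite ?normrN// -?opprD ?normrN//.
split => //; have E : - y - - x = - (y - x) by rewrite opprD.
by move: h1; rewrite E mulNmx opprK.
Qed.

Lemma half_pow_small (c e : R) : 0 <= c -> 0 < e -> exists m0, forall m, (m0 <= m)%N -> c * r ^+ m <= e.
Proof.
move=> c0 e0'; have [m0 hm0] := half_powR_small (c / e) be0; exists m0 => m mm.
have := hm0 m mm; rewrite powR_exprn; last exact: ltW.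
by rewrite mulrAC ler_pdivrMr// mul1r.
Qed.

Lemma taylor_C1_holder G : taylor G -> C1_holder be G.
Proof.
move=> [g hg].
have D x : continuous (mulmxr (g x) : V -> V) /\ G \o shift x = cst (G x) + (mulmxr (g x) : V -> V) +o_ (0 : V) id.
  split; first exact: mulmxr_continuous.
  apply/eqaddoP => /= e e0'; have [C C0 [M hM]] := hg (`|x| + 1).
  (* The factor 2 pays for passing from the dyadic scale [2^-m] to [|v|], which exceeds half of
     it. *)
  have [m0 hm0] := half_pow_small (mulr_ge0 C0 (ler0n R 2)) e0'.
  have key (v : V) : `|v| <= 2^-1 ^+ (M + m0) -> `|G (v + x) - G x - (v + x - x) *m g x| <= e * `|v|.
    move=> hv; have [->|v0] := eqVneq v 0; first by rewrite add0r !subrr mul0mx subr0 normr0 mulr0.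
    have vp : 0 < `|v| by rewrite normr_gt0.
    have [m [mM h1 h3]] := dyadic_scale vp hv.
    have hv1 : `|v| <= 1 by apply: le_trans h3 (half_pow_le1 _).
    have [|||k1 _] := hM m x (v + x) (leq_trans (leq_addr _ _) mM).
    - by rewrite lerDl.
    - by apply: le_trans (ler_normD _ _) _; rewrite addrC lerD2l.
    - by rewrite opprD addrCA subrr addr0 normrN.
    apply: le_trans k1 _; have k2 := hm0 m (leq_trans (leq_addl _ _) mM).
    apply: le_trans (ler_wpM2r (ltW vp) k2).
    have k3 : 2^-1 ^+ m <= 2 * `|v| by move: h1; rewrite exprS; lra.
    rewrite (mulrC (2^-1 ^+ m)) -!mulrA; apply: ler_wpM2l => //; rewrite mulrCA; apply: ler_wpM2l => //.
    exact/exprn_ge0/ltW.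
  apply/nbhs_ballP; exists (2^-1 ^+ (M + m0)) => [|v]; first exact: e0.
  rewrite -ball_normE /= sub0r normrN => /ltW /key hk; apply: le_trans hk.
  by rewrite le_eqVlt; apply/orP; left; apply/eqP; congr (`|_|); rewrite addrK -[RHS]addrA -opprD.
have dE x : 'd G x = mulmxr (g x) :> (V -> V) by apply: diff_unique; [exact: (D x).1|exact: (D x).2].
have JE : jacobian G = g.
  apply/funext => x; apply/row_matrixP => i; rewrite !rowE /jacobian mul_rV_lin1.
  by rewrite -[LHS]/(('d G x : V -> V) _) dE.
have H (x0 : V) : exists2 C : R, 0 <= C & \forall x & y \near x0, `|g x - g y| <= C * `|x - y| `^ be.
  have [C C0 [M hM]] := hg (`|x0| + 1); exists (C * 2) => //; first by rewrite mulr_ge0.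
  exists (ball x0 (2^-1 ^+ M.+1), ball x0 (2^-1 ^+ M.+1)) => /=.
    by split; apply/nbhs_ballP; exists (2^-1 ^+ M.+1) => //; exact: e0.
  move=> [x y] /= []; rewrite -!ball_normE /= => /ltW hx /ltW hy.
  have [->|xy] := eqVneq x y; first by rewrite !subrr normr0 mulr_ge0 ?powR_ge0// mulr_ge0.
  have xp : 0 < `|x - y| by rewrite normr_gt0 subr_eq0.
  have hxy : `|x - y| <= 2^-1 ^+ M.
    rewrite -(subrKA x0); apply: le_trans (ler_normD _ _) _; rewrite distrC.
    by move: hx hy; rewrite exprS; lra.
  have [m [mM h1 h3]] := dyadic_scale xp hxy.
  have nb z : `|x0 - z| <= 2^-1 ^+ M.+1 -> `|z| <= `|x0| + 1.
    move=> hz; have := ler_normB x0 (x0 - z); rewrite opprB addrC subrK => hh.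
    by apply: le_trans hh _; rewrite lerD2l; apply: le_trans hz (half_pow_le1 _).
  have [_ k1] := hM m x y mM (nb _ hx) (nb _ hy) h3.
  apply: le_trans k1 _; rewrite -mulrA; apply: ler_wpM2l => //.
  rewrite -powR_exprn; last exact: ltW.
  have k2 : 2^-1 ^+ m <= 2 * `|x - y| by move: h1; rewrite exprS; lra.
  apply: le_trans (ge0_ler_powR_base (ltW be0) (ltW (e0 m)) k2) _.
  rewrite (powRM _ (ler0n R 2) (normr_ge0 _)); apply: ler_wpM2r; first exact: powR_ge0.
  by rewrite -[leRHS](powRr1 (ler0n R 2)); apply: ler_powR => //; rewrite ler1n.
split.
- by move=> x; apply/diff_locallyP; rewrite (dE x); exact: D.
- rewrite JE => x; apply/(@cvgrPdist_lt R 'M[R]_d V (nbhs x) _ g (g x)) => e e0'; have [C C0 [M hM]] := hg (`|x| + 1).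
  have e2 : 0 < e / 2 by rewrite divr_gt0.
  have [m0 hm0] := half_pow_small C0 e2.
  apply/nbhs_ballP; exists (2^-1 ^+ (M + m0)) => [|y]; first exact: e0.
  rewrite -ball_normE /= => /ltW hy.
  have [||||_ k] := hM (M + m0)%N x y => //; first exact: leq_addr.
  + by rewrite lerDl.
  + have := ler_normB x (x - y); rewrite opprB addrC subrK => hh.
    by apply: le_trans hh _; rewrite lerD2l; apply: le_trans hy (half_pow_le1 _).
  apply: le_lt_trans k _; apply: le_lt_trans (hm0 _ (leq_addl _ _)) _; move: e0'; lra.
- by rewrite JE => x0; have [C _ hC] := H x0; exists C.
Qed.

Definition second_differences (G : V -> V) := forall K, exists2 C : R, 0 <= C & exists M, forall m, (M <= m)%N ->
  forall z : 'I_d -> int, `|lat m z : V| <= K -> forall i j m', (m' <= m)%N ->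
  `|rect id (fun u v => G (if u then (if v then lat m z + unit_step m' i + unit_step m j
       else lat m z + unit_step m' i) else (if v then lat m z + unit_step m j else lat m z)))|
     <= C * (2^-1 ^+ m' * r ^+ m).

Lemma geometric_lim (u : nat -> R) (C q : R) (n0 : nat) : 0 <= C -> 0 < q -> q < 1 ->
  (forall n, (n0 <= n)%N -> `|u n.+1 - u n| <= C * q ^+ n) ->
  forall n, (n0 <= n)%N -> `|u n - lim (u m @[m --> \oo])| <= C / (1 - q) * q ^+ n.
Proof.
move=> C0 q0 q1 hu; have [l hl] := geometric_limit C0 (ltW q0) q1 hu.
suff -> : lim (u m @[m --> \oo]) = l by [].
apply: cvg_lim => //; apply/cvgrPdist_le => eps eps0.
have qn : q ^+ n @[n --> \oo] --> (0 : R) by apply: cvg_expr; rewrite ger0_norm// ltW.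
have c0 : 0 < C / (1 - q) + 1 by rewrite ltr_wpDl// divr_ge0// subr_ge0 ltW.
have ec : 0 < eps / (C / (1 - q) + 1) by rewrite divr_gt0.
move/cvgrPdist_le : qn => /(_ _ ec) [n2 _ hn2].
exists (maxn n0 n2) => // k /=; rewrite geq_max => /andP[k0 k2].
rewrite distrC; apply: le_trans (hl k k0) _; have := hn2 k k2.
rewrite sub0r normrN ger0_norm ?exprn_ge0 ?(ltW q0)// ler_pdivlMr// => hh.
apply: le_trans hh; rewrite mulrC; apply: ler_wpM2l; first exact/exprn_ge0/ltW.
by rewrite lerDl.
Qed.

Section quotients.
Variable G : V -> V.
Hypotheses (cG : continuous G) (sG : second_differences G).

(** Difference quotients at scale [2^-j]. Their limits, the partial derivatives, form the rows of
    [g]. *)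
Let q (j : nat) (i : 'I_d) (x : V) : V := 2 ^+ j *: (G (x + unit_step j i) - G x).
Let g (x : V) : 'M[R]_d := \matrix_(i, l) lim (q n i x ord0 l @[n --> \oo]).

Lemma quotient_continuous j i : continuous (q j i).
Proof.
move=> x; suff H : {for x, continuous (fun x : V => G (x + unit_step j i) - G x)} by exact: (continuousZl_tmp H).
apply: (@continuousB _ V V (fun x => G (x + unit_step j i)) G); last exact: cG.
by apply: (@continuous_comp V V V (fun x : V => x + unit_step j i) G); [exact: continuous_addr|exact: cG].
Qed.

(** Chaining applied to the quotient itself. The factor [2^m'] cancels the coarse length in the
    mixed difference, so the constant does not depend on [m']; this is why the second differences
    have two scales. *)
Lemma quotient_holder K : exists2 C : R, 0 <= C & exists M, forall m' m i (x y : V), (M <= m)%N -> (m' <= m)%N ->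
  `|x| <= K -> `|y| <= K -> `|x - y| <= 2^-1 ^+ m -> `|q m' i x - q m' i y| <= C * r ^+ m.
Proof.
have [C C0 [M hM]] := sG (K + 1).
exists (d%:R * (1 + 2 * (1 - r)^-1) * C); first by rewrite !mulr_ge0// addr_ge0// mulr_ge0// invr_ge0 subr_ge0 ltW.
exists M => m' m i x y Mm m'm xK yK xy.
have hF k : (maxn M m' <= k)%N -> forall z : 'I_d -> int, `|lat k z : V| <= K + 1 ->
    forall j, `|q m' i (lat k z + unit_step k j) - q m' i (lat k z)| <= C * r ^+ k.
  rewrite geq_max => /andP[Mk mk] z zK j; have := hM k Mk z zK i j m' mk.
  set w := rect _ _; move=> hw.
  have -> : q m' i (lat k z + unit_step k j) - q m' i (lat k z) = 2 ^+ m' *: w.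
    rewrite /q /w /rect -scalerBr; congr (_ *: _).
    rewrite (addrAC (lat k z) (unit_step k j)); apply/rowP => l; rewrite !mxE; ring.
  rewrite normrZ ger0_norm ?exprn_ge0//; apply: le_trans (ler_wpM2l _ hw) _; first exact: exprn_ge0.
  have ab (a b : R) : a * b = 1 -> b * (C * (a * r ^+ k)) = C * r ^+ k by move=> ab; rewrite -[RHS]mul1r -ab; ring.
  by rewrite (ab _ _ (half_powM m')).
apply: (chaining r0 r1 C0 hF) => //; first exact: quotient_continuous.
- by rewrite geq_max Mm.
- by rewrite addrK.
- by rewrite addrK.
Qed.

(** At a lattice point, the change from scale [j] to [j + 1] is [2^j] times the second difference
    with two equal steps [2^-(j + 1)]. The Hoelder bound on the quotients moves it to any point. *)
Lemma quotient_step K : exists2 C : R, 0 <= C & exists M, forall j i (x : V), (M <= j)%N -> `|x| <= K ->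
  `|q j.+1 i x - q j i x| <= C * r ^+ j.
Proof.
have [C C0 [M hM]] := sG (K + 1); have [C1 C10 [M1 hM1]] := quotient_holder (K + 1).
exists (C1 + C + C1); first by rewrite !addr_ge0.
exists (maxn M M1) => j i x; rewrite geq_max => /andP[Mj M1j] xK.
pose z := flr j.+1 x; pose p : V := lat j.+1 z.
have px : `|p - x| <= 2^-1 ^+ j.+1 by exact: lat_flr_close.
have pK : `|p| <= K + 1.
  by rewrite -(subrK x p); apply: le_trans (ler_normD _ _) _; rewrite addrC; apply: lerD => //; apply: le_trans px (half_pow_le1 _).
have xK1 : `|x| <= K + 1 by apply: le_trans xK _; rewrite lerDl.
have rr : r ^+ j.+1 <= r ^+ j by rewrite exprS; apply: ler_piMl; [apply/exprn_ge0/ltW|exact: ltW].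
have a1 : `|q j i p - q j i x| <= C1 * r ^+ j.
  apply: le_trans (hM1 j j.+1 i p x _ _ pK xK1 px) _; [exact: leqW|exact: leqW|exact: ler_wpM2l].
have a2 : `|q j.+1 i p - q j.+1 i x| <= C1 * r ^+ j.
  apply: le_trans (hM1 j.+1 j.+1 i p x _ _ pK xK1 px) _; [exact: leqW|by []|exact: ler_wpM2l].
have a3 : `|q j i p - q j.+1 i p| <= C * r ^+ j.
  have := hM j.+1 (leqW Mj) z pK i i j.+1 (leqnn _); set w := rect _ _ => hw.
  have uE : unit_step j i = unit_step j.+1 i + unit_step j.+1 i :> V.
    by rewrite /unit_step -scalerDl; congr (_ *: _); rewrite exprS; field.
  have -> : q j i p - q j.+1 i p = 2 ^+ j *: w.
    rewrite /q /w /rect uE addrA exprS; apply/rowP => l; rewrite !mxE; ring.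
  rewrite normrZ ger0_norm ?exprn_ge0//; apply: le_trans (ler_wpM2l _ hw) _; first exact: exprn_ge0.
  rewrite mulrCA; apply: ler_wpM2l => //; rewrite mulrA; apply: le_trans rr.
  apply: ler_piMl; first exact/exprn_ge0/ltW.
  rewrite exprS mulrCA (mulrC (2 ^+ j)) half_powM mulr1; lra.
rewrite (_ : q j.+1 i x - q j i x = (q j i p - q j i x) - (q j i p - q j.+1 i p) - (q j.+1 i p - q j.+1 i x)); last first.
  by apply/rowP => l; rewrite !mxE; ring.
apply: le_trans (ler_normB _ _) _; apply: le_trans (lerD (ler_normB _ _) (lexx _)) _.
by rewrite !mulrDl !lerD.
Qed.

Lemma quotient_limit K : exists2 C : R, 0 <= C & exists M, forall j i (x : V), (M <= j)%N -> `|x| <= K ->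
  `|q j i x - row i (g x)| <= C * r ^+ j.
Proof.
have [C C0 [M hM]] := quotient_step K.
have C1 : 0 <= C / (1 - r) by rewrite divr_ge0// subr_ge0 ltW.
exists (C / (1 - r)) => //; exists M => j i x Mj xK.
apply: norm_le_coord => [|l]; first by rewrite mulr_ge0// exprn_ge0// ltW.
rewrite rowB [in X in _ - X]mxE [in X in _ - X]mxE.
apply: (geometric_lim (u := fun n => q n i x ord0 l) C0 r0 r1 _ Mj) => n Mn.
by rewrite -rowB; apply: le_trans (coord_le_norm _ l) _; exact: hM.
Qed.

Lemma gradient_holder K : exists2 C : R, 0 <= C & exists M, forall m (x y : V), (M <= m)%N ->
  `|x| <= K -> `|y| <= K -> `|x - y| <= 2^-1 ^+ m -> `|g x - g y| <= C * r ^+ m.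
Proof.
have [C1 C10 [M1 hM1]] := quotient_holder K; have [C2 C20 [M2 hM2]] := quotient_limit K.
have C0 : 0 <= C1 + C2 + C2 by rewrite !addr_ge0.
exists (C1 + C2 + C2) => //; exists (maxn M1 M2) => m x y; rewrite geq_max => /andP[M1m M2m] xK yK xy.
apply: mx_norm_le => [|i l]; first by rewrite mulr_ge0// exprn_ge0// ltW.
apply: (@le_trans _ _ `|row i (g x) - row i (g y)|).
  by have := coord_le_norm (row i (g x) - row i (g y)) l; rewrite !mxE.
rewrite (_ : _ - _ = (q m i x - q m i y) - (q m i x - row i (g x)) + (q m i y - row i (g y))); last first.
  by move: (row i (g x)) (row i (g y)) (q m i x) (q m i y) => z1 z2 z3 z4; apply/rowP => k; rewrite !mxE; ring.
apply: le_trans (ler_normD _ _) _; apply: le_trans (lerD (ler_normB _ _) (lexx _)) _.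
rewrite !mulrDl; apply: lerD; last exact: hM2.
by apply: lerD; [exact: hM1|exact: hM2].
Qed.

Lemma norm_delta i : `|delta_mx ord0 i : V| = 1.
Proof. by have := norm_unit_step (R := R) 0 i; rewrite /unit_step expr0 scale1r. Qed.

Lemma row_gradient_le i (x y : V) : `|row i (g x) - row i (g y)| <= `|g x - g y|.
Proof.
apply: norm_le_coord => // l; apply: le_trans (mx_entry_le_norm (g x - g y) i l).
by rewrite !mxE.
Qed.

(** The segment is cut into [k] steps of length [2^-n], on each of which the increment is close to
    the gradient at [x]. The bound is proportional to the length and free of [n], so continuity of
    [G] yields every real [tau]. *)
Lemma direction_up K : exists2 C : R, 0 <= C & exists M, forall m i (x : V) (tau : R), (M <= m)%N -> `|x| <= K ->
  0 <= tau -> tau <= 2^-1 ^+ m ->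
  `|G (x + tau *: delta_mx ord0 i) - G x - tau *: row i (g x)| <= C * (2^-1 ^+ m * r ^+ m).
Proof.
have [C1 C10 [M1 hM1]] := gradient_holder (K + 1); have [C2 C20 [M2 hM2]] := quotient_limit (K + 1).
have C0 : 0 <= C1 + C2 by rewrite addr_ge0.
exists (C1 + C2) => //; exists (maxn M1 M2) => m i x tau; rewrite geq_max => /andP[M1m M2m] xK t0 tm.
pose v := row i (g x); rewrite -/v.
have rm n : (m <= n)%N -> r ^+ n <= r ^+ m.
  by move=> mn; rewrite -(subnK mn) exprD; apply: ler_piMl; [exact/exprn_ge0/ltW|apply: exprn_ile1; exact: ltW].
have xK1 : `|x| <= K + 1 by apply: le_trans xK _; rewrite lerDl.
have U n k : (m <= n)%N -> k%:R * 2^-1 ^+ n <= 2^-1 ^+ m :> R ->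
    `|G (x + (k%:R * 2^-1 ^+ n) *: delta_mx ord0 i) - G x - (k%:R * 2^-1 ^+ n) *: v|
      <= k%:R * 2^-1 ^+ n * ((C1 + C2) * r ^+ m).
  move=> mn; elim: k => [|k IH] km; first by rewrite !mul0r !scale0r addr0 subrr subr0 normr0.
  have en := e0 n.
  have km' : k%:R * 2^-1 ^+ n <= 2^-1 ^+ m :> R.
    by apply: le_trans km; apply: ler_wpM2r; [exact: ltW|rewrite ler_nat].
  pose y := x + (k%:R * 2^-1 ^+ n) *: delta_mx ord0 i.
  have yE : x + (k.+1%:R * 2^-1 ^+ n) *: delta_mx ord0 i = y + unit_step n i.
    by rewrite /y /unit_step -addrA -scalerDl -natr1 mulrDl mul1r.
  have k0 : 0 <= k%:R * 2^-1 ^+ n :> R by apply: mulr_ge0 => //; exact: ltW.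
  have xy : `|x - y| <= 2^-1 ^+ m.
    rewrite /y opprD addrA subrr add0r normrN normrZ ger0_norm//.
    by rewrite norm_delta mulr1.
  have yK : `|y| <= K + 1.
    rewrite -(subrK x y); apply: le_trans (ler_normD _ _) _; rewrite addrC; apply: lerD => //.
    by rewrite distrC; apply: le_trans xy (half_pow_le1 _).
  have qE : G (y + unit_step n i) - G y = 2^-1 ^+ n *: q n i y by rewrite /q scalerA half_powM scale1r.
  rewrite yE.
  have -> : G (y + unit_step n i) - G x - (k.+1%:R * 2^-1 ^+ n) *: v = (G y - G x - (k%:R * 2^-1 ^+ n) *: v)
     + 2^-1 ^+ n *: ((q n i y - row i (g y)) - (row i (g x) - row i (g y))).
    rewrite opprB addrA subrK scalerBr -qE -natr1 mulrDl mul1r scalerDl /v.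
    by move: (2^-1 ^+ n *: _) (_ *: row i (g x)) => z1 z2; apply/rowP => l; rewrite !mxE; ring.
  apply: le_trans (ler_normD _ _) _; have -> : k.+1%:R = k%:R + 1 :> R by rewrite natr1.
  rewrite (mulrDl k%:R) mul1r [leRHS]mulrDl; apply: lerD; first exact: IH.
  rewrite normrZ ger0_norm ?(ltW en)//; apply: ler_wpM2l; first exact: ltW.
  apply: le_trans (ler_normB _ _) _; rewrite addrC mulrDl; apply: lerD.
    by apply: le_trans (row_gradient_le _ _ _) _; exact: hM1.
  apply: le_trans (hM2 n i y (leq_trans M2m mn) yK) _; apply: ler_wpM2l => //; exact: rm.
apply/ler_addgt0Pr => eps eps0.
have eps2 : 0 < eps / 2 by rewrite divr_gt0.
have /(@cvgrPdist_lt R V V (nbhs _) _ G (G (x + tau *: delta_mx ord0 i))) /(_ _ eps2) := @cG (x + tau *: delta_mx ord0 i).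
rewrite -nbhs_ballE => -[del /= del0 hdel].
have v1 : 0 < `|v| + 1 by rewrite ltr_wpDl.
have d2 : 0 < Num.min del (eps / 2 / (`|v| + 1)) by rewrite lt_min del0 divr_gt0.
have [k0 hk0] := half_pow_lt d2.
pose n := (m + k0)%N; pose k := Num.truncn (tau * 2 ^+ n).
have en := e0 n; have p2 : 0 < 2 ^+ n :> R by rewrite exprn_gt0.
have tp : 0 <= tau * 2 ^+ n by rewrite mulr_ge0// ltW.
have hpe := half_powM (R := R) n.
have /andP[k1 k2] := truncn_itv tp; rewrite -/k in k1 k2.
have tE : tau = tau * 2 ^+ n * 2^-1 ^+ n by rewrite -mulrA (mulrC (2 ^+ n)) hpe mulr1.
have a1 : k%:R * 2^-1 ^+ n <= tau.
  by rewrite [leRHS]tE; apply: ler_wpM2r => //; exact: ltW.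
have a2 : tau <= (k%:R + 1) * 2^-1 ^+ n.
  by rewrite [leLHS]tE natr1; apply: ler_wpM2r; exact: ltW.
have a3 : `|tau - k%:R * 2^-1 ^+ n| <= 2^-1 ^+ n.
  by rewrite ger0_norm ?subr_ge0//; move: a2; rewrite mulrDl mul1r; lra.
have enk : 2^-1 ^+ n <= 2^-1 ^+ k0 :> R by apply: half_pow_mono; exact: leq_addl.
move: hk0; rewrite lt_min => /andP[b1 b2].
have hb : ball (x + tau *: delta_mx ord0 i) del (x + (k%:R * 2^-1 ^+ n) *: delta_mx ord0 i).
  rewrite -ball_normE /= opprD addrACA subrr add0r -scalerBl normrZ.
  rewrite norm_delta mulr1.
  by apply: le_lt_trans a3 _; apply: le_lt_trans enk b1.
have h3 := hdel _ hb; have h4 := U n k (leq_addr _ _) (le_trans a1 tm).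
have h5 : `|(tau - k%:R * 2^-1 ^+ n) *: v| <= eps / 2.
  rewrite normrZ; apply: le_trans (ler_wpM2r (normr_ge0 _) (le_trans a3 enk)) _.
  move: b2; rewrite ltr_pdivlMr// mulrDr mulr1 => b2; have := e0 k0; lra.
have h6 : k%:R * 2^-1 ^+ n * ((C1 + C2) * r ^+ m) <= (C1 + C2) * (2^-1 ^+ m * r ^+ m).
  rewrite mulrCA; apply: ler_wpM2l => //; apply: ler_wpM2r; [exact/exprn_ge0/ltW|exact: le_trans a1 tm].
rewrite (_ : _ - _ - _ = (G (x + tau *: delta_mx ord0 i) - G (x + (k%:R * 2^-1 ^+ n) *: delta_mx ord0 i)) +
  (G (x + (k%:R * 2^-1 ^+ n) *: delta_mx ord0 i) - G x - (k%:R * 2^-1 ^+ n) *: v) - (tau - k%:R * 2^-1 ^+ n) *: v); last first.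
  rewrite scalerBl; move: (G _) (G _) (tau *: v) ((k%:R * _) *: v) => z1 z2 z3 z4.
  by apply/rowP => l; rewrite !mxE; ring.
apply: le_trans (ler_normB _ _) _; apply: le_trans (lerD (ler_normD _ _) (lexx _)) _.
move: h3 h4 h5 h6; lra.
Qed.

Lemma direction K : exists2 C : R, 0 <= C & exists M, forall m i (x : V) (tau : R), (M <= m)%N -> `|x| <= K ->
  `|tau| <= 2^-1 ^+ m ->
  `|G (x + tau *: delta_mx ord0 i) - G x - tau *: row i (g x)| <= C * (2^-1 ^+ m * r ^+ m).
Proof.
have [C1 C10 [M1 hM1]] := direction_up (K + 1); have [C2 C20 [M2 hM2]] := gradient_holder (K + 1).
exists (C1 + C2); first by rewrite addr_ge0.
exists (maxn M1 M2) => m i x tau; rewrite geq_max => /andP[M1m M2m] xK tm.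
have em := e0 m; have rm0 : 0 <= 2^-1 ^+ m * r ^+ m by apply: mulr_ge0; apply: exprn_ge0; exact: ltW.
have xK1 : `|x| <= K + 1 by apply: le_trans xK _; rewrite lerDl.
have [t0|t0] := leP 0 tau.
  rewrite ger0_norm// in tm; apply: le_trans (hM1 m i x tau M1m xK1 t0 tm) _.
  by apply: ler_wpM2r => //; rewrite lerDl.
rewrite ltr0_norm// in tm; have nt0 : 0 <= - tau by rewrite oppr_ge0 ltW.
pose y := x + tau *: delta_mx ord0 i; rewrite -/y.
have yx : y + (- tau) *: delta_mx ord0 i = x by rewrite /y scaleNr addrK.
have xy : `|x - y| <= 2^-1 ^+ m.
  rewrite -[X in X - _]yx addrC addKr normrZ ger0_norm//.
  by rewrite norm_delta mulr1.
have yK : `|y| <= K + 1.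
  rewrite -(subrK x y); apply: le_trans (ler_normD _ _) _; rewrite addrC; apply: lerD => //.
  by rewrite distrC; apply: le_trans xy (half_pow_le1 _).
have h3 := hM1 m i y (- tau) M1m yK nt0 tm; rewrite yx in h3.
have h4 : `|(- tau) *: (row i (g x) - row i (g y))| <= C2 * (2^-1 ^+ m * r ^+ m).
  rewrite normrZ ger0_norm// mulrCA; apply: ler_pM => //.
  by apply: le_trans (row_gradient_le _ _ _) _; exact: hM2.
rewrite (_ : _ - _ - _ = - (G x - G y - (- tau) *: row i (g y)) + (- tau) *: (row i (g x) - row i (g y))); last first.
  rewrite !scalerBr !scaleNr; move: (G y) (G x) (tau *: _) (tau *: _) => z1 z2 z3 z4.
  by apply/rowP => l; rewrite !mxE; ring.
apply: le_trans (ler_normD _ _) _; rewrite normrN mulrDl; exact: lerD.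
Qed.

(** The point [y] is reached from [x] along the coordinate directions; after each one the row of the
    gradient is transferred back to [x] by its Hoelder bound. *)
Lemma taylor_of_second_differences : taylor G.
Proof.
exists g => K.
have [C1 C10 [M1 hM1]] := direction (K + 1 + 1); have [C2 C20 [M2 hM2]] := gradient_holder (K + 1 + 1).
exists (d%:R * (C1 + C2) + C2); first by rewrite addr_ge0// mulr_ge0// addr_ge0.
exists (maxn M1 M2) => m x y; rewrite geq_max => /andP[M1m M2m] xK yK xy.
have em := e0 m; have rm0 : 0 <= 2^-1 ^+ m * r ^+ m by apply: mulr_ge0; apply: exprn_ge0; exact: ltW.
have xK2 : `|x| <= K + 1 + 1 by apply: le_trans xK _; rewrite -addrA lerDl.
have yK2 : `|y| <= K + 1 + 1 by apply: le_trans yK _; rewrite -addrA lerDl.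
have rm1 : 0 <= r ^+ m by apply: exprn_ge0; exact: ltW.
split; last first.
  apply: le_trans (hM2 m x y M2m xK2 yK2 xy) _; apply: ler_wpM2r => //.
  by rewrite lerDr mulr_ge0// addr_ge0.
pose v (k : nat) : V := \row_l (if (l < k)%N then (y - x) ord0 l else 0).
have vl k : `|v k| <= 2^-1 ^+ m.
  apply: norm_le_coord => [|l]; first exact: ltW.
  rewrite mxE; case: ifP => _; last by rewrite normr0 ltW.
  by apply: le_trans (coord_le_norm _ l) _; rewrite distrC.
suff S k : (k <= d)%N -> `|G (x + v k) - G x - v k *m g x| <= k%:R * ((C1 + C2) * (2^-1 ^+ m * r ^+ m)).
  have vd : v d = y - x by apply/rowP => l; rewrite !mxE ltn_ord.
  have := S d (leqnn _); rewrite vd (addrC x) subrK => hS; apply: le_trans hS _.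
  by rewrite [leRHS]mulrDl mulrA lerDl mulr_ge0.
elim: k => [|k IH] kd.
  have -> : v 0%N = 0 by apply/rowP => l; rewrite !mxE.
  by rewrite addr0 subrr mul0mx subr0 normr0 mul0r.
pose i := Ordinal kd; pose tau := (y - x) ord0 i.
have vS : v k.+1 = v k + tau *: delta_mx ord0 i.
  apply/rowP => l; rewrite !mxE eqxx /= ltnS leq_eqVlt.
  have -> : (l == i) = (l == k :> nat) by [].
  case: eqP => [lk|_] /=; last by rewrite mulr0 addr0.
  rewrite lk ltnn add0r mulr1 /tau !mxE.
  by have -> : l = i by exact: val_inj.
have xv : `|x - (x + v k)| <= 2^-1 ^+ m by rewrite opprD addrA subrr add0r normrN.
have vK : `|x + v k| <= K + 1 + 1.
  by apply: le_trans (ler_normD _ _) _; have := vl k; have := half_pow_le1 (R := R) m; move: xK; lra.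
have tl : `|tau| <= 2^-1 ^+ m by apply: le_trans (coord_le_norm _ i) _; rewrite distrC.
have h3 := hM1 m i (x + v k) tau M1m vK tl.
have h4 : `|tau *: (row i (g x) - row i (g (x + v k)))| <= C2 * (2^-1 ^+ m * r ^+ m).
  rewrite normrZ mulrCA; apply: ler_pM => //.
  by apply: le_trans (row_gradient_le _ _ _) _; exact: hM2.
rewrite (_ : _ - _ - _ = (G (x + v k) - G x - v k *m g x) + ((G (x + v k + tau *: delta_mx ord0 i) - G (x + v k) - tau *: row i (g (x + v k)))
   - tau *: (row i (g x) - row i (g (x + v k))))); last first.
  rewrite vS mulmxDl -scalemxAl -rowE addrA scalerBr.
  move: (G _) (G _) (_ *m _) (tau *: _) (tau *: _) => z1 z2 z3 z4 z5.
  by apply/rowP => l; rewrite !mxE; ring.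
apply: le_trans (ler_normD _ _) _; rewrite -natr1 mulrDl mul1r; apply: lerD; first exact: IH (ltnW kd).
by apply: le_trans (ler_normB _ _) _; rewrite mulrDl; apply: lerD.
Qed.

End quotients.

End taylor.

(** * The time-integrated drift *)

Section null_modification.
Context dd (S : measurableType dd) (R : realType) (mu : {measure set S -> \bar R}).
Variable N : set S.
Hypotheses (mN : measurable N) (N0 : mu N = 0%E).
Local Open Scope ereal_scope.
Import HBNNSimple.

(* No measurability: the integral of a nonnegative function is a supremum over simple functions below it. *)
Lemma ge0_le_integral_null (D : set S) (f g : S -> \bar R) : (forall x, 0 <= f x) -> (forall x, 0 <= g x) ->
  (forall x, D x -> ~ N x -> f x <= g x) -> \int[mu]_(x in D) f x <= \int[mu]_(x in D) g x.
Proof.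
move=> f0 g0 fg; rewrite !ge0_integralE//.
apply: ge_ereal_sup => _ [h hf <-].
have mCN : measurable (~` N) by exact: measurableC.
pose h' := proj_nnsfun h mCN.
have h'E x : h' x = (h x * \1_(~` N) x)%R by [].
have -> : sintegral mu h = sintegral mu h'.
  rewrite -!integralT_nnsfun (ge0_negligible_integral mN _ _ _ N0)//; last first.
    by move=> x _; rewrite lee_fin; exact: fun_ge0.
    exact/measurable_EFinP.
  rewrite [RHS](ge0_negligible_integral mN _ _ _ N0)//; last first.
    by move=> x _; rewrite lee_fin; exact: fun_ge0.
    exact/measurable_EFinP.
  apply: eq_integral => x; rewrite inE => -[_ nx].
  by rewrite h'E indicE mem_set// mulr1.
apply: ereal_sup_ubound; exists h' => // x.
rewrite h'E indicE; case: (pselect (N x)) => nx.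
  rewrite (_ : (x \in ~` N) = false) ?mulr0; last by apply/negP; rewrite inE.
  by rewrite /patch; case: ifP.
rewrite mem_set// mulr1; apply: le_trans (hf x) _; rewrite /patch; case: ifP => //; rewrite inE => Dx.
exact: fg.
Qed.

Lemma integral_null_eq (D : set S) (f g : S -> \bar R) : (forall x, D x -> ~ N x -> f x = g x) ->
  \int[mu]_(x in D) f x = \int[mu]_(x in D) g x.
Proof.
move=> fg; rewrite integralE [RHS]integralE; congr (_ - _); apply/eqP; rewrite eq_le; apply/andP; split;
  apply: ge0_le_integral_null => // x Dx nx; by rewrite ?funeposE ?funenegE (fg x Dx nx).
Qed.

End null_modification.

Section holder_norm.
Context {R : realType} {d : nat}.
Local Notation V := 'rV[R]_d.
Variable a : R.
Hypotheses (d0 : (0 < d)%N) (a0 : 0 < a).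
Implicit Types f g : V -> V.
Local Notation N := (@holder_norm R d a).

Let supn f : \bar R := ereal_sup [set `|f x|%:E | x in [set: V]].
Let sup2 f : \bar R := ereal_sup [set (`|f z.1 - f z.2| / `|z.1 - z.2| `^ a)%:E | z in [set z : V * V | z.1 != z.2]].

Let supn0 f : (0 <= supn f)%E.
Proof. by apply: ereal_sup_ge; exists `|f 0|%:E; [exists 0|rewrite lee_fin]. Qed.

Let q0 f (z : V * V) : 0 <= `|f z.1 - f z.2| / `|z.1 - z.2| `^ a.
Proof. by rewrite divr_ge0// powR_ge0. Qed.

(** The supremum needs two distinct points, since over the empty set it would be [-oo]; [0 < d]
    provides [0] and the all-ones vector. *)
Let sup20 f : (0 <= sup2 f)%E.
Proof.
have h : (0 : V) != const_mx 1.
  by apply/eqP => /rowP /(_ (Ordinal d0)); rewrite !mxE => /eqP; rewrite eq_sym oner_eq0.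
by apply: ereal_sup_ge; exists (`|f 0 - f (const_mx 1)| / `|0 - const_mx 1 : V| `^ a)%:E; [exists (0, const_mx 1)|rewrite lee_fin; exact: (q0 f (0, const_mx 1))].
Qed.

Lemma holder_norm_ge0 f : (0 <= N f)%E.
Proof. exact: (adde_ge0 (supn0 f) (sup20 f)). Qed.

Lemma holder_normN f : N (- f) = N f.
Proof.
congr (_ + _)%E; congr (ereal_sup _); apply/seteqP; split => _ [z zz <-]; exists z => //; rewrite !fctE.
- by rewrite normrN.
- by rewrite normrN.
- by rewrite -opprD normrN.
- by rewrite -opprD normrN.
Qed.

Lemma holder_normD f g : (N (f + g)%R <= N f + N g)%E.
Proof.
have h1 : (supn (f + g)%R <= supn f + supn g)%E.
  apply: ge_ereal_sup => _ [x _ <-]; rewrite !fctE; apply: (@le_trans _ _ (`|f x|%:E + `|g x|%:E)%E).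
    by rewrite -EFinD lee_fin ler_normD.
  by apply: leeD; apply: ereal_sup_ubound; exists x.
have h2 : (sup2 (f + g)%R <= sup2 f + sup2 g)%E.
  apply: ge_ereal_sup => _ [z zz <-]; rewrite !fctE.
  apply: (@le_trans _ _ ((`|f z.1 - f z.2| / `|z.1 - z.2| `^ a)%:E + (`|g z.1 - g z.2| / `|z.1 - z.2| `^ a)%:E)%E).
    rewrite -EFinD lee_fin -mulrDl; apply: ler_wpM2r; first by rewrite invr_ge0 powR_ge0.
    by rewrite opprD addrACA; exact: ler_normD.
  by apply: leeD; apply: ereal_sup_ubound; exists z.
by rewrite /holder_norm -/(supn _) -/(sup2 _) -/(supn f) -/(supn g) -/(sup2 f) -/(sup2 g) addeACA; apply: leeD.
Qed.

Lemma holder_normB f g : N (f - g) = N (g - f).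
Proof. by rewrite -opprB holder_normN. Qed.

Lemma holder_norm_bound f : (N f < +oo)%E -> vholder_bounded (fine (N f)) a f.
Proof.
move=> Nf; have NE : N f = (fine (N f))%:E by rewrite fineK// ge0_fin_numE// holder_norm_ge0.
have h1 x : `|f x| <= fine (N f).
  rewrite -lee_fin -NE; apply: (@le_trans _ _ (supn f)); first by apply: ereal_sup_ubound; exists x.
  by apply: leeDl; exact: sup20.
have h2 x y : `|f x - f y| <= fine (N f) * `|x - y| `^ a.
  have [->|xy] := eqVneq x y; first by rewrite subrr normr0 mulr_ge0 ?powR_ge0// fine_ge0// holder_norm_ge0.
  have p : 0 < `|x - y| `^ a by rewrite powR_gt0// normr_gt0 subr_eq0.
  rewrite -ler_pdivrMr// -lee_fin -NE; apply: (@le_trans _ _ (sup2 f)); first by apply: ereal_sup_ubound; exists (x, y).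
  by apply: leeDr; exact: supn0.
split => //; split; last by exists (fine (N f)).
have N0 : 0 <= fine (N f) by rewrite fine_ge0// holder_norm_ge0.
move=> x; apply/(@cvgrPdist_le R V V (nbhs x) _ f (f x)) => e e0.
have [dl dl0 hdl] := powR_small N0 a0 e0.
apply/nbhs_ballP; exists dl => // y; rewrite -ball_normE /= => /ltW xy.
by apply: le_trans (h2 x y) _; exact: hdl.
Qed.

End holder_norm.

Lemma cvg_of_ebound (R : realType) (u : nat -> R) (l : R) (v : nat -> \bar R) :
  (forall n, (`|u n - l|%:E <= v n)%E) -> v n @[n --> \oo] --> 0%E -> u n @[n --> \oo] --> l.
Proof.
move=> uv /fine_cvgP [[n1 _ fv] v0]; apply/cvgrPdist_le => e e0.
move/cvgrPdist_le : v0 => /(_ _ e0) [n2 _ hn2]; exists (maxn n1 n2) => // n /=.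
rewrite geq_max => /andP[n1n n2n]; have := hn2 n n2n; rewrite sub0r normrN => h.
rewrite distrC; apply: le_trans (le_trans (ler_norm _) h).
by rewrite -lee_fin fineK ?uv//; exact: fv.
Qed.

(** A simple function has finite range, so the preimage is a finite union over the values [w], on
    each of which only [F w] matters. *)
Lemma measurable_simple_apply (R : realType) (W : zmodType) (N : W -> \bar R) (g : R -> W) (F : W -> R -> R) :
  simple_into N g -> (forall t, measurable_fun setT (F (g t))) -> measurable_fun setT (fun r => F (g r) r).
Proof.
move=> [fg mg _] mF _ C mC; rewrite setTI.
have -> : (fun r => F (g r) r) @^-1` C = \bigcup_(w in range g) (g @^-1` [set w] `&` F w @^-1` C).
  apply/seteqP; split => r /=; first by move=> h; exists (g r); [exists r|].
  by move=> [_ [t _ <-]] /= [-> h].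
apply: fin_bigcup_measurable => // _ [t _ <-]; apply: measurableI; first exact: mg.
by have := mF t measurableT C mC; rewrite setTI.
Qed.

(** A representative that is regular at every time, dominated by a real weight [beta], and
    measurable along measurable paths. The rate [rho] of the integrated weight is all that remains
    of the integrability exponent. *)
Record drift_field (R : realType) (d : nat) (T a rho Cw : R) (bt : R -> 'rV[R]_d -> 'rV[R]_d) (beta : R -> R) : Prop := DriftField {
  df_ge0 : forall r, 0 <= beta r;
  df_meas : measurable_fun setT beta;
  df_holder : forall r, vholder_bounded (beta r) a (bt r);
  df_comp : forall Y : R -> @borelV R d, measurable_fun setT Y -> forall i, measurable_fun setT (fun r => bt r (Y r) ord0 i);
  df_weight : forall s t : R, s <= t -> (\int[lebesgue_measure]_(r in `[s, t]) (beta r)%:E <= (Cw * (t - s) `^ rho)%:E)%E;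
  df_out : forall r, ~ (0 < r < T) -> beta r = 0 }.

(** * A regular representative of the drift and its weight *)

Section representative.
Context {R : realType} {d : nat}.
Local Notation V := 'rV[R]_d.
Local Notation Vm := (@borelV R d).
Local Notation mu := (@lebesgue_measure R).
Variables (q : \bar R) (T a : R) (b : R -> V -> V).
Hypotheses (d0 : (0 < d)%N) (a0 : 0 < a) (T0 : 0 < T) (q1 : (1 <= q)%E) (hb : Lq_holder q T a b).
Local Notation N := (@holder_norm R d a).

(** Integrated and optimised in the level [A], this takes the place of Hoelder's inequality. *)
Lemma weight_pointwise (A p x : R) : 0 < A -> 1 <= p -> 0 <= x -> x <= A + A `^ (1 - p) * x `^ p.
Proof.
move=> A0 p1 x0; have [xA|Ax] := leP x A; first by apply: le_trans xA _; rewrite lerDl mulr_ge0// powR_ge0.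
have xp := lt_trans A0 Ax.
apply: (@le_trans _ _ (A `^ (1 - p) * x `^ p)); last by rewrite lerDr ltW.
have Ap : 0 < A `^ (p - 1) by exact: powR_gt0.
have -> : A `^ (1 - p) = (A `^ (p - 1))^-1 by rewrite -powRN opprB.
have -> : x `^ p = x `^ (p - 1) * x.
  by rewrite -{3}(powRr1 x0) -powRD ?subrK//; apply/implyP => _; rewrite gt_eqF.
rewrite mulrA; apply: ler_peMl => //; rewrite mulrC ler_pdivlMr// mul1r.
by apply: ge0_ler_powR_base; [rewrite subr_ge0|exact: ltW|exact: ltW].
Qed.

Lemma integral_itv_cst (s t A : R) : s <= t -> (\int[mu]_(r in `[s, t]) A%:E = (A * (t - s))%:E)%E.
Proof.
move=> st; rewrite integral_cst//= lebesgue_measure_itv/= lte_fin.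
case: ltP => [_|ts]; first by rewrite -EFinB -EFinM.
have -> : s = t by apply/eqP; rewrite eq_le st ts.
by rewrite subrr mulr0 mule0.
Qed.

(** [qi] is [1/q], with value 0 for [q = +oo], where the essential supremum is a bound off a null
    set. *)
Lemma Lq_weight (beta : R -> R) (N0 : set R) : measurable N0 -> mu N0 = 0%E -> (forall r, 0 <= beta r) -> measurable_fun setT beta ->
  (forall r, 0 < r < T -> ~ N0 r -> N (b r) = (beta r)%:E) -> (forall r, ~ (0 < r < T) -> beta r = 0) ->
  exists2 qi : R, [/\ 0 <= qi, qi <= 1 & (q^-1 = qi%:E)%E] & exists2 Cw : R, 0 <= Cw &
   forall s t : R, s <= t -> (\int[mu]_(r in `[s, t]) (beta r)%:E <= (Cw * (t - s) `^ (1 - qi))%:E)%E.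
Proof.
move=> mN0 N00 b0 mb Nb bout; have [_ _] := hb.
have mbE D : measurable_fun D (fun r => (beta r)%:E) by apply/measurable_EFinP; exact: measurable_funS mb.
case: q q1 => [p| |]//; last first.
  have mT : (0 < mu setT)%E.
    apply: (@lt_le_trans _ _ (mu `[0, 1])); first by rewrite lebesgue_measure_itv/= lte_fin ltr01 sube0 lte_fin ltr01.
    by apply: le_measure; rewrite ?inE//.
  move=> _; rewrite unlock mT => /ereal_inf_lt [y].
  move=> [N1 [mN1 N10 sub]] yoo; exists 0; first by split.
  have [A A0 yA] : exists2 A : R, 0 <= A & (y <= A%:E)%E.
    case: y yoo {sub} => [y| |]// _; first by exists `|y| => //; rewrite lee_fin ler_norm.
    by exists 0 => //; exact: leNye.
  exists A => // s t st; rewrite subr0.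
  apply: (@le_trans _ _ (\int[mu]_(r in `[s, t]) A%:E)%E); last first.
    by rewrite integral_itv_cst// powRr1// subr_ge0.
  apply: (@ge0_le_integral_null _ _ _ mu (N0 `|` N1)).
  - exact: measurableU.
  - exact: null_set_setU.
  - by move=> r; rewrite lee_fin.
  - by move=> r; rewrite lee_fin.
  move=> r _ /not_orP [n0 n1].
  have [rT|rT] := pselect (0 < r < T); last by rewrite bout// lee_fin.
  rewrite -Nb//; apply: le_trans yA; apply: contrapT => nle; apply: n1; apply: sub => /=.
  rewrite patchE mem_set/=; last by rewrite in_itv.
  by rewrite gee0_abs//; exact: holder_norm_ge0.
rewrite lee_fin => p1 Ln; have p0 : 0 < p by exact: lt_le_trans ltr01 p1.
have pi0 : 0 < p^-1 by rewrite invr_gt0.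
have pi1 : p^-1 <= 1 by rewrite invf_le1.
exists p^-1; first by split => //; [exact: ltW|rewrite inver gt_eqF].
have mp D : measurable_fun D (fun r => (beta r `^ p)%:E).
  by apply/measurable_EFinP; apply: (@measurable_funS _ _ _ _ setT) => //; exact: (measurableT_comp (measurable_powR p) mb).
pose I := (\int[mu]_r (beta r `^ p)%:E)%E.
have Ioo : (I < +oo)%E.
  apply: le_lt_trans (_ : (_ <= \int[mu]_x `|((fun t => N (b t)) \_ `]0%R, T[%classic) x| `^ p)%E) _.
    apply: (@ge0_le_integral_null _ _ _ mu N0) => //.
    - by move=> r; rewrite lee_fin powR_ge0.
    - by move=> r; exact: poweR_ge0.
    move=> r _ n0; have [rT|rT] := pselect (0 < r < T); last by rewrite bout// powR0 ?gt_eqF//; exact: poweR_ge0.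
    by rewrite patchE mem_set/=; [rewrite Nb// gee0_abs ?lee_fin//|rewrite in_itv].
  move: Ln; rewrite unlock; set J := (\int[mu]_x _)%E => Jp.
  have [//|] := ltP J +oo%E; rewrite leye_eq => /eqP JE; move: Jp; rewrite JE poweRyr// ?gt_eqF//.
have I0 : (0 <= I)%E by apply: integral_ge0 => r _; rewrite lee_fin powR_ge0.
have IE : I = (fine I)%:E by rewrite fineK// ge0_fin_numE.
exists (1 + fine I); first by rewrite addr_ge0// fine_ge0.
move=> s t st; have [ts|st'] := leP t s.
  have -> : t = s by apply/eqP; rewrite eq_le ts st.
  by rewrite set_itv1 integral_set1 lee_fin mulr_ge0 ?powR_ge0// addr_ge0// fine_ge0.
have ts0 : 0 < t - s by rewrite subr_gt0.
(* The level at which both terms of [weight_pointwise] have order [(t - s)^(1 - 1/p)]. *)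
pose A := (t - s) `^ (- p^-1); have A0 : 0 < A by exact: powR_gt0.
apply: (@le_trans _ _ (\int[mu]_(r in `[s, t]) (A%:E + (A `^ (1 - p))%:E * (beta r `^ p)%:E))%E).
  apply: ge0_le_integral => //.
  - by move=> r _; rewrite lee_fin.
  - exact: mbE.
  - by apply: emeasurable_funD; [exact: measurable_cst|apply: measurable_funeM; exact: mp].
  - by move=> r _; rewrite -EFinM -EFinD lee_fin; exact: weight_pointwise.
rewrite ge0_integralD//; last first.
- by apply: measurable_funeM; exact: mp.
- by move=> r _; rewrite -EFinM lee_fin mulr_ge0// powR_ge0.
- by move=> r _; rewrite lee_fin ltW.
rewrite integral_itv_cst// ge0_integralZl_EFin//; last first.
- exact: powR_ge0.
- exact: mp.
- by move=> r _; rewrite lee_fin powR_ge0.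
have Ie : (\int[mu]_(r in `[s, t]) (beta r `^ p)%:E <= (fine I)%:E)%E.
  rewrite -IE; apply: ge0_subset_integral => //; first exact: mp.
  by move=> r _; rewrite lee_fin powR_ge0.
apply: (@le_trans _ _ ((A * (t - s))%:E + (A `^ (1 - p))%:E * (fine I)%:E)%E).
  by apply: leeD => //; apply: lee_wpmul2l => //; rewrite lee_fin powR_ge0.
rewrite -EFinM -EFinD lee_fin.
have e1 : A * (t - s) = (t - s) `^ (1 - p^-1).
  rewrite /A -{2}(powRr1 (ltW ts0)) -powRD; first by congr (_ `^ _); ring.
  by apply/implyP => _; rewrite gt_eqF.
have e2 : A `^ (1 - p) = (t - s) `^ (1 - p^-1).
  rewrite /A -powRrM; congr (_ `^ _).
  by rewrite mulrBr mulr1 mulNr mulVf ?gt_eqF//; ring.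
by rewrite e1 e2 mulrDl mul1r mulrC.
Qed.

(** [N0] collects the times at which the norm is infinite or the simple approximations do not
    converge; there, and outside of the interval, the drift is set to zero. Elsewhere norms and
    values are limits of those of the simple functions, which gives measurability. *)
Lemma holder_representative : exists N0, [/\ measurable N0, mu N0 = 0%E &
  exists bt beta, (forall r, 0 < r < T -> ~ N0 r -> bt r = b r) /\
  exists2 qi : R, [/\ 0 <= qi, qi <= 1 & (q^-1 = qi%:E)%E] & exists2 Cw : R, 0 <= Cw &
  drift_field T a (1 - qi) Cw bt beta].
Proof.
have [ae1 [g [sg ae2]] _] := hb.
have [N1 [mN1 N10 sub1]] := ae1; have [N2 [mN2 N20 sub2]] := ae2.
pose N0 := N1 `|` N2; have mN0 : measurable N0 by exact: measurableU.
have N00 : mu N0 = 0%E by apply: null_set_setU.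
have good r : ~ N0 r -> 0 < r < T -> (N (b r) < +oo)%E /\ N (g n r - b r) @[n --> \oo] --> 0%E.
  move=> /not_orP [n1 n2] rT; split; apply: contrapT => nn.
  - by apply: n1; apply: sub1 => /=; exact: contra_not (fun h => h rT) nn.
  - by apply: n2; apply: sub2 => /=; exact: contra_not (fun h => h rT) nn.
pose G : set R := `]0, T[%classic `\` N0.
have mG : measurable G by exact: measurableD.
have GP r : G r <-> (0 < r < T) /\ ~ N0 r by rewrite /G /= in_itv.
pose bt r : V -> V := if r \in G then b r else (fun=> 0).
pose beta r : R := if r \in G then fine (N (b r)) else 0.
have fN f : (N f < +oo)%E -> N f = (fine (N f))%:E by move=> h; rewrite fineK// ge0_fin_numE// holder_norm_ge0.
have diff f h : (N f < +oo)%E -> (N h < +oo)%E -> (`|fine (N f) - fine (N h)|%:E <= N (f - h)%R)%E.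
  move=> ff hh; have h1 := holder_normD a (f - h) h; have h2 := holder_normD a (h - f) f.
  rewrite subrK in h1; rewrite subrK holder_normB in h2; rewrite (fN f)// (fN h)// in h1 h2.
  move: h1 h2; have := holder_norm_ge0 a d0 (f - h); case: (N (f - h)) => [x| |]//.
    rewrite -!EFinD !lee_fin ler_norml => _ h1 h2; apply/andP; split; lra.
  by move=> _ _ _; exact: leey.
have coordb (f : V -> V) (x : V) i : (`|f x ord0 i|%:E <= N f)%E.
  have [ff|] := ltP (N f) +oo%E; last by rewrite leye_eq => /eqP ->; exact: leey.
  rewrite fN// lee_fin; apply: le_trans (coord_le_norm _ _) _.
  by have [_ + _] := holder_norm_bound d0 a0 ff; exact.
have hol r : vholder_bounded (beta r) a (bt r).
  rewrite /beta /bt; case: ifP => [|_].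
    by rewrite inE => /GP [rT n0]; apply: holder_norm_bound => //; exact: (good r n0 rT).1.
  split; first by split; [exact: cst_continuous|exists 0 => x; rewrite normr0].
  - by move=> x; rewrite normr0.
  - by move=> x y; rewrite subrr normr0 mul0r.
have gfin n t : (N (g n t) < +oo)%E by have [_ _] := sg n.
have mbeta : measurable_fun setT beta.
  apply: (@measurable_fun_cvg _ _ _ _ (fun n r => fine (N (g n r)) * \1_G r)).
    move=> n; apply: measurable_funM; last exact: measurable_indic.
    by apply: (measurable_simple_apply (F := fun w _ => fine (N w)) (sg n)) => t; exact: measurable_cst.
  move=> r _; rewrite /beta; case: ifP => [|nG]; last first.
    have -> : (fun n => fine (N (g n r)) * \1_G r) = cst 0 by apply/funext => n; rewrite indicE nG mulr0.
    exact: cvg_cst.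
  move=> rG; have -> : (fun n => fine (N (g n r)) * \1_G r) = (fun n => fine (N (g n r))).
    by apply/funext => n; rewrite indicE rG mulr1.
  move: rG; rewrite inE => /GP [rT n0]; have [g1 g2] := good r n0 rT.
  by apply: cvg_of_ebound g2 => n; exact: diff.
have mcomp (Y : R -> Vm) : measurable_fun setT Y -> forall i, measurable_fun setT (fun r => bt r (Y r) ord0 i).
  move=> mY i; apply: (@measurable_fun_cvg _ _ _ _ (fun n r => g n r (Y r) ord0 i * \1_G r)).
    move=> n; apply: measurable_funM; last exact: measurable_indic.
    apply: (measurable_simple_apply (F := fun (w : V -> V) r => w (Y r) ord0 i) (sg n)) => t.
    have [[cw _] _ _] := holder_norm_bound d0 a0 (gfin n t).
    have := measurable_contV cw mY; move/(measurableT_comp (measurable_coord i)); exact.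
  move=> r _; rewrite /bt; case: ifP => [|nG]; last first.
    rewrite mxE; have -> : (fun n => g n r (Y r) ord0 i * \1_G r) = cst 0 by apply/funext => n; rewrite indicE nG mulr0.
    exact: cvg_cst.
  move=> rG; have -> : (fun n => g n r (Y r) ord0 i * \1_G r) = (fun n => g n r (Y r) ord0 i).
    by apply/funext => n; rewrite indicE rG mulr1.
  move: rG; rewrite inE => /GP [rT n0]; have [g1 g2] := good r n0 rT.
  by apply: cvg_of_ebound g2 => n; have := coordb (g n r - b r) (Y r) i; rewrite !mxE.
have beta0 r : 0 <= beta r by rewrite /beta; case: ifP => // _; rewrite fine_ge0// holder_norm_ge0.
have bout r : ~ (0 < r < T) -> beta r = 0.
  by move=> rT; rewrite /beta; case: ifP => //; rewrite inE => /GP [].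
exists N0; split=> //; exists bt, beta; split.
  by move=> r rT n0; rewrite /bt mem_set//; exact/GP.
have [|qi hqi [Cw Cw0 hw]] := Lq_weight mN0 N00 beta0 mbeta _ bout.
  by move=> r rT n0; rewrite /beta mem_set; [apply: fN; exact: (good r n0 rT).1|exact/GP].
by exists qi => //; exists Cw => //; split.
Qed.

End representative.

(** The sum of [2^n] increments of order [2^-(n th)] tends to zero when [th > 1]; the uniqueness
    half of a sewing argument. *)
Lemma increments_zero (R : realType) (d : nat) (f : R -> 'rV[R]_d) (s t C th : R) : 1 < th -> s <= t -> 0 <= C ->
  (forall u v, s <= u -> u <= v -> v <= t -> `|f v - f u| <= C * (v - u) `^ th) -> f t = f s.
Proof.
move=> th1 st C0 H; apply/eqP; rewrite -subr_eq0 -normr_le0.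
have p0 : 0 < th - 1 by rewrite subr_gt0.
have ts0 : 0 <= t - s by rewrite subr_ge0.
apply: (@half_powR_limit _ _ 0 (C * (t - s) `^ th) (th - 1) 0 p0) => n _; rewrite add0r.
pose m := (t - s) * 2^-1 ^+ n; have en := @half_pow_gt0 R n; have m0 : 0 <= m by rewrite mulr_ge0// ltW.
have hk k : (k <= 2 ^ n)%N -> `|f (s + k%:R * m) - f s| <= k%:R * (C * m `^ th).
  have mt j : (j <= 2 ^ n)%N -> s + j%:R * m <= t.
    move=> jn; rewrite -lerBrDl /m mulrCA; apply: ler_piMr => //.
    rewrite -[leRHS](half_powM (R := R) n) mulrC; apply: ler_wpM2l; first exact: ltW.
    by rewrite -natrX ler_nat.
  elim: k => [|k IH] kn; first by rewrite mul0r addr0 subrr normr0 mul0r.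
  have e : s + k.+1%:R * m - (s + k%:R * m) = m by rewrite -natr1; ring.
  have := H (s + k%:R * m) (s + k.+1%:R * m); rewrite e => h.
  rewrite -(subrKA (f (s + k%:R * m))); apply: le_trans (ler_normD _ _) _.
  have -> : k.+1%:R * (C * m `^ th) = C * m `^ th + k%:R * (C * m `^ th) by rewrite -natr1; ring.
  apply: lerD; last exact: IH (ltnW kn).
  apply: h; [by rewrite lerDl mulr_ge0|by rewrite lerD2l ler_wpM2r// ler_nat|exact: mt].
have := hk (2 ^ n)%N (leqnn _).
have p2 : (2 ^ n)%:R * m = t - s by rewrite /m natrX (mulrC (t - s)) mulrA (mulrC (2 ^+ n)) half_powM mul1r.
rewrite p2 addrCA subrr addr0 => h; apply: le_trans h _.
rewrite /m (powRM _ ts0 (ltW en)).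
have -> : (2^-1 ^+ n) `^ th = (2^-1 ^+ n) `^ (th - 1) * 2^-1 ^+ n.
  by rewrite -{3}(powRr1 (ltW en)) -powRD ?subrK//; apply/implyP => _; rewrite gt_eqF.
rewrite natrX; have := half_powM (R := R) n.
move: (2^-1 ^+ n) (2 ^+ n) ((t - s) `^ th) => a b c ab.
by rewrite [leLHS](_ : _ = (a * b) * (C * c * a `^ (th - 1))); [rewrite ab mul1r|ring].
Qed.

Lemma within_measurable (R : realType) (d : nat) (Y : R -> 'rV[R]_d) (s t : R) :
  {within `[s, t], continuous Y} -> measurable_fun setT (fun r => (if r \in `[s, t] then Y r else 0) : @borelV R d).
Proof.
move=> cY; apply: measurable_to_V => i.
have -> : (fun r => (if r \in `[s, t] then Y r else 0) ord0 i) = (fun r => Y r ord0 i) \_ `[s, t].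
  apply/funext => r; rewrite /patch; case: ifPn => h; first by rewrite mem_set.
  by rewrite memNset ?mxE//; exact/negP.
apply/(measurable_restrictT _ _).1 => //.
apply: subspace_continuous_measurable_fun => // x.
by apply: (@continuous_comp _ _ _ (Y : subspace `[s, t] -> 'rV[R]_d) (fun v : 'rV[R]_d => v ord0 i)); [exact: cY|exact: continuous_coord].
Qed.

(** * The integral equation and the expansion *)

Section nonlinear_integral.
Context {R : realType} {d : nat}.
Local Notation V := 'rV[R]_d.
Local Notation Vm := (@borelV R d).
Local Notation mu := (@lebesgue_measure R).
Variables (T a rho Cw : R) (bt : R -> V -> V) (beta : R -> R).
Hypotheses (T0 : 0 < T) (a0 : 0 < a) (rho0 : 0 < rho) (Cw0 : 0 <= Cw).
Hypothesis field : drift_field T a rho Cw bt beta.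

Definition vint (s t : R) (F : R -> V) : V := \row_i (\int[mu]_(r in `[s, t]) F r ord0 i).
(** Integration from [-oo] gives one monotone function on the whole line, so grid times and
    reflected times need no restriction to [[0, T]]. *)
Definition drift_weight (t : R) : R := \int[mu]_(r in `]-oo, t]) beta r.
Definition drift (s t : R) (z : V) : V := vint s t (bt ^~ z).
Definition dominated (F : R -> V) := (forall i, measurable_fun setT (fun r => F r ord0 i)) /\ forall r, `|F r| <= beta r.

Lemma integrable_beta D : measurable D -> mu.-integrable D (EFin \o beta).
Proof.
move=> mD; apply: (@integrableS _ _ _ _ setT) => //.
apply/integrableP; split; first by apply/measurable_EFinP; exact: (df_meas field).
have b0 := df_ge0 field.
have -> : (\int[mu]_x `|(EFin \o beta) x| = \int[mu]_(x in `[0%R, T]) (beta x)%:E)%E.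
  rewrite [RHS]integral_mkcond; apply: eq_integral => x _; rewrite /= ger0_norm// patchE.
  case: ifPn => // /negP nx; rewrite (df_out field)// => /andP[h1 h2]; apply: nx.
  by rewrite mem_set//= in_itv/= !ltW.
by apply: le_lt_trans (df_weight field (ltW T0)) _; exact: ltry.
Qed.

Lemma dominated_integrable F i D : measurable D -> dominated F -> mu.-integrable D (EFin \o (fun r => F r ord0 i)).
Proof.
move=> mD [mF FB]; apply: (le_integrable mD _ _ (integrable_beta mD)).
  by apply/measurable_EFinP; apply: measurable_funS (mF i).
move=> r _; rewrite /= lee_fin; apply: le_trans (coord_le_norm _ i) _.
by apply: le_trans (FB r) _; exact: ler_norm.
Qed.

Lemma weightB (s t : R) : s <= t -> drift_weight t - drift_weight s = \int[mu]_(r in `[s, t]) beta r.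
Proof.
move=> st; rewrite /drift_weight Rintegral_itvB//; last exact: integrable_beta.
by rewrite Rintegral_itv_obnd_cbnd//; exact: integrable_beta.
Qed.

Lemma vintB (s u t : R) F : dominated F -> s <= u -> u <= t -> vint s t F = vint s u F + vint u t F.
Proof.
move=> dF su ut; apply/rowP => i; rewrite !mxE.
rewrite -[X in _ = _ + X](@Rintegral_itv_obnd_cbnd _ u (BRight t) (fun r => F r ord0 i)); last exact: dominated_integrable.
rewrite -(@Rintegral_itvB _ (fun r => F r ord0 i) (BLeft s) (BRight t) u) ?bnd_simp//; last exact: dominated_integrable.
by rewrite addrC subrK.
Qed.

Lemma vint_close (s t c : R) F G : dominated F -> dominated G -> 0 <= c -> s <= t ->
  (forall r, s <= r -> r <= t -> `|F r - G r| <= c * beta r) ->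
  `|vint s t F - vint s t G| <= c * (drift_weight t - drift_weight s).
Proof.
move=> dF dG c0 st FG; rewrite weightB//.
have b0 : 0 <= \int[mu]_(r in `[s, t]) beta r by apply: Rintegral_ge0 => r _; exact: (df_ge0 field).
apply: norm_le_coord => [|i]; first exact: mulr_ge0.
have iF : mu.-integrable `[s, t] (EFin \o (fun r => F r ord0 i)) by exact: dominated_integrable.
have iG : mu.-integrable `[s, t] (EFin \o (fun r => G r ord0 i)) by exact: dominated_integrable.
have iFG : mu.-integrable `[s, t] (EFin \o (fun r => F r ord0 i - G r ord0 i)).
  by rewrite (_ : _ \o _ = ((EFin \o (fun r => F r ord0 i)) \- (EFin \o (fun r => G r ord0 i)))%E)//; exact: integrableB.
rewrite !mxE -RintegralB//; apply: le_trans (le_normr_Rintegral _ iFG) _ => //.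
rewrite -RintegralZl//; last exact: integrable_beta.
apply: le_Rintegral => //.
- exact: (integrable_norm iFG).
- by rewrite (_ : _ \o _ = (fun r => c%:E * (EFin \o beta) r)%E)//; apply: integrableZl => //; exact: integrable_beta.
move=> r /=; rewrite in_itv/= => /andP[sr rt]; rewrite -rowB; apply: le_trans (coord_le_norm _ i) _; exact: FG.
Qed.

Lemma dominated0 : dominated (fun=> 0).
Proof.
split; first by move=> i; rewrite (_ : (fun _ => _) = cst 0); [exact: measurable_cst|apply/funext => r; rewrite mxE].
by move=> r; rewrite normr0; exact: (df_ge0 field).
Qed.

Lemma vint0 s t : vint s t (fun=> 0) = 0.
Proof.
apply/rowP => i; rewrite !mxE (@eq_Rintegral _ _ _ _ _ (cst 0)); first by rewrite Rintegral_cst// mul0r.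
by [].
Qed.

Lemma vint_bound (s t : R) F : dominated F -> s <= t -> `|vint s t F| <= drift_weight t - drift_weight s.
Proof.
move=> dF st; rewrite -[leRHS]mul1r -[X in `|X|]subr0 -(vint0 s t).
by apply: vint_close => //; [exact: dominated0|move=> r _ _; rewrite subr0 mul1r; exact: dF.2].
Qed.

Lemma dominated_comp (Y : R -> Vm) : measurable_fun setT Y -> dominated (fun r => bt r (Y r)).
Proof.
by move=> mY; split; [exact: (df_comp field mY)|move=> r; have [_ + _] := df_holder field r; exact].
Qed.

Lemma dominated_point z : dominated (bt ^~ z).
Proof. by apply: (@dominated_comp (fun=> z)); exact: measurable_cst. Qed.

Lemma drift_weight_mono s t : s <= t -> drift_weight s <= drift_weight t.
Proof. by move=> st; rewrite -subr_ge0 weightB//; apply: Rintegral_ge0 => r _; exact: (df_ge0 field). Qed.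

Lemma drift_weight_rho s t : s <= t -> drift_weight t - drift_weight s <= Cw * (t - s) `^ rho.
Proof.
move=> st; rewrite weightB// /Rintegral -lee_fin fineK; first exact: (df_weight field).
rewrite ge0_fin_numE; last by apply: integral_ge0 => r _; rewrite lee_fin; exact: (df_ge0 field).
by apply: le_lt_trans (df_weight field st) _; exact: ltry.
Qed.

Lemma drift_norm s t z : s <= t -> `|drift s t z| <= drift_weight t - drift_weight s.
Proof. by move=> st; apply: vint_bound => //; exact: dominated_point. Qed.

Lemma drift_close (Y : R -> Vm) (s t K : R) z : measurable_fun setT Y -> 0 <= K -> s <= t ->
  (forall r, s <= r -> r <= t -> `|(Y r : V) - z| <= K) ->
  `|vint s t (fun r => bt r (Y r)) - drift s t z| <= K `^ a * (drift_weight t - drift_weight s).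
Proof.
move=> mY K0 st YK; apply: vint_close => //; [exact: dominated_comp|exact: dominated_point|exact: powR_ge0|].
move=> r sr rt; have [_ _ h] := df_holder field r; apply: le_trans (h _ _) _.
rewrite mulrC; apply: ler_wpM2r; first exact: (df_ge0 field).
by apply: ge0_ler_powR_base => //; [exact: ltW|exact: YK].
Qed.

Lemma drift_holder_weight s t z z' : s <= t -> `|drift s t z - drift s t z'| <= (drift_weight t - drift_weight s) * `|z - z'| `^ a.
Proof.
by move=> st; rewrite mulrC; apply: (@drift_close (fun=> z)) => //; exact: measurable_cst.
Qed.

Lemma drift_split s u t z : s <= u -> u <= t -> drift s t z = drift s u z + drift u t z.
Proof. by apply: vintB; exact: dominated_point. Qed.

Lemma eq_vint (s t : R) F G : (forall r, s <= r -> r <= t -> F r = G r) -> vint s t F = vint s t G.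
Proof.
move=> FG; apply/rowP => i; rewrite !mxE; apply: eq_Rintegral => r; rewrite inE /= in_itv/= => /andP[sr rt].
by rewrite FG.
Qed.

(* [b] agrees with [bt] off a null set, so the integral of the possibly nonmeasurable [b r (Y r)] may be computed with [bt]. *)
Lemma vint_null (b : R -> V -> V) (N : set R) (s t : R) (Y : R -> V) : measurable N -> mu N = 0%E -> 0 <= s -> t <= T ->
  (forall r, 0 < r < T -> ~ N r -> bt r = b r) ->
  vint s t (fun r => b r (Y r)) = vint s t (fun r => bt r (Y r)).
Proof.
move=> mN N0 s0 tT bb; apply/rowP => i; rewrite !mxE /Rintegral; congr fine.
have mN' : measurable (N `|` ([set 0] `|` [set T])).
  by apply: measurableU => //; apply: measurableU; exact: measurable_set1.
have N0' : mu (N `|` ([set 0] `|` [set T])) = 0%E.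
  apply: null_set_setU => //; first by apply: measurableU; exact: measurable_set1.
  by apply: null_set_setU; [exact: measurable_set1|exact: measurable_set1|exact: lebesgue_measure_set1|exact: lebesgue_measure_set1].
apply: (@integral_null_eq _ _ _ mu _ mN' N0').
move=> r /=; rewrite in_itv/= => /andP[sr rt] /not_orP [n0 /not_orP [r0 rT]].
rewrite bb// !lt_neqAle (le_trans s0 sr) (le_trans rt tT) !andbT; apply/andP; split; apply/eqP => h.
  by apply: r0; rewrite /= h.
by apply: rT.
Qed.

Lemma integrable_null (b : R -> V -> V) (N : set R) (s t : R) (Y : R -> V) : measurable N -> mu N = 0%E -> 0 <= s -> s <= t -> t <= T ->
  (forall r, 0 < r < T -> ~ N r -> bt r = b r) ->
  (\int[mu]_(r in `[s, t]) `|b r (Y r)|%:E < +oo)%E.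
Proof.
move=> mN N0 s0 st tT bb.
apply: le_lt_trans (_ : (_ <= \int[mu]_(r in `[s, t]) (beta r)%:E)%E) _; last first.
  by apply: le_lt_trans (df_weight field st) _; exact: ltry.
have mN' : measurable (N `|` ([set 0] `|` [set T])).
  by apply: measurableU => //; apply: measurableU; exact: measurable_set1.
have N0' : mu (N `|` ([set 0] `|` [set T])) = 0%E.
  apply: null_set_setU => //; first by apply: measurableU; exact: measurable_set1.
  by apply: null_set_setU; [exact: measurable_set1|exact: measurable_set1|exact: lebesgue_measure_set1|exact: lebesgue_measure_set1].
apply: (@ge0_le_integral_null _ _ _ mu _ mN' N0').
- by move=> r; rewrite lee_fin.
- by move=> r; rewrite lee_fin; exact: (df_ge0 field).
move=> r /=; rewrite in_itv/= => /andP[sr rt] /not_orP [n0 /not_orP [r0 rT]].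
rewrite lee_fin -bb//; first by have [_ + _] := df_holder field r; exact.
rewrite !lt_neqAle (le_trans s0 sr) (le_trans rt tT) !andbT; apply/andP; split; apply/eqP => h.
  by apply: r0; rewrite /= h.
by apply: rT.
Qed.

Variables (h : R) (W : R -> V) (CW : R).
Hypotheses (h0 : 0 < h) (hrho : h <= rho) (CW0 : 0 <= CW).
Let theta := rho + a * h.
Hypothesis theta1 : 1 < theta.

Lemma equation_of_expansion (Y : R -> V) (s E CA : R) : 0 <= s -> 0 <= E -> 0 <= CA -> {within `[s, T], continuous Y} ->
  (forall u v, s <= u -> u <= v -> v <= T -> `|Y v - Y u| <= CA * (v - u) `^ h) ->
  (forall u v, s <= u -> u <= v -> v <= T -> `|Y v - Y u - (W v - W u) - drift u v (Y u)| <= E * (v - u) `^ theta) ->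
  forall t, s <= t -> t <= T -> Y t = Y s + vint s t (fun r => bt r (Y r)) + (W t - W s).
Proof.
(* [Y] is known to be continuous on [[s, T]] only; extending it by zero gives a measurable path on
   the line. *)
move=> s0 E0 CA0 cY YH YE t st tT; pose Y' (r : R) : V := if r \in `[s, T] then Y r else 0.
have mY : measurable_fun setT (Y' : R -> Vm) by exact: within_measurable cY.
have YY r : s <= r -> r <= T -> Y' r = Y r by move=> sr rT; rewrite /Y' in_itv/= sr rT.
have dY := dominated_comp mY.
pose Z u := Y u - W u - vint s u (fun r => bt r (Y' r)).
have ZE : Z t = Z s.
  apply: (@increments_zero _ _ Z s t (E + Cw * CA `^ a) theta theta1 st).
    by rewrite addr_ge0// mulr_ge0// powR_ge0.
  move=> u v su uv vt; have vT := le_trans vt tT; have uT := le_trans uv vT.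
  have uv0 : 0 <= v - u by rewrite subr_ge0.
  have -> : Z v - Z u = (Y v - Y u - (W v - W u) - drift u v (Y u)) - (vint u v (fun r => bt r (Y' r)) - drift u v (Y u)).
    by rewrite /Z (vintB dY su uv); apply/rowP => i; rewrite !mxE; ring.
  apply: le_trans (ler_normB _ _) _; rewrite mulrDl; apply: lerD; first exact: YE.
  have K0 : 0 <= CA * (v - u) `^ h by rewrite mulr_ge0// powR_ge0.
  apply: le_trans (drift_close (K := CA * (v - u) `^ h) mY K0 uv _) _.
    move=> r ur rv; rewrite YY ?(le_trans su ur) ?(le_trans rv vT)//.
    apply: le_trans (YH u r su ur (le_trans rv vT)) _; apply: ler_wpM2l => //.
    by apply: ge0_ler_powR_base; [exact: ltW|rewrite subr_ge0|rewrite lerD2r].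
  apply: le_trans (ler_wpM2l (powR_ge0 _ _) (drift_weight_rho uv)) _; rewrite mulrC.
  by apply: holder_product.
have vE : vint s t (fun r => bt r (Y r)) = vint s t (fun r => bt r (Y' r)).
  by apply: eq_vint => r sr rt; rewrite YY// (le_trans rt).
have vs : vint s s (fun r => bt r (Y' r)) = 0.
  by apply/rowP => i; rewrite !mxE set_itv1 Rintegral_set1.
rewrite vE; move: ZE; rewrite /Z vs subr0; move: (vint _ _ _) => z.
move=> ZE; have -> : Y t = (Y t - W t - z) + W t + z by apply/rowP => i; rewrite !mxE; ring.
by rewrite ZE; apply/rowP => i; rewrite !mxE; ring.
Qed.

(** The equation first yields the Hoelder exponent [h] for [Y], as noise and weight both have it;
    freezing the drift then costs order [theta]. *)
Lemma expansion_of_equation (Y : R -> V) (s : R) : 0 <= s -> {within `[s, T], continuous Y} ->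
  (forall u v, 0 <= u -> u <= v -> v <= T -> `|W v - W u| <= CW * (v - u) `^ h) ->
  (forall t, s <= t -> t <= T -> Y t = Y s + vint s t (fun r => bt r (Y r)) + (W t - W s)) ->
  exists2 E, 0 <= E & forall u v, s <= u -> u <= v -> v <= T ->
    `|Y v - Y u| <= E * (v - u) `^ h /\ `|Y v - Y u - (W v - W u) - drift u v (Y u)| <= E * (v - u) `^ theta.
Proof.
move=> s0 cY WH YE; pose Y' (r : R) : V := if r \in `[s, T] then Y r else 0.
have mY : measurable_fun setT (Y' : R -> Vm) by exact: within_measurable cY.
have YY r : s <= r -> r <= T -> Y' r = Y r by move=> sr rT; rewrite /Y' in_itv/= sr rT.
have dY := dominated_comp mY.
pose CA := CW + Cw * T `^ (rho - h).
have CA0 : 0 <= CA by rewrite addr_ge0// mulr_ge0// powR_ge0.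
have E0 : 0 <= Cw * CA `^ a by rewrite mulr_ge0// powR_ge0.
have inc u v : s <= u -> u <= v -> v <= T -> Y v - Y u - (W v - W u) = vint u v (fun r => bt r (Y' r)).
  move=> su uv vT; have uT := le_trans uv vT; rewrite (YE v (le_trans su uv) vT) (YE u su uT).
  have e w : w <= T -> vint s w (fun r => bt r (Y r)) = vint s w (fun r => bt r (Y' r)).
    by move=> wT; apply: eq_vint => r sr rt; rewrite YY// (le_trans rt).
  by rewrite !e// (vintB dY su uv); apply/rowP => i; rewrite !mxE; ring.
have hol u v : s <= u -> u <= v -> v <= T -> `|Y v - Y u| <= CA * (v - u) `^ h.
  move=> su uv vT; rewrite -(subrK (W v - W u) (Y v - Y u)) inc//.
  apply: le_trans (ler_normD _ _) _; rewrite addrC /CA mulrDl; apply: lerD; first exact: WH (le_trans s0 su) uv vT.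
  apply: le_trans (vint_bound dY uv) _; apply: le_trans (drift_weight_rho uv) _.
  rewrite -mulrA; apply: ler_wpM2l => //; apply: powR_le_base => //; first by rewrite subr_ge0.
  by have u0 := le_trans s0 su; lra.
exists (CA + Cw * CA `^ a); first by rewrite addr_ge0.
move=> u v su uv vT; split.
  by apply: le_trans (hol u v su uv vT) _; apply: ler_wpM2r; [exact: powR_ge0|rewrite lerDl].
have uT := le_trans uv vT; have uv0 : 0 <= v - u by rewrite subr_ge0.
rewrite inc//; have K0 : 0 <= CA * (v - u) `^ h by rewrite mulr_ge0// powR_ge0.
apply: le_trans (drift_close (K := CA * (v - u) `^ h) mY K0 uv _) _.
  move=> r ur rv; rewrite YY ?(le_trans su ur) ?(le_trans rv vT)//.
  apply: le_trans (hol u r su ur (le_trans rv vT)) _; apply: ler_wpM2l => //.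
  by apply: ge0_ler_powR_base; [exact: ltW|rewrite subr_ge0|rewrite lerD2r].
apply: le_trans (ler_wpM2l (powR_ge0 _ _) (drift_weight_rho uv)) _; rewrite mulrC.
apply: (@le_trans _ _ (Cw * CA `^ a * (v - u) `^ theta)); first exact: holder_product.
by apply: ler_wpM2r; [exact: powR_ge0|rewrite lerDr].
Qed.

End nonlinear_integral.

(** * Brownian increments *)

Section brownian.
Context {R : realType} {disp : measure_display} {Omega : measurableType disp}.
Variables (P : probability Omega R) (d : nat) (F : R -> set (set Omega)) (B : R -> Omega -> 'rV[R]_d).
Local Notation V := 'rV[R]_d.
Local Notation Vm := (@borelV R d).
Hypotheses (hF : filtration F) (hB : brownian_motion P F B).

Definition history (t : R) : Type := g_sigma_algebraType (F t).
HB.instance Definition _ t := Measurable.on (history t).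

Lemma historyE t : 0 <= t -> @measurable _ (history t) = F t.
Proof. by move=> t0; apply: sigma_algebra_id; case: hF => h _ _; exact: h. Qed.

Lemma measurable_B_history r t : 0 <= r -> r <= t -> measurable_fun [set: history t] (B r : history t -> Vm).
Proof.
move=> r0 rt _ A mA; rewrite setTI historyE ?(le_trans r0)//.
have [_ _ mono] := hF; apply: (mono r t r0 rt).
by have [aB _ _ _ _] := hB; exact: aB.
Qed.

Lemma measurable_B t : 0 <= t -> measurable_fun [set: Omega] (B t : Omega -> Vm).
Proof.
move=> t0 _ A mA; rewrite setTI; have [_ sub _] := hF; apply: (sub t t0).
by have [aB _ _ _ _] := hB; exact: aB.
Qed.

Lemma measurable_increment s t : 0 <= s -> 0 <= t -> measurable_fun [set: Omega] (increment B s t : Omega -> Vm).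
Proof. by move=> s0 t0; apply: measurable_subV; exact: measurable_B. Qed.

Lemma measurable_increment_history s t r : 0 <= s -> s <= r -> 0 <= t -> t <= r ->
  measurable_fun [set: history r] (increment B s t : history r -> Vm).
Proof. by move=> s0 sr t0 tr; apply: measurable_subV; exact: measurable_B_history. Qed.

Let mB0 t : measurable_fun [set: Omega] (increment B 0 (Num.max 0 t) : Omega -> Vm).
Proof. by apply: measurable_increment => //; rewrite le_max lexx. Qed.

(** The maximum with 0 makes this a probability for every real [t], since adaptedness of [B] is
    given for nonnegative times. *)
Definition brownian_law (t : R) : probability Vm R :=
  distribution P (HB.pack (increment B 0 (Num.max 0 t) : Omega -> Vm) (isMeasurableFun.Build _ _ _ _ _ (mB0 t)) : {mfun Omega >-> Vm}).

Lemma brownian_lawE t A : 0 <= t -> brownian_law t A = P (increment B 0 t @^-1` A).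
Proof. by move=> t0; rewrite -[LHS]/(P (increment B 0 (Num.max 0 t) @^-1` A)) max_r. Qed.

Lemma gaussian_brownian_law t : 0 < t -> gaussian_law (brownian_law t) t.
Proof.
move=> t0 C mC; rewrite brownian_lawE ?(ltW t0)//.
by have [_ _ _ _ /(_ 0 t C (lexx _) t0 mC)] := hB; rewrite subr0.
Qed.

Lemma increment_law s t A : 0 <= s -> s < t -> @measurable _ Vm A -> P (increment B s t @^-1` A) = brownian_law (t - s) A.
Proof.
move=> s0 st mA; have ts0 : 0 < t - s by rewrite subr_gt0.
have t0 : 0 <= t by apply: le_trans s0 (ltW st).
pose X : {mfun Omega >-> Vm} := HB.pack (increment B s t : Omega -> Vm) (isMeasurableFun.Build _ _ _ _ _ (measurable_increment s0 t0)).
rewrite -[LHS]/(distribution P X A).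
apply: (@measure_box_unique R d (distribution P X) (brownian_law (t - s))) mA.
  by rewrite -ge0_fin_numE//; exact: fin_num_measure.
move=> C mC; rewrite [RHS](gaussian_brownian_law ts0 mC).
by have [_ _ _ _ /(_ s t C s0 st mC)] := hB.
Qed.

Lemma increment_indep s t A C : 0 <= s -> s < t -> @measurable _ (history s) A -> @measurable _ Vm C ->
  P (A `&` increment B s t @^-1` C) = (P A * brownian_law (t - s) C)%E.
Proof.
move=> s0 st mA mC; rewrite -increment_law//; have [_ _ _ ind _] := hB; apply: ind => //.
by rewrite -historyE.
Qed.

Lemma brownian_law_integral (t : R) (f : Vm -> \bar R) : 0 <= t -> measurable_fun setT f -> (forall w, 0 <= f w)%E ->
  (\int[brownian_law t]_w f w = \int[P]_x f (increment B 0 t x))%E.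
Proof.
move=> t0 mf f0; rewrite /brownian_law /distribution ge0_integral_pushforward//.
by apply: eq_integral => x _; rewrite /= max_r.
Qed.

(** The increment over [[0, s + t]] is the sum of those over [[0, s]] and [[s, s + t]]; the second
    is independent of the history at [s]. *)
Lemma brownian_convolution (s t : R) (f : Vm -> \bar R) : 0 < s -> 0 < t ->
  measurable_fun setT f -> (forall w, 0 <= f w)%E ->
  (\int[brownian_law (s + t)]_w f w = \int[brownian_law s]_w \int[brownian_law t]_w' f ((w : V) + (w' : V))%R)%E.
Proof.
move=> s0 t0 mf f0; have s0' := ltW s0; have t0' := ltW t0.
have st0 : 0 <= s + t by rewrite addr_ge0.
have sst : s < s + t by rewrite ltrDl.
pose h (z : Vm * Vm) : \bar R := f (((z.1 : V) + (z.2 : V)) : Vm).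
have mh : measurable_fun setT h by apply: measurableT_comp mf (@measurable_VD R d).
have h0 z : (0 <= h z)%E by exact: f0.
have mY := measurable_increment (lexx 0) s0'; have mW := measurable_increment s0' st0.
have -> : (\int[brownian_law (s + t)]_w f w = \int[P]_x h (increment B 0 s x, increment B s (s + t) x))%E.
  rewrite brownian_law_integral//; apply: eq_integral => x _; rewrite /h /=; congr f.
  by rewrite /increment [RHS]addrC subrKA.
rewrite (@indep_integral _ _ _ _ Omega Vm Vm P (brownian_law t) _ _ h mY mW)//; last first.
  move=> A C mA mC.
  have mA' : @measurable _ (history s) (increment B 0 s @^-1` A).
    by rewrite -[X in measurable X]setTI; exact: (measurable_increment_history (lexx 0) s0' s0' (lexx s)).
  by rewrite (increment_indep s0' sst mA' mC) addrAC subrr add0r.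
rewrite [RHS](@brownian_law_integral s (fun z : Vm => (\int[brownian_law t]_w' f ((z : V) + (w' : V))%R)%E))//.
- by apply: (@measurable_fun_fubini_tonelli_F _ _ Vm Vm R (brownian_law t) h).
- by move=> w; exact: integral_ge0.
Qed.

Section forward_noise.
Variables (tau : nat -> R) (dl : R).
Hypotheses (tau0 : forall j, 0 <= tau j) (dl0 : 0 < dl) (tauS : forall j, tau j.+1 - tau j = dl).
Let W j := increment B (tau j) (tau j.+1).

Let tau_lt j : tau j < tau j.+1. Proof. by rewrite -subr_gt0 tauS. Qed.

Let tau_mono j k : (j <= k)%N -> tau j <= tau k.
Proof. by move=> /subnK <-; elim: (k - j)%N => [//|n IH]; apply: le_trans IH _; rewrite addSn ltW. Qed.

Lemma forward_noise N : iid_noise P (brownian_law dl) N W.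
Proof.
split; first by move=> j; exact: measurable_increment.
move=> C mC; elim: N => [|N IH].
  by rewrite big_ord0 (_ : cylinder W 0 C = setT) ?probability_setT//; apply/seteqP; split.
rewrite big_ord_recr /= -IH.
have -> : cylinder W N.+1 C = cylinder W N C `&` W N @^-1` C N.
  apply/seteqP; split => w.
    by move=> h; split; [move=> j /= jN; apply: h; rewrite /= ltnS ltnW|apply: h => /=].
  by move=> [h1 h2] j /=; rewrite ltnS leq_eqVlt => /orP[/eqP ->|jN] //; exact: h1.
rewrite /W increment_indep// ?tauS//.
apply: (@bigcap_measurableType _ (history (tau N))) => j /= jN.
rewrite -[X in measurable X]setTI.
by apply: (measurable_increment_history (tau0 j) (tau_mono (ltnW jN)) (tau0 j.+1) (tau_mono jN)).
Qed.

End forward_noise.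

(** The product formula is invariant under reversing the order of the factors, so the reversed
    scheme has independent noise as well. *)
Lemma reversed_noise (g : probability Vm R) (N : nat) (W W' : nat -> Omega -> V) : iid_noise P g N W ->
  (forall j, measurable_fun setT (W' j : Omega -> Vm)) ->
  (forall j, (j < N)%N -> W' j = W (N - j.+1)%N) -> iid_noise P g N W'.
Proof.
move=> [mW hW] mW' WE; split => // C mC.
pose C' j := C (N - j.+1)%N.
have -> : cylinder W' N C = cylinder W N C'.
  apply/seteqP; split => w h j /= jN; have jN' : (N - j.+1 < N)%N by rewrite ltn_subrL (leq_trans _ jN).
    by have := h (N - j.+1)%N jN'; rewrite /= WE// subnSK// subKn// ltnW.
  by have := h (N - j.+1)%N jN'; rewrite /= /C' WE// subnSK// subKn// ltnW.
rewrite hW; last by move=> j; exact: mC.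
rewrite (reindex_inj rev_ord_inj) /=; apply: eq_bigr => j _.
by rewrite /C' subnSK// subKn// ltnW.
Qed.

End brownian.

(** * Hoelder continuity of the paths *)

Section path_regularity.
Context {R : realType} {d : nat} {disp : measure_display} {Omega : measurableType disp}.
Local Notation V := 'rV[R]_d.
Local Notation Vm := (@borelV R d).
Variables (P : probability Omega R) (gam : R -> probability Vm R).
Hypothesis hgam : forall t : R, 0 < t -> gaussian_law (gam t) t.
Variables (T : R) (T0 : 0 < T) (W : R -> Omega -> V).
Hypothesis noise : forall n, iid_noise P (gam (T / 2 ^+ n)) (2 ^ n) (fun j w => W (tick T n j.+1) w - W (tick T n j) w).

Lemma grid_noise_moment n j q : (j < 2 ^ n)%N -> (0 < q)%N ->
  (\int[P]_w (`|(W (tick T n j.+1) w - W (tick T n j) w : V)| ^+ q)%:E = \int[gam (T / 2 ^+ n)]_z (`|(z : V)| ^+ q)%:E)%E.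
Proof.
move=> jn q0; have [mW _] := noise n.
pose D : Omega -> Vm := fun w => W (tick T n j.+1) w - W (tick T n j) w.
have mD : measurable_fun [set: Omega] D by exact: (mW j).
pose X : {mfun Omega >-> Vm} := HB.pack D (isMeasurableFun.Build _ _ _ _ _ mD).
have mf : measurable_fun [set: Vm] (fun z : Vm => (`|(z : V)| ^+ q)%:E).
  by apply/measurable_EFinP; apply: measurable_funX; exact: measurable_normV.
have f0 (z : Vm) : (0 <= (`|(z : V)| ^+ q)%:E)%E by rewrite lee_fin exprn_ge0.
have -> : (\int[P]_w (`|(W (tick T n j.+1) w - W (tick T n j) w : V)| ^+ q)%:E = \int[distribution P X]_z (`|(z : V)| ^+ q)%:E)%E.
  by rewrite /distribution ge0_integral_pushforward.
apply: eq_measure_integral => A mA _.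
have := past_indep (noise n) jn (A := setT) measurableT mA.
by rewrite setTI probability_setT mul1e.
Qed.

(** Moments of an order [p] with [p (1/2 - h) >= 2] make each of the [2^n] events of level [n] have
    probability of order [4^-n]. *)
Lemma increments_small (h : R) : 0 < h -> h < 2^-1 ->
  {ae P, forall w, exists M, forall n j, (M <= n)%N -> (j < 2 ^ n)%N ->
    `|W (tick T n j.+1) w - W (tick T n j) w| <= (2^-1 `^ h) ^+ n}.
Proof.
move=> h0 h12; pose kap := 2^-1 - h; have kap0 : 0 < kap by rewrite subr_gt0.
pose q := (Num.truncn (2 / kap)).+1; pose p := q.*2.
have p0 : (0 < p)%N by rewrite /p double_gt0.
have pk : 2%:R <= p%:R * kap.
  have k0 : 0 <= 2 / kap by apply: divr_ge0 => //; exact: ltW.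
  have /andP[_ hh] := truncn_itv k0.
  rewrite -ler_pdivrMr//; apply: ltW; apply: lt_le_trans hh _.
  by rewrite ler_nat /p -addnn leq_addr.
have [C C0 hC] := gaussian_moment (R := R) (d := d) p0.
pose B m (j : 'I_(2 ^ m)) : set Omega := [set w | (2^-1 `^ h) ^+ m < `|W (tick T m j.+1) w - W (tick T m j) w|].
pose c := C * Num.sqrt T ^+ p.
have c0 : 0 <= c by rewrite mulr_ge0// exprn_ge0.
have a0 m : 0 < (2^-1 `^ h) ^+ m :> R by rewrite exprn_gt0// powR_gt0.
have HB m (j : 'I_(2 ^ m)) : measurable (B m j) /\ (P (B m j) <= (c * (2^-1 ^+ m) ^+ 2)%:E)%E.
  have dl0 : 0 < T / 2 ^+ m by rewrite divr_gt0// exprn_gt0.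
  have [mW _] := noise m.
  have hm : (\int[P]_w (`|(W (tick T m j.+1) w - W (tick T m j) w : V)| ^+ p)%:E <= (C * Num.sqrt (T / 2 ^+ m) ^+ p)%:E)%E.
    by rewrite grid_noise_moment//; exact: hC (hgam dl0).
  have [mB PB] := markov_norm (a0 m) (mW j) hm.
  split; first exact: mB.
  apply: le_trans PB _; rewrite lee_fin.
  have -> : Num.sqrt (T / 2 ^+ m) ^+ p = Num.sqrt T ^+ p * ((2^-1 `^ 2^-1) ^+ m) ^+ p.
    rewrite -exprVn sqrtrM ?(ltW T0)// exprMn; congr (_ * _); congr (_ ^+ p).
    have h2 : 0 <= 2^-1 :> R by rewrite invr_ge0.
    rewrite -(powR_exprn _ _ h2) powR12_sqrt; last exact: exprn_ge0.
    by [].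
  have S0 : 0 <= Num.sqrt T ^+ p by rewrite exprn_ge0.
  rewrite /c -[leLHS]mulrA -[leRHS]mulrA; apply: (ler_wpM2l C0).
  rewrite -[leLHS]mulrA; apply: (ler_wpM2l S0).
  exact: half_ratio pk.
have := @union_borel_cantelli _ _ _ P (fun m => 'I_(2 ^ m) : finType) B c 1 0 c0 (fun m j => (HB m j).1) _ (fun m j _ => (HB m j).2).
have card m : (0 <= m)%N -> (#|'I_(2 ^ m)| <= 2 ^ (1 * m))%N by move=> _; rewrite card_ord mul1n.
move=> /(_ card); apply: filterS => w [M hM]; exists M => n j Mn jn.
by have := hM n (Ordinal jn) Mn => /negP; rewrite -leNgt.
Qed.

End path_regularity.

Section path_holder.
Context {R : realType} {d : nat}.
Local Notation V := 'rV[R]_d.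
Variables (T : R) (T0 : 0 < T) (Y : R -> V) (h : R) (M : nat).
Hypotheses (h0 : 0 < h) (cY : {within `[0, T], continuous Y}).
Hypothesis small : forall n j, (M <= n)%N -> (j < 2 ^ n)%N -> `|Y (tick T n j.+1) - Y (tick T n j)| <= (2^-1 `^ h) ^+ n.
Let r : R := 2^-1 `^ h.
Let r0 : 0 < r. Proof. by rewrite powR_gt0// invr_gt0. Qed.
Let r1 : r < 1. Proof. exact: half_powR_lt1. Qed.

(** Rescaled by [T] and clamped, the path becomes a continuous function on the whole line, and the
    chaining lemma applies to it in dimension one. *)
Let clamp (t : R) : R := if t <= 0 then 0 else if t <= 1 then t else 1.

Let clamp_itv t : 0 <= clamp t <= 1.
Proof. by rewrite /clamp; case: (leP t 0) => a; [rewrite lexx ler01|case: (leP t 1) => b; rewrite ?(ltW a) ?b ?lexx ?ler01]. Qed.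

Let clamp_lip s t : `|clamp s - clamp t| <= `|s - t|.
Proof.
have := ler_norm (s - t); have := ler_norm (t - s); rewrite (distrC t).
move: `|s - t| => D h1 h2; rewrite ler_norml /clamp.
case: (leP s 0) => a1; case: (leP t 0) => a2; do ?[case: (leP s 1) => a3]; do ?[case: (leP t 1) => a4]; apply/andP; split; lra.
Qed.

Let F (x : 'rV[R]_1) : V := Y (T * clamp (x ord0 ord0)).

Let F_cont : continuous F.
Proof.
move=> x; apply/(@cvgrPdist_lt R V 'rV[R]_1 (nbhs x) _ F (F x)) => e e0.
have Tin t : `[0, T]%classic (T * clamp t).
  by have /andP[c1 c2] := clamp_itv t; rewrite /= in_itv/= mulr_ge0 ?(ltW T0)//= ler_piMr// ltW.
have /subspace_continuousP /(_ _ (Tin (x ord0 ord0))) := cY.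
move=> /(@cvgrPdist_lt R V _ _ _ _ _) /(_ _ e0) => /nbhs_ballP [dl /= dl0 hdl].
apply/nbhs_ballP; exists (dl / T); first by rewrite /= divr_gt0.
move=> y; rewrite -ball_normE /= => xy; apply: hdl; last exact: Tin.
rewrite -ball_normE /= -mulrBr normrM gtr0_norm// mulrC -ltr_pdivlMr//.
apply: le_lt_trans xy; apply: le_trans (clamp_lip _ _) _; rewrite -rowB; exact: coord_le_norm.
Qed.

Let F_lattice m : (M <= m)%N -> forall z : 'I_1 -> int, `|lat m z : 'rV[R]_1| <= 2 -> forall i,
  `|F (lat m z + unit_step m i) - F (lat m z)| <= 1 * r ^+ m.
Proof.
move=> Mm z _ i; rewrite mul1r (ord1 i) /F !mxE eqxx mulr1.
have em := @half_pow_gt0 R m; have r0m : 0 <= r ^+ m by apply: exprn_ge0; exact: ltW.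
have hp := half_powM (R := R) m.
have -> : (z ord0)%:~R * 2^-1 ^+ m + 2^-1 ^+ m = (z ord0 + 1)%:~R * 2^-1 ^+ m :> R by rewrite intrD mulrDl mul1r.
move: (z ord0) => k.
have [k0|k0] := ltP k 0.
  have i1 : (k%:~R : R) * 2^-1 ^+ m <= 0 by rewrite pmulr_lle0// lerz0 ltW.
  have i2 : ((k + 1)%:~R : R) * 2^-1 ^+ m <= 0 by rewrite pmulr_lle0// lerz0 -ltzD1 ltrD2r.
  by rewrite /clamp i1 i2 subrr normr0.
case: k k0 => // k _; rewrite -PoszD addn1.
have [k2|k2] := leqP (2 ^ m) k.
  have c1 j : (2 ^ m <= j)%N -> clamp ((Posz j)%:~R * 2^-1 ^+ m) = 1.
    move=> jm; have g1 : 1 <= (Posz j)%:~R * 2^-1 ^+ m :> R.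
      by rewrite -[leLHS]hp mulrC; apply: ler_wpM2r; [exact: ltW|rewrite -natrX ler_nat].
    rewrite /clamp leNgt (lt_le_trans ltr01 g1) /=; case: ifP => // g2.
    by apply/eqP; rewrite eq_le g2 g1.
  by rewrite !c1// ?subrr ?normr0// leqW.
have c1 j : (j <= 2 ^ m)%N -> T * clamp ((Posz j)%:~R * 2^-1 ^+ m) = tick T m j.
  move=> jm; have g1 : (Posz j)%:~R * 2^-1 ^+ m <= 1 :> R.
    by rewrite -[leRHS]hp mulrC; apply: ler_wpM2l; [exact: ltW|rewrite -natrX ler_nat].
  have -> : clamp ((Posz j)%:~R * 2^-1 ^+ m) = j%:R * 2^-1 ^+ m.
    rewrite /clamp g1; case: ifP => // g2; apply/eqP; rewrite eq_le g2 andbT.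
    by apply: mulr_ge0 => //; exact: ltW.
  by rewrite /tick meshE mulrCA.
by rewrite (c1 _ k2) (c1 _ (ltnW k2)); exact: small.
Qed.

Lemma path_holder_of_grid : exists2 C : R, 0 <= C & forall s t, 0 <= s -> s <= t -> t <= T -> `|Y t - Y s| <= C * (t - s) `^ h.
Proof.
pose A := (1%:R * (1 + 2 * (1 - r)^-1)) * 1 : R.
have A0 : 0 <= A by rewrite !mulr_ge0// addr_ge0// mulr_ge0// invr_ge0 subr_ge0 ltW.
pose F1 (x : R) : V := Y (T * clamp x).
have hC m x y : (M <= m)%N -> 0 <= x -> x <= 1 -> 0 <= y -> y <= 1 -> `|x - y| <= 2^-1 ^+ m -> `|F1 x - F1 y| <= A * r ^+ m.
  move=> Mm x0 x1 y0 y1 xy.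
  have cn (c : R) : 0 <= c -> `|const_mx c : 'rV[R]_1| <= c.
    by move=> c0; apply: norm_le_coord => // i; rewrite mxE ger0_norm.
  have := @chaining R 1 d r r0 r1 F 1 2 M ler01 F_lattice m (const_mx x) (const_mx y) F_cont Mm.
  rewrite /F !mxE; apply.
  - by apply: le_trans (cn x x0) _; lra.
  - by apply: le_trans (cn y y0) _; lra.
  - apply: norm_le_coord => [|i]; first exact/ltW/half_pow_gt0.
    by rewrite !mxE.
have FE s : 0 <= s -> s <= T -> F1 (s / T) = Y s.
  move=> s0 sT; rewrite /F1 /clamp; have T0' := ltW T0.
  have g1 : s / T <= 1 by rewrite ler_pdivrMr// mul1r.
  rewrite g1; case: ifP => [g2|_]; last by rewrite mulrC divfK// gt_eqF.
  move: g2; rewrite pmulr_lle0 ?invr_gt0// => g2; have -> : s = 0 by apply/eqP; rewrite eq_le g2 s0.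
  by rewrite mulr0.
pose K := A * 2 ^+ M * r ^+ M * (2 ^+ M) `^ h + A * 2 `^ h.
have K0 : 0 <= K.
  have rM : 0 <= r ^+ M by apply: exprn_ge0; exact: ltW.
  by apply: addr_ge0; [apply: mulr_ge0; [apply: mulr_ge0 => //; apply: mulr_ge0 => //; exact: exprn_ge0|exact: powR_ge0]|apply: mulr_ge0 => //; exact: powR_ge0].
have near_ x y : 0 <= x -> x <= y -> y <= 1 -> `|F1 y - F1 x| <= K * (y - x) `^ h.
  move=> x0 xy y1; have y0 := le_trans x0 xy; have x1 := le_trans xy y1.
  have [yx|xy'] := leP y x.
    have -> : y = x by apply/eqP; rewrite eq_le yx xy.
    by rewrite subrr normr0 mulr_ge0// powR_ge0.
  have D0 : 0 < y - x by rewrite subr_gt0.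
  have [Dm|Dm] := leP (y - x) (2^-1 ^+ M).
    have [m [mM h1 h2]] := dyadic_scale D0 Dm.
    apply: le_trans (hC m y x mM y0 y1 x0 x1 _) _; first by rewrite ger0_norm// ltW.
    have rE : r ^+ m <= 2 `^ h * (y - x) `^ h.
      rewrite -(powRM _ (ler0n R 2) (ltW D0)) -powR_exprn ?invr_ge0//.
      apply: ge0_ler_powR_base; [exact: ltW|exact/ltW/half_pow_gt0|].
      by move: h1; rewrite exprS; lra.
    apply: le_trans (ler_wpM2l A0 rE) _; rewrite mulrA; apply: ler_wpM2r; first exact: powR_ge0.
    rewrite /K lerDr; apply: mulr_ge0; last exact: powR_ge0.
    by apply: mulr_ge0; [apply: mulr_ge0 => //; exact: exprn_ge0|apply: exprn_ge0; exact: ltW].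
  pose u k : R := x + k%:R * ((y - x) * 2^-1 ^+ M).
  have e0 := @half_pow_gt0 R M; have hp := half_powM (R := R) M.
  have st0 : 0 <= (y - x) * 2^-1 ^+ M by rewrite mulr_ge0 ?ltW.
  have uE : u (2 ^ M)%N = y.
    by rewrite /u natrX (mulrC (y - x)) mulrA (mulrC (2 ^+ M)) hp mul1r addrC subrK.
  have u01 k : (k <= 2 ^ M)%N -> 0 <= u k /\ u k <= 1.
    move=> kM; split; first by rewrite /u addr_ge0// mulr_ge0.
    by apply: le_trans y1; rewrite -uE /u lerD2l; apply: ler_wpM2r => //; rewrite ler_nat.
  have S k : (k <= 2 ^ M)%N -> `|F1 (u k) - F1 x| <= k%:R * (A * r ^+ M).
    elim: k => [|k IH] kM; first by rewrite /u mul0r addr0 subrr normr0 mul0r.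
    rewrite -(subrKA (F1 (u k))); apply: le_trans (ler_normD _ _) _.
    have -> : k.+1%:R * (A * r ^+ M) = A * r ^+ M + k%:R * (A * r ^+ M) by rewrite -natr1; ring.
    apply: lerD; last exact: IH (ltnW kM).
    have [a1 a2] := u01 _ kM; have [a3 a4] := u01 _ (ltnW kM).
    apply: hC => //; have -> : u k.+1 - u k = (y - x) * 2^-1 ^+ M by rewrite /u -natr1; ring.
    by rewrite ger0_norm//; apply: ler_piMl; [exact: ltW|lra].
  have := S (2 ^ M)%N (leqnn _); rewrite uE => hS; apply: le_trans hS _.
  have p1 : 1 <= (2 ^+ M) `^ h * (y - x) `^ h.
    rewrite -(powRM _ (exprn_ge0 _ (ler0n R 2)) (ltW D0)); apply: (@le_trans _ _ (1 `^ h)); first by rewrite powR1.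
    apply: ge0_ler_powR_base => //; first exact: ltW.
    by rewrite -[leLHS]hp mulrC; apply: ler_wpM2l; [exact: exprn_ge0|exact: ltW].
  rewrite /K mulrDl; apply: (@le_trans _ _ (A * 2 ^+ M * r ^+ M * ((2 ^+ M) `^ h * (y - x) `^ h))).
    rewrite natrX mulrA (mulrC (2 ^+ M)); apply: ler_peMr => //.
    by apply: mulr_ge0; [apply: mulr_ge0 => //; exact: exprn_ge0|apply: exprn_ge0; exact: ltW].
  by rewrite -[leRHS]addrC mulrA lerDr; apply: mulr_ge0; [apply: mulr_ge0 => //; exact: powR_ge0|exact: powR_ge0].
exists (K * (T^-1) `^ h); first by rewrite mulr_ge0// powR_ge0.
move=> s t s0 st tT; have t0 := le_trans s0 st; have sT := le_trans st tT.
have ti : 0 <= T^-1 by rewrite invr_ge0 ltW.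
rewrite -(FE t t0 tT) -(FE s s0 sT); apply: le_trans (near_ _ _ _ _ _) _.
- by rewrite mulr_ge0.
- by apply: ler_wpM2r.
- by rewrite ler_pdivrMr// mul1r.
- rewrite -mulrBl -mulrA; apply: ler_wpM2l => //.
  by rewrite mulrC (powRM _ ti) ?subr_ge0.
Qed.

End path_holder.

(** * The stochastic flow *)

Lemma holder_continuous (R : realType) (d : nat) (f : 'rV[R]_d -> 'rV[R]_d) (A a : R) : 0 <= A -> 0 < a ->
  (forall x y, `|f x - f y| <= A * `|x - y| `^ a) -> continuous f.
Proof.
move=> A0 a0 hf x; apply/(@cvgrPdist_le R 'rV[R]_d 'rV[R]_d (nbhs x) _ f (f x)) => e e0.
have [dl dl0 hdl] := powR_small A0 a0 e0.
apply/nbhs_ballP; exists dl => // y; rewrite -ball_normE /= => /ltW xy.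
by apply: le_trans (hf x y) _; exact: hdl.
Qed.

Lemma locally_uniform_continuous (R : realType) (d : nat) (G : 'rV[R]_d -> 'rV[R]_d) :
  (forall K e, 0 < e -> exists2 dl : R, 0 < dl & forall x y, `|x| <= K -> `|y| <= K -> `|x - y| <= dl -> `|G x - G y| <= e) ->
  continuous G.
Proof.
move=> hG x; apply/(@cvgrPdist_le R 'rV[R]_d 'rV[R]_d (nbhs x) _ G (G x)) => e e0.
have [dl dl0 hdl] := hG (`|x| + 1) e e0.
apply/nbhs_ballP; exists (Num.min dl 1); first by rewrite /= lt_min dl0 ltr01.
move=> y; rewrite -ball_normE /= => /ltW; rewrite le_min => /andP[b3 b4].
apply: hdl => //; first by rewrite lerDl.
have := ler_normB x (x - y); rewrite opprB addrC subrK; lra.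
Qed.

(** The part of [path_data] that is free of the noise and the grid; it is stable under time
    reversal, so both flows are built from it. *)
Record drift_family (R : realType) (d : nat) (al rho Cw : R) (wt : R -> R) (psi : R -> R -> 'rV[R]_d -> 'rV[R]_d) : Prop := DriftFamily {
  fam_mono : forall s t, s <= t -> wt s <= wt t;
  fam_rho : forall s t, s <= t -> wt t - wt s <= Cw * (t - s) `^ rho;
  fam_bound : forall s t z, s <= t -> `|psi s t z| <= wt t - wt s;
  fam_holder : forall s t z z', s <= t -> `|psi s t z - psi s t z'| <= (wt t - wt s) * `|z - z'| `^ al;
  fam_add : forall s u t z, s <= u -> u <= t -> psi s t z = psi s u z + psi u t z }.

Definition mollified_steps (R : realType) (d : nat) (gam : R -> probability (@borelV R d) R) (T : R)
    (psi : R -> R -> 'rV[R]_d -> 'rV[R]_d) (n j : nat) : 'rV[R]_d -> 'rV[R]_d :=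
  vheat gam (T / 2 ^+ n) (psi (tick T n j) (tick T n j.+1)).

(** The exponent [gm] of the pathwise part, [(1 + kap) / theta] with [kap = (theta - 1) / 2]. *)
Definition flow_exponent (R : realType) (al rho h : R) : R := (1 + (rho + al * h - 1) / 2) / (rho + al * h).

(** * The almost sure event on which the pathwise theory applies *)

Section flow_event.
Context {R : realType} {d : nat} {disp : measure_display} {Omega : measurableType disp}.
Local Notation V := 'rV[R]_d.
Local Notation Vm := (@borelV R d).
Variables (P : probability Omega R) (gam : R -> probability Vm R).
Hypothesis hgam : forall t : R, 0 < t -> gaussian_law (gam t) t.
Hypothesis conv : forall (s t : R) (f : Vm -> \bar R), 0 < s -> 0 < t ->
  measurable_fun setT f -> (forall w, 0 <= f w)%E ->
  (\int[gam (s + t)]_w f w = \int[gam s]_w \int[gam t]_w' f ((w : V) + (w' : V))%R)%E.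
Variables (T al rho Cw h : R) (wt : R -> R) (psi : R -> R -> V -> V) (W : R -> Omega -> V).
Hypotheses (T0 : 0 < T) (al0 : 0 < al) (al1 : al < 1) (h0 : 0 < h) (h12 : h < 2^-1) (hrho : h <= rho) (Cw0 : 0 <= Cw).
Hypothesis theta1 : 1 < rho + al * h.
Hypothesis fam : drift_family al rho Cw wt psi.
Hypothesis noise : forall n, iid_noise P (gam (T / 2 ^+ n)) (2 ^ n) (fun j w => W (tick T n j.+1) w - W (tick T n j) w).
Hypothesis cW : {ae P, forall w, {within `[0, T], continuous (W ^~ w)}}.
Local Notation f := (mollified_steps gam T psi).

Lemma family_vholder s t : s <= t -> vholder_bounded (wt t - wt s) al (psi s t).
Proof.
move=> st; have w0 : 0 <= wt t - wt s by rewrite subr_ge0 (fam_mono fam).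
split; first split.
- by apply: (holder_continuous w0 al0) => x y; exact: (fam_holder fam x y st).
- by exists (wt t - wt s) => x; exact: (fam_bound fam x st).
- by move=> x; exact: (fam_bound fam x st).
- by move=> x y; exact: (fam_holder fam x y st).
Qed.

Let ticks n j : tick T n j <= tick T n j.+1. Proof. exact: tick_le. Qed.

Lemma family_path_data : exists2 Kf : R, 0 <= Kf & forall (Y : R -> V) CW,
  (forall s t, 0 <= s -> s <= t -> t <= T -> `|Y t - Y s| <= CW * (t - s) `^ h) ->
  path_data T al rho h Cw CW Kf Y wt psi f.
Proof.
have [K K0 hK] := vheat_close hgam al0 al1; exists K => // Y CW hY.
have m0 n : 0 < T / 2 ^+ n by exact: mesh_gt0.
split => //; try by [apply: (fam_mono fam)|apply: (fam_rho fam)|apply: (fam_bound fam)|apply: (fam_holder fam)|apply: (fam_add fam)].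
- move=> n j z; have [cp hp _] := family_vholder (ticks n j); exact: vheat_bound.
- move=> n j z; apply: le_trans (hK _ (m0 n) _ _ z (family_vholder (ticks n j))) _.
  by rewrite -powR12_sqrt ?(ltW (m0 n))// -powRrM (mulrC _ al).
- by move=> n j; have [cp _ _] := family_vholder (ticks n j); have [] := vheat_vcb hgam (m0 n) cp.
Qed.

Lemma family_drift_data n : drift_data al rho Cw (T / 2 ^+ n) (fun j => wt (tick T n j.+1) - wt (tick T n j))
  (fun j => psi (tick T n j) (tick T n j.+1)).
Proof.
split.
- by move=> j; rewrite subr_ge0 (fam_mono fam).
- by move=> j; exact: family_vholder.
- move=> k m; have -> : \sum_(0 <= i < m) (wt (tick T n (k + i).+1) - wt (tick T n (k + i))) = wt (tick T n (k + m)) - wt (tick T n k).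
    have := telescope_sumr (fun i => wt (tick T n (k + i))) (leq0n m); rewrite addn0 => <-.
    by apply: eq_bigr => i _; rewrite addnS.
  apply: le_trans (fam_rho fam (tick_le T0 n (leq_addr m k))) _.
  by rewrite tickD addrAC subrr add0r.
Qed.

Variable be : R.
Hypotheses (be0 : 0 < be) (beal : be < al) (brho : 1 - (al - be) / 2 < rho).

(** Three almost sure properties, namely continuity, small grid increments and the lattice bounds,
    hold jointly; for such a sample point everything else is deterministic. *)
Lemma flow_event (be' : R) : 0 < be' -> be' < be -> {ae P, forall w,
  [/\ exists2 CW : R, 0 <= CW & forall s t, 0 <= s -> s <= t -> t <= T -> `|W t w - W s w| <= CW * (t - s) `^ h,
      solution_flow T rho al h (flow_exponent al rho h) (W ^~ w) psi (limit_flow T (W ^~ w) f),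
      forall s t x, ordered_times T s t -> approx T (W ^~ w) f n s t x @[n --> \oo] --> limit_flow T (W ^~ w) f s t x &
      forall s t, ordered_times T s t -> taylor be' (limit_flow T (W ^~ w) f s t)]}.
Proof.
move=> be'0 be'1; pose kc := cauchy_exponent al rho h; pose gm := flow_exponent al rho h.
have th0 : 0 < rho + al * h by exact: lt_trans theta1.
have kap0 : 0 < (rho + al * h - 1) / 2 by rewrite divr_gt0// subr_gt0.
have gm0 : 0 < gm by apply: divr_gt0 => //; exact: addr_gt0.
have gm1 : gm < 1 by exact: half_gap.
have kc0 : 0 < kc by rewrite lt_min kap0; exact: mulr_gt0.
(* [Lam * kc > 2] gives both [1 / Lam < kc], for convergence, and the requirement of the second
   differences. *)
pose Lam := (Num.truncn (2 / kc)).+1.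
have LK : 2 < Lam%:R * kc.
  have k0 : 0 <= 2 / kc by apply: divr_ge0 => //; exact: ltW.
  by have /andP[_ hh] := truncn_itv k0; rewrite -ltr_pdivrMr.
have Lp : 0 < Lam%:R :> R by rewrite ltr0n.
have LamK : Lam%:R^-1 < kc by rewrite -[ltLHS]mul1r ltr_pdivrMr// mulrC; move: LK; lra.
have [n1 ev] := lattice_event hgam conv T0 al0 al1 be0 beal Cw0 brho noise family_drift_data Lam gm1 be'1.
have inc := increments_small hgam T0 noise h0 h12.
have [Kf Kf0 hdata] := family_path_data.
move: cW inc ev; apply: filterS3 => w cw [M1 hM1] [M hM].
have [CW CW0 hCW] := path_holder_of_grid T0 h0 cw hM1.
have data := hdata (W ^~ w) CW hCW.
have hLB m n : (M <= m)%N -> (n1 <= n)%N -> (n <= Lam * m)%N -> forall k l, (k + l <= 2 ^ n)%N ->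
   forall z : 'I_d -> int, (forall i, `|z i| <= (m * 2 ^ m)%:Z) ->
   lattice_bounds (path_flow T (W ^~ w) f n k l) m (2^-1 `^ gm) (2^-1 `^ be') z.
  move=> Mm nn nL k l kl z hz; have := hM m Mm n k (k + l)%N nn nL (leq_addr _ _) kl z hz.
  by rewrite /grid_flow addKn.
have lattice m n : (M <= m)%N -> (n1 <= n)%N -> (n <= Lam * m)%N -> forall k l, (k + l <= 2 ^ n)%N ->
  forall z : 'I_d -> int, (forall i, `|z i| <= (m * 2 ^ m)%:Z) -> forall i,
  `|path_flow T (W ^~ w) f n k l (lat m z + unit_step m i) - path_flow T (W ^~ w) f n k l (lat m z)| <= (2^-1 `^ gm) ^+ m.
  by move=> Mm nn nL k l kl z hz i; have [h1 _] := hLB m n Mm nn nL k l kl z hz i i 0%N.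
have h12' := ltW h12; have L0 : (0 < Lam)%N by [].
pose LH := limit_flow_holder T0 al0 h0 h12' hrho Cw0 CW0 Kf0 theta1 data L0 LamK lattice.
pose LC := limit_flow_close T0 al0 h0 h12' hrho Cw0 CW0 Kf0 theta1 data L0 LamK lattice.
have sf : solution_flow T rho al h gm (W ^~ w) psi (limit_flow T (W ^~ w) f).
  split.
  - by move=> s x s0 sT; exact: limit_flow_refl.
  - by move=> s q t x; exact: (limit_flow_flow T0 al0 h0 h12' hrho Cw0 CW0 Kf0 theta1 data L0 LamK lattice).
  - exists (CW + Cw * T `^ (rho - h)); first by rewrite addr_ge0// mulr_ge0// powR_ge0.
    by move=> s t x; exact: LC.
  - exact: LH.
  - exact: (limit_flow_expansion T0 al0 h0 h12' hrho Cw0 CW0 Kf0 theta1 data L0 LamK lattice).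
  - by move=> s t E K Y; exact: (limit_flow_unique T0 al0 h0 h12' hrho Cw0 CW0 Kf0 theta1 data L0 LamK lattice).
split; first by exists CW.
- exact: sf.
- move=> s t x [s0 st tT].
  have [C C0 [n0 hn0]] := approx_limit T0 al0 h0 h12' hrho Cw0 CW0 Kf0 theta1 data L0 LamK lattice `|x|.
  apply/(@cvgrPdist_le R V nat \oo _ _ _) => e e0.
  have [n2 hn2] := half_powR_small (C / e) kc0.
  exists (maxn n0 n2) => // k /=; rewrite geq_max => /andP[k0 k2].
  rewrite distrC; apply: le_trans (hn0 k k0 s t x s0 st tT (lexx _)) _.
  by have := hn2 k k2; rewrite mulrAC ler_pdivrMr// mul1r.
- move=> s t o; have [s0 st tT] := o.
  apply: taylor_of_second_differences => //.
    apply: locally_uniform_continuous.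
    move=> K e e0; have [dl dl0 hdl] := solution_flow_uniform h0 gm0 sf K e0.
    exists dl => // x y xK yK xy; apply: hdl => //; by rewrite subrr normr0 ltW.
  move=> K; have be1 : be' <= 1 by apply: ltW; apply: lt_trans be'1 _; exact: lt_trans al1.
  have [C C0 [M3 hM3]] := limit_second_difference T0 al0 h0 h12' hrho Cw0 CW0 Kf0 theta1 data L0 LamK lattice be'0 be1 (ltW LK) hLB K.
  by exists C => //; exists M3 => m Mm z zK i j m' mm; exact: hM3.
Qed.

End flow_event.

Section adaptedness.
Context {R : realType} {d : nat} {disp : measure_display} {Omega : measurableType disp}.
Variable P : probability Omega R.
Local Notation V := 'rV[R]_d.
Local Notation Vm := (@borelV R d).

(** The exceptional null set and all its subsets belong to the completion. Off it [X] is a pointwise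
    limit, and multiplication by its indicator makes the convergence hold everywhere. *)
Lemma ae_limit_measurable (G : set (set Omega)) (g : nat -> Omega -> V) (X : Omega -> V) :
  (forall n, measurable_fun [set: g_sigma_algebraType (G `|` P.-negligible)] (g n : g_sigma_algebraType (G `|` P.-negligible) -> Vm)) ->
  {ae P, forall w, g n w @[n --> \oo] --> X w} -> rv_measurable (completed P G) X.
Proof.
move=> mg [N [mN N0 sub]]; pose S := g_sigma_algebraType (G `|` P.-negligible).
have negS (A : set Omega) : A `<=` N -> @measurable _ S A.
  by move=> AN; apply: sub_sigma_algebra; right; exists N.
have mCN : @measurable _ S (~` N) by apply: measurableC; exact: negS.
suff mX : measurable_fun [set: S] (X : S -> Vm).
  by move=> C mC; have := mX measurableT C mC; rewrite setTI.
apply: measurable_to_V => i.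
have mX' : measurable_fun [set: S] (fun w : S => X w ord0 i * \1_(~` N) w).
  apply: (@measurable_fun_cvg _ _ _ _ (fun n (w : S) => g n w ord0 i * \1_(~` N) w)).
    move=> n; apply: measurable_funM; last exact: measurable_indic.
    exact: (measurableT_comp (measurable_coord i) (mg n)).
  move=> w _; have [Nw|Nw] := pselect (N w).
    have e : (w \in ~` N) = false by apply/negP; rewrite inE.
    rewrite indicE e mulr0 (_ : (fun n => _) = cst 0); first exact: cvg_cst.
    by apply/funext => n; rewrite mulr0.
  have e : (w \in ~` N) by rewrite inE.
  rewrite indicE e mulr1 (_ : (fun n => _) = (fun n => g n w ord0 i)); last first.
    by apply/funext => n; rewrite mulr1.
  have cw : g n w @[n --> \oo] --> X w by apply: contrapT => h; apply: Nw; exact: sub.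
  exact: (cvg_comp _ _ cw (@continuous_coord R d i (X w))).
move=> _ C mC; rewrite setTI.
have -> : (fun w : S => X w ord0 i) @^-1` C = ((fun w : S => X w ord0 i * \1_(~` N) w) @^-1` C `&` ~` N) `|`
   ((fun w : S => X w ord0 i) @^-1` C `&` N).
  apply/seteqP; split => w /=.
    move=> h; have [Nw|Nw] := pselect (N w); [by right|left; split => //].
    by rewrite indicE mem_set// mulr1.
  by move=> [[+ Nw]|[]//]; rewrite indicE mem_set// mulr1.
apply: measurableU; last by apply: negS => w [].
by apply: measurableI => //; rewrite -[X in measurable X]setTI; exact: mX'.
Qed.

(** Since both ends are rounded inwards, the scheme uses only increments between times in [[s, t]],
    each a difference of increments from [s]. *)
Lemma approx_measurable dS (S : measurableType dS) (T : R) (W : R -> S -> V) (f : nat -> nat -> V -> V) (s t : R) : 0 < T ->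
  0 <= s -> s <= t -> t <= T -> (forall n j, continuous (f n j)) ->
  (forall r, s <= r -> r <= t -> measurable_fun [set: S] (fun w => W r w - W s w : Vm)) ->
  forall n x, measurable_fun [set: S] (fun w => approx T (W ^~ w) f n s t x : Vm).
Proof.
move=> T0 s0 st tT cf mW n x; have t0 := le_trans s0 st; have sT := le_trans st tT.
rewrite /approx /path_flow.
have /andP[k1 _] := cetick_itv T0 n s0 sT; have /andP[l1 _] := fltick_itv T0 n t0.
move: (cetick T n s) (fltick T n t) k1 l1 => k l k1 l1.
suff H j : (j <= l - k)%N ->
   measurable_fun [set: S] (fun w => flow (f n) (fun j => W (tick T n j.+1) w - W (tick T n j) w) k j x : Vm) by exact: H.
elim: j => [|j IH] jl /=; first exact: measurable_cst.
have mi : measurable_fun [set: S] (fun w => W (tick T n (k + j).+1) w - W (tick T n (k + j)) w : Vm).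
  have r1 i : (i <= j.+1)%N -> s <= tick T n (k + i) /\ tick T n (k + i) <= t.
    move=> ij; split; first by apply: le_trans k1 _; apply: tick_le => //; exact: leq_addr.
    by apply: le_trans l1; apply: tick_le => //; move: ij jl; clear; lia.
  have [a1 a2] := r1 j (leqnSn j); have [a3 a4] := r1 j.+1 (leqnn _).
  have := measurable_subV (mW _ a3 a4) (mW _ a1 a2); rewrite addnS.
  by congr (measurable_fun _ _); apply/funext => w; apply/rowP => i; rewrite !mxE; ring.
have my := measurable_addV (IH (ltnW jl)) mi.
exact: measurable_addV my (measurable_contV (cf n (k + j)%N) my).
Qed.

Lemma holder_within (Y : R -> V) (s t C h : R) : 0 <= C -> 0 < h ->
  (forall u v, s <= u -> u <= v -> v <= t -> `|Y v - Y u| <= C * (v - u) `^ h) -> {within `[s, t], continuous Y}.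
Proof.
move=> C0 h0 hY; apply/subspace_continuousP => x /=; rewrite in_itv/= => /andP[sx xt].
apply/(@cvgrPdist_le R V _ _ _ _ _) => e e0.
have [dl dl0 hdl] := powR_small C0 h0 e0.
apply/nbhs_ballP; exists dl => // y; rewrite -ball_normE /= => /ltW xy; rewrite in_itv/= => /andP[sy yt].
have [le_xy|/ltW le_yx] := leP x y.
  rewrite distrC; apply: le_trans (hY x y sx le_xy yt) _; apply: hdl; first by rewrite subr_ge0.
  by apply: le_trans xy; rewrite distrC ler_norm.
apply: le_trans (hY y x sy le_yx xt) _; apply: hdl; first by rewrite subr_ge0.
by apply: le_trans xy; rewrite ler_norm.
Qed.

End adaptedness.

(** * Assembly of the stochastic flow *)

Section main.
Context {R : realType} {disp : measure_display} {Omega : measurableType disp}.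
Variables (P : probability Omega R) (d : nat) (F : R -> set (set Omega)) (B : R -> Omega -> 'rV[R]_d).
Local Notation V := 'rV[R]_d.
Local Notation Vm := (@borelV R d).
Hypotheses (hF : filtration F) (hB : brownian_motion P F B).
Variables (T al rho Cw : R) (b bt : R -> V -> V) (beta : R -> R) (N0 : set R).
Hypotheses (T0 : 0 < T) (al0 : 0 < al) (al1 : al < 1) (rho1 : rho <= 1) (Cw0 : 0 <= Cw) (rho2 : 2 * (1 - rho) < al).
Hypothesis field : drift_field T al rho Cw bt beta.
Hypotheses (mN0 : measurable N0) (N00 : @lebesgue_measure R N0 = 0%E).
Hypothesis bb : forall r, 0 < r < T -> ~ N0 r -> bt r = b r.

(** The midpoint of the admissible range: [h < 1/2] for Brownian paths, and [h > (1 - rho) / al] for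
    [theta > 1]. The range is nonempty because [2 (1 - rho) < al]. *)
Let h := ((1 - rho) / al + 2^-1) / 2.
Let hal : (1 - rho) / al < 2^-1. Proof. by rewrite ltr_pdivrMr// mulrC ltr_pdivlMr// mulrC. Qed.
Let hal0 : 0 <= (1 - rho) / al. Proof. by rewrite divr_ge0 ?subr_ge0// ltW. Qed.
Let h0 : 0 < h. Proof. by rewrite /h; move: hal0; lra. Qed.
Let h12 : h < 2^-1. Proof. by rewrite /h; move: hal; lra. Qed.
Let rho12 : 2^-1 < rho. Proof. by move: rho2 al1; lra. Qed.
Let hrho : h <= rho. Proof. by move: h12 rho12; lra. Qed.
Let theta1 : 1 < rho + al * h.
Proof.
have : (1 - rho) / al < h by rewrite /h; move: hal; lra.
by rewrite ltr_pdivrMr// mulrC; lra.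
Qed.
Let rho0 : 0 < rho. Proof. by move: rho12; lra. Qed.
Let gm0 : 0 < flow_exponent al rho h.
Proof. by apply: divr_gt0; [apply: addr_gt0 => //; rewrite divr_gt0// subr_gt0|exact: lt_trans theta1]. Qed.

Let gam := brownian_law hF hB.
Let hgam t : 0 < t -> gaussian_law (gam t) t. Proof. exact: gaussian_brownian_law. Qed.
Let conv := brownian_convolution hF hB.

Let psi := @drift R d bt.
Let wt := drift_weight beta.
Let fam : drift_family al rho Cw wt psi.
Proof.
split.
- exact: (drift_weight_mono T0 field).
- exact: (drift_weight_rho T0 field).
- by move=> s t z st; exact: (drift_norm T0 field).
- by move=> s t z z' st; exact: (drift_holder_weight T0 al0 field).
- by move=> s u t z; exact: (drift_split T0 field).
Qed.

(** If [X] solves the equation, then [u -> - X (T - u)] solves it with this drift and the noise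
    [- B (T - u)]; the reflection undoes the sign change caused by reversing time. *)
Let psi' (u v : R) (z : V) := psi (T - v) (T - u) (- z).
Let wt' (u : R) := - wt (T - u).
Let fam' : drift_family al rho Cw wt' psi'.
Proof.
have rv (s t : R) : s <= t -> T - t <= T - s by move=> st; rewrite lerD2l lerN2.
have we s t : wt' t - wt' s = wt (T - s) - wt (T - t) by rewrite /wt' opprK addrC.
have ie (s t : R) : t - s = (T - s) - (T - t) by ring.
split.
- by move=> s t st; rewrite /wt' lerN2 (fam_mono fam)// rv.
- by move=> s t st; rewrite we (ie s t); exact: (fam_rho fam (rv _ _ st)).
- by move=> s t z st; rewrite we; exact: (fam_bound fam _ (rv _ _ st)).
- move=> s t z z' st; rewrite we; have -> : `|z - z'| = `|- z - - z'| by rewrite -opprD normrN.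
  exact: (fam_holder fam _ _ (rv _ _ st)).
- by move=> s u t z su ut; rewrite /psi' [RHS]addrC; apply: (fam_add fam); exact: rv.
Qed.

(** The maximum keeps [B] at nonnegative times when grid points exceed [T]. *)
Let B' (u : R) (w : Omega) : V := - B (Num.max 0 (T - u)) w.
Let B'E u w : u <= T -> B' u w = - B (T - u) w.
Proof. by move=> uT; rewrite /B' max_r// subr_ge0. Qed.

Let noise n : iid_noise P (gam (T / 2 ^+ n)) (2 ^ n) (fun j w => B (tick T n j.+1) w - B (tick T n j) w).
Proof.
apply: (@forward_noise _ _ _ P d F B hF hB (tick T n) (T / 2 ^+ n)).
- by move=> j; exact: tick_ge0.
- exact: mesh_gt0.
- by move=> j; rewrite tickS addrAC subrr add0r.
Qed.

Let noise' n : iid_noise P (gam (T / 2 ^+ n)) (2 ^ n) (fun j w => B' (tick T n j.+1) w - B' (tick T n j) w).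
Proof.
apply: (reversed_noise (noise n)).
  move=> j; have mB u : measurable_fun [set: Omega] (B' u : Omega -> Vm).
    apply: (measurable_contV (F := -%R)) => //; first exact: oppr_continuous.
    by apply: (measurable_B hF hB); rewrite le_max lexx.
  exact: measurable_subV.
move=> j jN; apply/funext => w.
have tr i : (i <= 2 ^ n)%N -> T - tick T n i = tick T n (2 ^ n - i).
  by move=> iN; rewrite -{1}(tick_end T n) -{1}(subnK iN) tickD addrK.
rewrite !B'E ?tick_leT// ?(ltnW jN)// !tr// ?(ltnW jN)//.
by rewrite -subSn// subSS opprK addrC.
Qed.

Let cB : {ae P, forall w, {within `[0, T], continuous (B ^~ w)}}.
Proof.
have [_ _ + _ _] := hB; apply: filterS => w; apply: continuous_subspaceW => r /=.
by rewrite !in_itv/= => /andP[-> _].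
Qed.

Let cB' : {ae P, forall w, {within `[0, T], continuous (B' ^~ w)}}.
Proof.
move: cB; apply: filterS => w /subspace_continuousP cw; apply/subspace_continuousP => x /=.
rewrite in_itv/= => /andP[x0 xT].
have Tx : `[0, T]%classic (T - x) by rewrite /= in_itv/= subr_ge0 xT gerBl x0.
move: (cw _ Tx) => /(@cvgrPdist_le R V _ _ _ _ _) H.
apply/(@cvgrPdist_le R V _ _ _ _ _) => e e0; have /nbhs_ballP [dl /= dl0 hdl] := H e e0.
apply/nbhs_ballP; exists dl => // y; rewrite -ball_normE /= => xy; rewrite in_itv/= => /andP[y0 yT].
suff E : `|B' x w - B' y w| <= e by exact: E.
rewrite !B'E// -opprD normrN; apply: (hdl (T - y)).
  by rewrite -ball_normE /= (_ : T - x - (T - y) = - (x - y)) ?normrN//; ring.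
by rewrite /= in_itv/= subr_ge0 yT gerBl y0.
Qed.

Local Notation f := (mollified_steps gam T psi).
Local Notation f' := (mollified_steps gam T psi').
Let X s t x w := limit_flow T (B ^~ w) f s t x.
Let X' s t x w := limit_flow T (B' ^~ w) f' s t x.

Let good (be : R) : 0 < be -> be < al - 2 * (1 - rho) -> {ae P, forall w,
  [/\ exists2 CW : R, 0 <= CW & forall s t, 0 <= s -> s <= t -> t <= T -> `|B t w - B s w| <= CW * (t - s) `^ h,
      solution_flow T rho al h (flow_exponent al rho h) (B ^~ w) psi (fun s t x => X s t x w),
      forall s t x, ordered_times T s t -> approx T (B ^~ w) f n s t x @[n --> \oo] --> X s t x w &
      forall s t, ordered_times T s t -> taylor be (fun x => X s t x w)]}.
Proof.
(* The moment bounds are taken with an exponent [c] strictly between [be] and the critical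
   [al - 2 (1 - rho)]; the gap [c - be] is spent in Borel-Cantelli. *)
move=> be0 be1; pose c := (be + (al - 2 * (1 - rho))) / 2.
by apply: (flow_event hgam conv T0 al0 al1 h0 h12 hrho Cw0 theta1 fam noise cB (be := c)); rewrite /c; move: rho1 be0 be1; lra.
Qed.

Let good' (be : R) : 0 < be -> be < al - 2 * (1 - rho) -> {ae P, forall w,
  solution_flow T rho al h (flow_exponent al rho h) (B' ^~ w) psi' (fun s t x => X' s t x w) /\
  forall s t, ordered_times T s t -> taylor be (fun x => X' s t x w)}.
Proof.
move=> be0 be1; pose c := (be + (al - 2 * (1 - rho))) / 2.
have : {ae P, forall w,
  [/\ exists2 CW : R, 0 <= CW & forall s t, 0 <= s -> s <= t -> t <= T -> `|B' t w - B' s w| <= CW * (t - s) `^ h,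
      solution_flow T rho al h (flow_exponent al rho h) (B' ^~ w) psi' (fun s t x => X' s t x w),
      forall s t x, ordered_times T s t -> approx T (B' ^~ w) f' n s t x @[n --> \oo] --> X' s t x w &
      forall s t, ordered_times T s t -> taylor be (fun x => X' s t x w)]}.
  by apply: (flow_event hgam conv T0 al0 al1 h0 h12 hrho Cw0 theta1 fam' noise' cB' (be := c)); rewrite /c; move: rho1 be0 be1; lra.
by apply: filterS => w [].
Qed.

(** One fixed admissible exponent, for the properties of the flow whose statement involves none. *)
Let be0 := (al - 2 * (1 - rho)) / 2.
Let be00 : 0 < be0. Proof. by rewrite /be0; move: rho2; lra. Qed.
Let be01 : be0 < al - 2 * (1 - rho). Proof. by rewrite /be0; move: rho2; lra. Qed.

Let f_cont n j : continuous (f n j).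
Proof.
have st : tick T n j <= tick T n j.+1 by exact: tick_le.
have [cp _ _] := family_vholder al0 fam st.
by have [] := vheat_vcb hgam (mesh_gt0 T0 n) cp.
Qed.

Lemma flow_adapted s t x : 0 <= s -> s <= t -> t <= T -> rv_measurable (increments_algebra P B s t) (X s t x).
Proof.
move=> s0 st tT; set G := [set A | exists r C, [/\ s <= r <= t, borel C & A = increment B s r @^-1` C]].
pose S := g_sigma_algebraType (G `|` P.-negligible).
have mi r : s <= r -> r <= t -> measurable_fun [set: S] (fun w => B r w - B s w : Vm).
  move=> sr rt _ C mC; rewrite setTI; apply: sub_sigma_algebra; left.
  by exists r, C; split => //; rewrite sr rt.
apply: (@ae_limit_measurable R d _ Omega P G (fun n w => approx T (B ^~ w) f n s t x)).
  by move=> n; exact: (@approx_measurable R d _ S T B f s t T0 s0 st tT f_cont mi n x).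
by move: (good be00 be01); apply: filterS => w [_ _ h3 _]; apply: h3; split.
Qed.

Lemma increments_in_history s t : 0 <= s -> s <= t -> increments_algebra P B s t `<=` completed P (F t).
Proof.
move=> s0 st; apply: sub_smallest2r => // A [[r [C [/andP[sr rt] mC ->]]]|nA]; last by right.
left; have t0 := le_trans s0 st; rewrite -(historyE hF t0) -[X in measurable X]setTI.
exact: (measurable_increment_history hF hB s0 st (le_trans s0 sr) rt).
Qed.

(** Stated for any [G] because it is used with two filtrations: the increments of [B] after [s], and
    the completed given one. *)
Lemma flow_solution (G : R -> set (set Omega)) s x : 0 <= s <= T ->
  (forall t, s <= t <= T -> rv_measurable (G t) (X s t x)) -> sde_solution P b B G T s x (fun t => X s t x).
Proof.
move=> /andP[s0 sT] mG; split => //.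
- move: (good be00 be01); apply: filterS => w [_ sf _ _].
  have [CA CA0 hC] := sf_close sf.
  apply: (holder_within CA0 h0) => u v su uv vT; rewrite (sf_flow sf x s0 su uv vT).
  exact: hC (le_trans s0 su) uv vT.
- by apply: aeW => w; exact: (@integrable_null R d T al rho Cw bt beta field b N0 s T (fun r => X s r x w) mN0 N00 s0 sT (lexx T) bb).
- move: (good be00 be01); apply: filterS => w [_ sf _ _] t /andP[st tT].
  have [CA CA0 hC] := sf_close sf; have [CX CX0 hX] := sf_expansion sf.
  have hol u v : s <= u -> u <= v -> v <= T -> `|X s v x w - X s u x w| <= CA * (v - u) `^ h.
    by move=> su uv vT; rewrite (sf_flow sf x s0 su uv vT); exact: hC (le_trans s0 su) uv vT.
  have ex u v : s <= u -> u <= v -> v <= T -> `|X s v x w - X s u x w - (B v w - B u w) - psi u v (X s u x w)| <= CX * (v - u) `^ (rho + al * h).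
    by move=> su uv vT; rewrite (sf_flow sf x s0 su uv vT); exact: hX (le_trans s0 su) uv vT.
  have := equation_of_expansion T0 al0 rho0 Cw0 field h0 theta1 s0 CX0 CA0 (holder_within CA0 h0 hol) hol ex st tT.
  rewrite (sf_refl sf x s0 sT) => ->; congr (_ + _ + _); symmetry.
  by apply: (vint_null (T := T) (N := N0)).
Qed.

(** For almost every sample point the equation for [Y] implies the expansion, so the deterministic
    uniqueness of the limit flow decides. Starting from [x] is read off from the equation at time
    [s]. *)
Lemma flow_unique_solution (G : R -> set (set Omega)) s x (Y : R -> Omega -> V) : 0 <= s <= T ->
  sde_solution P b B G T s x Y -> indistinguishable P s T (fun t => X s t x) Y.
Proof.
move=> /andP[s0 sT] [_ cY _ eY]; move: (good be00 be01) cY eY.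
apply: filterS3 => w [[CW CW0 hW] sf _ _] cY eY t /andP[st tT].
have vs : vint s s (fun r => b r (Y r w)) = 0 by apply/rowP => i; rewrite !mxE set_itv1 Rintegral_set1.
have Ys : Y s w = x.
  by rewrite eY ?lexx ?sT//; rewrite -/(vint s s (fun r => b r (Y r w))) vs /increment subrr !addr0.
have eY' v : s <= v -> v <= T -> Y v w = Y s w + vint s v (fun r => bt r (Y r w)) + (B v w - B s w).
  move=> sv vT; have <- : vint s v (fun r => b r (Y r w)) = vint s v (fun r => bt r (Y r w)).
    by apply: (vint_null (T := T) (N := N0)).
  by rewrite {1}eY ?sv ?vT// Ys.
have [E E0 hE] := expansion_of_equation T0 al0 rho0 Cw0 field h0 hrho CW0 s0 cY hW eY'.
rewrite -Ys; symmetry.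
apply: (@sf_unique _ _ _ _ _ _ _ _ _ _ sf s t E (`|x| + E * T `^ h) (fun u => Y u w) s0 st tT E0).
  move=> u su ut; rewrite -[Y u w](subrK x); apply: le_trans (ler_normD _ _) _; rewrite addrC; apply: lerD => //.
  have uT := le_trans ut tT; rewrite -Ys; apply: le_trans (hE s u (lexx s) su uT).1 _; apply: ler_wpM2l => //.
  by apply: ge0_ler_powR_base; [exact: ltW|rewrite subr_ge0|move: s0 uT; lra].
by move=> u v su uv vt; exact: (hE u v su uv (le_trans vt tT)).2.
Qed.

Let Psi w s t y := - X' (T - t) (T - s) (- y) w.

Let Psi_inverse : {ae P, forall w, inverse_family T (fun s t x => X s t x w) (Psi w) /\
  (continuous_stx T (fun s t x => X s t x w) /\ continuous_stx T (Psi w))}.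
Proof.
move: (good be00 be01) (good' be00 be01); apply: filterS2 => w [_ sf _ _] [sf' _]; split.
  apply: (reversed_inverse rho0 al0 h0 sf sf' Cw0).
  - move=> u v z z' uv; apply: le_trans (fam_holder fam z z' uv) _; apply: ler_wpM2r; first exact: powR_ge0.
    exact: (fam_rho fam uv).
  - by move=> u u0 uT; exact: B'E.
  - by [].
split; apply: locally_uniform_stx; first exact: (solution_flow_uniform h0 gm0 sf).
by apply: (@reversed_uniform _ _ T (fun s t x => X' s t x w)); exact: (solution_flow_uniform h0 gm0 sf').
Qed.

Lemma flow_homeo : homeo_flow P b B T X.
Proof.
split.
- move=> s x sT; apply: flow_solution => // t /andP[st tT]; have /andP[s0 _] := sT; exact: flow_adapted.
- by move: Psi_inverse; apply: filterS => w [h1 [h3 h4]]; exists (Psi w); split.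
- move: (good be00 be01); apply: filterS => w [_ sf _ _]; split.
    by move=> s r t x; exact: (sf_flow sf).
  by move=> s x /andP[s0 sT]; exact: (sf_refl sf).
Qed.

Lemma flow_diffeo be : 0 < be -> be < al - 2 * (1 - rho) -> diffeo_flow P b B T be X.
Proof.
move=> b0 b1; split; first exact: flow_homeo.
have be1 : be <= 1 by move: b1 al1 rho1; lra.
move: Psi_inverse (good b0 b1) (good' b0 b1); apply: filterS3 => w [h1 _] [_ _ _ tX] [_ tX'].
exists (Psi w); split => // s t o; split; first exact: (taylor_C1_holder b0 be1 (tX _ _ o)).
have [s0 st tT] := o.
apply: (taylor_C1_holder b0 be1); apply: taylor_opp; apply: tX'.
by split; [rewrite subr_ge0|rewrite lerD2l lerN2|rewrite gerBl].
Qed.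

Lemma flow_exists : exists Z : R -> R -> V -> Omega -> V,
    (forall (s : R) (x : V), 0 <= s <= T ->
      sde_solution P b B (fun t => completed P (F t)) T s x (fun t => Z s t x)
      /\ (forall Y : R -> Omega -> V,
            sde_solution P b B (fun t => completed P (F t)) T s x Y ->
            indistinguishable P s T (fun t => Z s t x) Y)) /\
    (forall be : R, 0 < be -> be < al - 2 * (1 - rho) -> diffeo_flow P b B T be Z).
Proof.
exists X; split; last exact: flow_diffeo.
move=> s x sT; split; last by move=> Y; exact: flow_unique_solution.
apply: flow_solution => // t /andP[st tT] C mC; have /andP[s0 _] := sT.
by apply: (increments_in_history s0 st); exact: flow_adapted.
Qed.

End main.

Theorem lemma2p1 (R : realType) (disp : measure_display)
    (Omega : measurableType disp) (P : probability Omega R)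
    (d : nat) (F : R -> set (set Omega)) (B : R -> Omega -> 'rV[R]_d)
    (T : R) (q : \bar R) (alpha : R) (b : R -> 'rV[R]_d -> 'rV[R]_d)
    (hd : (1 <= d)%N) (hF : filtration F) (hB : brownian_motion P F B)
    (hT : 0 < T) (hq : (1 <= q)%E) (halpha : 0 < alpha < 1)
    (hqalpha : (2%:E / q < alpha%:E)%E) (hb : Lq_holder q T alpha b) :
  exists X : R -> R -> 'rV[R]_d -> Omega -> 'rV[R]_d,
    (forall (s : R) (x : 'rV[R]_d), 0 <= s <= T ->
      sde_solution P b B (fun t => completed P (F t)) T s x (fun t => X s t x)
      /\ (forall Y : R -> Omega -> 'rV[R]_d,
            sde_solution P b B (fun t => completed P (F t)) T s x Y ->
            indistinguishable P s T (fun t => X s t x) Y)) /\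
    (forall alpha' : R, 0 < alpha' ->
      (alpha'%:E < alpha%:E - 2%:E / q)%E ->
      diffeo_flow P b B T alpha' X).
Proof.
have /andP[al0 al1] := halpha.
have [N0 [mN0 N00 [bt [beta [bb [qi [qi0 qi1 qiE] [Cw Cw0 fld]]]]]]] := holder_representative hd al0 hq hb.
(* Covers [q = +oo] as well, with [qi = 0]; from here on [rho] is [1 - qi], and [2 / q] is
   [2 (1 - rho)]. *)
have e2 : (2%:E / q = (2 * qi)%:E)%E by rewrite qiE -EFinM.
rewrite e2 lte_fin in hqalpha.
have r1 : 1 - qi <= 1 by rewrite gerBl.
have r2 : 2 * (1 - (1 - qi)) < alpha by rewrite subKr.
have [X [X1 X2]] := flow_exists hF hB hT al0 al1 r1 Cw0 r2 fld mN0 N00 bb.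
exists X; split=> // be b0; rewrite e2 -EFinB lte_fin => b1; apply: X2 => //.
by rewrite subKr.
Qed.
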